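(* Let $N\ge2$, $R>0$, and let $B_R\subset\mathbb{R}^N$ be the ball centered at the origin with radius $R$. If $\beta>-1$, then $$\Lambda(B_R,\beta)=\hat\beta\,h(B_R)=\hat\beta\,\frac{N}{R},$$ where $\hat\beta=\min\{\beta,1\}$.
   Context: For a bounded open set $\Omega\subset\mathbb{R}^N$ with Lipschitz boundary and $\beta\in\mathbb{R}$, define $$\Lambda(\Omega,\beta)=\inf_{u\in BV(\Omega),\,u\not\equiv 0}\ \frac{|Du|(\Omega)+\min(\beta,1)\int_{\partial\Omega}|u|\,d\mathcal{H}^{N-1}}{\int_\Omega |u|\,dx},$$ where $|Du|(\Omega)$ is the total variation of $u$ in $\Omega$ and, in the boundary integral, $u$ denotes the $BV$-trace of $u$ on $\partial\Omega$. The Cheeger constant of $\Omega$ is $$h(\Omega)=\inf_{E\subseteq\Omega}\frac{P(E)}{|E|},$$ the infimum being over measurable sets $E\subseteq\Omega$ of positive measure and finite perimeter, where $P(E)=|D\chi_E|(\mathbb{R}^N)$. *)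

(* Defs.v *)
From HB Require Import structures.
From mathcomp Require Import all_boot all_order all_algebra.
From mathcomp Require Import all_classical all_reals all_analysis.

Set Implicit Arguments.
Unset Strict Implicit.
Unset Printing Implicit Defensive.

Import Order.TTheory GRing.Theory Num.Theory.
Import numFieldNormedType.Exports.

Local Open Scope classical_set_scope.
Local Open Scope ring_scope.

(* The norm of the library on 'rV[R]_N is the sup norm; it induces the usual
   topology and the usual derivatives, but balls, diameters and the bound on
   test fields need the Euclidean norm. *)
Definition enorm (R : realType) (N : nat) (x : 'rV[R]_N) : R :=
  Num.sqrt (\sum_(i < N) x ord0 i ^+ 2).

Definition eball (R : realType) (N : nat) (x : 'rV[R]_N) (r : R) :
    set 'rV[R]_N :=
  [set y | enorm (y - x) < r].

(* Outer measure defined by finite or countable covers ([None] stands for an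
   absent member) by sets [S i], [C i], of cost [c i]. *)
Section cover_outer.
Context {R : realType} {T I : Type}.
Variables (C : set I) (S : I -> set T) (c : I -> \bar R).
Local Open Scope ereal_scope.

Definition covers (A : set T) : set (nat -> option I) :=
  [set F | (forall k i, F k = Some i -> C i) /\
           A `<=` \bigcup_k oapp S set0 (F k)].

Definition cover_outer (A : set T) : \bar R :=
  ereal_inf [set \sum_(k <oo) oapp c 0 (F k) | F in covers A].

Hypothesis c_ge0 : forall i, 0 <= c i.

Let oc_ge0 o : 0 <= oapp c 0 o. Proof. by case: o => /=. Qed.

Lemma le_cover_outer : {homo cover_outer : A B / A `<=` B >-> A <= B}.
Proof.
move=> A B AB; apply/ereal_inf_le_tmp => x [F [CF BF] <-{x}].
by exists F => //; split => //; exact: subset_trans AB BF.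
Qed.

Lemma cover_outer_ge0 A : 0 <= cover_outer A.
Proof.
by apply: le_ereal_inf_tmp => x [F _ <-{x}]; exact: nneseries_ge0.
Qed.

Lemma cover_outer0 : cover_outer set0 = 0.
Proof.
apply/eqP; rewrite eq_le cover_outer_ge0 andbT.
by apply: ereal_inf_lbound; exists (fun=> None); [by split|exact: eseries0].
Qed.

Lemma cover_outer_sigma_subadditive : sigma_subadditive cover_outer.
Proof.
move=> A; have [[i ioo]|] := pselect (exists i, cover_outer (A i) = +oo).
  rewrite (eseries_pinfty _ _ ioo) ?leey// => n _.
  by rewrite -ltNye (lt_le_trans _ (cover_outer_ge0 _)).
rewrite -forallNE => Aoo.
suff add2e (e : {posnum R}) : cover_outer (\bigcup_n A n) <=
    \sum_(i <oo) cover_outer (A i) + e%:num%:E.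
  by apply/lee_addgt0Pr => _/posnumP[].
rewrite (le_trans _ (epsilon_trick _ _ _))//; last first.
  by move=> n; exact: cover_outer_ge0.
pose P n (F : nat -> option I) := covers (A n) F /\
  \sum_(k <oo) oapp c 0 (F k) <=
    cover_outer (A n) + (e%:num / (2 ^ n.+1)%:R)%:E.
have [G PG] : {G : nat -> nat -> option I & forall n, P n (G n)}.
  apply: (@choice _ _ P) => n; rewrite /P /cover_outer.
  set U := (X in ereal_inf X); move infU : (ereal_inf U) => iU.
  case: iU infU => [r Ur|Uoo|Uoo].
  - have en1 : (0 < e%:num / (2 ^ n.+1)%:R)%R by [].
    have /(lb_ereal_inf_adherent en1) : ereal_inf U \is a fin_num by rewrite Ur.
    move=> [x [F AF Fx] xU].
    by exists F; split => //; rewrite Fx -Ur; exact/ltW.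
  - by have := Aoo n; rewrite /cover_outer Uoo.
  - suff : lbound U 0 by move/le_ereal_inf_tmp; rewrite Uoo.
    by move=> /= _ [F AF <-]; exact: nneseries_ge0.
pose g := oapp c 0 \o uncurry G.
have g_ge0 x : 0 <= g x by exact: oc_ge0.
apply: (@le_trans _ _ (\esum_(i in setT) g i)).
  apply: ereal_inf_lbound => /=.
  have /card_esym/ppcard_eqP[f] := card_nat2.
  exists (uncurry G \o f).
    split => [k i /= Gi|].
      by apply: (PG (f k).1).1.1 (f k).2 _ _; move: Gi; case: (f k).
    move=> t [i _ /(PG i).1.2[j _ Gijt]].
    by exists (f^-1%FUN (i, j)) => //=; rewrite invK ?inE.
  rewrite -(esum_pred_image g _ xpredT) ?[fun=> _]set_true//.
  by rewrite image_eq.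
rewrite (_ : esum _ _ = \sum_(i <oo) \sum_(j <oo) oapp c 0 (G i j)); last first.
  pose J : nat -> set (nat * nat) := fun i => [set (i, j) | j in setT].
  rewrite (_ : setT = \bigcup_k J k); last first.
    by rewrite predeqE => -[a b]; split => // _; exists a => //; exists b.
  rewrite esum_bigcupT /=; last 2 first.
  - apply/trivIsetP => i j _ _ ij.
    rewrite predeqE => -[n m] /=; split => //= -[] [_] _ [<-{n} _].
    by move=> [m' _] [] /esym/eqP; rewrite (negbTE ij).
  - by [].
  rewrite -(image_id [set: nat]) -fun_true esum_pred_image//; last first.
    by move=> n _; exact: esum_ge0.
  apply: eq_eseriesr => /= j _.
  rewrite -(esum_pred_image g (pair j) predT)//=; last first.
    by move=> ? ? _ _; exact: (@can_inj _ _ _ snd).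
  by congr esum; rewrite predeqE => -[a b]; split; move=> [i _ <-]; exists i.
apply: lee_lim.
- apply: is_cvg_nneseries => n *.
  by apply: nneseries_ge0 => m *.
- by apply: is_cvg_nneseries => n *; apply: adde_ge0 => //; exact: cover_outer_ge0.
- by near=> n; apply: lee_sum => i _; exact: (PG i).2.
Unshelve. all: by end_near. Qed.

End cover_outer.

Section lebesgue.
Variables (R : realType) (N : nat).

Definition box (ab : 'rV[R]_N * 'rV[R]_N) : set 'rV[R]_N :=
  [set x | forall i, ab.1 ord0 i <= x ord0 i <= ab.2 ord0 i].

Definition box_vol (ab : 'rV[R]_N * 'rV[R]_N) : R :=
  \prod_(i < N) Num.max 0 (ab.2 ord0 i - ab.1 ord0 i).

Definition leb_outer : set 'rV[R]_N -> \bar R :=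
  cover_outer setT box (fun ab => (box_vol ab)%:E).

Let box_vol_ge0 ab : (0 <= (box_vol ab)%:E)%E.
Proof. by rewrite lee_fin prodr_ge0// => i _; rewrite le_max lexx. Qed.

HB.instance Definition _ := isOuterMeasure.Build R _ leb_outer
  (cover_outer0 _ _ box_vol_ge0) (cover_outer_ge0 _ _ box_vol_ge0)
  (le_cover_outer _ _ _) (cover_outer_sigma_subadditive _ _ box_vol_ge0).

Definition leb : set (caratheodory_type leb_outer) -> \bar R := leb_outer.

HB.instance Definition _ := isMeasure.Build _ _ _ leb
  (@caratheodory_measure0 _ _ leb_outer) (@caratheodory_measure_ge0 _ _ leb_outer)
  (@caratheodory_measure_sigma_additive _ _ leb_outer).

End lebesgue.

Arguments leb_outer R N _ : clear implicits.
Arguments leb R N _ : clear implicits.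

Section hausdorff.
Variables (R : realType) (N k : nat).

(* Only meaningful for bounded [B]. *)
Definition diam (B : set 'rV[R]_N) : R :=
  sup [set enorm (x - y) | x in B & y in B].

(* The volume of a [k]-dimensional ball of diameter [diam B]; this gives the
   normalization for which the measure is the Lebesgue measure when [k = N]. *)
Definition hausdorff_cost (B : set 'rV[R]_N) : \bar R :=
  (leb_outer R k (eball (0 : 'rV[R]_k) 1) * ((diam B / 2) ^+ k)%:E)%E.

Definition hausdorff_pre (d : R) : set 'rV[R]_N -> \bar R :=
  cover_outer [set B | forall x y, B x -> B y -> enorm (x - y) <= d]
    id hausdorff_cost.

Definition hausdorff_outer (A : set 'rV[R]_N) : \bar R :=
  ereal_sup [set hausdorff_pre d A | d in [set d | 0 < d]].

Let hausdorff_cost_ge0 B : (0 <= hausdorff_cost B)%E.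
Proof.
rewrite /hausdorff_cost mule_ge0 ?outer_measure_ge0// lee_fin exprn_ge0//.
rewrite divr_ge0// /diam; set A := (X in sup X).
have [[[a Aa] ubA]|/sup_out->//] := pselect (has_sup A).
apply: (le_trans _ (ub_le_sup ubA Aa)).
by case: Aa => x _ [y _ <-]; exact: sqrtr_ge0.
Qed.

Let hausdorff_outer0 : hausdorff_outer set0 = 0%E.
Proof.
have pre0 d : hausdorff_pre d set0 = 0%E.
  by apply: cover_outer0; exact: hausdorff_cost_ge0.
rewrite /hausdorff_outer [X in ereal_sup X](_ : _ = [set 0%E]) ?ereal_sup1//.
apply/seteqP; split => [_ [d _ <-]|_ ->]; first exact: pre0.
by exists 1 => /=.
Qed.

Let hausdorff_outer_ge0 A : (0 <= hausdorff_outer A)%E.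
Proof.
apply: le_ereal_sup_tmp; exists (hausdorff_pre 1 A) => //; first by exists 1 => /=.
by apply: cover_outer_ge0; exact: hausdorff_cost_ge0.
Qed.

Let le_hausdorff_outer :
  {homo hausdorff_outer : A B / A `<=` B >-> (A <= B)%E}.
Proof.
move=> A B AB; apply: ge_ereal_sup => _ [d d0 <-].
apply: (le_trans (le_cover_outer _ _ _ AB)).
by apply: ereal_sup_ubound; exists d.
Qed.

Let hausdorff_outer_sigma_subadditive : sigma_subadditive hausdorff_outer.
Proof.
move=> F; apply: ge_ereal_sup => _ [d d0 <-].
apply: (le_trans (cover_outer_sigma_subadditive _ _ hausdorff_cost_ge0 _)).
apply: lee_nneseries => n _.
  by move=> *; apply: cover_outer_ge0; exact: hausdorff_cost_ge0.
by apply: ereal_sup_ubound; exists d.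
Qed.

HB.instance Definition _ := isOuterMeasure.Build R _ hausdorff_outer
  hausdorff_outer0 hausdorff_outer_ge0 le_hausdorff_outer
  hausdorff_outer_sigma_subadditive.

Definition hausdorff : set (caratheodory_type hausdorff_outer) -> \bar R := hausdorff_outer.

HB.instance Definition _ := isMeasure.Build _ _ _ hausdorff
  (@caratheodory_measure0 _ _ hausdorff_outer) (@caratheodory_measure_ge0 _ _ hausdorff_outer)
  (@caratheodory_measure_sigma_additive _ _ hausdorff_outer).

End hausdorff.

Arguments hausdorff_outer R N k _ : clear implicits.
Arguments hausdorff R N k _ : clear implicits.

Section bv.
Context {R : realType} {N : nat}.
Implicit Types (Omega E : set 'rV[R]_N) (u : 'rV[R]_N -> R).
Implicit Types phi : 'rV[R]_N -> 'rV[R]_N.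

Definition divergence phi (x : 'rV[R]_N) : R := \tr (jacobian phi x).

Definition test_field Omega : set ('rV[R]_N -> 'rV[R]_N) :=
  [set phi | [/\ forall x, differentiable phi x,
                 continuous (jacobian phi),
                 compact (closure [set x | phi x != 0]),
                 closure [set x | phi x != 0] `<=` Omega &
                 forall x, enorm (phi x) <= 1]].

(* |Du|(Omega), for Omega open and u in L^1(Omega), by duality with the
   C^1_c(Omega; R^N) fields bounded by 1. *)
Definition variation Omega u : \bar R :=
  ereal_sup [set (\int[leb R N]_(x in Omega) (u x * divergence phi x)%:E)%E
            | phi in test_field Omega].

Definition BV Omega : set ('rV[R]_N -> R) :=
  [set u | (leb R N).-integrable Omega (EFin \o u) /\
           (variation Omega u < +oo)%E].

(* For u in BV(Omega), Omega bounded with Lipschitz boundary, such a t exists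
   and is unique at H^(N-1)-almost every x in the boundary of Omega. *)
Definition is_bv_trace Omega u (x : 'rV[R]_N) (t : R) : Prop :=
  ((r ^- N)%:E * \int[leb R N]_(y in Omega `&` eball x r) `|u y - t|%:E)%E
    @[r --> 0^'+] --> 0%E.

Definition bv_trace Omega u (x : 'rV[R]_N) : R :=
  xget 0 [set t | is_bv_trace Omega u x t].

Definition boundary Omega : set 'rV[R]_N := closure Omega `\` interior Omega.

(* Meant for Omega bounded and open with Lipschitz boundary; the denominator is
   then finite and positive, u not being 0 almost everywhere in Omega. *)
Definition Lambda Omega (beta : R) : \bar R :=
  ereal_inf [set ((variation Omega u + (Num.min beta 1)%:E *
                     \int[hausdorff R N N.-1]_(x in boundary Omega)
                       `|bv_trace Omega u x|%:E)
                   / \int[leb R N]_(x in Omega) `|u x|%:E)%E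
            | u in [set u | BV Omega u /\
                    ~ {ae leb R N, forall x, Omega x -> u x = 0}]].

Definition perimeter E : \bar R := variation setT \1_E.

Definition cheeger Omega : \bar R :=
  ereal_inf [set (perimeter E / leb R N E)%E
            | E in [set E | [/\ (leb_outer R N).-cara.-measurable E,
                                E `<=` Omega, (0 < leb R N E)%E &
                                (perimeter E < +oo)%E]]].

End bv.

(* Main.v *)
(* Every u in BV(B), B the ball of radius r, satisfies
     | int_(boundary B) |u| dH - (N / r) int_B |u| | <= |Du|(B),
   and |min(beta, 1)| <= 1, so the quotient defining Lambda is at least
   min(beta, 1) N / r; constants give equality.

   The inequality comes from dilations. For a test function g, the derivative of
   t |-> int u(y) t^N g(t y) dy is int u div(t^(N-1) g(t y) y) dy, whence
     int |u(y) - u(l y)| dy <= (1/l - 1) r l^(-N) |Du|  on annuli, 0 < l < 1.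
   Applied to B, it compares the integral of |u| over a thin collar of the
   boundary with the integral over B. Applied to the dyadic annuli converging to
   the boundary, whose variations have a finite sum, it shows that u has almost
   everywhere a limit T along dyadic dilations, the distance from u to T being
   bounded by the tail of a series; by the weak-type maximal inequality and
   Lebesgue differentiation, T is the trace of u at almost every boundary point.

   On the sphere, the Hausdorff measure is N / r times the Lebesgue measure of
   the cone: both bounds are local, where the sphere is almost a flat disc, and
   there they rest on the isodiametric inequality.

   Finally h(B) = N / r: the fields y / rho, rho > r, cut off outside B, bound
   the perimeter of a subset of B from below, and smoothing the indicator of B
   radially bounds P(B) from above. *)

From HB Require Import structures.
From mathcomp Require Import all_boot all_order all_algebra.
From mathcomp Require Import lra zify.
From mathcomp Require Import all_classical all_reals all_analysis measurable_realfun.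
Require Import Defs.
Set Implicit Arguments.
Unset Strict Implicit.
Unset Printing Implicit Defensive.
Import Order.TTheory GRing.Theory Num.Theory.
Import numFieldNormedType.Exports.
Local Open Scope classical_set_scope.
Local Open Scope ring_scope.

(** * Lebesgue measure *)

(** Two features shape the proof. The trace is defined pointwise by averages, so it has to be
    produced before anything can be said about it; and both measures come from covers, so scaling,
    rotations and volumes of cones are obtained by comparing outer measures on the covering sets,
    for arbitrary sets and without product measures. The dilations used have ratios exp(i 2^-n). For
    growing n they form nested groups, half-open shells are exact fundamental domains for them, and
    the dyadic limit T is exactly invariant under all of them. Hence the integral of |T| over one
    fixed annulus is an exact multiple of its integral over each thin collar, and the same holds for
    the tails bounding |u - T|: the error stays small even after division by the thickness of the
    collar. The fixed annulus also stands for the sphere in every statement that holds almost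
    everywhere. The factor min(beta, 1) may be negative, whence a two-sided comparison of the
    boundary integral with the integral over the ball; beta > -1 gives |min(beta, 1)| <= 1. *)

Section outer_covers.
Context {R : realType} {T I : Type}.
Variables (C : set I) (S : I -> set T) (c : I -> \bar R).
Hypothesis c_ge0 : forall i, (0 <= c i)%E.
Local Open Scope ereal_scope.

Lemma cover_outer_le1 (A : set T) i :
  C i -> A `<=` S i -> cover_outer C S c A <= c i.
Proof.
move=> Ci AS; apply: ereal_inf_lbound; exists (fun n => if n is 0%N then Some i else None).
  by split=> [[|k] j //= [<-//]|x Ax]; exists 0%N => //=; exact: AS.
rewrite (nneseries_split _ 1%N) ?big_nat1/=; last first.
  by move=> [|k] _ //=.
by rewrite eseries0 ?adde0// => -[|k].
Qed.

(** By subadditivity of [nu], each cover of [A] bounds [nu A] by [K] times its cost. Most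
    inequalities between outer measures below come from this: they are checked on the covering sets
    alone and then hold for arbitrary sets. *)
Lemma cover_outer_le_bound (nu : set T -> \bar R) (K : R) :
  (0 < K)%R -> nu set0 = 0 -> {homo nu : A B / A `<=` B >-> A <= B} ->
  sigma_subadditive nu -> (forall i, C i -> nu (S i) <= K%:E * c i) ->
  forall A, nu A <= K%:E * cover_outer C S c A.
Proof.
move=> K0 nu0 nuS nusub nuK A.
rewrite muleC -lee_pdivrMr//; apply: le_ereal_inf_tmp => _ [F [FC AF] <-].
have nu_ge0 B : 0 <= nu B by rewrite -nu0; apply: nuS; exact: sub0set.
rewrite lee_pdivrMr// muleC -nneseriesZl//; last by move=> k _; case: (F k) => /=.
apply: (le_trans (nuS _ _ AF)); apply: (le_trans (nusub _)).
apply: lee_nneseries => // k _; case E : (F k) => [i|] /=.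
  by apply: nuK; exact: FC E.
by rewrite nu0 mule0.
Qed.

End outer_covers.

Section leb_basic.
Context {R : realType}.
Local Open Scope ereal_scope.

Lemma box_vol_ge0 N (ab : 'rV[R]_N * 'rV[R]_N) : (0 <= box_vol ab)%R.
Proof. by rewrite prodr_ge0// => i _; rewrite le_max lexx. Qed.

Lemma leb_outer_box_le N (ab : 'rV[R]_N * 'rV[R]_N) (A : set 'rV[R]_N) :
  A `<=` box ab -> leb_outer R N A <= (box_vol ab)%:E.
Proof.
by move=> AB; apply: (@cover_outer_le1 _ _ _ setT (@box R N) (fun ab => (box_vol ab)%:E)) => // i; rewrite lee_fin box_vol_ge0.
Qed.

Lemma leb_outer_le_bound N (nu : set 'rV[R]_N -> \bar R) (K : R) :
  (0 < K)%R -> nu set0 = 0 -> {homo nu : A B / A `<=` B >-> A <= B} ->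
  sigma_subadditive nu -> (forall ab, nu (box ab) <= (K * box_vol ab)%:E) ->
  forall A, nu A <= K%:E * leb_outer R N A.
Proof.
move=> K0 nu0 nuS nusub nuK A.
apply: cover_outer_le_bound => //; first by move=> ab; rewrite lee_fin box_vol_ge0.
Qed.

Definition rcat0 k (t : R) (y : 'rV[R]_k) : 'rV[R]_k.+1 :=
  \row_i oapp (fun j => y ord0 j) t (unlift ord0 i).

Definition rtail k (x : 'rV[R]_k.+1) : 'rV[R]_k := \row_j x ord0 (lift ord0 j).

Lemma rcat00 k t (y : 'rV[R]_k) : rcat0 t y ord0 ord0 = t.
Proof. by rewrite mxE unlift_none. Qed.

Lemma rcat0S k t (y : 'rV[R]_k) j : rcat0 t y ord0 (lift ord0 j) = y ord0 j.
Proof. by rewrite mxE liftK. Qed.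

Lemma rtail_rcat0 k t (y : 'rV[R]_k) : rtail (rcat0 t y) = y.
Proof. by apply/rowP => j; rewrite mxE rcat0S. Qed.

Lemma rcat0_rtail k (x : 'rV[R]_k.+1) : rcat0 (x ord0 ord0) (rtail x) = x.
Proof.
apply/rowP => i; rewrite mxE; case: unliftP => [j|] ->//=.
by rewrite mxE.
Qed.

Lemma box_rcat0 k (ab : 'rV[R]_k.+1 * 'rV[R]_k.+1) t y :
  box ab (rcat0 t y) <-> ((ab.1 ord0 ord0 <= t <= ab.2 ord0 ord0)%R /\
                       box (rtail ab.1, rtail ab.2) y).
Proof.
split=> [h|[h1 h2] i].
  split; first by have := h ord0; rewrite rcat00.
  by move=> j; have := h (lift ord0 j); rewrite rcat0S !mxE.
have [j|] := unliftP ord0 i => ->; last by rewrite rcat00.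
by have := h2 j; rewrite rcat0S !mxE.
Qed.

Lemma box_vol_rtail k (ab : 'rV[R]_k.+1 * 'rV[R]_k.+1) :
  box_vol ab = (Num.max 0 (ab.2 ord0 ord0 - ab.1 ord0 ord0) *
                box_vol (rtail ab.1, rtail ab.2))%R.
Proof.
rewrite /box_vol big_ord_recl; congr (_ * _)%R.
by apply: eq_bigr => j _; rewrite !mxE.
Qed.

(** The half of Fubini's theorem that survives for arbitrary sets. A cover of [X] by boxes restricts
    to a cover of each slice, so [m] is at most the total volume of the slices of the boxes at
    height [z]; this is integrated over [z] between [s] and [t]. *)
Lemma leb_outer_slice k (X : set 'rV[R]_k.+1) (m s t : R) :
  (0 <= m)%R -> (s <= t)%R ->
  (forall z, (s < z < t)%R -> m%:E <= leb_outer R k [set y | X (rcat0 z y)]) ->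
  (m * (t - s))%:E <= leb_outer R k.+1 X.
Proof.
move=> m0 st hX; apply: le_ereal_inf_tmp => _ [F [_ XF] <-].
pose tl (ab : 'rV[R]_k.+1 * 'rV[R]_k.+1) := (rtail ab.1, rtail ab.2).
pose I (ab : 'rV[R]_k.+1 * 'rV[R]_k.+1) := `[ab.1 ord0 ord0, ab.2 ord0 ord0]%classic : set R.
pose g n (z : measurableTypeR R) : \bar R := oapp (fun ab => (box_vol (tl ab) * \1_(I ab) z)%:E) 0 (F n).
have g0 n z : 0 <= g n z.
  rewrite /g; case: (F n) => //= ab; rewrite lee_fin mulr_ge0// box_vol_ge0//.
have mg n : measurable_fun setT (g n).
  rewrite /g; case: (F n) => [ab|] /=; last exact: measurable_cst.
  apply/measurable_EFinP; apply: measurable_funM => //.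
  by apply: measurable_indic; exact: measurable_itv.
have -> : (m * (t - s))%:E = \int[lebesgue_measure]_(z in `]s, t[) m%:E.
  rewrite integral_cst//= lebesgue_measure_itv/= lte_fin; case: ltP => // ts.
  by have -> : s = t by [apply/le_anti/andP]; rewrite subrr mulr0 mule0.
apply: (@le_trans _ _ (\int[lebesgue_measure]_(z in `]s, t[) \sum_(n <oo) g n z)).
  apply: ge0_le_integral => //.
    apply: (@measurable_funS _ _ _ _ setT) => //.
    exact: ge0_emeasurable_sum.
  move=> z; rewrite /= in_itv/= => zst; apply: (le_trans (hX _ zst)).
  (* The boxes that the height [z] crosses, with their coordinate 0 dropped. *)
  pose G n : option ('rV[R]_k * 'rV[R]_k) :=
    obind (fun ab => if z \in I ab then Some (tl ab) else None) (F n).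
  apply: ereal_inf_lbound; exists G.
    split=> // y /= /XF[n _]; rewrite /G /g; case E : (F n) => [ab|]//= /box_rcat0[h1 h2].
    by exists n => //; rewrite /G E /= ifT// inE /I/= in_itv.
  apply: eq_eseriesr => n _; rewrite /G /g; case: (F n) => //= ab.
  by rewrite indicE; case: (z \in _); rewrite /= ?mulr1 ?mulr0.
rewrite integral_nneseries//; last first.
  move=> n; exact: (@measurable_funS _ _ _ _ setT).
apply: lee_nneseries => n _; first by move=> _; apply: integral_ge0.
rewrite /g; case: (F n) => [ab|] /=; last by rewrite integral0.
under eq_integral do rewrite EFinM.
rewrite ge0_integralZl//=; last 2 first.
- apply/measurable_EFinP; apply: (@measurable_funS _ _ _ _ setT) => //.
  by apply: measurable_indic; exact: measurable_itv.
- by rewrite lee_fin box_vol_ge0.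
rewrite box_vol_rtail mulrC EFinM lee_wpmul2l ?lee_fin ?box_vol_ge0//.
have mI : measurable (I ab : set (measurableTypeR R)) by exact: measurable_itv.
rewrite integral_indic//=.
apply: (@le_trans _ _ (lebesgue_measure (I ab))).
  by apply: le_measure; rewrite ?inE//=; exact: measurableI.
rewrite lebesgue_measure_itv/= lte_fin; case: ifP => h; rewrite -?EFinB lee_fin le_max ?lexx//.
by rewrite orbT.
Qed.

(** By induction on the dimension: each slice of the box has at least the volume of the base. *)
Lemma leb_outer_box N (ab : 'rV[R]_N * 'rV[R]_N) :
  leb_outer R N (box ab) = (box_vol ab)%:E.
Proof.
apply/eqP; rewrite eq_le leb_outer_box_le//=.
elim: N ab => [|k IH] ab.
  (* In dimension 0 the space is one point and every box has volume 1, an empty product; some member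
     of the cover contains the point. *)
  rewrite /box_vol big_ord0; apply: le_ereal_inf_tmp => _ [F [_ XF] <-].
  have [|n _] := XF (0%R : 'rV[R]_0); first by case.
  case E : (F n) => [cd|]//= _.
  rewrite (@nneseriesD1 _ _ n)//=; last by move=> i _; case: (F i) => //= xy; rewrite lee_fin box_vol_ge0.
  rewrite E/= /box_vol big_ord0 leeDl// nneseries_ge0// => i _ _.
  by case: (F i) => //= xy; rewrite lee_fin prodr_ge0// => j _; rewrite le_max lexx.
rewrite box_vol_rtail; case: (leP (ab.2 ord0 ord0 - ab.1 ord0 ord0)%R 0%R) => h.
  by rewrite mul0r outer_measure_ge0.
rewrite mulrC; apply: leb_outer_slice; first exact: box_vol_ge0.
  by lra.
move=> z /andP[az zb]; apply: (le_trans (IH _)); apply: le_outer_measure => y hy/=.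
by apply/box_rcat0; split=> //; rewrite !ltW.
Qed.

End leb_basic.

Definition mble {R : realType} {N : nat} (A : set 'rV[R]_N) : Prop :=
  (leb_outer R N).-cara.-measurable A.

Section leb_measurable.
Context {R : realType} {N : nat}.
Local Open Scope ereal_scope.
Notation mu := (leb_outer R N).

Lemma box_affine (a : R) (v : 'rV[R]_N) (ab : 'rV[R]_N * 'rV[R]_N) : (0 < a)%R ->
  (fun x => a *: x + v)%R @^-1` box ab =
  box (a^-1 *: (ab.1 - v), a^-1 *: (ab.2 - v))%R.
Proof.
move=> a0; apply/seteqP; split=> x /= h i; have := h i; rewrite !mxE;
  by rewrite -(@ler_pM2l _ a)// -[X in (_ <= X)%R -> _](@ler_pM2l _ a)// ?mulrA ?divff ?gt_eqF// ?mul1r ?lerBlDr ?lerBrDr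
  || by rewrite !(@ler_pdivrMl _ a) // !(@ler_pdivlMl _ a)// lerBlDr lerBrDr.
Qed.

Lemma box_vol_affine (a : R) (v : 'rV[R]_N) (ab : 'rV[R]_N * 'rV[R]_N) : (0 < a)%R ->
  (box_vol (a^-1 *: (ab.1 - v), a^-1 *: (ab.2 - v)) = a ^- N * box_vol ab)%R.
Proof.
move=> a0; rewrite /box_vol/= -exprVn -[in X in (X * _)%R](card_ord N) -prodr_const -big_split/=.
apply: eq_bigr => i _; rewrite !mxE -mulrBr maxr_pMr ?invr_ge0 ?ltW// mulr0.
by congr (Num.max _ (_ * _))%R; lra.
Qed.

Lemma leb_outer_affine_le (a : R) (v : 'rV[R]_N) A : (0 < a)%R ->
  mu ((fun x => a *: x + v)%R @^-1` A) <= (a ^- N)%:E * mu A.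
Proof.
move=> a0; move: A; apply: leb_outer_le_bound.
- by rewrite invr_gt0 exprn_gt0.
- by rewrite preimage_set0 outer_measure0.
- by move=> A B AB; apply: le_outer_measure; exact: preimage_subset.
- by move=> F; rewrite preimage_bigcup; exact: outer_measure_sigma_subadditive.
- by move=> ab; rewrite box_affine// leb_outer_box box_vol_affine.
Qed.

(** The reverse inequality is [leb_outer_affine_le] for the inverse map. *)
Lemma leb_outer_affine (a : R) (v : 'rV[R]_N) A : (0 < a)%R ->
  mu ((fun x => a *: x + v)%R @^-1` A) = (a ^- N)%:E * mu A.
Proof.
move=> a0; apply/eqP; rewrite eq_le leb_outer_affine_le//=.
have an0 : (0 < a ^+ N)%R by rewrite exprn_gt0.
rewrite muleC lee_pdivrMr//.
have := @leb_outer_affine_le a^-1 (- (a^-1 *: v))%R ((fun x => a *: x + v)%R @^-1` A).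
rewrite invr_gt0 => /(_ a0); rewrite exprVn invrK muleC.
congr (_ <= _); congr (mu _); apply/seteqP; split=> x /=;
  by rewrite scalerDr scalerN !scalerA divff ?gt_eqF// !scale1r subrK.
Qed.

Lemma leb_outer_scale (a : R) A : (0 < a)%R ->
  mu ((fun x => a *: x)%R @^-1` A) = (a ^- N)%:E * mu A.
Proof.
move=> a0; rewrite -(@leb_outer_affine a 0%R A a0); congr (mu _).
by apply/seteqP; split=> x /=; rewrite addr0.
Qed.

Lemma leb_outer_shift (v : 'rV[R]_N) A : mu ((fun x => x + v)%R @^-1` A) = mu A.
Proof.
have := @leb_outer_affine 1%R v A ltr01; rewrite expr1n invr1 mul1e => <-.
by congr (mu _); apply/seteqP; split=> x /=; rewrite scale1r.
Qed.

(** The sum of the measures of the two parts of [X] is itself monotone and subadditive in [X], so it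
    is enough to bound it on boxes, and the half-space cuts a box into two boxes. *)
Lemma halfspace_cara (i : 'I_N) (c : R) : mu.-caratheodory [set x | (x ord0 i <= c)%R].
Proof.
apply: le_caratheodory_measurable => X; rewrite -[leRHS]mul1e.
pose A := [set x : 'rV[R]_N | (x ord0 i <= c)%R].
pose nu X := mu (X `&` A) + mu (X `&` ~` A).
move: X; apply: (@leb_outer_le_bound _ _ nu 1%R) => //.
- by rewrite /nu !set0I outer_measure0 adde0.
- by move=> B C BC; rewrite leeD//; apply: le_outer_measure; apply: setSI.
- move=> F; rewrite /nu nneseriesD//; last 2 first.
    by move=> *; exact: outer_measure_ge0.
    by move=> *; exact: outer_measure_ge0.
  rewrite !setI_bigcupl; apply: leeD; exact: outer_measure_sigma_subadditive.
move=> [a b]; rewrite mul1r.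
pose b' := (\row_j if j == i then Num.min (b ord0 i) c else b ord0 j)%R.
pose a' := (\row_j if j == i then Num.max (a ord0 i) c else a ord0 j)%R.
have h1 : mu (box (a, b) `&` A) <= (box_vol (a, b'))%:E.
  apply: leb_outer_box_le => x [xab xA] j; rewrite /= !mxE.
  by case: eqP => [->|_]; [have := xab i|have := xab j]; rewrite //= le_min xA andbT.
have h2 : mu (box (a, b) `&` ~` A) <= (box_vol (a', b))%:E.
  apply: leb_outer_box_le => x [xab /negP xA] j; rewrite /= !mxE.
  move: xA; rewrite /= -ltNge => xA.
  by case: eqP => [->|_]; [have := xab i|have := xab j]; rewrite //= ge_max (ltW xA) andbT.
apply: (le_trans (leeD h1 h2)); rewrite -EFinD lee_fin /box_vol/=.
rewrite (bigD1 i)//= [X in (_ + X)%R](bigD1 i)//= [leRHS](bigD1 i)//= !mxE eqxx.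
rewrite [X in (_ * X + _)%R](_ : _ = \prod_(j < N | j != i) Num.max 0 (b ord0 j - a ord0 j))%R; last first.
  by apply: eq_bigr => j /negbTE ji; rewrite !mxE ji.
rewrite [X in (_ + _ * X)%R](_ : _ = \prod_(j < N | j != i) Num.max 0 (b ord0 j - a ord0 j))%R; last first.
  by apply: eq_bigr => j /negbTE ji; rewrite !mxE ji.
rewrite -mulrDl ler_wpM2r ?prodr_ge0//; first by move=> j _; rewrite le_max lexx.
rewrite /Num.max /Num.min; repeat case: ifP; lra.
Qed.

Lemma mble_halfspace (i : 'I_N) (c : R) : mble [set x | (x ord0 i <= c)%R].
Proof. exact: halfspace_cara. Qed.

Lemma measurable_coord (i : 'I_N) :
  measurable_fun [set: caratheodory_type mu] ((fun x => x ord0 i) : caratheodory_type mu -> R).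
Proof.
apply: (measurability _ (RGenOInfty.measurableE R)) => _ [_ [c ->] <-].
rewrite setTI; have -> : (fun x : caratheodory_type mu => x ord0 i) @^-1` `]c, +oo[ =
    ~` [set x : 'rV[R]_N | (x ord0 i <= c)%R].
  by apply/seteqP; split=> x /=; rewrite in_itv/= andbT ltNge => /negP.
exact/measurableC/mble_halfspace.
Qed.

Lemma mble_qball (c : 'rV[R]_N) (e : R) : mble [set x : 'rV[R]_N | forall i, (`|x ord0 i - c ord0 i| < e)%R].
Proof.
rewrite [X in mble X](_ : _ =
    \bigcap_(i in [set: 'I_N]) [set x : 'rV[R]_N | (`|x ord0 i - c ord0 i| < e)%R]); last first.
  by apply/seteqP; split=> x /= h i; [move=> _|]; exact: h.
apply: fin_bigcap_measurable => // i _.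
have := measurable_coord i measurableT (measurable_itv `](c ord0 i - e)%R, (c ord0 i + e)%R[).
rewrite setTI; congr (measurable _); apply/seteqP; split=> x /=; rewrite in_itv/= ltr_distl//.
Qed.

Lemma ball_rV (x y : 'rV[R]_N) (e : R) : (0 < e)%R ->
  ball x e y <-> (forall i, (`|y ord0 i - x ord0 i| < e)%R).
Proof.
move=> e0; split=> [h i|h].
  by case: h => _ /(_ ord0 i); rewrite /ball/= distrC.
by split=> // i j; rewrite /ball/= distrC ord1.
Qed.

Lemma open_mble (A : set 'rV[R]_N) : open A -> mble A.
Proof.
move=> oA.
pose c (q : 'rV[rat]_N) : 'rV[R]_N := map_mx (@ratr R) q.
(* Open cubes with rational centre and half-side 1/(n+1), kept only when they lie in [A]. *)
pose F (qn : 'rV[rat]_N * nat) : set 'rV[R]_N :=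
  if pselect ([set x : 'rV[R]_N | forall i, (`|x ord0 i - c qn.1 ord0 i| < qn.2.+1%:R^-1)%R] `<=` A)
  then [set x : 'rV[R]_N | forall i, (`|x ord0 i - c qn.1 ord0 i| < qn.2.+1%:R^-1)%R] else set0.
have -> : A = \bigcup_i F i.
  apply/seteqP; split=> x; last by move=> [qn _]; rewrite /F; case: pselect => // h; exact: h.
  move=> Ax; have /nbhs_ballP[e /= e0 eA] : nbhs x A by exact: open_nbhs_nbhs.
  have [n hn] : exists n, (n.+1%:R^-1 < e / 2)%R.
    have e20 : (0 < e / 2)%R by rewrite divr_gt0.
    near \oo => n; exists n; near: n; exact: near_infty_natSinv_lt (PosNum e20).
  have /choice[q hq] : forall i, exists q : rat, (`|x ord0 i - ratr q| < n.+1%:R^-1)%R.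
    move=> i; have [|q] := @rat_in_itvoo R (x ord0 i - n.+1%:R^-1)%R (x ord0 i + n.+1%:R^-1)%R.
      by rewrite ltrBlDr -addrA ltrDl -mulr2n mulrn_wgt0// invr_gt0.
    by rewrite in_itv/= => hq; exists q; rewrite distrC ltr_distl.
  have hx i : (`|x ord0 i - c (\row_i q i) ord0 i| < n.+1%:R^-1)%R by rewrite !mxE.
  exists (\row_i q i, n) => //; rewrite /F; case: pselect => // -[].
  move=> y /= hy; apply: eA; apply/ball_rV => // i.
  rewrite (le_lt_trans (ler_distD (c (\row_i q i) ord0 i) _ _))//.
  by rewrite [ltRHS]splitr ltrD ?(lt_trans (hy i))// distrC (lt_trans (hx i)).
apply: countable_bigcupT_measurable => [|qn]; first exact: countableP.
rewrite /F; case: pselect => /= _; last exact: measurable0.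
exact: (mble_qball (c qn.1) qn.2.+1%:R^-1).
Unshelve. all: by end_near. Qed.

Lemma closed_mble (A : set 'rV[R]_N) : closed A -> mble A.
Proof. by move=> /closed_openC/open_mble/measurableC; rewrite setCK. Qed.

Lemma continuous_mfun (f : 'rV[R]_N -> R) : continuous f ->
  measurable_fun [set: caratheodory_type mu] (f : caratheodory_type mu -> R).
Proof.
move=> cf; apply: (measurability _ (RGenOInfty.measurableE R)) => _ [_ [c ->] <-].
by rewrite setTI; apply: open_mble; move/continuousP : cf; apply; exact: interval_open.
Qed.

End leb_measurable.

(** * Euclidean balls *)

Section enorm_theory.
Context {R : realType} {N : nat}.
Implicit Types (x y c : 'rV[R]_N) (a r : R).

Definition dotv x y : R := \sum_(i < N) x ord0 i * y ord0 i.

Lemma dotvE x y : dotv x y = \tr (x^T *m y).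
Proof.
rewrite mxtrace_mulC /mxtrace big_ord_recl big_ord0 addr0 mxE.
by apply: eq_bigr => i _; rewrite !mxE mulrC.
Qed.

Lemma enorm_ge0 x : 0 <= enorm x. Proof. exact: sqrtr_ge0. Qed.
Hint Resolve enorm_ge0 : core.

Lemma sqr_enorm x : enorm x ^+ 2 = \sum_(i < N) x ord0 i ^+ 2.
Proof. by rewrite sqr_sqrtr// sumr_ge0// => i _; rewrite sqr_ge0. Qed.

Lemma sqr_enormE x : enorm x ^+ 2 = dotv x x.
Proof. by rewrite sqr_enorm; apply: eq_bigr => i _; rewrite expr2. Qed.

Lemma enorm0 : enorm (0 : 'rV[R]_N) = 0.
Proof. by rewrite /enorm big1 ?sqrtr0// => i _; rewrite mxE expr0n. Qed.

Lemma enormZ a x : enorm (a *: x) = `|a| * enorm x.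
Proof.
rewrite /enorm (eq_bigr (fun i => a ^+ 2 * x ord0 i ^+ 2)); last first.
  by move=> i _; rewrite mxE exprMn.
by rewrite -mulr_sumr sqrtrM ?sqr_ge0// sqrtr_sqr.
Qed.

Lemma enormN x : enorm (- x) = enorm x.
Proof. by rewrite -scaleN1r enormZ normrN1 mul1r. Qed.

Lemma enormB x y : enorm (x - y) = enorm (y - x).
Proof. by rewrite -enormN opprB. Qed.

Lemma ler_coord_enorm x i : `|x ord0 i| <= enorm x.
Proof.
rewrite -(ler_pXn2r (n := 2))// ?nnegrE// sqr_enorm real_normK ?num_real//.
by rewrite (bigD1 i)//= lerDl sumr_ge0// => j _; rewrite sqr_ge0.
Qed.

Lemma enorm_eq0 x : (enorm x == 0) = (x == 0).
Proof.
apply/eqP/eqP => [x0|->]; last exact: enorm0.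
apply/rowP => i; rewrite mxE; apply/eqP; rewrite -normr_eq0 eq_le normr_ge0 andbT.
by rewrite -x0 ler_coord_enorm.
Qed.

Lemma enorm_gt0 x : (0 < enorm x) = (x != 0).
Proof. by rewrite lt_neqAle eq_sym enorm_eq0 enorm_ge0 andbT. Qed.

Lemma dotvC x y : dotv x y = dotv y x.
Proof. by apply: eq_bigr => i _; rewrite mulrC. Qed.

Lemma dotvDl x y z : dotv (x + y) z = dotv x z + dotv y z.
Proof. by rewrite -big_split; apply: eq_bigr => i _; rewrite mxE mulrDl. Qed.

Lemma dotvZl a x y : dotv (a *: x) y = a * dotv x y.
Proof. by rewrite mulr_sumr; apply: eq_bigr => i _; rewrite mxE mulrA. Qed.

Lemma dotvDr x y z : dotv z (x + y) = dotv z x + dotv z y.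
Proof. by rewrite dotvC dotvDl !(dotvC z). Qed.

Lemma dotvZr a x y : dotv y (a *: x) = a * dotv y x.
Proof. by rewrite dotvC dotvZl dotvC. Qed.

Lemma dotv_le x y : `|dotv x y| <= enorm x * enorm y.
Proof.
rewrite -(ler_pXn2r (n := 2))// ?nnegrE ?mulr_ge0// exprMn real_normK ?num_real//.
have [->|y0] := eqVneq y 0.
  rewrite enorm0 expr0n mulr0 /dotv big1 ?expr0n// => i _; by rewrite mxE mulr0.
have B0 : 0 < enorm y ^+ 2 by rewrite exprn_gt0// enorm_gt0.
(* Cauchy-Schwarz: the squared norm of |y|^2 x - (x.y) y is |y|^2 (|x|^2 |y|^2 - (x.y)^2). *)
have : 0 <= enorm (enorm y ^+ 2 *: x + (- dotv x y) *: y) ^+ 2 by exact: sqr_ge0.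
rewrite sqr_enormE !(dotvDl, dotvDr, dotvZl, dotvZr) -!sqr_enormE (dotvC y x).
set C := dotv x y; set A := enorm x; set B := enorm y ^+ 2 => h.
rewrite -subr_ge0 -(pmulr_rge0 _ B0) -/B; apply: (le_trans h); rewrite le_eqVlt; apply/orP; left.
by apply/eqP; rewrite -/B; lra.
Qed.

Lemma ler_enormD x y : enorm (x + y) <= enorm x + enorm y.
Proof.
rewrite -(ler_pXn2r (n := 2))// ?nnegrE ?addr_ge0//.
rewrite sqr_enormE !(dotvDl, dotvDr) -!sqr_enormE (dotvC y x) sqrrD.
have := dotv_le x y; rewrite ler_norml => /andP[_ h].
by rewrite mulr2n; lra.
Qed.

Lemma ler_enormB x y : enorm x - enorm y <= enorm (x - y).
Proof. by rewrite lerBlDr (le_trans _ (ler_enormD _ _))// subrK. Qed.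

Lemma ler_dist_enorm x y : `|enorm x - enorm y| <= enorm (x - y).
Proof. by rewrite ler_norml lerNl opprB enormB ler_enormB enormB ler_enormB. Qed.

Lemma ler_enorm_sup x (e : R) : 0 <= e -> (forall i, `|x ord0 i| <= e) ->
  enorm x <= Num.sqrt N%:R * e.
Proof.
move=> e0 h; rewrite -(ler_pXn2r (n := 2))// ?nnegrE ?mulr_ge0// exprMn sqr_enorm [in leRHS]sqr_sqrtr ?ler0n//.
apply: (@le_trans _ _ (\sum_(i < N) e ^+ 2)).
  apply: ler_sum => i _; rewrite -[X in X <= _]real_normK ?num_real//.
  by rewrite ler_pXn2r ?nnegrE.
by rewrite sumr_const card_ord mulr_natl.
Qed.

Lemma enorm_lipschitz_continuous (f : 'rV[R]_N -> R) :
  (forall x y, `|f x - f y| <= enorm (x - y)) -> continuous f.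
Proof.
move=> lf x A /nbhs_ballP[e /= e0 eA].
suff : nbhs x (f @^-1` A) by [].
apply/nbhs_ballP.
pose K := Num.sqrt (N%:R : R) + 1.
have K0 : 0 < K by rewrite ltr_wpDl// sqrtr_ge0.
have eK : 0 < e / K by rewrite divr_gt0.
exists (e / K) => //= y /ball_rV-/(_ eK) h; apply: eA; rewrite /ball/=; apply: (le_lt_trans (lf _ _)).
apply: (@le_lt_trans _ _ (Num.sqrt N%:R * (e / K))).
  apply: ler_enorm_sup; first exact: ltW.
  by move=> i; rewrite !mxE distrC ltW.
by rewrite mulrCA -[ltRHS]mulr1 ltr_pM2l// ltr_pdivrMr// mul1r ltrDl.
Qed.

Lemma continuous_enormB c : continuous (fun x : 'rV[R]_N => enorm (x - c)).
Proof.
apply: enorm_lipschitz_continuous => x y; apply: (le_trans (ler_dist_enorm _ _)).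
by rewrite opprB addrA subrK.
Qed.

Lemma continuous_enorm : continuous (@enorm R N).
Proof. by apply: enorm_lipschitz_continuous => x y; exact: ler_dist_enorm. Qed.

Lemma open_eball c r : open (eball c r : set 'rV[R]_N).
Proof.
rewrite (_ : eball c r = (fun x => enorm (x - c)) @^-1` [set z | z < r])//.
by move/continuousP: (@continuous_enormB c); apply; exact: open_lt.
Qed.

Definition ceball c r := [set x : 'rV[R]_N | enorm (x - c) <= r].

Lemma closed_ceball c r : closed (ceball c r).
Proof.
rewrite (_ : ceball c r = (fun x => enorm (x - c)) @^-1` [set z | z <= r])//.
by move/continuous_closedP: (@continuous_enormB c); apply; exact: closed_le.
Qed.

Lemma mble_eball c r : mble (eball c r : set 'rV[R]_N).
Proof. exact/open_mble/open_eball. Qed.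

Definition ballvol : R := fine (leb_outer R N (eball 0 1)).

Lemma leb_eball1_fin : (leb_outer R N (eball 0 1) < +oo)%E.
Proof.
apply: (@le_lt_trans _ _ (box_vol (const_mx (- 1), const_mx 1) : R)%:E); last by rewrite ltry.
apply: leb_outer_box_le => x; rewrite /eball/= subr0 => x1 i; rewrite !mxE -ler_norml.
by rewrite (le_trans (ler_coord_enorm _ _))// ltW.
Qed.

Lemma leb_eball1 : leb_outer R N (eball 0 1) = ballvol%:E.
Proof. by rewrite /ballvol fineK// ge0_fin_numE ?leb_eball1_fin// outer_measure_ge0. Qed.

Lemma ballvol_gt0 : 0 < ballvol.
Proof.
(* The cube of half-side 1/(N+1) lies in the unit ball, since the square root of N is less than N +
   1. *)
rewrite -lte_fin -leb_eball1; pose e : R := N.+1%:R^-1.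
have e0 : 0 < e by rewrite invr_gt0.
apply: (@lt_le_trans _ _ (leb_outer R N (box (const_mx (- e), const_mx e)))).
  rewrite leb_outer_box lte_fin prodr_gt0// => i _; rewrite !mxE lt_max; apply/orP; right.
  lra.
apply: le_outer_measure => x xe; rewrite /eball/= subr0.
apply: (@le_lt_trans _ _ (Num.sqrt N%:R * e)).
  by apply: ler_enorm_sup => [|i]; [exact: ltW|have := xe i; rewrite !mxE ler_norml].
rewrite ltr_pdivrMr// mul1r -(ltr_pXn2r (n := 2))// ?nnegrE// sqr_sqrtr ?ler0n//.
by rewrite -natrX ltr_nat; lia.
Qed.

Lemma leb_eball c r : 0 < r -> leb_outer R N (eball c r) = (r ^+ N * ballvol)%:E.
Proof.
move=> r0; have ri : 0 < r^-1 by rewrite invr_gt0.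
rewrite EFinM -leb_eball1.
have := @leb_outer_affine R N r^-1 (- (r^-1 *: c)) (eball 0 1) ri.
rewrite exprVn invrK => <-; congr (leb_outer R N _); apply/seteqP; split=> x; rewrite /eball/= subr0 -scalerBr enormZ;
  by rewrite gtr0_norm// ltr_pdivrMl// mulr1.
Qed.

(** The closed ball lies in the open balls of radius r + 1/(n+1), and the volume is a polynomial in
    the radius, hence continuous. *)
Lemma leb_ceball c r : 0 < r -> leb_outer R N (ceball c r) = (r ^+ N * ballvol)%:E.
Proof.
move=> r0; apply/eqP; rewrite eq_le -{2}(leb_eball c)// le_outer_measure ?andbT; last first.
  by move=> x; rewrite /eball/ceball/= => /ltW.
pose p : {poly R} := ballvol *: 'X^N.
have pE (x : R) : p.[x] = x ^+ N * ballvol by rewrite hornerZ hornerXn mulrC.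
have cp : (fun n : nat => p.[r + n.+1%:R^-1]) @ \oo --> p.[r].
  have H : (fun n : nat => r + n.+1%:R^-1) @ \oo --> r + 0.
    by apply: cvgD; [exact: cvg_cst|exact: cvg_harmonic].
  rewrite addr0 in H; apply: (cvg_comp _ _ H).
  exact: continuous_horner.
rewrite -pE; apply/lee_addgt0Pr => e e0.
have [n hn] : exists n : nat, p.[r + n.+1%:R^-1] < p.[r] + e.
  near \oo => n; exists n; near: n; apply: (cvgr_lt _ cp); lra.
rewrite -EFinD; apply: (@le_trans _ _ p.[r + n.+1%:R^-1]%:E); last by rewrite lee_fin ltW.
rewrite pE -(leb_eball c); last by rewrite addr_gt0.
apply: le_outer_measure => x; rewrite /ceball/eball/= => xr.
by rewrite (le_lt_trans xr)// ltrDl.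
Unshelve. all: by end_near. Qed.

End enorm_theory.
Arguments ballvol R N : clear implicits.

Section subadditive_extremal.
Context {R : realType} {N : nat}.
Variable nu : set 'rV[R]_N -> \bar R.
Hypothesis nu0 : nu set0 = 0%E.
Hypothesis le_nu : {homo nu : A B / A `<=` B >-> (A <= B)%E}.
Hypothesis nu_sub : sigma_subadditive nu.

Lemma sigma_sub_ge0 A : (0 <= nu A)%E.
Proof. by rewrite -nu0; apply: le_nu; exact: sub0set. Qed.

Lemma sigma_subU A B : (nu (A `|` B) <= nu A + nu B)%E.
Proof.
have -> : A `|` B = \bigcup_n [eta (fun n => if n is 0%N then A else if n is 1%N then B else set0)] n.
  apply/seteqP; split=> [x [Ax|Bx]|x [[|[|n]] _]//].
  - by exists 0%N.
  - by exists 1%N.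
  - by left.
  - by right.
apply: (le_trans (nu_sub _)); rewrite (nneseries_split _ 2%N); last by move=> *; exact: sigma_sub_ge0.
rewrite eseries0; last by move=> [|[|n]].
by rewrite addr0 big_nat_recr//= big_nat1.
Qed.

Lemma sigma_sub_fin (I : finType) (P : pred I) (F : I -> set 'rV[R]_N) A :
  A `<=` \bigcup_(i in [set i | P i]) F i -> (nu A <= \sum_(i | P i) nu (F i))%E.
Proof.
move=> AF; apply: (@le_trans _ _ (nu (\big[setU/set0]_(i | P i) F i))).
  apply: le_nu; apply: (subset_trans AF); move=> x [i Pi Fx]; by rewrite (bigD1 i)//=; left.
apply: (big_rec2 (fun x y => (nu x <= y)%E)) => [|i x y Pi xy]; first by rewrite nu0.
by apply: (le_trans (sigma_subU _ _)); rewrite leeD2l.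
Qed.

End subadditive_extremal.

Section leb_extremal.
Context {R : realType} {N : nat}.
Variable nu : set 'rV[R]_N -> \bar R.
Hypothesis nu0 : nu set0 = 0%E.
Hypothesis le_nu : {homo nu : A B / A `<=` B >-> (A <= B)%E}.
Hypothesis nu_sub : sigma_subadditive nu.
Hypothesis nu_shift : forall v A, nu ((fun x => x + v) @^-1` A) = nu A.

Let cube (c : 'rV[R]_N) (l : R) := box (c, c + const_mx l).

(** Cover the box by cubes of a grid of side l = 1/(n+1). Direction [i] takes at most w_i/l + 1 of
    them, so the total is at most C times the product of the w_i + l, and l tends to 0. *)
Lemma box_cube_cover (C : R) (n0 : nat) : 0 <= C ->
  (forall n : nat, (n0 <= n)%N -> (nu (cube 0 n.+1%:R^-1) <= (C * n.+1%:R^-1 ^+ N)%:E)%E) ->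
  forall ab, (nu (box ab) <= (C * box_vol ab)%:E)%E.
Proof.
move=> C0 hC [a b].
have [h|/existsNP[i hi]] := pselect (forall i, a ord0 i <= b ord0 i); last first.
  rewrite (_ : box _ = set0) ?nu0 ?lee_fin ?mulr_ge0 ?box_vol_ge0//.
  by apply/seteqP; split=> // x /(_ i)/=/andP[h1 h2]; apply: hi; exact: le_trans h2.
pose w i := b ord0 i - a ord0 i.
have w0 i : 0 <= w i by rewrite subr_ge0.
have key n : (n0 <= n)%N -> (nu (box (a, b)) <= (C * \prod_(i < N) (w i + n.+1%:R^-1))%:E)%E.
  move=> n0n; pose l : R := n.+1%:R^-1.
  have l0 : 0 < l by rewrite invr_gt0.
  pose K i := (Num.trunc (w i / l)).+1.
  pose M := \max_i K i.
  pose Q (i : 'I_N) : pred 'I_M := [pred j : 'I_M | (j < K i)%N].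
  pose F (f : {ffun 'I_N -> 'I_M}) := cube (a + \row_i (l * (f i)%:R)) l.
  have cov : box (a, b) `<=` \bigcup_(f in [set f | f \in family Q]) F f.
    move=> x xab; pose j i := Num.trunc ((x ord0 i - a ord0 i) / l).
    have jd i : 0 <= (x ord0 i - a ord0 i) / l.
      by rewrite divr_ge0 ?(ltW l0)// subr_ge0; have /andP[] := xab i.
    have jK i : (j i < K i)%N.
      rewrite ltnS; apply: le_truncn; rewrite ler_pM2r ?invr_gt0// lerD2r.
      by have /andP[] := xab i.
    have jM i : (j i < M)%N by rewrite (leq_trans (jK i))// (leq_bigmax i).
    exists [ffun i => Ordinal (jM i)].
      by apply/familyP => i; rewrite inE ffunE/=.
    move=> i; rewrite /= !mxE ffunE/=.
    have /andP[h1 h2] := truncn_itv (jd i).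
    move: h1 h2; rewrite -/(j i) ler_pdivlMr// ltr_pdivrMr// -natr1 mulrDl mul1r => h1 h2.
    by apply/andP; split; lra.
  apply: (le_trans (sigma_sub_fin nu0 le_nu nu_sub cov)).
  apply: (@le_trans _ _ (\sum_(f in family Q) (C * l ^+ N)%:E)%E).
    apply: lee_sum => f _; apply: le_trans (hC n n0n).
    rewrite -(nu_shift (a + \row_i (l * (f i)%:R)) (F f)); apply: le_nu => x hx i.
    by have := hx i; rewrite /= !mxE -/l => /andP[h1 h2]; apply/andP; split; lra.
  rewrite sumEFin lee_fin -mulr_sumr ler_wpM2l//.
  rewrite (eq_bigr (fun f : {ffun 'I_N -> 'I_M} => \prod_(i < N) l)); last first.
    by move=> f _; rewrite prodr_const card_ord.
  rewrite -(bigA_distr_big_dep _ (fun _ _ => l)) ler_prod// => i _.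
  rewrite sumr_ge0/=; last by move=> *; exact: ltW.
  rewrite (big_ord_narrow (leq_bigmax i)) sumr_const card_ord.
  rewrite /K mulrS -/l addrC lerD2r -mulr_natl -ler_pdivlMr//.
  by have /andP[] := truncn_itv (divr_ge0 (w0 i) (ltW l0)).
pose p : {poly R} := C *: \prod_(i < N) ((w i)%:P + 'X).
have pE (x : R) : p.[x] = C * \prod_(i < N) (w i + x).
  by rewrite hornerZ horner_prod; congr (_ * _); apply: eq_bigr => i _; rewrite hornerD hornerC hornerX.
have -> : C * box_vol (a, b) = p.[0].
  by rewrite pE; congr (_ * _); apply: eq_bigr => i _; rewrite addr0; apply/max_idPr; exact: w0.
have cp : (fun n : nat => p.[n.+1%:R^-1]) @ \oo --> p.[0].
  apply: (@cvg_comp _ _ _ (fun n : nat => n.+1%:R^-1 : R) (horner p) _ (nbhs (0 : R))).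
    exact: cvg_harmonic.
  exact: continuous_horner.
apply/lee_addgt0Pr => e e0.
have [n n0n hn] : exists2 n : nat, (n0 <= n)%N & p.[n.+1%:R^-1] < p.[0] + e.
  near \oo => n; exists n; near: n; [exact: nbhs_infty_ge|apply: (cvgr_lt _ cp); lra].
by apply: (le_trans (key n n0n)); rewrite -pE -EFinD lee_fin ltW.
Unshelve. all: by end_near. Qed.

(** The bound is asked for small cubes alone, from [n0] on; this suits set functions that are
    controlled only at small scale, such as [hausdorff_pre]. *)
Lemma le_leb_cube (C : R) (n0 : nat) : 0 < C ->
  (forall n : nat, (n0 <= n)%N -> (nu (cube 0 n.+1%:R^-1) <= (C * n.+1%:R^-1 ^+ N)%:E)%E) ->
  forall A, (nu A <= C%:E * leb_outer R N A)%E.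
Proof.
move=> C0 hC; apply: leb_outer_le_bound => //.
exact: (@box_cube_cover _ n0 (ltW C0) hC).
Qed.

Hypothesis nu_scale : forall a A, 0 < a -> nu ((fun x => a *: x) @^-1` A) = ((a ^- N)%:E * nu A)%E.
Hypothesis nu_cube : (nu (cube 0 1) < +oo)%E.
Hypothesis nu_ball : (nu (eball 0 1) <= leb_outer R N (eball 0 1))%E.

(* If nu is c times Lebesgue on cubes then nu <= c leb everywhere; comparing on
   a cube Q with the splitting Q = D + (Q \ D), D the unit ball, forces c <= 1. *)
Lemma le_leb_of_ball A : (nu A <= leb_outer R N A)%E.
Proof.
pose c := fine (nu (cube 0 1)).
have c0 : 0 <= c by rewrite fine_ge0// sigma_sub_ge0.
have cE : nu (cube 0 1) = c%:E by rewrite /c fineK// ge0_fin_numE// sigma_sub_ge0.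
have cubeE l : 0 < l -> nu (cube 0 l) = (c * l ^+ N)%:E.
  move=> l0; have := @nu_scale l^-1 (cube 0 1); rewrite invr_gt0 => /(_ l0).
  rewrite exprVn invrK cE -EFinM mulrC => <-; congr nu; apply/seteqP; split=> x h i;
  by have := h i; rewrite /= !mxE !add0r ler_pdivrMl// ler_pdivlMl// mulr1 mulr0.
suff c1 : c <= 1.
  rewrite -[leRHS]mul1e; apply: (@le_leb_cube _ 0) => // n _.
  by rewrite cubeE ?invr_gt0// lee_fin ler_wpM2r// exprn_ge0// invr_ge0.
rewrite leNgt; apply/negP => c1.
have nuc B : (nu B <= c%:E * leb_outer R N B)%E.
  by apply: (@le_leb_cube _ 0) => [|n _]; [lra|rewrite cubeE ?invr_gt0].
pose Q : set 'rV[R]_N := box (const_mx (-1), const_mx 1).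
have QE : nu Q = (c * 2 ^+ N)%:E.
  rewrite -cubeE// -(nu_shift (const_mx (-1)) Q); congr nu; apply/seteqP; split=> x h i;
  by have := h i; rewrite /= !mxE add0r => /andP[h1 h2]; apply/andP; split; lra.
have lQ : leb_outer R N Q = (2 ^+ N)%:E.
  rewrite leb_outer_box /box_vol (eq_bigr (fun=> 2)); last first.
    by move=> i _ /=; rewrite !mxE /Num.max ifT; lra.
  by rewrite prodr_const card_ord.
have DQ : eball 0 1 `<=` Q.
  move=> x; rewrite /eball/= subr0 => x1 i; rewrite !mxE -ler_norml.
  by rewrite (le_trans (ler_coord_enorm _ _))// ltW.
have hs : (leb_outer R N Q = leb_outer R N (eball 0 1) + leb_outer R N (Q `\` eball 0 1))%E.
  by rewrite (mble_eball 0 1 Q) setIidr.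
have := sigma_subU nu0 le_nu nu_sub (eball 0 1) (Q `\` eball 0 1).
rewrite setDUK// QE => h; have := le_trans h (leeD nu_ball (nuc _)).
rewrite lQ leb_eball1 in hs *.
have := ballvol_gt0 (R := R) (N := N); set d := ballvol R N => d0.
case: (leb_outer _ _ (Q `\` _)) hs => [q| |]//.
rewrite -!EFinM -!EFinD lee_fin => -[->]; rewrite -/d.
have : 0 < (c - 1) * d by rewrite mulr_gt0 ?subr_gt0.
lra.
Qed.

End leb_extremal.

(** The rotated measure is translation invariant, scales with degree N and agrees with [leb_outer]
    on the unit ball, so [le_leb_of_ball] applies; the transpose gives the converse. *)
Lemma leb_outer_isometry {R : realType} {N : nat} (M : 'M[R]_N) A :
  M *m M^T = 1%:M -> leb_outer R N ((fun x => x *m M) @^-1` A) = leb_outer R N A.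
Proof.
have en (M0 : 'M[R]_N) (x : 'rV[R]_N) : M0 *m M0^T = 1%:M -> enorm (x *m M0) = enorm x.
  move=> MM; apply/eqP; rewrite -(eqrXn2 (n := 2)) ?enorm_ge0// !sqr_enormE !dotvE.
  by rewrite trmx_mul mxtrace_mulC -mulmxA (mulmxA M0) MM mul1mx mxtrace_mulC.
have le M0 B : M0 *m M0^T = 1%:M -> (leb_outer R N ((fun x => x *m M0) @^-1` B) <= leb_outer R N B)%E.
  move=> MM; have MM' := mulmx1C MM.
  pose nu C := leb_outer R N ((fun x : 'rV[R]_N => x *m M0) @^-1` C).
  move: B; apply: (@le_leb_of_ball _ _ nu).
  - by rewrite /nu preimage_set0 outer_measure0.
  - by move=> C D CD; apply: le_outer_measure; exact: preimage_subset.
  - by move=> F; rewrite /nu preimage_bigcup; exact: outer_measure_sigma_subadditive.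
  - move=> v C; rewrite /nu -[RHS](leb_outer_shift (v *m M0^T)); congr leb_outer.
    by apply/seteqP; split=> x /=; rewrite mulmxDl -mulmxA MM' mulmx1.
  - move=> a C a0; rewrite /nu -leb_outer_scale//; congr leb_outer.
    by apply/seteqP; split=> x /=; rewrite scalemxAl.
  - apply: (@le_lt_trans _ _ (leb_outer R N (eball 0 (Num.sqrt N%:R + 1)))).
      apply: le_outer_measure => x h; rewrite /eball/= subr0 -(en M0)//.
      apply: (@le_lt_trans _ _ (Num.sqrt N%:R * 1)); last by rewrite mulr1 ltrDl.
      apply: ler_enorm_sup => // i; have := h i; rewrite /= !mxE add0r => /andP[h1 h2].
      by rewrite ger0_norm.
    by rewrite leb_eball ?ltry// ltr_wpDl// sqrtr_ge0.
  - rewrite /nu (_ : _ @^-1` _ = eball 0 1)//.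
    by apply/seteqP; split=> x; rewrite /eball/= !subr0 en.
move=> MM; apply/eqP; rewrite eq_le le//=.
have MM' := mulmx1C MM.
have := @le M^T ((fun x => x *m M) @^-1` A); rewrite trmxK => /(_ MM').
congr (_ <= _)%E; congr leb_outer; apply/seteqP; split=> x /=; by rewrite -mulmxA MM' mulmx1.
Qed.

(** * The isodiametric inequality *)

Section flat_hausdorff.
Context {R : realType}.
Local Open Scope ereal_scope.

(** [diam] is a [sup], with a junk value on unbounded sets, so an explicit bound accompanies it. *)
Definition pairwise_le N (B : set 'rV[R]_N) (D : R) :=
  forall x y, B x -> B y -> (enorm (x - y) <= D)%R.

Lemma diam_le N (B : set 'rV[R]_N) D : (0 <= D)%R -> pairwise_le B D -> (diam B <= D)%R.
Proof.
move=> D0 BD; rewrite /diam; set S := (X in sup X).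
have [S0|S0] := pselect (S !=set0).
  by apply: ge_sup => // _ [x Bx [y By <-]]; exact: BD.
suff -> : S = set0 by rewrite sup0.
by apply/seteqP; split=> // x Sx; apply: S0; exists x.
Qed.

Lemma le_diam N (B : set 'rV[R]_N) D x y : pairwise_le B D -> B x -> B y ->
  (enorm (x - y) <= diam B)%R.
Proof.
move=> BD Bx By; apply: ub_le_sup; last by exists x => //; exists y.
by exists D => _ [z Bz [w Bw <-]]; exact: BD.
Qed.

Lemma diam_ge0 N (B : set 'rV[R]_N) : (0 <= diam B)%R.
Proof.
rewrite /diam; set S := (X in sup X).
have [[[a Sa] ubS]|/sup_out->//] := pselect (has_sup S).
by apply: (le_trans _ (ub_le_sup ubS Sa)); case: Sa => x _ [y _ <-]; exact: enorm_ge0.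
Qed.

Lemma hausdorff_costE N k (B : set 'rV[R]_N) :
  hausdorff_cost k B = (ballvol R k * (diam B / 2) ^+ k)%:E.
Proof. by rewrite /hausdorff_cost leb_eball1. Qed.

Lemma hausdorff_cost_le N N' k (B : set 'rV[R]_N) (B' : set 'rV[R]_N') a :
  (0 <= a)%R -> (diam B <= a * diam B')%R ->
  hausdorff_cost k B <= (a ^+ k)%:E * hausdorff_cost k B'.
Proof.
move=> a0 BB'; rewrite !hausdorff_costE -EFinM lee_fin mulrCA -exprMn.
rewrite ler_wpM2l ?(ltW (ballvol_gt0))// lerXn2r ?nnegrE ?divr_ge0 ?mulr_ge0 ?diam_ge0//.
by rewrite mulrA ler_wpM2r// invr_ge0.
Qed.

Lemma hausdorff_cost_ge0 N k (B : set 'rV[R]_N) : 0 <= hausdorff_cost k B.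
Proof.
by rewrite hausdorff_costE lee_fin mulr_ge0 ?(ltW (ballvol_gt0))// exprn_ge0// divr_ge0 ?diam_ge0.
Qed.
Hint Resolve hausdorff_cost_ge0 : core.

Lemma le_hausdorff_cost N k (A B : set 'rV[R]_N) D :
  pairwise_le B D -> A `<=` B -> hausdorff_cost k A <= hausdorff_cost k B.
Proof.
move=> BD AB; have := @hausdorff_cost_le _ _ k A B 1%R; rewrite expr1n mul1e mul1r; apply=> //.
by apply: diam_le => [|x y /AB Bx /AB By]; [exact: diam_ge0|exact: (le_diam BD)].
Qed.

(** The Hausdorff content: the members of a cover are bounded but of any size. Unlike
    [hausdorff_pre], it scales exactly under dilations. *)
Definition hausdorff_infty N k : set 'rV[R]_N -> \bar R :=
  cover_outer [set B | exists D, pairwise_le B D] id (@hausdorff_cost R N k).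

Lemma hausdorff_infty_affine_le k (a : R) (v : 'rV[R]_k) A : (0 < a)%R ->
  hausdorff_infty k ((fun x => a *: x + v)%R @^-1` A) <= (a ^- k)%:E * hausdorff_infty k A.
Proof.
move=> a0; move: A; apply: cover_outer_le_bound.
- by move=> B.
- by rewrite invr_gt0 exprn_gt0.
- by rewrite preimage_set0 /hausdorff_infty cover_outer0.
- by move=> A B AB; apply: le_cover_outer; exact: preimage_subset.
- by move=> F; rewrite preimage_bigcup; apply: cover_outer_sigma_subadditive.
move=> B [D BD].
have h x y : B (a *: x + v)%R -> B (a *: y + v)%R -> (enorm (x - y) <= a^-1 * diam B)%R.
  move=> Bx By; have := le_diam BD Bx By.
  by rewrite opprD addrACA subrr addr0 -scalerBr enormZ gtr0_norm// ler_pdivlMl.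
apply: (@le_trans _ _ (hausdorff_cost k ((fun x => a *: x + v)%R @^-1` B))).
  by apply: cover_outer_le1 => //; exists (a^-1 * diam B)%R => x y; exact: h.
rewrite -exprVn; apply: hausdorff_cost_le; first by rewrite invr_ge0 ltW.
by apply: diam_le => [|x y]; [rewrite mulr_ge0 ?diam_ge0// invr_ge0 ltW|exact: h].
Qed.

Lemma hausdorff_infty_affine k (a : R) (v : 'rV[R]_k) A : (0 < a)%R ->
  hausdorff_infty k ((fun x => a *: x + v)%R @^-1` A) = (a ^- k)%:E * hausdorff_infty k A.
Proof.
move=> a0; apply/eqP; rewrite eq_le hausdorff_infty_affine_le//=.
have an0 : (0 < a ^+ k)%R by rewrite exprn_gt0.
rewrite muleC lee_pdivrMr//.
have := @hausdorff_infty_affine_le k a^-1 (- (a^-1 *: v))%R ((fun x => a *: x + v)%R @^-1` A).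
rewrite invr_gt0 => /(_ a0); rewrite exprVn invrK muleC.
congr (_ <= _); congr (hausdorff_infty k _); apply/seteqP; split=> x /=;
  by rewrite scalerDr scalerN !scalerA divff ?gt_eqF// !scale1r subrK.
Qed.

(** The content has the invariances that [le_leb_of_ball] asks for, and the unit ball, covered by
    itself, costs at most [ballvol]. *)
Lemma hausdorff_infty_le_leb k (A : set 'rV[R]_k) : hausdorff_infty k A <= leb_outer R k A.
Proof.
have cst D (B : set 'rV[R]_k) : pairwise_le B D -> hausdorff_infty k B <= hausdorff_cost k B.
  by move=> BD; apply: cover_outer_le1 => //; exists D.
apply: le_leb_of_ball.
- by rewrite /hausdorff_infty cover_outer0.
- by move=> B C; exact: le_cover_outer.
- exact: cover_outer_sigma_subadditive.
- move=> v B; have := @hausdorff_infty_affine k 1%R v B ltr01; rewrite expr1n invr1 mul1e => <-.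
  by congr (hausdorff_infty k _); apply/seteqP; split=> x /=; rewrite scale1r.
- move=> a B a0; have := @hausdorff_infty_affine k a 0%R B a0 => <-.
  by congr (hausdorff_infty k _); apply/seteqP; split=> x /=; rewrite addr0.
- apply: (@le_lt_trans _ _ (hausdorff_cost k (box (0, 0 + const_mx 1)%R : set 'rV[R]_k))).
    apply: (cst (Num.sqrt k%:R * 1)%R) => x y bx by'; apply: ler_enorm_sup => // i.
    have := bx i; have := by' i; rewrite /= !mxE !add0r => /andP[h1 h2] /andP[h3 h4].
    by rewrite ler_norml; lra.
  by rewrite hausdorff_costE ltry.
- have h : pairwise_le (eball (0 : 'rV[R]_k) 1) 2.
    move=> x y; rewrite /eball/= !subr0 => hx hy; apply: (le_trans (ler_enormD _ _)).
    by rewrite enormN; lra.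
  apply: (le_trans (cst _ _ h)); rewrite hausdorff_costE leb_eball1 lee_fin.
  rewrite -[leRHS]mulr1 ler_wpM2l ?(ltW (ballvol_gt0))// exprn_ile1 ?divr_ge0 ?diam_ge0//.
  by rewrite ler_pdivrMr// mul1r diam_le.
Qed.

Lemma hausdorff_pre_shift_le k d (v : 'rV[R]_k) A :
  hausdorff_pre k d ((fun x => x + v)%R @^-1` A) <= hausdorff_pre k d A.
Proof.
rewrite -[leRHS]mul1e; move: A; apply: cover_outer_le_bound => //.
- by rewrite preimage_set0 /hausdorff_pre cover_outer0.
- by move=> A B AB; apply: le_cover_outer; exact: preimage_subset.
- by move=> F; rewrite preimage_bigcup; apply: cover_outer_sigma_subadditive.
have xyv (x y : 'rV[R]_k) : (x + v - (y + v) = x - y)%R by rewrite opprD addrACA subrr addr0.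
move=> B BD; rewrite mul1e.
apply: (@le_trans _ _ (hausdorff_cost k ((fun x => x + v)%R @^-1` B))).
  by apply: cover_outer_le1 => // x y Bx By; rewrite -xyv; exact: BD.
have := @hausdorff_cost_le _ _ k ((fun x => x + v)%R @^-1` B) B 1%R.
rewrite expr1n mul1e mul1r; apply=> //.
apply: diam_le => [|x y Bx By]; first exact: diam_ge0.
by rewrite -xyv; exact: le_diam BD Bx By.
Qed.

(** For a fixed [d] scaling is lost, but on a cube of diameter at most [d] the content already
    bounds [hausdorff_pre]: intersecting a cover with the cube makes its members small and no
    dearer. *)
Lemma hausdorff_pre_le_leb k d (A : set 'rV[R]_k) : (0 < d)%R ->
  hausdorff_pre k d A <= leb_outer R k A.
Proof.
move=> d0; rewrite -[leRHS]mul1e.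
pose K := (Num.sqrt k%:R + 1 : R)%R.
have K0 : (0 < K)%R by rewrite ltr_wpDl// sqrtr_ge0.
apply: (@le_leb_cube _ _ _ _ _ _ _ 1%R (Num.trunc (K / d))) => //.
- by rewrite /hausdorff_pre cover_outer0.
- by move=> B C; exact: le_cover_outer.
- exact: cover_outer_sigma_subadditive.
- move=> v B; apply/eqP; rewrite eq_le hausdorff_pre_shift_le/=.
  have := hausdorff_pre_shift_le d (- v) ((fun x => x + v)%R @^-1` B).
  by congr (_ <= _); congr hausdorff_pre; apply/seteqP; split=> x /=; rewrite subrK.
move=> n hn; set Q := box _; rewrite mul1r.
have QE : leb_outer R k Q = (n.+1%:R^-1 ^+ k)%:E.
  rewrite leb_outer_box /box_vol (eq_bigr (fun=> n.+1%:R^-1)%R); last first.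
    by move=> i _; rewrite /= !mxE add0r subr0; apply/max_idPr; rewrite invr_ge0.
  by rewrite prodr_const card_ord.
rewrite -QE; apply: (le_trans _ (hausdorff_infty_le_leb _)).
apply: le_ereal_inf_tmp => _ [F [FD QF] <-].
pose G m := omap (fun B => B `&` Q) (F m).
have Qd : pairwise_le Q d.
  move=> x y bx by'; apply: (@le_trans _ _ (K * n.+1%:R^-1)%R); last first.
    rewrite ler_pdivrMr// mulrC -ler_pdivrMr// ltW//; have /andP[_] := truncn_itv (ltW (divr_gt0 K0 d0)).
    by move/lt_le_trans; apply; rewrite ler_nat ltnS.
  apply: (@le_trans _ _ (Num.sqrt k%:R * n.+1%:R^-1)%R); last first.
    by rewrite ler_wpM2r ?invr_ge0// lerDl.
  apply: ler_enorm_sup => [|i]; first by rewrite invr_ge0.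
  have := bx i; have := by' i; rewrite /= !mxE !add0r.
  by set l := (_^-1)%R => /andP[h1 h2] /andP[h3 h4]; rewrite ler_norml; lra.
apply: (@le_trans _ _ (\sum_(m <oo) oapp (hausdorff_cost k) 0 (G m))).
  apply: ereal_inf_lbound; exists G => //; split.
    move=> m B; rewrite /G; case: (F m) => //= B' [<-] x y [_ Qx] [_ Qy]; exact: Qd.
  move=> x Qx; have [m _ Fx] := QF _ Qx; exists m => //; rewrite /G.
  by case: (F m) Fx.
apply: lee_nneseries => m _; first by rewrite /G => _; case: (F m) => /=.
rewrite /G; case E : (F m) => [B|]//=; have [D BD] := FD _ _ E.
exact: (le_hausdorff_cost k BD (@subIsetl _ _ _)).
Qed.

End flat_hausdorff.

(** * Brunn-Minkowski for finite unions of boxes, and the isodiametric inequality *)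

Section isodiametric.
Context {R : realType} {N : nat}.
Notation vec := 'rV[R]_N.
Notation mu := (leb_outer R N).

(** Half-open, so that a hyperplane cuts a box into exactly two boxes of the same kind. *)
Definition hbox (ab : vec * vec) : set vec :=
  [set x | forall i, ab.1 ord0 i <= x ord0 i < ab.2 ord0 i].

Definition nondeg (ab : vec * vec) : bool := [forall i, ab.1 ord0 i < ab.2 ord0 i].

(** Disjointness witnessed by a coordinate hyperplane, the form in which the Hadwiger-Ohmann cut
    uses it. *)
Definition boxsep (ab cd : vec * vec) : bool :=
  [exists i, (ab.2 ord0 i <= cd.1 ord0 i) || (cd.2 ord0 i <= ab.1 ord0 i)].

Definition hunion (s : seq (vec * vec)) : set vec := [set x | exists2 ab, ab \in s & hbox ab x].

Definition svol (s : seq (vec * vec)) : R := \sum_(ab <- s) box_vol ab.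

Lemma nondeg_vol ab : nondeg ab -> 0 < box_vol ab.
Proof. by move/forallP => h; apply: prodr_gt0 => i _; rewrite lt_max subr_gt0 h orbT. Qed.

Lemma box_vol_nondeg ab : 0 < box_vol ab -> nondeg ab.
Proof.
move=> h; apply/forallP => i; rewrite -subr_gt0 ltNge; apply/negP => hi.
by move: h; rewrite /box_vol (bigD1 i)//= (max_idPl hi) mul0r ltxx.
Qed.

Lemma svol_ge0 s : 0 <= svol s.
Proof. by apply: sumr_ge0 => ab _; exact: box_vol_ge0. Qed.

Definition cutlo (i : 'I_N) (c : R) (ab : vec * vec) : vec * vec :=
  (ab.1, \row_j if j == i then Num.min (ab.2 ord0 j) c else ab.2 ord0 j).
Definition cuthi (i : 'I_N) (c : R) (ab : vec * vec) : vec * vec :=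
  (\row_j (if j == i then Num.max (ab.1 ord0 j) c else ab.1 ord0 j), ab.2).

Lemma hbox_cutlo i c ab x : hbox (cutlo i c ab) x <-> hbox ab x /\ x ord0 i < c.
Proof.
split=> [h|[h xc] j]; last first.
  by rewrite /= mxE; have := h j; case: eqP => // -> /andP[-> h2]; rewrite lt_min h2 xc.
split; last by have := h i; rewrite /= mxE eqxx lt_min => /andP[_ /andP[]].
by move=> j; have := h j; rewrite /= mxE; case: eqP => // -> /andP[-> ]; rewrite lt_min => /andP[].
Qed.

Lemma hbox_cuthi i c ab x : hbox (cuthi i c ab) x <-> hbox ab x /\ c <= x ord0 i.
Proof.
split=> [h|[h xc] j]; last first.
  by rewrite /= mxE; have := h j; case: eqP => // -> /andP[h2 ->]; rewrite ge_max h2 xc.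
split; last by have := h i; rewrite /= mxE eqxx ge_max => /andP[/andP[]].
by move=> j; have := h j; rewrite /= mxE; case: eqP => // -> /andP[+ ->]; rewrite ge_max => /andP[->].
Qed.

Definition side i (ab : vec * vec) := \prod_(j < N | j != i) Num.max 0 (ab.2 ord0 j - ab.1 ord0 j).

Lemma vol_cutlo i c ab : box_vol (cutlo i c ab) =
  Num.max 0 (Num.min (ab.2 ord0 i) c - ab.1 ord0 i) * side i ab.
Proof.
rewrite /box_vol (bigD1 i)//= !mxE eqxx; congr (_ * _).
by apply: eq_bigr => j /negbTE ji; rewrite mxE ji.
Qed.

Lemma vol_cuthi i c ab : box_vol (cuthi i c ab) =
  Num.max 0 (ab.2 ord0 i - Num.max (ab.1 ord0 i) c) * side i ab.
Proof.
rewrite /box_vol (bigD1 i)//= !mxE eqxx; congr (_ * _).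
by apply: eq_bigr => j /negbTE ji; rewrite mxE ji.
Qed.

Lemma vol_cut i c ab : box_vol (cutlo i c ab) + box_vol (cuthi i c ab) = box_vol ab.
Proof.
rewrite vol_cutlo vol_cuthi -mulrDl /box_vol (bigD1 i)//= -/(side i ab); congr (_ * _).
rewrite /Num.max /Num.min; repeat case: ifP; lra.
Qed.

Definition slo i c s := [seq ab <- map (cutlo i c) s | nondeg ab].
Definition shi i c s := [seq ab <- map (cuthi i c) s | nondeg ab].

Lemma svol_filter s : svol [seq ab <- s | nondeg ab] = svol s.
Proof.
rewrite /svol big_filter big_mkcond/=; apply: eq_bigr => ab _; case: ifPn => // h.
apply/eqP; rewrite eq_le box_vol_ge0/= leNgt; apply/negP => /box_vol_nondeg h'.
by rewrite h' in h.
Qed.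

Lemma svol_cut i c s : svol (slo i c s) + svol (shi i c s) = svol s.
Proof.
rewrite !svol_filter /svol !big_map -big_split/=.
by apply: eq_bigr => ab _; exact: vol_cut.
Qed.

Lemma hunion_slo i c s x : hunion (slo i c s) x -> hunion s x /\ x ord0 i < c.
Proof.
case=> ab; rewrite mem_filter => /andP[_ /mapP[cd cds ->]] /hbox_cutlo[h1 h2].
by split=> //; exists cd.
Qed.

Lemma hunion_shi i c s x : hunion (shi i c s) x -> hunion s x /\ c <= x ord0 i.
Proof.
case=> ab; rewrite mem_filter => /andP[_ /mapP[cd cds ->]] /hbox_cuthi[h1 h2].
by split=> //; exists cd.
Qed.

Lemma boxsep_cut (f : vec * vec -> vec * vec) ab cd :
  (forall (p : vec * vec) i, p.1 ord0 i <= (f p).1 ord0 i /\ (f p).2 ord0 i <= p.2 ord0 i) ->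
  boxsep ab cd -> boxsep (f ab) (f cd).
Proof.
move=> hf /existsP[i h]; apply/existsP; exists i.
have [a1 a2] := hf ab i; have [c1 c2] := hf cd i.
by case/orP: h => h; apply/orP; [left|right]; [exact: le_trans a2 (le_trans h c1)|exact: le_trans c2 (le_trans h a1)].
Qed.

Lemma pairwise_slo i c s : pairwise boxsep s -> pairwise boxsep (slo i c s).
Proof.
move=> h; apply: pairwise_filter; rewrite pairwise_map; apply: sub_pairwise h => ab cd.
apply: boxsep_cut => p j; rewrite /= mxE; split=> //; case: eqP => // ->.
by rewrite ge_min lexx.
Qed.

Lemma pairwise_shi i c s : pairwise boxsep s -> pairwise boxsep (shi i c s).
Proof.
move=> h; apply: pairwise_filter; rewrite pairwise_map; apply: sub_pairwise h => ab cd.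
apply: boxsep_cut => p j; rewrite /= mxE; split=> //; case: eqP => // ->.
by rewrite le_max lexx.
Qed.

(** The volume below the hyperplane at height c is continuous in c; it is 0 for low c and the whole
    volume for high c. *)
Lemma svol_slo_ivt i t th : 0 < svol t -> 0 < th < 1 ->
  exists c, svol (slo i c t) = th * svol t.
Proof.
move=> t0 /andP[th0 th1].
pose f (c : R) : R := \sum_(ab <- t) Num.max 0 (Num.min (ab.2 ord0 i) c - ab.1 ord0 i) * side i ab.
have fE c : svol (slo i c t) = f c.
  by rewrite svol_filter /svol big_map; apply: eq_bigr => ab _; exact: vol_cutlo.
have cf : continuous f.
  rewrite /f; elim: t {t0 fE f} => [|ab t IH] c.
    by under eq_fun do rewrite big_nil; exact: cvg_cst.
  under eq_fun do rewrite big_cons.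
  apply: cvgD; last exact: IH.
  apply: cvgM; last exact: cvg_cst.
  apply: (@continuous_max _ _ (cst 0) (fun c => Num.min (ab.2 ord0 i) c - ab.1 ord0 i) c).
    exact: cvg_cst.
  apply: (@cvgB _ R); last exact: cvg_cst.
  by apply: (@continuous_min _ _ (cst (ab.2 ord0 i)) id c); [exact: cvg_cst|exact: cvg_id].
pose lo := - \sum_(ab <- t) (`|ab.1 ord0 i| + `|ab.2 ord0 i|).
pose hi := \sum_(ab <- t) (`|ab.1 ord0 i| + `|ab.2 ord0 i|).
have hab ab : ab \in t -> `|ab.1 ord0 i| + `|ab.2 ord0 i| <= hi.
  move=> abt; rewrite /hi (big_rem ab)//= lerDl sumr_ge0// => *; by rewrite addr_ge0.
have flo : f lo = 0.
  rewrite /f big_seq big1// => ab /hab h.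
  have : lo - ab.1 ord0 i <= 0.
    rewrite /lo -/hi; have := ler_norm (- ab.1 ord0 i); rewrite normrN.
    have := normr_ge0 (ab.2 ord0 i); lra.
  move=> h2; rewrite (max_idPl _) ?mul0r// (le_trans _ h2)// lerD2r ge_min lexx orbT//.
have fhi : f hi = svol t.
  rewrite /f /svol; apply: eq_big_seq => ab /hab h.
  rewrite (min_idPl _); last by have := ler_norm (ab.2 ord0 i); have := normr_ge0 (ab.1 ord0 i); lra.
  by rewrite /box_vol (bigD1 i).
have lohi : lo <= hi.
  have : 0 <= hi by rewrite sumr_ge0// => *; rewrite addr_ge0.
  by rewrite /lo -/hi; lra.
have [||c _ fc] := @IVT R f lo hi (th * svol t) lohi.
- exact: continuous_subspaceT.
- rewrite flo fhi min_l ?max_r ?(ltW t0)// mulr_ge0 ?(ltW th0) ?(ltW t0)//=.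
  by rewrite ler_piMl ?(ltW t0)// ltW.
by exists c; rewrite fE.
Qed.

Definition midset (A B : set vec) : set vec := [set 2^-1 *: (x + y) | x in A & y in B].

(** The box whose edges are the means of the edges lies in the midpoint set; edge by edge, the mean
    of the lengths is at least their geometric mean. *)
Lemma midset_hbox ab cd : nondeg ab -> nondeg cd ->
  ((Num.sqrt (box_vol ab * box_vol cd))%:E <= mu (midset (hbox ab) (hbox cd)))%E.
Proof.
move=> nab ncd.
pose m : vec * vec := (2^-1 *: (ab.1 + cd.1), 2^-1 *: (ab.2 + cd.2)).
pose w (p : vec * vec) i := p.2 ord0 i - p.1 ord0 i.
have w0 p i : nondeg p -> 0 < w p i by move/forallP/(_ i); rewrite subr_gt0.
have volE p : nondeg p -> box_vol p = \prod_i w p i.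
  by move=> np; apply: eq_bigr => i _; apply/max_idPr; exact/ltW/w0.
have nm : nondeg m.
  apply/forallP => i; rewrite /m /= !mxE ltr_pM2l ?invr_gt0//.
  by apply: ltrD; [exact: (forallP nab)|exact: (forallP ncd)].
have sub : hbox m `<=` midset (hbox ab) (hbox cd).
  move=> z hz.
  pose s i := (z ord0 i - m.1 ord0 i) / w m i.
  have s01 i : 0 <= s i < 1.
    have /andP[h1 h2] := hz i; have wm := w0 m i nm.
    apply/andP; split; first by apply: divr_ge0; [rewrite subr_ge0|exact: ltW].
    by rewrite /s ltr_pdivrMr// mul1r; move: h2; rewrite /w; lra.
  (* The points of the two boxes at the relative position that [z] has in [m]; their midpoint is
     [z]. *)
  pose pt (p : vec * vec) : vec := \row_i (p.1 ord0 i + s i * w p i).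
  have hpt p : nondeg p -> hbox p (pt p).
    move=> np i; rewrite mxE; have wp := w0 p i np; have /andP[h1 h2] := s01 i.
    rewrite lerDl mulr_ge0 ?(ltW wp)//=; rewrite -ltrBrDl -/(w p i) -[ltRHS]mul1r ltr_pM2r//.
  exists (pt ab); first exact: hpt.
  exists (pt cd); first exact: hpt.
  apply/rowP => i; rewrite !mxE.
  have wm : w m i != 0 by rewrite gt_eqF// w0.
  have -> : z ord0 i = m.1 ord0 i + s i * w m i by rewrite /s divfK// addrC subrK.
  by rewrite /m /w /= !mxE; lra.
(* The half-open box contains closed boxes of almost the same volume. *)
have lm : mu (hbox m) = (box_vol m)%:E.
  apply/eqP; rewrite eq_le leb_outer_box_le/=; last by move=> x h i; have /andP[-> /ltW] := h i.
  pose p : {poly R} := \prod_i ((w m i)%:P - 'X).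
  have pE (x : R) : p.[x] = \prod_i (w m i - x).
    by rewrite horner_prod; apply: eq_bigr => i _; rewrite hornerD hornerN hornerC hornerX.
  have -> : box_vol m = p.[0] by rewrite volE// pE; apply: eq_bigr => i _; rewrite subr0.
  have cp : (fun n : nat => p.[n.+1%:R^-1]) @ \oo --> p.[0].
    apply: (@cvg_comp _ _ _ (fun n : nat => n.+1%:R^-1 : R) (horner p) _ (nbhs (0 : R))).
      exact: cvg_harmonic.
    exact: continuous_horner.
  apply/lee_addgt0Pr => e e0.
  have : \forall n \near \oo, forall i : 'I_N, (n.+1%:R^-1 : R) < w m i.
    apply: filter_forall => i.
    exact: near_infty_natSinv_lt (PosNum (w0 m i nm)).
  move=> hw; have [n [hn1 hn2]] : exists n : nat, (forall i : 'I_N, (n.+1%:R^-1 : R) < w m i) /\ p.[0] - e < p.[n.+1%:R^-1].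
    near \oo => n; exists n; split; near: n; [exact: hw|apply: (cvgr_gt _ cp); lra].
  apply: (@le_trans _ _ (mu (box (m.1, m.2 - const_mx n.+1%:R^-1)%R) + e%:E)%E); last first.
    rewrite leeD2r// le_outer_measure// => x h i; have := h i; rewrite /= !mxE => /andP[-> h2]/=.
    by rewrite (le_lt_trans h2)// ltrBlDr ltrDl.
  rewrite leb_outer_box -EFinD lee_fin -lerBlDr (le_trans (ltW hn2))// pE.
  apply: ler_prod => i _; rewrite subr_ge0 (ltW (hn1 i))/= !mxE le_max; apply/orP; right.
  have wmi : w m i = 2^-1 * (ab.2 ord0 i + cd.2 ord0 i) - 2^-1 * (ab.1 ord0 i + cd.1 ord0 i).
    by rewrite /w /m /= !mxE.
  by rewrite wmi addrAC.
apply: (@le_trans _ _ (mu (hbox m))); last exact: le_outer_measure.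
rewrite lm lee_fin -[leRHS](ger0_norm (box_vol_ge0 m)) -sqrtr_sqr.
rewrite ler_wsqrtr// !volE// -prodrXl -big_split/=.
apply: ler_prod => i _; rewrite mulr_ge0 ?(ltW (w0 _ _ _))//=.
have -> : w m i = 2^-1 * (w ab i + w cd i) by rewrite /w /m /= !mxE; lra.
by have := sqr_ge0 (w ab i - w cd i); rewrite !expr2; set x := w ab i; set y := w cd i; lra.
Unshelve. all: by end_near. Qed.

Lemma midsetC A B : midset A B = midset B A.
Proof.
by apply/seteqP; split=> z [x Ax [y By <-]]; exists y => //; exists x => //; rewrite addrC.
Qed.

Lemma mble_lt_coord (i : 'I_N) (c : R) : mble [set x : vec | x ord0 i < c].
Proof.
have := @measurable_coord R N i measurableT _ (measurable_itv `]-oo, c[).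
by rewrite setTI; congr (mble _); apply/seteqP; split=> x; rewrite /= in_itv.
Qed.

Lemma svol_ge s ab : ab \in s -> box_vol ab <= svol s.
Proof.
by move=> abs; rewrite /svol (big_rem ab)//= lerDl sumr_ge0// => *; exact: box_vol_ge0.
Qed.

Lemma size_cut_lt (f : vec * vec -> vec * vec) s q : q \in s -> ~~ nondeg (f q) ->
  (size [seq ab <- map f s | nondeg ab] < size s)%N.
Proof.
move=> qs nq; rewrite size_filter -(size_map f s) ltn_neqAle count_size andbT -all_count.
by apply/negP => /allP/(_ _ (map_f f qs)); rewrite (negbTE nq).
Qed.

(* Hadwiger-Ohmann: cut both families by parallel coordinate hyperplanes in the
   same proportion; the two halves of the midpoint set lie on different sides. *)
Lemma brunn_minkowski_step s t : all nondeg s -> all nondeg t ->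
  pairwise boxsep s -> pairwise boxsep t -> 0 < svol t ->
  (forall s' t', (size s' + size t' < size s + size t)%N -> all nondeg s' -> all nondeg t' ->
     pairwise boxsep s' -> pairwise boxsep t' -> 0 < svol s' -> 0 < svol t' ->
     ((Num.sqrt (svol s' * svol t'))%:E <= mu (midset (hunion s') (hunion t')))%E) ->
  (1 < size s)%N ->
  ((Num.sqrt (svol s * svol t))%:E <= mu (midset (hunion s) (hunion t)))%E.
Proof.
move=> ns nt ps pt t0 IH ss.
have [i [p [q [psx qsx pq]]]] : exists i p q, [/\ p \in s, q \in s & p.2 ord0 i <= q.1 ord0 i].
  case: s ss ps {ns IH} => [|ab [|cd s]]// _ /= /andP[/andP[/existsP[i /orP[h|h]] _] _]; exists i.
    by exists ab, cd; split=> //; rewrite !inE eqxx ?orbT.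
  by exists cd, ab; split=> //; rewrite !inE eqxx ?orbT.
have np := allP ns _ psx; have nq := allP ns _ qsx.
(* Cutting along the upper face of [p] leaves [p] whole below and [q] whole above. Each side loses
   one of the two, so both have fewer boxes than [s]. *)
pose c := p.2 ord0 i.
have lo_lt : (size (slo i c s) < size s)%N.
  apply: (size_cut_lt qsx); apply/negP => /forallP/(_ i); rewrite /= mxE eqxx lt_min => /andP[_].
  by rewrite ltNge pq.
have hi_lt : (size (shi i c s) < size s)%N.
  apply: (size_cut_lt psx); apply/negP => /forallP/(_ i); rewrite /= mxE eqxx gt_max => /andP[_].
  by rewrite ltxx.
have lo0 : 0 < svol (slo i c s).
  rewrite svol_filter (lt_le_trans (nondeg_vol np))//.
  have -> : p = cutlo i c p.
    rewrite [LHS]surjective_pairing /cutlo; congr pair; apply/rowP => j; rewrite mxE.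
    by case: eqP => // ->; rewrite /c minxx.
  exact: svol_ge (map_f _ psx).
have hi0 : 0 < svol (shi i c s).
  rewrite svol_filter (lt_le_trans (nondeg_vol nq))//.
  have -> : q = cuthi i c q.
    rewrite [LHS]surjective_pairing /cuthi; congr pair; apply/rowP => j; rewrite mxE.
    by case: eqP => // ->; apply/esym/max_idPl.
  exact: svol_ge (map_f _ qsx).
have cut := svol_cut i c s.
have s0 : 0 < svol s by rewrite -cut addr_gt0.
pose th := svol (slo i c s) / svol s.
have thS : svol (slo i c s) = th * svol s by rewrite /th divfK// gt_eqF.
have th0 : 0 < th by rewrite divr_gt0.
have th1 : th < 1 by rewrite ltr_pdivrMr// mul1r -cut ltrDl.
(* The other family is cut in the same proportion [th], so that the two geometric means add up
   without loss. *)
have [c' hc'] := svol_slo_ivt i t0 (introT andP (conj th0 th1)).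
have cut' := svol_cut i c' t.
have shiS : svol (shi i c s) = (1 - th) * svol s by lra.
have shiT : svol (shi i c' t) = (1 - th) * svol t by lra.
have ST0 : 0 <= svol s * svol t by rewrite mulr_ge0 ?svol_ge0.
have sz : (forall f, size [seq ab <- map f t | nondeg ab] <= size t)%N.
  by move=> f; rewrite size_filter -(size_map f t) count_size.
have h1 : ((th * Num.sqrt (svol s * svol t))%:E <= mu (midset (hunion (slo i c s)) (hunion (slo i c' t))))%E.
  rewrite -{1}(ger0_norm (ltW th0)) -sqrtr_sqr -sqrtrM ?sqr_ge0//.
  have -> : th ^+ 2 * (svol s * svol t) = svol (slo i c s) * svol (slo i c' t) by rewrite thS hc'; lra.
  apply: (IH (slo i c s) (slo i c' t)); rewrite ?filter_all ?pairwise_slo// ?hc' ?(mulr_gt0 th0 t0)//.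
  by rewrite -addSn leq_add// sz.
have h2 : (((1 - th) * Num.sqrt (svol s * svol t))%:E <= mu (midset (hunion (shi i c s)) (hunion (shi i c' t))))%E.
  have th1' : 0 < 1 - th by rewrite subr_gt0.
  rewrite -{1}(ger0_norm (ltW th1')) -sqrtr_sqr -sqrtrM ?sqr_ge0//.
  have -> : (1 - th) ^+ 2 * (svol s * svol t) = svol (shi i c s) * svol (shi i c' t) by rewrite shiS shiT; lra.
  apply: (IH (shi i c s) (shi i c' t)); rewrite ?filter_all ?pairwise_shi// ?shiT ?(mulr_gt0 th1' t0)//.
  by rewrite -addSn leq_add// sz.
(* Midpoints of the two lower parts lie strictly below this height, those of the two upper parts at
   or above it. *)
pose m := 2^-1 * (c + c').
rewrite (mble_lt_coord i m (midset _ _)).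
have -> : Num.sqrt (svol s * svol t) = th * Num.sqrt (svol s * svol t) + (1 - th) * Num.sqrt (svol s * svol t) by lra.
rewrite EFinD; apply: leeD.
  apply: (le_trans h1); apply: le_outer_measure => _ [x /hunion_slo[sx xc] [y /hunion_slo[ty yc] <-]].
  split; first by exists x => //; exists y.
  by rewrite /= !mxE ltr_pM2l ?invr_gt0// ltrD.
apply: (le_trans h2); apply: le_outer_measure => _ [x /hunion_shi[sx xc] [y /hunion_shi[ty yc] <-]].
split; first by exists x => //; exists y.
by apply/negP; rewrite -leNgt !mxE ler_pM2l ?invr_gt0// lerD.
Qed.

(** Strong induction on the total number of boxes; the statement is symmetric, so a cut may start
    from whichever family has at least two. *)
Lemma brunn_minkowski_boxes s t : all nondeg s -> all nondeg t ->
  pairwise boxsep s -> pairwise boxsep t -> 0 < svol s -> 0 < svol t ->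
  ((Num.sqrt (svol s * svol t))%:E <= mu (midset (hunion s) (hunion t)))%E.
Proof.
have [n] := ubnP (size s + size t); elim: n s t => // n IH s t hn ns nt ps pt s0 t0.
have IH' s' t' : (size s' + size t' < size s + size t)%N -> all nondeg s' -> all nondeg t' ->
     pairwise boxsep s' -> pairwise boxsep t' -> 0 < svol s' -> 0 < svol t' ->
     ((Num.sqrt (svol s' * svol t'))%:E <= mu (midset (hunion s') (hunion t')))%E.
  by move=> h; apply: IH; rewrite (leq_trans h).
have [ss|ss] := ltnP 1 (size s); first exact: brunn_minkowski_step.
have [tt|tt] := ltnP 1 (size t).
  rewrite mulrC midsetC; apply: brunn_minkowski_step => // s' t' h *.
  by rewrite mulrC midsetC; apply: IH' => //; rewrite addnC [X in (_ < X)%N]addnC.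
case: s ss s0 ns {hn ps IH' IH} => [|ab [|//]] _; first by rewrite /svol big_nil ltxx.
case: t tt t0 nt {pt} => [|cd [|//]] _; first by rewrite /svol big_nil ltxx.
rewrite /svol !big_seq1 /= !andbT => t0 nt s0 ns.
apply: (le_trans (midset_hbox ns nt)); apply: le_outer_measure => _ [x hx [y hy <-]].
by exists x; [exists ab => //; rewrite inE|exists y => //; exists cd => //; rewrite inE].
Qed.

Lemma mu_hunion_le s : (mu (hunion s) <= (svol s)%:E)%E.
Proof.
elim: s => [|ab s IH].
  rewrite (_ : hunion _ = set0) ?outer_measure0 ?lee_fin ?svol_ge0//.
  by apply/seteqP; split=> // x [].
have hs : hunion (ab :: s) `<=` box ab `|` hunion s.
  move=> x [cd]; rewrite inE => /orP[/eqP-> h|cds h]; last by right; exists cd.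
  by left => i; have /andP[-> /ltW] := h i.
apply: (le_trans (le_outer_measure _ _ _ hs)).
apply: (le_trans (sigma_subU (outer_measure0 _) (@le_outer_measure _ _ _) (@outer_measure_sigma_subadditive _ _ _) _ _)).
by rewrite /svol big_cons EFinD leeD// leb_outer_box_le.
Qed.

(** Brunn-Minkowski for [A] and its reflection -A: the midpoints (a - b)/2 have norm at most D/2, so
    the ball of that radius has at least the volume of [A]. To use boxes, [A] is replaced by the
    grid boxes of mesh [e] that meet it, at an error of order [e]. *)
Lemma isodiametric (A : set vec) (D : R) : 0 <= D -> pairwise_le A D ->
  (mu A <= (ballvol R N * (D / 2) ^+ N)%:E)%E.
Proof.
move=> D0 AD.
have [[a0 Aa0]|A0] := pselect (A !=set0); last first.
  rewrite (_ : A = set0); last by apply/seteqP; split=> // x Ax; apply: A0; exists x.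
  by rewrite outer_measure0 lee_fin mulr_ge0 ?(ltW (ballvol_gt0))// exprn_ge0// divr_ge0.
pose C : R := Num.sqrt N%:R + 1.
have C0 : 0 < C by rewrite ltr_wpDl// sqrtr_ge0.
have key n : (mu A <= (ballvol R N * (D / 2 + C * n.+1%:R^-1) ^+ N)%:E)%E.
  pose e : R := n.+1%:R^-1.
  have e0 : 0 < e by rewrite invr_gt0.
  pose K := (Num.trunc ((D + D) / e)).+1.
  (* [A] lies in the cube of half-side [D] around [a0]; the grid starts at its lowest corner. *)
  pose base : vec := a0 - const_mx D.
  pose bx (f : {ffun 'I_N -> 'I_K}) : vec * vec :=
    (base + \row_i (e * (f i)%:R), base + \row_i (e * (f i).+1%:R)).
  pose s := [seq bx f | f <- enum {ffun 'I_N -> 'I_K} & `[< hbox (bx f) `&` A !=set0 >]].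
  pose ng (p : vec * vec) : vec * vec := (- p.2, - p.1).
  pose t := map ng s.
  have ns : all nondeg s.
    apply/allP => _ /mapP[f _ ->]; apply/forallP => i; rewrite !mxE ltrD2l ltr_pM2l// ltr_nat//.
  have ps : pairwise boxsep s.
    rewrite pairwise_map; apply: (@sub_pairwise _ (fun f g => f != g)); last first.
      by rewrite -uniq_pairwise filter_uniq// enum_uniq.
    move=> f g /eqP fg; apply/existsP; apply: contrapT => /forallNP h; apply: fg.
    apply/ffunP => i; apply/val_inj/eqP; rewrite eqn_leq; apply/andP.
    have := h i; rewrite /= !mxE => /negP; rewrite negb_or -!ltNge !ltrD2l !ltr_pM2l// !ltr_nat !ltnS.
    by move=> /andP[-> ->].
  have nt : all nondeg t.
    by apply/allP => _ /mapP[p /(allP ns)/forallP np ->]; apply/forallP => i; rewrite !mxE ltrN2 np.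
  have pt : pairwise boxsep t.
    rewrite pairwise_map; apply: sub_pairwise ps => p q /existsP[i h]; apply/existsP; exists i.
    by rewrite /= !mxE !lerN2 orbC.
  have st : svol t = svol s.
    rewrite /svol big_map; apply: eq_bigr => p _; apply: eq_bigr => i _.
    by rewrite !mxE opprK addrC.
  have As : A `<=` hunion s.
    move=> a Aa; pose j i := Num.trunc ((a ord0 i - base ord0 i) / e).
    have ad i : - D <= a ord0 i - a0 ord0 i <= D.
      have := le_trans (ler_coord_enorm (a - a0) i) (AD _ _ Aa Aa0).
      by rewrite !mxE ler_norml.
    have jd i : 0 <= (a ord0 i - base ord0 i) / e.
      by rewrite divr_ge0 ?(ltW e0)// !mxE; have /andP[] := ad i; lra.
    have jK i : (j i < K)%N.
      rewrite ltnS; apply: le_truncn; rewrite ler_pM2r ?invr_gt0// !mxE.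
      by have /andP[] := ad i; lra.
    pose f : {ffun 'I_N -> 'I_K} := [ffun i => Ordinal (jK i)].
    have fa : hbox (bx f) a.
      move=> i; have fi : f i = Ordinal (jK i) by rewrite ffunE.
      rewrite /= !mxE fi/=; have /andP[h1 h2] := truncn_itv (jd i).
      move: h1 h2; rewrite -/(j i) ler_pdivlMr// ltr_pdivrMr// !mxE => h1 h2.
      by apply/andP; split; lra.
    exists (bx f) => //; apply: map_f; rewrite mem_filter mem_enum inE andbT.
    by apply/asboolP; exists a.
  have [s0|s0] := ltP 0 (svol s); last first.
    apply: (le_trans (le_outer_measure _ _ _ As)); apply: (le_trans (mu_hunion_le _)).
    rewrite lee_fin (le_trans s0)// mulr_ge0 ?(ltW (ballvol_gt0))// exprn_ge0// addr_ge0 ?divr_ge0//.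
    exact: ltW.
  have t0 : 0 < svol t by rewrite st.
  have r0 : 0 < D / 2 + C * e by rewrite ltr_wpDl ?divr_ge0// mulr_gt0.
  apply: (@le_trans _ _ (svol s)%:E).
    by apply: (le_trans (le_outer_measure _ _ _ As)); exact: mu_hunion_le.
  rewrite -(ger0_norm (svol_ge0 s)) -sqrtr_sqr expr2 -{2}st.
  apply: (le_trans (brunn_minkowski_boxes ns nt ps pt s0 t0)).
  rewrite mulrC -(leb_ceball (0 : vec) r0); apply: le_outer_measure.
  (* Closed inequalities on both sides, because the reflection of a half-open box is half-open at
     the opposite faces. *)
  have near p x y : p \in s -> hbox p x \/ hbox p y -> (forall i, p.1 ord0 i <= x ord0 i <= p.2 ord0 i) ->
      (forall i, p.1 ord0 i <= y ord0 i <= p.2 ord0 i) -> enorm (x - y) <= C * e.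
    move=> /mapP[f _ ->] _ hx hy; apply: (@le_trans _ _ (Num.sqrt N%:R * e)); last first.
      by rewrite ler_wpM2r ?(ltW e0)// lerDl.
    apply: ler_enorm_sup => [|i]; first exact: ltW.
    have := hx i; have := hy i; rewrite /= !mxE -natr1 mulrDr mulr1 => /andP[h1 h2] /andP[h3 h4].
    by rewrite ler_norml; lra.
  have hb p x : hbox p x -> forall i, p.1 ord0 i <= x ord0 i <= p.2 ord0 i.
    by move=> h i; have /andP[-> /ltW] := h i.
  move=> _ [x [p psx px] [y [_ /mapP[q qsx ->] qy] <-]].
  have [a [pa Aa]] : hbox p `&` A !=set0.
    by case/mapP : psx => f; rewrite mem_filter => /andP[/asboolP h _] ->.
  have [b [qb Ab]] : hbox q `&` A !=set0.
    by case/mapP : qsx => f; rewrite mem_filter => /andP[/asboolP h _] ->.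
  rewrite /ceball/= subr0 enormZ ger0_norm ?invr_ge0//.
  have -> : x + y = (x - a) + (a - b) + (b - (- y)) by apply/rowP => i; rewrite !mxE; lra.
  have n1 := near p x a psx (or_introl px) (hb _ _ px) (hb _ _ pa).
  have hy i : q.1 ord0 i <= (- y) ord0 i <= q.2 ord0 i.
    by have := qy i; rewrite /= !mxE => /andP[h1 h2]; apply/andP; split; lra.
  have n2 := near q b (- y) qsx (or_introl qb) (hb _ _ qb) hy.
  have := ler_enormD (x - a + (a - b)) (b - - y); have := ler_enormD (x - a) (a - b).
  have := AD _ _ Aa Ab; rewrite -/e in n1 n2 *; lra.
pose p : {poly R} := ballvol R N *: ((D / 2)%:P + C *: 'X) ^+ N.
have pE (x : R) : p.[x] = ballvol R N * (D / 2 + C * x) ^+ N.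
  by rewrite hornerZ horner_exp hornerD hornerC hornerZ hornerX.
have -> : ballvol R N * (D / 2) ^+ N = p.[0] by rewrite pE mulr0 addr0.
have cp : (fun n : nat => p.[n.+1%:R^-1]) @ \oo --> p.[0].
  apply: (@cvg_comp _ _ _ (fun n : nat => n.+1%:R^-1 : R) (horner p) _ (nbhs (0 : R))).
    exact: cvg_harmonic.
  exact: continuous_horner.
apply/lee_addgt0Pr => e e0.
have [n hn] : exists n : nat, p.[n.+1%:R^-1] < p.[0] + e.
  near \oo => n; exists n; near: n; apply: (cvgr_lt _ cp); lra.
by apply: (le_trans (key n)); rewrite -pE -EFinD lee_fin ltW.
Unshelve. all: by end_near. Qed.

End isodiametric.

Lemma mble_split {R : realType} {N : nat} (X A : set 'rV[R]_N) : mble A ->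
  leb_outer R N X = (leb_outer R N (X `&` A) + leb_outer R N (X `&` ~` A))%E.
Proof. exact. Qed.

Lemma le_leb {R : realType} {N : nat} (A B : set 'rV[R]_N) : A `<=` B ->
  (leb_outer R N A <= leb_outer R N B)%E.
Proof. exact: le_outer_measure. Qed.

Lemma leb_setU {R : realType} {N : nat} (A B : set 'rV[R]_N) :
  (leb_outer R N (A `|` B) <= leb_outer R N A + leb_outer R N B)%E.
Proof.
apply: sigma_subU; [exact: outer_measure0|exact: le_outer_measure|].
exact: outer_measure_sigma_subadditive.
Qed.

Lemma sqr_enormB {R : realType} {N : nat} (x y : 'rV[R]_N) :
  enorm (x - y) ^+ 2 = enorm x ^+ 2 + enorm y ^+ 2 - 2 * dotv x y.
Proof.
rewrite sqr_enormE -(scaleN1r y) !(dotvDl, dotvDr, dotvZl, dotvZr) -!sqr_enormE (dotvC y x).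
lra.
Qed.

(** Many limits below are taken in polynomials along 1/(n+1), where continuity is free; [n0] skips
    the first values, at which the inequality may not be available. *)
Lemma poly_lim_le {R : realType} (p q : {poly R}) (n0 : nat) :
  (forall n : nat, (n0 <= n)%N -> p.[n.+1%:R^-1] <= q.[n.+1%:R^-1]) -> p.[0] <= q.[0].
Proof.
move=> pq; rewrite -subr_ge0 -hornerN -hornerD; set f := _ + _.
have cf : (fun n : nat => f.[n.+1%:R^-1]) @ \oo --> f.[0].
  apply: (@cvg_comp _ _ _ (fun n : nat => n.+1%:R^-1 : R) (horner f) _ (nbhs (0 : R))).
    exact: cvg_harmonic.
  exact: continuous_horner.
rewrite leNgt; apply/negP => f0.
have [n n0n] : exists2 n : nat, (n0 <= n)%N & f.[n.+1%:R^-1] < 0.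
  near \oo => n; exists n; near: n; [exact: nbhs_infty_ge|exact: (cvgr_lt _ cf)].
by rewrite hornerD hornerN subr_lt0 ltNge pq.
Unshelve. all: by end_near. Qed.

(** The reflection in the hyperplane orthogonal to [p - q]; equality of the norms makes the
    component of [p] along [p - q] exactly half of [p - q]. *)
Lemma householder {R : realType} {N : nat} (p q : 'rV[R]_N) : enorm p = enorm q ->
  exists2 M : 'M[R]_N, M *m M^T = 1%:M & p *m M = q.
Proof.
move=> pq; pose v := p - q.
have [v0|v0] := eqVneq v 0.
  by exists 1%:M; rewrite ?trmx1 ?mulmx1//; apply/eqP; rewrite -subr_eq0 -/v v0.
have vv : v *m v^T = (enorm v ^+ 2)%:M.
  apply/matrixP => i j; rewrite !ord1 !mxE eqxx mulr1n sqr_enorm.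
  by apply: eq_bigr => l _; rewrite !mxE expr2.
have n0 : enorm v ^+ 2 != 0 by rewrite expf_neq0// enorm_eq0.
pose M := 1%:M - (2 / enorm v ^+ 2) *: (v^T *m v).
have MT : M^T = M.
  by rewrite /M raddfB/= trmx1 linearZ/= trmx_mul trmxK.
exists M.
  pose W := v^T *m v.
  have WW : W *m W = enorm v ^+ 2 *: W.
    by rewrite /W -(mulmxA v^T) (mulmxA v) vv mul_scalar_mx -scalemxAr.
  have ae : 2 / enorm v ^+ 2 * enorm v ^+ 2 = 2 by rewrite divfK.
  rewrite MT /M -/W mulmxBr mulmx1 mulmxBl mul1mx -scalemxAl -scalemxAr WW !scalerA -mulrA ae.
  by apply/matrixP => i j; rewrite !mxE; set c := 2 / _; lra.
have pv : p *m v^T = (enorm v ^+ 2 / 2)%:M.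
  apply/matrixP => i j; rewrite !ord1 !mxE eqxx mulr1n.
  rewrite (eq_bigr (fun l => p ord0 l * v ord0 l)); last by move=> l _; rewrite mxE.
  rewrite -/(dotv p v) sqr_enormE /v !(dotvDl, dotvDr) -!(scaleN1r q) !(dotvZl, dotvZr).
  have := sqr_enormE p; rewrite pq sqr_enormE (dotvC q p); lra.
rewrite /M mulmxBr mulmx1 -scalemxAr mulmxA pv mul_scalar_mx scalerA.
have -> : 2 / enorm v ^+ 2 * (enorm v ^+ 2 / 2) = 1.
  by rewrite mulrA divfK// divff// pnatr_eq0.
by rewrite scale1r /v opprB addrC subrK.
Qed.

(** * Hausdorff measure of the sphere *)

Section flat_cone.
Context {R : realType} {k : nat}.
Implicit Types (P : set 'rV[R]_k) (rho : R).

(** The cone with apex 0 over a copy of [P] in the plane x_0 = 1, cut at height [rho]. *)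
Definition flatcone P rho : set 'rV[R]_k.+1 :=
  [set x : 'rV[R]_k.+1 | 0 < x ord0 ord0 < rho /\ P ((x ord0 ord0)^-1 *: rtail x)].

Lemma rtailZ (a : R) (x : 'rV[R]_k.+1) : rtail (a *: x) = a *: rtail x.
Proof. by apply/rowP => j; rewrite !mxE. Qed.

Lemma flatcone_scale P rho : 0 < rho ->
  leb_outer R k.+1 (flatcone P rho) = ((rho ^+ k.+1)%:E * leb_outer R k.+1 (flatcone P 1))%E.
Proof.
move=> r0; have ri : 0 < rho^-1 by rewrite invr_gt0.
rewrite -[rho in RHS]invrK exprVn -leb_outer_scale//; congr leb_outer.
apply/seteqP; split=> x; rewrite /flatcone/= rtailZ !mxE invfM invrK scalerA;
by rewrite mulrAC divff ?gt_eqF// mul1r pmulr_rgt0// ltr_pdivrMl// mulr1.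
Qed.

Lemma onem_pow_sub (h : R) n : 1 - (1 - h) ^+ n = h * \sum_(i < n) (1 - h) ^+ i.
Proof. by have := subrX1 (1 - h) n; lra. Qed.

(** With F the measure of the cone, the part below height 1 - h has measure (1 - h)^(k+1) F, and the
    slab above it lies in a box of height h over a slight enlargement of [box ab]. Dividing by h and
    letting it tend to 0 gives (k+1) F <= [box_vol ab]. *)
Lemma leb_flatcone_box_le (ab : 'rV[R]_k * 'rV[R]_k) :
  (leb_outer R k.+1 (flatcone (box ab) 1) <= (k.+1%:R^-1 * box_vol ab)%:E)%E.
Proof.
case: ab => a b.
have [hab|/existsNP[i hi]] := pselect (forall i, a ord0 i <= b ord0 i); last first.
  rewrite (_ : flatcone _ _ = set0) ?outer_measure0 ?lee_fin ?mulr_ge0 ?box_vol_ge0 ?invr_ge0//.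
  apply/seteqP; split=> // x [_ /(_ i)/=/andP[h1 h2]]; apply: hi; exact: le_trans h2.
pose M : R := \sum_i (`|a ord0 i| + `|b ord0 i|).
have Mab i : `|a ord0 i| <= M /\ `|b ord0 i| <= M.
  have : `|a ord0 i| + `|b ord0 i| <= M.
    by rewrite /M (bigD1 i)//= lerDl sumr_ge0// => *; rewrite addr_ge0.
  by have := normr_ge0 (a ord0 i); have := normr_ge0 (b ord0 i); lra.
have M0 : 0 <= M by apply: sumr_ge0 => *; rewrite addr_ge0.
have bd (x : 'rV[R]_k.+1) i : 0 < x ord0 ord0 < 1 -> box (a, b) ((x ord0 ord0)^-1 *: rtail x) ->
    x ord0 ord0 * a ord0 i <= x ord0 (lift ord0 i) <= x ord0 ord0 * b ord0 i.
  move=> /andP[x0 x1] /(_ i); rewrite /= !mxE.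
  by rewrite ler_pdivlMl// ler_pdivrMl//.
set f := leb_outer _ _ _.
(* Finiteness allows the measure of the lower part to be subtracted. *)
have ffin : (f < +oo)%E.
  apply: (@le_lt_trans _ _ (leb_outer R k.+1 (box (const_mx (- (M + 1)), const_mx (M + 1))))).
    apply: le_outer_measure => x [x01 xab] i; rewrite !mxE.
    have [j ->|->] := unliftP ord0 i; last first.
      by have /andP[x0 x1] := x01; apply/andP; split; lra.
    have /andP[h1 h2] := bd x j x01 xab; have /andP[x0 x1] := x01.
    have [m1 m2] := Mab j; have : `|x ord0 ord0| <= 1 by rewrite ler_norml; apply/andP; split; lra.
    move=> nx; have n1 : `|x ord0 ord0 * a ord0 j| <= M.
      by rewrite normrM -[leRHS]mul1r ler_pM.
    have n2 : `|x ord0 ord0 * b ord0 j| <= M by rewrite normrM -[leRHS]mul1r ler_pM.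
    move: n1 n2; rewrite !ler_norml => /andP[n1 n1'] /andP[n2 n2'].
    by apply/andP; split; lra.
  by rewrite leb_outer_box ltry.
have f0 : (0 <= f)%E by exact: outer_measure_ge0.
have fE : f = (fine f)%:E by rewrite fineK// ge0_fin_numE.
rewrite fE lee_fin ler_pdivlMl//; set F := fine f in fE *.
pose w i := b ord0 i - a ord0 i.
pose p : {poly R} := \sum_(i < k.+1) F *: (1%:P - 'X) ^+ i.
pose q : {poly R} := \prod_(i < k) ((w i)%:P + (2 * M) *: 'X).
have -> : k.+1%:R * F = p.[0].
  rewrite horner_sum (eq_bigr (fun=> F)); last first.
    by move=> i _; rewrite hornerZ horner_exp !hornerE subr0 expr1n mulr1.
  by rewrite sumr_const card_ord mulr_natl.
have -> : box_vol (a, b) = q.[0].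
  rewrite horner_prod; apply: eq_bigr => i _.
  by rewrite !hornerE ?mulr0 ?addr0; apply/max_idPr; rewrite /= subr_ge0.
apply: (@poly_lim_le _ _ _ 1%N) => n n1; set h : R := _^-1.
have h0 : 0 < h by rewrite invr_gt0.
have h1 : h < 1 by rewrite invf_lt1// ltr1n.
have qE : q.[h] = \prod_(i < k) (w i + 2 * M * h).
  by rewrite horner_prod; apply: eq_bigr => i _; rewrite !hornerE.
have pE : p.[h] = F * \sum_(i < k.+1) (1 - h) ^+ i.
  by rewrite mulr_sumr horner_sum; apply: eq_bigr => i _; rewrite hornerZ horner_exp !hornerE.
pose B : 'rV[R]_k.+1 * 'rV[R]_k.+1 :=
  (rcat0 (1 - h) (a - const_mx (h * M)), rcat0 1 (b + const_mx (h * M))).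
have sub : flatcone (box (a, b)) 1 `<=` flatcone (box (a, b)) (1 - h) `|` box B.
  move=> x [x01 xab]; have /andP[x0 x1] := x01.
  have [xh|xh] := ltP (x ord0 ord0) (1 - h); first by left; split=> //; rewrite x0.
  right; rewrite -[x]rcat0_rtail; apply/box_rcat0; split; first by rewrite /= !rcat00 xh ltW.
  move=> i; rewrite /= !rtail_rcat0 !mxE; have /andP[g1 g2] := bd x i x01 xab.
  have [m1 m2] := Mab i.
  have m3 : `|(1 - x ord0 ord0) * a ord0 i| <= h * M.
    by rewrite normrM ler_pM// ger0_norm; lra.
  have m4 : `|(1 - x ord0 ord0) * b ord0 i| <= h * M.
    by rewrite normrM ler_pM// ger0_norm; lra.
  move: m3 m4; rewrite !ler_norml => /andP[m3 m3'] /andP[m4 m4'].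
  by apply/andP; split; lra.
have BV : box_vol B = h * q.[h].
  rewrite box_vol_rtail /= !rcat00 qE; congr (_ * _).
    by rewrite (_ : 1 - (1 - h) = h); [apply/max_idPr; exact: ltW|lra].
  apply: eq_bigr => i _; rewrite !rtail_rcat0 !mxE (_ : _ - _ = w i + 2 * M * h); last first.
    by rewrite /w; lra.
  by apply/max_idPr; rewrite addr_ge0 ?subr_ge0// mulr_ge0 ?(ltW h0)// mulr_ge0.
have := le_trans (le_leb sub) (leb_setU _ _).
rewrite (@flatcone_scale _ (1 - h)) ?subr_gt0//.
rewrite -/f leb_outer_box BV fE -EFinM -EFinD lee_fin pE => H.
rewrite -(ler_pM2l h0) mulrCA -onem_pow_sub; lra.
Qed.

(** The upper bound extends from boxes to all sets by covers. The lower bound repeats the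
    self-similarity argument, with the slab bounded below by [leb_outer_slice]. *)
Lemma leb_flatcone P rho : 0 < rho ->
  leb_outer R k.+1 (flatcone P rho) = ((rho ^+ k.+1 / k.+1%:R)%:E * leb_outer R k P)%E.
Proof.
move=> r0; rewrite flatcone_scale// EFinM -muleA; congr (_ * _)%E.
apply/eqP; rewrite eq_le; apply/andP; split.
  pose nu P := leb_outer R k.+1 (flatcone P 1).
  move: P; apply: (@leb_outer_le_bound _ _ nu).
  - by rewrite invr_gt0.
  - by rewrite /nu (_ : flatcone _ _ = set0) ?outer_measure0//; apply/seteqP; split=> // x [].
  - by move=> A B AB; apply: le_outer_measure => x [h /AB].
  - move=> F; rewrite /nu (_ : flatcone _ _ = \bigcup_n flatcone (F n) 1).
      exact: outer_measure_sigma_subadditive.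
    apply/seteqP; split=> [x [h [n _ Fx]]|x [n _ [h Fx]]]; first by exists n.
    by split=> //; exists n.
  - exact: leb_flatcone_box_le.
rewrite muleC lee_pdivrMr//.
set f := leb_outer _ _ (flatcone _ _).
have [foo|ffin] := eqVneq f +oo%E; first by rewrite foo gt0_mulye ?leey// lte_fin ltr0n.
have f0 : (0 <= f)%E by exact: outer_measure_ge0.
have fE : f = (fine f)%:E by rewrite fineK// ge0_fin_numE// lt_neqAle ffin leey.
rewrite fE -EFinM; set F := fine f in fE *.
have key (m : R) : 0 <= m -> (m%:E <= leb_outer R k P)%E -> m <= F * k.+1%:R.
  move=> m0 mP.
  pose q : {poly R} := \sum_(i < k.+1) F *: (1%:P - 'X) ^+ i.
  pose p : {poly R} := m *: (1%:P - 'X) ^+ k.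
  have -> : F * k.+1%:R = q.[0].
    rewrite horner_sum (eq_bigr (fun=> F)); last first.
      by move=> i _; rewrite hornerZ horner_exp !hornerE subr0 expr1n mulr1.
    by rewrite sumr_const card_ord mulr_natr.
  have -> : m = p.[0] by rewrite hornerZ horner_exp !hornerE subr0 expr1n mulr1.
  apply: (@poly_lim_le _ _ _ 1%N) => n n1; set h : R := _^-1.
  have h0 : 0 < h by rewrite invr_gt0.
  have h1 : h < 1 by rewrite invf_lt1// ltr1n.
  have qE : q.[h] = F * \sum_(i < k.+1) (1 - h) ^+ i.
    by rewrite mulr_sumr horner_sum; apply: eq_bigr => i _; rewrite hornerZ horner_exp !hornerE.
  have pE : p.[h] = m * (1 - h) ^+ k by rewrite hornerZ horner_exp !hornerE.
  have spl := mble_split (flatcone P 1) (mble_lt_coord ord0 (1 - h)).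
  have e1 : flatcone P 1 `&` [set x : 'rV[R]_k.+1 | x ord0 ord0 < 1 - h] = flatcone P (1 - h).
    apply/seteqP; split=> [x [[/andP[x0 _] Px] xh]|x [/andP[x0 xh] Px]].
      by split=> //; rewrite x0.
    by split=> //; split=> //; rewrite x0 (lt_trans xh)//= ltrBlDr ltrDl.
  rewrite e1 (@flatcone_scale _ (1 - h)) ?subr_gt0// -/f fE in spl.
  have low : ((m * (1 - h) ^+ k * h)%:E <=
      leb_outer R k.+1 (flatcone P 1 `&` ~` [set x : 'rV[R]_k.+1 | (x ord0 ord0 < 1 - h)%R]))%E.
    rewrite [X in (m * _ * X)%:E](_ : h = 1 - (1 - h)); last by lra.
    apply: leb_outer_slice; first by rewrite mulr_ge0// exprn_ge0// subr_ge0 ltW.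
      by lra.
    move=> z /andP[zh z1].
    have z0 : 0 < z by lra.
    apply: (@le_trans _ _ ((z ^+ k)%:E * leb_outer R k P)%E).
      apply: (@le_trans _ _ ((z ^+ k)%:E * m%:E)%E); last by rewrite lee_wpmul2l// lee_fin exprn_ge0// ltW.
      by rewrite -EFinM lee_fin mulrC ler_wpM2r// lerXn2r ?nnegrE ?(ltW z0)// ?subr_ge0 ltW.
    rewrite -[z in (z ^+ k)%:E]invrK exprVn -leb_outer_scale ?invr_gt0//.
    apply: le_outer_measure => y Py; split.
      by split; rewrite rcat00 ?z0// rtail_rcat0.
    by apply/negP; rewrite rcat00 -leNgt ltW.
  have := leeD2l ((1 - h) ^+ k.+1 * F)%:E low; rewrite EFinM -spl -EFinM -EFinD lee_fin => H.
  rewrite pE qE -(ler_pM2l h0) mulrCA [in leRHS]mulrCA -onem_pow_sub; lra.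
have P0 : (0 <= leb_outer R k P)%E by exact: outer_measure_ge0.
case: (leb_outer R k P) P0 key => [m| |]//; first by rewrite !lee_fin => m0; exact.
(* If [P] had infinite measure, every [m] would be allowed in [key]. *)
move=> _ key; have := key (F * k.+1%:R + 1); rewrite leey.
have F0 : 0 <= F by rewrite -lee_fin -fE.
have : 0 <= F * k.+1%:R by rewrite mulr_ge0.
move=> h h2; have : F * k.+1%:R + 1 <= F * k.+1%:R by apply: h2 => //; exact: addr_ge0.
by move=> h3; exfalso; lra.
Qed.

End flat_cone.

Section sphere_hausdorff.
Context {R : realType} {k : nat}.
Notation vec := 'rV[R]_k.+1.
Notation mu := (leb_outer R k.+1).
Variable r : R.
Hypothesis r0 : 0 < r.

Definition sphere : set vec := [set x | enorm x = r].

Definition cone (X : set vec) : set vec :=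
  [set y | exists2 x, X x & exists2 t, 0 < t < 1 & y = t *: x].

(** The cone measure: a cone over a piece of the sphere has volume r/N times the area of the piece,
    with N = k + 1. *)
Definition sigma (X : set vec) : \bar R := ((k.+1%:R / r)%:E * mu (cone X))%E.

Let nr0 : (0 <= (k.+1%:R / r)%:E)%E.
Proof. by rewrite lee_fin divr_ge0 ?ltW. Qed.

Lemma le_cone A B : A `<=` B -> cone A `<=` cone B.
Proof. by move=> AB y [x /AB Bx h]; exists x. Qed.

Lemma le_sigma A B : A `<=` B -> (sigma A <= sigma B)%E.
Proof. by move=> AB; rewrite lee_wpmul2l//; apply: le_outer_measure; exact: le_cone. Qed.

Lemma sigma0 : sigma set0 = 0%E.
Proof.
rewrite /sigma (_ : cone _ = set0) ?outer_measure0 ?mule0//.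
by apply/seteqP; split=> // y [].
Qed.

Lemma sigma_sub : sigma_subadditive sigma.
Proof.
move=> F; rewrite /sigma nneseriesZl//; last by move=> *; exact: outer_measure_ge0.
rewrite lee_wpmul2l// (_ : cone _ = \bigcup_n cone (F n)); first exact: outer_measure_sigma_subadditive.
by apply/seteqP; split=> [y [x [n _ Fx] h]|y [n _ [x Fx h]]]; [exists n => //; exists x|exists x => //; exists n].
Qed.

Lemma sigma_ge0 A : (0 <= sigma A)%E.
Proof. by rewrite mule_ge0// outer_measure_ge0. Qed.

Lemma enorm_isom (M : 'M[R]_k.+1) (x : vec) : M *m M^T = 1%:M -> enorm (x *m M) = enorm x.
Proof.
move=> MM; apply/eqP; rewrite -(eqrXn2 (n := 2)) ?enorm_ge0// !sqr_enormE !dotvE.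
by rewrite trmx_mul mxtrace_mulC -mulmxA (mulmxA M) MM mul1mx mxtrace_mulC.
Qed.

Lemma sqr_enorm_rcat (x : vec) : enorm x ^+ 2 = x ord0 ord0 ^+ 2 + enorm (rtail x) ^+ 2.
Proof.
by rewrite !sqr_enorm big_ord_recl; congr (_ + _); apply: eq_bigr => j _; rewrite mxE.
Qed.

Lemma enorm_rtail (x : vec) : enorm (rtail x) <= enorm x.
Proof.
by rewrite -(ler_pXn2r (n := 2)) ?nnegrE ?enorm_ge0// sqr_enorm_rcat lerDr sqr_ge0.
Qed.

(* r times the gnomonic (central) projection onto the plane x_0 = 1. *)
Definition gno (x : vec) : 'rV[R]_k := (r / x ord0 ord0) *: rtail x.

(** Write a = r/x_0 and b = r/y_0, both at least 1, and c = x.y <= r^2. The difference of the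
    squared distances is r^2 (a - b)^2 + 2 (r^2 - c)(a b - 1). *)
Lemma gno_expand (x y : vec) : sphere x -> sphere y -> 0 < x ord0 ord0 -> 0 < y ord0 ord0 ->
  enorm (x - y) <= enorm (gno x - gno y).
Proof.
rewrite /sphere/= => xr yr x0 y0; rewrite -(ler_pXn2r (n := 2)) ?nnegrE ?enorm_ge0//.
pose a := r / x ord0 ord0; pose b := r / y ord0 ord0.
have xle : x ord0 ord0 <= r by rewrite -xr (le_trans (ler_norm _)) ?ler_coord_enorm.
have yle : y ord0 ord0 <= r by rewrite -yr (le_trans (ler_norm _)) ?ler_coord_enorm.
have a1 : 1 <= a by rewrite /a ler_pdivlMr// mul1r.
have b1 : 1 <= b by rewrite /b ler_pdivlMr// mul1r.
have ax : a * x ord0 ord0 = r by rewrite /a divfK// gt_eqF.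
have by' : b * y ord0 ord0 = r by rewrite /b divfK// gt_eqF.
have -> : enorm (gno x - gno y) ^+ 2 = enorm (a *: x - b *: y) ^+ 2.
  rewrite [RHS]sqr_enorm_rcat !mxE ax by' subrr expr0n add0r; congr (enorm _ ^+ 2).
  by rewrite /gno; apply/rowP => i; rewrite !mxE.
have c1 : dotv x y <= r ^+ 2.
  by rewrite (le_trans (ler_norm _))// (le_trans (dotv_le _ _))// xr yr expr2.
rewrite !sqr_enormB !enormZ xr yr !(dotvZl, dotvZr) !exprMn !real_normK ?num_real//.
set c := dotv x y in c1 *.
have : 0 <= (r ^+ 2 - c) * (a * b - 1) by rewrite mulr_ge0 ?subr_ge0// mulr_ege1.
have := mulr_ge0 (sqr_ge0 r) (sqr_ge0 (a - b)); rewrite !expr2; lra.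
Qed.

(** Near the pole the central projection is almost an isometry. With m = r - e, the change of the
    tail contributes r/m and the change of the factor r e/m^2; the sum is (r/m)^2. *)
Lemma gno_lipschitz (x y : vec) (e : R) : 0 <= e < r -> sphere x -> sphere y ->
  r - e <= x ord0 ord0 -> r - e <= y ord0 ord0 -> enorm (rtail y) <= e ->
  enorm (gno x - gno y) <= (r / (r - e)) ^+ 2 * enorm (x - y).
Proof.
move=> /andP[e0 er] xr yr xe ye te; pose m := r - e.
have m0 : 0 < m by rewrite subr_gt0.
have x0 : 0 < x ord0 ord0 by exact: lt_le_trans xe.
have y0 : 0 < y ord0 ord0 by exact: lt_le_trans ye.
have -> : gno x - gno y = (r / x ord0 ord0) *: rtail (x - y) +
    (r / x ord0 ord0 - r / y ord0 ord0) *: rtail y.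
  by apply/rowP => i; rewrite !mxE; lra.
apply: (le_trans (ler_enormD _ _)); rewrite !enormZ.
have h1 : `|r / x ord0 ord0| * enorm (rtail (x - y)) <= r / m * enorm (x - y).
  rewrite ger0_norm ?divr_ge0 ?(ltW r0) ?(ltW x0)//.
  by rewrite ler_pM ?enorm_ge0 ?divr_ge0 ?enorm_rtail ?(ltW r0) ?(ltW x0)// ler_pM2l// lef_pV2.
have h2 : `|r / x ord0 ord0 - r / y ord0 ord0| <= r / m ^+ 2 * enorm (x - y).
  have -> : r / x ord0 ord0 - r / y ord0 ord0 =
      r / (x ord0 ord0 * y ord0 ord0) * (y ord0 ord0 - x ord0 ord0).
    rewrite invfM; set X := (x _ _)^-1; set Y := (y _ _)^-1.
    have e1 : r * (X * Y) * y ord0 ord0 = r * X by rewrite -!mulrA mulVf ?gt_eqF// mulr1.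
    have e2 : r * (X * Y) * x ord0 ord0 = r * Y.
      by rewrite -!mulrA (mulrC Y) mulrA (mulrA _ _ Y) -(mulrA r) mulVf ?gt_eqF// mulr1.
    by rewrite mulrBr e1 e2.
  rewrite normrM ger0_norm ?divr_ge0 ?mulr_ge0 ?(ltW r0) ?(ltW x0) ?(ltW y0)//.
  apply: ler_pM => //; first by rewrite divr_ge0 ?mulr_ge0 ?(ltW r0) ?(ltW x0) ?(ltW y0).
    by rewrite ler_pM2l// lef_pV2 ?posrE ?mulr_gt0 ?exprn_gt0// expr2 ler_pM// ltW.
  by have := ler_coord_enorm (x - y) ord0; rewrite !mxE distrC.
have h3 : `|r / x ord0 ord0 - r / y ord0 ord0| * enorm (rtail y) <= r / m ^+ 2 * enorm (x - y) * e.
  by rewrite ler_pM ?enorm_ge0.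
apply: (le_trans (lerD h1 h3)); rewrite [X in _ + X <= _]mulrAC -mulrDl ler_wpM2r ?enorm_ge0//.
rewrite expr_div_n -!exprVn -/m; set V := m^-1.
have mV : r * V * (m * V) = r * V by rewrite divff ?mulr1// gt_eqF.
by rewrite le_eqVlt; apply/orP; left; apply/eqP; move: mV; rewrite /m; lra.
Qed.

Lemma cone_sub_flatcone (X : set vec) : X `<=` sphere -> (forall x, X x -> 0 < x ord0 ord0) ->
  cone X `<=` flatcone [set g | exists2 x, X x & g = (x ord0 ord0)^-1 *: rtail x] r.
Proof.
move=> Xs X0 _ [x Xx [t /andP[t0 t1] ->]]; have x0 := X0 _ Xx.
have xr : x ord0 ord0 <= r by rewrite -(Xs _ Xx) (le_trans (ler_norm _)) ?ler_coord_enorm.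
split; rewrite mxE; first by rewrite mulr_gt0//= (lt_le_trans _ xr)// gtr_pMl.
exists x => //; rewrite rtailZ scalerA invfM mulrAC mulVf ?gt_eqF// mul1r//.
Qed.

Lemma flatcone_sub_cone (X : set vec) m : (forall x, X x -> 0 < x ord0 ord0) ->
  (forall x, X x -> m <= x ord0 ord0) ->
  flatcone [set g | exists2 x, X x & g = (x ord0 ord0)^-1 *: rtail x] m `<=` cone X.
Proof.
move=> X0 Xm y [/andP[y0 ym] [x Xx xy]]; have x0 := X0 _ Xx.
exists x => //; exists (y ord0 ord0 / x ord0 ord0).
  by rewrite divr_gt0//= ltr_pdivrMr// mul1r (lt_le_trans ym)// Xm.
apply/rowP => i; have [j|] := unliftP ord0 i => ->; rewrite mxE; last by rewrite divfK// gt_eqF.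
have := congr1 (fun v : 'rV[R]_k => y ord0 ord0 * v ord0 j) xy; rewrite !mxE mulVKf ?gt_eqF// => ->.
by rewrite mulrA.
Qed.

Lemma cone_rotate (X : set vec) (M : 'M[R]_k.+1) : M *m M^T = 1%:M ->
  sigma [set x *m M | x in X] = sigma X.
Proof.
move=> MM; rewrite /sigma -(leb_outer_isometry (cone [set x *m M | x in X]) MM); congr (_ * mu _)%E.
apply/seteqP; split=> [y [_ [x Xx <-] [t t01 yt]]|_ [x Xx [t t01 ->]]].
  exists x => //; exists t => //.
  have := congr1 (fun v => v *m M^T) yt.
  by rewrite -scalemxAl -!mulmxA MM !mulmx1.
by exists (x *m M); [exists x|exists t => //; rewrite scalemxAl].
Qed.

Let pole : vec := rcat0 r 0.

Lemma enorm_pole : enorm pole = r.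
Proof.
apply/eqP; rewrite -(eqrXn2 (n := 2)) ?enorm_ge0 ?(ltW r0)// sqr_enorm_rcat rcat00 rtail_rcat0.
by rewrite enorm0 expr0n addr0.
Qed.

Lemma near_pole (p x : vec) (M : 'M[R]_k.+1) (e : R) : M *m M^T = 1%:M -> p *m M = pole ->
  enorm (x - p) <= e -> r - e <= (x *m M) ord0 ord0 /\ enorm (rtail (x *m M)) <= e.
Proof.
move=> MM pM xe.
have h : enorm (x *m M - pole) <= e by rewrite -pM -mulmxBl enorm_isom.
split.
  have := le_trans (ler_coord_enorm (x *m M - pole) ord0) h.
  by rewrite !mxE unlift_none/= ler_norml => /andP[]; lra.
have -> : rtail (x *m M) = rtail (x *m M - pole).
  by apply/rowP => i; rewrite !mxE liftK/= mxE subr0.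
exact: le_trans (enorm_rtail _) h.
Qed.

Let gno_set (X : set vec) := [set g : 'rV[R]_k | exists2 x, X x & g = (x ord0 ord0)^-1 *: rtail x].

Lemma gnoE (x : vec) : (x ord0 ord0)^-1 *: rtail x = r^-1 *: gno x.
Proof. by rewrite /gno scalerA mulrA mulVf ?mul1r// gt_eqF. Qed.

(** Rotate a point of [B] to the pole, project centrally, apply the isodiametric inequality in the
    plane, and return to the cone by [leb_flatcone]. The factor is the Lipschitz constant of the
    projection to the power k. *)
Lemma sigma_isodiam (B : set vec) (d : R) : 0 < d < r -> pairwise_le B d ->
  (sigma (B `&` sphere) <= (((r / (r - d)) ^+ 2) ^+ k)%:E * hausdorff_cost k B)%E.
Proof.
move=> /andP[d0 dr] Bd.
have [[p [Bp Sp]]|X0] := pselect (B `&` sphere !=set0); last first.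
  rewrite (_ : B `&` sphere = set0); last first.
    by apply/seteqP; split=> // x h; apply: X0; exists x.
  rewrite sigma0; apply: mule_ge0; last exact: hausdorff_cost_ge0.
  by rewrite lee_fin !exprn_ge0// divr_ge0 ?(ltW r0)// subr_ge0 ltW.
have [|M MM pM] := @householder _ _ p pole; first by rewrite enorm_pole.
rewrite -(cone_rotate _ MM); set X := [set _ | _ in _].
have XS x : X x -> sphere x by move=> [y [_ Sy] <-]; rewrite /sphere/= enorm_isom.
have Xp x : X x -> r - d <= x ord0 ord0 /\ enorm (rtail x) <= d.
  by move=> [y [By Sy] <-]; apply: (near_pole MM pM); exact: Bd.
have X0 x : X x -> 0 < x ord0 ord0 by move=> /Xp[h _]; rewrite (lt_le_trans _ h)// subr_gt0.
have Xd x y : X x -> X y -> enorm (x - y) <= diam B.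
  by move=> [x' [Bx' _] <-] [y' [By' _] <-]; rewrite -mulmxBl enorm_isom//; exact: le_diam Bd Bx' By'.
pose L := (r / (r - d)) ^+ 2.
have L0 : 0 <= L by rewrite exprn_ge0// divr_ge0 ?(ltW r0)// subr_ge0 ltW.
have GD : pairwise_le (gno_set X) (r^-1 * (L * diam B)).
  move=> _ _ [x Xx ->] [y Xy ->]; rewrite !gnoE -scalerBr enormZ ger0_norm ?invr_ge0 ?(ltW r0)//.
  rewrite ler_pM2l ?invr_gt0//; apply: (@le_trans _ _ (L * enorm (x - y))).
    have [hx _] := Xp _ Xx; have [hy ty] := Xp _ Xy.
    by apply: gno_lipschitz; rewrite ?(ltW d0)//; exact: XS.
  by rewrite ler_wpM2l// Xd.
have D0 : 0 <= r^-1 * (L * diam B) by rewrite mulr_ge0 ?invr_ge0 ?(ltW r0)// mulr_ge0// diam_ge0.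
apply: (@le_trans _ _ ((k.+1%:R / r)%:E * ((r ^+ k.+1 / k.+1%:R)%:E * (ballvol R k * ((r^-1 * (L * diam B)) / 2) ^+ k)%:E))%E).
  rewrite lee_wpmul2l//; apply: (le_trans (le_leb (cone_sub_flatcone XS X0))).
  rewrite leb_flatcone// lee_wpmul2l ?lee_fin ?divr_ge0 ?exprn_ge0 ?(ltW r0)//.
  exact: isodiametric.
rewrite hausdorff_costE -!EFinM lee_fin -/L.
have -> : r^-1 * (L * diam B) / 2 = r^-1 * (L * (diam B / 2)) by rewrite -!mulrA.
rewrite exprMn [(L * _) ^+ k]exprMn exprVn; set q := (diam B / 2) ^+ k; set l := L ^+ k; set w := ballvol R k.
have -> : k.+1%:R / r * (r ^+ k.+1 / k.+1%:R * (w * (r ^- k * (l * q)))) =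
    (k.+1%:R / k.+1%:R) * (r / r) * (r ^+ k / r ^+ k) * (l * (w * q)).
  by rewrite exprS; set a := k.+1%:R; set b := a^-1; set c := r^-1; set e := (r ^+ k)^-1; lra.
by rewrite !divff ?mul1r ?expf_neq0 ?gt_eqF// ltr0n.
Qed.

Lemma sigma_le_hausdorff X : X `<=` sphere -> (sigma X <= hausdorff_outer R k.+1 k X)%E.
Proof.
move=> XS.
have key (d : R) : 0 < d < r ->
    (sigma X <= (((r / (r - d)) ^+ 2) ^+ k)%:E * hausdorff_outer R k.+1 k X)%E.
  move=> d0r; have /andP[d0 dr] := d0r.
  have K0 : 0 < ((r / (r - d)) ^+ 2) ^+ k by rewrite !exprn_gt0// divr_gt0// subr_gt0.
  apply: (@le_trans _ _ ((((r / (r - d)) ^+ 2) ^+ k)%:E * hausdorff_pre k d X)%E); last first.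
    by rewrite lee_wpmul2l ?lee_fin ?(ltW K0)//; apply: ereal_sup_ubound; exists d.
  pose nu A := sigma (A `&` sphere).
  have -> : sigma X = nu X by rewrite /nu setIidl.
  apply: cover_outer_le_bound => //.
  - by move=> B; exact: hausdorff_cost_ge0.
  - by rewrite /nu set0I sigma0.
  - by move=> A B AB; apply: le_sigma; exact: setSI.
  - by move=> F; rewrite /nu setI_bigcupl; exact: sigma_sub.
  - by move=> B Bd; exact: sigma_isodiam.
have H0 : (0 <= hausdorff_outer R k.+1 k X)%E by exact: outer_measure_ge0.
case: (hausdorff_outer R k.+1 k X) H0 key => [h| |]//; last by move=> _ _; exact: leey.
rewrite lee_fin => h0 key.
have sfin : sigma X = (fine (sigma X))%:E.
  rewrite fineK// ge0_fin_numE ?sigma_ge0//.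
  have /key : 0 < r / 2 < r by rewrite divr_gt0//= ltr_pdivrMr// ltr_pMr// ltr1n.
  by move=> /le_lt_trans; apply; rewrite -EFinM ltry.
rewrite sfin lee_fin; set s := fine _ in sfin *.
(* With d = e r the distortion is (1 - e)^(-2k), and e tends to 0. *)
pose p : {poly R} := s *: ((1%:P - 'X) ^+ 2) ^+ k.
have -> : s = p.[0] by rewrite hornerZ !horner_exp !hornerE subr0 !expr1n mulr1.
have -> : h = (h%:P).[0] by rewrite hornerC.
apply: (@poly_lim_le _ _ _ 1%N) => n n1; set e : R := _^-1.
have e0 : 0 < e by rewrite invr_gt0.
have e1 : e < 1 by rewrite invf_lt1// ltr1n.
have /key : 0 < e * r < r by rewrite mulr_gt0//= gtr_pMl.
have -> : r / (r - e * r) = (1 - e)^-1.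
  by rewrite -{2}(mul1r r) -mulrBl invfM mulrCA divff ?mulr1// gt_eqF.
rewrite sfin -EFinM lee_fin hornerC hornerZ !horner_exp !hornerE -exprM -[X in _ <= X -> _]mulrC.
by rewrite -exprM exprVn ler_pdivlMr// exprn_gt0// subr_gt0.
Qed.

(** The central projection does not decrease distances, so a cover of the plane image pulls back to
    a cover of [X] that costs no more, and in the plane [hausdorff_pre] is at most Lebesgue
    measure. *)
Lemma pre_le_sigma_local X (e d : R) : 0 < e < r -> 0 < d -> X `<=` sphere -> pairwise_le X e ->
  (hausdorff_pre k d X <= ((r / (r - e)) ^+ k.+1)%:E * sigma X)%E.
Proof.
move=> /andP[e0 er] d0 XS Xe.
have m0 : 0 < r - e by rewrite subr_gt0.
have [[p Xp]|X0] := pselect (X !=set0); last first.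
  rewrite (_ : X = set0); last by apply/seteqP; split=> // x h; apply: X0; exists x.
  rewrite /hausdorff_pre cover_outer0; last exact: hausdorff_cost_ge0.
  by rewrite sigma0 mule0.
have [|M MM pM] := @householder _ _ p pole; first by rewrite enorm_pole XS.
pose X' := [set x *m M | x in X].
have X'S x : X' x -> sphere x by move=> [y Xy <-]; rewrite /sphere/= enorm_isom// XS.
have X'p x : X' x -> r - e <= x ord0 ord0.
  by move=> [y Xy <-]; have [] := near_pole MM pM (Xe _ _ Xy Xp).
have X'0 x : X' x -> 0 < x ord0 ord0 by move=> /X'p; exact: lt_le_trans.
have gd x y : X x -> X y -> enorm (x - y) <= enorm (gno (x *m M) - gno (y *m M)).
  move=> Xx Xy; rewrite -(enorm_isom _ MM) mulmxBl.
  have X'M z : X z -> X' (z *m M) by exists z.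
  by apply: gno_expand; [apply: X'S|apply: X'S|apply: X'0|apply: X'0]; exact: X'M.
pose nu (P : set 'rV[R]_k) := hausdorff_pre k d [set x | X x /\ P (gno (x *m M))].
have nuE : hausdorff_pre k d X = nu [set gno x | x in X'].
  congr hausdorff_pre; apply/seteqP; split=> [x Xx|x []//]; split=> //.
  by exists (x *m M) => //; exists x.
have nule P : (nu P <= hausdorff_pre k d P)%E.
  rewrite -[leRHS]mul1e; move: P; apply: cover_outer_le_bound => //.
  - by move=> B; exact: hausdorff_cost_ge0.
  - rewrite /nu (_ : [set _ | _] = set0) ?/hausdorff_pre ?cover_outer0//; first exact: hausdorff_cost_ge0.
    by apply/seteqP; split=> // x [].
  - by move=> A B AB; apply: le_cover_outer => x [Xx /AB].
  - move=> F; rewrite /nu (_ : [set _ | _] = \bigcup_n [set x | X x /\ F n (gno (x *m M))]).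
      by apply: cover_outer_sigma_subadditive; exact: hausdorff_cost_ge0.
    by apply/seteqP; split=> [x [Xx [n _ Fx]]|x [n _ [Xx Fx]]]; [exists n|split=> //; exists n].
  - move=> B Bd; rewrite mul1e.
    apply: (@le_trans _ _ (hausdorff_cost k [set x | X x /\ B (gno (x *m M))])).
      apply: cover_outer_le1 => //; first by move=> ?; exact: hausdorff_cost_ge0.
      by move=> x y [Xx Bx] [Xy By]; apply: (le_trans (gd _ _ Xx Xy)); exact: Bd.
    have := @hausdorff_cost_le _ _ _ k [set x | X x /\ B (gno (x *m M))] B 1 ler01.
    rewrite expr1n mul1e mul1r; apply; apply: diam_le; first exact: diam_ge0.
    by move=> x y [Xx Bx] [Xy By]; apply: (le_trans (gd _ _ Xx Xy)); exact: le_diam Bd Bx By.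
rewrite nuE; apply: (le_trans (nule _)); apply: (le_trans (hausdorff_pre_le_leb _ d0)).
have -> : [set gno x | x in X'] = (fun g => r^-1 *: g) @^-1` gno_set X'.
  apply/seteqP; split=> [_ [x Xx <-]|g [x Xx]]; first by exists x; rewrite // gnoE.
  move=> gx; exists x => //; rewrite -[LHS]scale1r -[1](@divff _ r) ?gt_eqF// -scalerA -gnoE -gx.
  by rewrite scalerA divff ?scale1r// gt_eqF.
rewrite leb_outer_scale ?invr_gt0// exprVn invrK.
rewrite -(cone_rotate X MM) -/X'.
have := le_leb (flatcone_sub_cone X'0 X'p); rewrite leb_flatcone// -/(gno_set X') => H.
apply: (@le_trans _ _ ((r ^+ k * (k.+1%:R / (r - e) ^+ k.+1))%:E * mu (cone X'))%E).
  rewrite EFinM -muleA lee_wpmul2l ?lee_fin ?exprn_ge0 ?(ltW r0)//.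
  have c0 : 0 < k.+1%:R / (r - e) ^+ k.+1 by rewrite divr_gt0// exprn_gt0.
  rewrite -lee_pdivrMl// (le_trans _ H)// lee_wpmul2r ?outer_measure_ge0//.
  by rewrite lee_fin invf_div.
rewrite /sigma muleA -EFinM lee_wpmul2r ?outer_measure_ge0// lee_fin expr_div_n (exprS r).
rewrite le_eqVlt; apply/orP; left; apply/eqP; set a := k.+1%:R; set b := ((r - e) ^+ _)^-1.
have -> : r * r ^+ k * b * (a / r) = r ^+ k * (a * b) * (r / r) by set c := r^-1; lra.
by rewrite divff ?mulr1// gt_eqF.
Qed.

Lemma cone_polar (X : set vec) y : X `<=` sphere -> cone X y ->
  [/\ 0 < enorm y < r & X ((r / enorm y) *: y)].
Proof.
move=> XS [x Xx [t /andP[t0 t1] ->]].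
have tr : enorm (t *: x) = t * r by rewrite enormZ gtr0_norm// (XS _ Xx).
rewrite tr mulr_gt0//= gtr_pMl// t1; split=> //.
by rewrite scalerA mulrAC (mulrC r) divff ?scale1r// mulf_neq0 ?gt_eqF.
Qed.

Lemma polar_cone (X : set vec) y : 0 < enorm y < r -> X ((r / enorm y) *: y) -> cone X y.
Proof.
move=> /andP[y0 yr] Xy; exists ((r / enorm y) *: y) => //; exists (enorm y / r).
  by rewrite divr_gt0//= ltr_pdivrMr// mul1r.
by rewrite scalerA mulrA divfK ?gt_eqF// divff ?gt_eqF// scale1r.
Qed.

Lemma ceball_dense (e : R) : 0 < e -> exists c : nat -> vec, forall x, exists n, enorm (x - c n) < e.
Proof.
move=> e0; pose f (q : 'rV[rat]_k.+1) : vec := map_mx (@ratr R) q.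
exists (fun n => oapp f 0 (unpickle n)) => x.
pose K : R := Num.sqrt k.+1%:R + 1.
have K0 : 0 < K by rewrite ltr_wpDl// sqrtr_ge0.
pose e' := e / K; have e'0 : 0 < e' by rewrite divr_gt0.
have /choice[q hq] : forall i, exists q : rat, `|x ord0 i - ratr q| < e'.
  move=> i; have [|q] := @rat_in_itvoo R (x ord0 i - e') (x ord0 i + e').
    by rewrite ltrBlDr -addrA ltrDl addr_gt0.
  by rewrite in_itv/= => hq; exists q; rewrite distrC ltr_distl.
exists (pickle (\row_i q i)); rewrite pickleK/=.
apply: (@le_lt_trans _ _ (Num.sqrt k.+1%:R * e')).
  by apply: ler_enorm_sup => [|i]; [exact: ltW|rewrite !mxE ltW].
by rewrite /e' mulrCA -[ltRHS]mulr1 ltr_pM2l// ltr_pdivrMr// mul1r ltrDl.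
Qed.

(** [X] is cut into pieces of diameter at most [e], where [pre_le_sigma_local] applies. The cutting
    sets are measurable and invariant under dilations, so they split the cone of [X] into the cones
    of the pieces without loss, even for a non-measurable [X]. *)
Lemma hausdorff_le_sigma X : X `<=` sphere -> (hausdorff_outer R k.+1 k X <= sigma X)%E.
Proof.
move=> XS; apply: ge_ereal_sup => _ [d d0 <-].
have key (e : R) : 0 < e < r -> (hausdorff_pre k d X <= ((r / (r - e)) ^+ k.+1)%:E * sigma X)%E.
  move=> e0r; have /andP[e0 er] := e0r.
  have e20 : 0 < e / 2 by rewrite divr_gt0.
  have [c hc] := ceball_dense e20.
  (* Points whose projection to the sphere is within [e / 2] of [c n], the inequality being
     multiplied by the norm to avoid a division. *)
  pose O n : set vec := [set y | enorm (r *: y - enorm y *: c n) < e / 2 * enorm y].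
  have oO n : open (O n).
    pose f (y : vec) := e / 2 * enorm y - enorm (r *: y - enorm y *: c n).
    have cf : continuous f.
      move=> y.
      have c1 : {for y, continuous (fun y : vec => e / 2 * enorm y)}.
        by apply: continuousM; [exact: cst_continuous|exact: continuous_enorm].
      have c2 : {for y, continuous (fun y : vec => r *: y - enorm y *: c n)}.
        have c3 : {for y, continuous (fun y : vec => enorm y *: c n)}.
          exact: (continuous_comp (@continuous_enorm R k.+1 y) (@scalel_continuous _ _ (c n) _)).
        have c4 : {for y, continuous (fun y : vec => r *: y)} by exact: scaler_continuous.
        exact: (continuousB c4 c3).
      have c5 := continuous_comp c2 (@continuous_enorm R k.+1 _).
      exact: (continuousB c1 c5).
    rewrite (_ : O n = f @^-1` [set z | 0 < z]).
      by move/continuousP : cf; apply; exact: open_gt.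
    by apply/seteqP; split=> y; rewrite /O/f/= subr_gt0.
  pose A := seqDU O.
  have mA n : mble (A n).
    by apply: (@seqDU_measurable _ (caratheodory_type mu) O) => m; exact/open_mble.
  have OZ n t y : 0 < t -> O n (t *: y) <-> O n y.
    move=> t0; rewrite /O/= enormZ gtr0_norm// scalerA mulrC -!scalerA -scalerBr enormZ gtr0_norm//.
    by rewrite mulrCA ltr_pM2l.
  have AZ n t y : 0 < t -> A n (t *: y) <-> A n y.
    move=> t0; rewrite /A /seqDU -bigcup_mkord; split=> -[h1 h2]; split; first exact/(OZ n t y t0).
    - by move=> [m mn Om]; apply: h2; exists m => //; exact/(OZ m t y t0).
    - exact/(OZ n t y t0).
    - by move=> [m mn Om]; apply: h2; exists m => //; exact/(OZ m t y t0).
  have Xcov : X `<=` \bigcup_n (X `&` A n).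
    move=> x Xx; have [n hn] := hc x.
    have : (\bigcup_n O n) x.
      exists n => //; rewrite /O/= (XS _ Xx) -scalerBr enormZ gtr0_norm// mulrC ltr_pM2r//.
    by rewrite (seqDU_bigcup_eq O) => -[m _ Am]; exists m.
  have p0 : (0 <= ((r / (r - e)) ^+ k.+1)%:E)%E.
    by rewrite lee_fin exprn_ge0// divr_ge0 ?(ltW r0)// subr_ge0 ltW.
  apply: (@le_trans _ _ (hausdorff_pre k d (\bigcup_n (X `&` A n)))); first exact: le_cover_outer.
  apply: (le_trans (cover_outer_sigma_subadditive _ _ _ _)); first exact: hausdorff_cost_ge0.
  apply: (@le_trans _ _ (\sum_(n <oo) ((r / (r - e)) ^+ k.+1)%:E * sigma (X `&` A n))%E).
    apply: lee_nneseries => n _.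
      by move=> *; apply: cover_outer_ge0; exact: hausdorff_cost_ge0.
    apply: pre_le_sigma_local => //; first by move=> x [/XS].
    move=> x y [Xx [Ox _]] [Xy [Oy _]].
    have h z : X z -> O n z -> enorm (z - c n) < e / 2.
      move=> Xz; rewrite /O/= (XS _ Xz) -scalerBr enormZ gtr0_norm// mulrC ltr_pM2r//.
    have := h _ Xx Ox; have := h _ Xy Oy; have := ler_enormD (x - c n) (c n - y).
    by rewrite addrA subrK (enormB (c n)); lra.
  rewrite nneseriesZl//; last by move=> *; exact: sigma_ge0.
  rewrite lee_wpmul2l// /sigma nneseriesZl//; last by move=> *; exact: outer_measure_ge0.
  rewrite lee_wpmul2l//.
  have -> : (\sum_(i <oo) mu (cone (X `&` A i)))%E = (\sum_(i <oo) mu (cone X `&` A i))%E.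
    apply: eq_eseriesr => n _; congr mu; apply/seteqP; split=> [_ [x [Xx Ax] [t t01 ->]]|_ [[x Xx [t t01 ->]] Ax]].
      by have /andP[t0 _] := t01; split; [exists x => //; exists t|apply/AZ].
    by have /andP[t0 _] := t01; exists x; [split => //; move: Ax => /AZ; exact|exists t].
  have := @caratheodory_lime_le _ _ mu A mA (@trivIset_seqDU _ _) (cone X).
  by apply: le_trans; rewrite leeDl// outer_measure_ge0.
case E : (sigma X) (sigma_ge0 X) key => [s| |]// s0 key; last by rewrite leey.
have pfin : (hausdorff_pre k d X < +oo)%E.
  have /key : 0 < r / 2 < r by rewrite divr_gt0//= ltr_pdivrMr// ltr_pMr// ltr1n.
  by move=> /le_lt_trans; apply; rewrite -EFinM ltry.
have p0 : (0 <= hausdorff_pre k d X)%E by apply: cover_outer_ge0; exact: hausdorff_cost_ge0.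
have pE : hausdorff_pre k d X = (fine (hausdorff_pre k d X))%:E by rewrite fineK// ge0_fin_numE.
rewrite pE lee_fin; set h := fine _ in pE *.
pose p : {poly R} := h *: (1%:P - 'X) ^+ k.+1.
have -> : h = p.[0] by rewrite hornerZ !horner_exp !hornerE subr0 !expr1n mulr1.
have -> : s = (s%:P).[0] by rewrite hornerC.
apply: (@poly_lim_le _ _ _ 1%N) => n n1; set e : R := _^-1.
have e0 : 0 < e by rewrite invr_gt0.
have e1 : e < 1 by rewrite invf_lt1// ltr1n.
have /key : 0 < e * r < r by rewrite mulr_gt0//= gtr_pMl.
have -> : r / (r - e * r) = (1 - e)^-1.
  by rewrite -{2}(mul1r r) -mulrBl invfM mulrCA divff ?mulr1// gt_eqF.
rewrite pE -EFinM lee_fin hornerC hornerZ !horner_exp !hornerE -[X in _ <= X -> _]mulrC.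
by rewrite exprVn ler_pdivlMr// exprn_gt0// subr_gt0.
Qed.

Lemma hausdorff_sphere X : X `<=` sphere -> hausdorff_outer R k.+1 k X = sigma X.
Proof.
by move=> XS; apply/eqP; rewrite eq_le hausdorff_le_sigma// sigma_le_hausdorff.
Qed.

End sphere_hausdorff.

(** * Measurable sets for the Hausdorff measure *)

Section hausdorff_measurable.
Context {R : realType}.
Local Open Scope ereal_scope.

Lemma hausdorff_pre_le_pre N k (d d' : R) (A : set 'rV[R]_N) : (d <= d')%R ->
  hausdorff_pre k d' A <= hausdorff_pre k d A.
Proof.
move=> dd'; apply: ereal_inf_le_tmp => _ [F [FC AF] <-]; exists F => //; split=> // m B /FC h x y Bx By.
exact: le_trans (h _ _ Bx By) dd'.
Qed.

(** A covering set of diameter at most [d < s] cannot meet both [A] and [B], so a cover of the union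
    splits into two. *)
Lemma hausdorff_pre_sep N k (d s : R) (A B : set 'rV[R]_N) : (d < s)%R ->
  (forall x y, A x -> B y -> (s <= enorm (x - y))%R) ->
  hausdorff_pre k d A + hausdorff_pre k d B <= hausdorff_pre k d (A `|` B).
Proof.
move=> ds AB; apply: le_ereal_inf_tmp => _ [F [FC ABF] <-].
pose FA n := if `[< oapp id set0 (F n) `&` A !=set0 >] then F n else None.
pose FB n := if `[< oapp id set0 (F n) `&` B !=set0 >] then F n else None.
have c0 o : 0 <= oapp (@hausdorff_cost R N k) 0 o.
  by case: o => //= C; exact: hausdorff_cost_ge0.
apply: (@le_trans _ _ (\sum_(n <oo) oapp (@hausdorff_cost R N k) 0 (FA n) +
    \sum_(n <oo) oapp (@hausdorff_cost R N k) 0 (FB n))).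
  apply: leeD; apply: ereal_inf_lbound.
    exists FA => //; split=> [n C|x Ax]; first by rewrite /FA; case: ifP => // _ /FC.
    have [n _ Fx] := ABF _ (or_introl Ax); exists n => //; rewrite /FA ifT//.
    by apply/asboolP; exists x.
  exists FB => //; split=> [n C|x Bx]; first by rewrite /FB; case: ifP => // _ /FC.
  have [n _ Fx] := ABF _ (or_intror Bx); exists n => //; rewrite /FB ifT//.
  by apply/asboolP; exists x.
rewrite -nneseriesD//.
apply: lee_nneseries => n _; first by rewrite adde_ge0.
rewrite /FA /FB; case: asboolP => [[x [Fx Ax]]|_]; last first.
  by rewrite add0e; case: ifP => //= _; exact: c0.
case: asboolP => [[y [Fy By]]|_]; last by rewrite adde0.
case E : (F n) Fx Fy => [C|]//= Fx Fy; have := FC _ _ E x y Fx Fy.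
by move=> h; have := AB _ _ Ax By; rewrite leNgt (le_lt_trans h).
Qed.

Lemma hausdorff_outer_sep N k (s : R) (A B : set 'rV[R]_N) : (0 < s)%R ->
  (forall x y, A x -> B y -> (s <= enorm (x - y))%R) ->
  hausdorff_outer R N k A + hausdorff_outer R N k B <= hausdorff_outer R N k (A `|` B).
Proof.
move=> s0 AB; set H := hausdorff_outer R N k.
have p0 d (C : set 'rV[R]_N) : 0 <= hausdorff_pre k d C.
  by apply: cover_outer_ge0; exact: hausdorff_cost_ge0.
have key d d' : (0 < d)%R -> (0 < d')%R ->
    hausdorff_pre k d A + hausdorff_pre k d' B <= H (A `|` B).
  move=> d0 d'0; pose m := Num.min (s / 2)%R (Num.min d d').
  have m0 : (0 < m)%R by rewrite !lt_min d0 d'0 divr_gt0.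
  have [md md'] : (m <= d)%R /\ (m <= d')%R by rewrite /m !ge_min !lexx !orbT.
  have ms : (m < s)%R by rewrite /m gt_min ltr_pdivrMr// ltr_pMr// ltr1n.
  apply: (le_trans (leeD (hausdorff_pre_le_pre k A md) (hausdorff_pre_le_pre k B md'))).
  apply: (le_trans (hausdorff_pre_sep k ms AB)).
  by apply: ereal_sup_ubound; exists m.
have [->|fin] := eqVneq (H (A `|` B)) +oo; first exact: leey.
have Hf C : C `<=` A `|` B -> H C \is a fin_num.
  move=> CAB; rewrite ge0_fin_numE ?outer_measure_ge0//.
  by rewrite (le_lt_trans (le_outer_measure _ _ _ CAB))// ltey.
have fA : H A \is a fin_num by apply: Hf => x; left.
have fB : H B \is a fin_num by apply: Hf => x; right.
rewrite -leeBrDr//; apply: ge_ereal_sup => _ [d d0 <-]; rewrite leeBrDr//.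
have pf : hausdorff_pre k d A \is a fin_num.
  rewrite ge0_fin_numE//; apply: (@le_lt_trans _ _ (H A)); first by apply: ereal_sup_ubound; exists d.
  by rewrite -ge0_fin_numE ?outer_measure_ge0.
rewrite addeC -leeBrDr//; apply: ge_ereal_sup => _ [d' d'0 <-].
by rewrite leeBrDr// addeC key.
Qed.

(** Caratheodory's criterion for metric outer measures, with [dist] in the role of the distance to
    the sphere. The parts [A n] of [X] away from the sphere are separated from it; what they miss
    outside the sphere is a tail of the shells [Y j]. *)
Lemma sphere_cara N k (r : R) :
  (hausdorff_outer R N k).-caratheodory [set x : 'rV[R]_N | enorm x = r].
Proof.
set D := [set x : 'rV[R]_N | enorm x = r]; set H := hausdorff_outer R N k.
apply: le_caratheodory_measurable => X; change (H (X `&` D) + H (X `&` ~` D) <= H X).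
have [->|fin] := eqVneq (H X) +oo; first exact: leey.
pose dist (x : 'rV[R]_N) : R := `|enorm x - r|%R.
have dlip x y : (`|dist x - dist y| <= enorm (x - y))%R.
  apply: (le_trans (ler_dist_dist _ _)); rewrite opprB addrA subrK.
  exact: ler_dist_enorm.
pose e n : R := n.+1%:R^-1%R.
have e0 n : (0 < e n)%R by rewrite invr_gt0.
have e_dec n m : (n < m)%N -> (e m < e n)%R.
  by move=> nm; rewrite ltf_pV2 ?posrE// ltr_nat ltnS.
pose A n := [set x | X x /\ (e n < dist x)%R].
pose Y n := [set x | X x /\ (e n.+1 < dist x <= e n)%R].
have XD : X `&` ~` D = \bigcup_n A n.
  apply/seteqP; split=> [x [Xx /eqP xD]|x [n _ [Xx nx]]]; last first.
    by split=> // xD; move: nx; rewrite /dist xD subrr normr0 ltNge ltW.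
  have d0 : (0 < dist x)%R by rewrite normr_gt0 subr_eq0.
  have [n hn] : exists n, (e n < dist x)%R.
    near \oo => n; exists n; near: n; exact: near_infty_natSinv_lt (PosNum d0).
  by exists n.
have XDn n : X `&` ~` D `<=` A n `|` \bigcup_j Y (n + j)%N.
  rewrite XD => x [m _ [Xx mx]]; have [nx|nx] := ltP (e n) (dist x); first by left.
  right; have [j] := ubnP m; elim: j m mx => // j IH m mx.
  case: m mx => [|m] mx hm.
    by have := lt_le_trans mx nx; case: n {IH nx} => [|n]; rewrite ?ltxx// ltNge ltW// e_dec.
  have [mx'|mx'] := ltP (e m) (dist x); first exact: (IH m).
  have nm : (n <= m)%N.
    rewrite leqNgt; apply/negP => mn; have := lt_le_trans mx nx; rewrite ltNge; apply/negP/negPn.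
    by move: mn; rewrite leq_eqVlt => /orP[/eqP<-//|/e_dec/ltW].
  by exists (m - n)%N => //; rewrite subnKC//; split=> //; rewrite mx mx'.
have HX C : C `<=` X -> H C \is a fin_num.
  move=> CX; rewrite ge0_fin_numE ?outer_measure_ge0//.
  by rewrite (le_lt_trans (le_outer_measure _ _ _ CX))// ltey.
(* Shells of the same parity are at positive distance from each other, so their measures add up. *)
have oddsum (b : bool) n : \sum_(j < n) H (Y (b + j.*2)%N) <= H (\bigcup_(j in [set j | (j < n)%N]) Y (b + j.*2)%N).
  elim: n => [|[|n] IH]; first by rewrite big_ord0 outer_measure_ge0.
    by rewrite big_ord_recr big_ord0/= add0e; apply: le_outer_measure => x Yx; exists 0%N.
  rewrite big_ord_recr/=; apply: (le_trans (leeD2r _ IH)).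
  apply: (@le_trans _ _ (H ((\bigcup_(j in [set j | (j < n.+1)%N]) Y (b + j.*2)%N) `|` Y (b + n.+1.*2)%N))); last first.
    apply: le_outer_measure => x [[j jn Yx]|Yx]; first by exists j => //=; rewrite ltnS ltnW.
    by exists n.+1 => //=.
  apply: (@hausdorff_outer_sep _ _ (e (b + n.*2).+1 - e (b + n.*2).+2)).
    by rewrite subr_gt0 e_dec.
  move=> x y [j /= jn [_ /andP[h1 _]]] [_ /andP[_ h2]].
  rewrite doubleS !addnS in h2.
  have h3 : (e (b + n.*2).+1 <= e (b + j.*2).+1)%R.
    rewrite lef_pV2 ?posrE// ler_nat !ltnS leq_add2l leq_double -ltnS//.
  apply: le_trans (dlip x y); apply: le_trans (ler_norm _).
  by rewrite lerB// (le_trans h3)// ltW.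
(* Each parity contributes at most [H X]. *)
have Ysum : \sum_(j <oo) H (Y j) < +oo.
  apply: (@le_lt_trans _ _ (H X + H X)); last first.
    by rewrite -ge0_fin_numE ?adde_ge0 ?outer_measure_ge0// fin_numD !HX.
  apply: lime_le; first by apply: is_cvg_nneseries => *; exact: outer_measure_ge0.
  near=> n; apply: (@le_trans _ _ (\sum_(0 <= j < n.*2) H (Y j))).
    by apply: lee_sum_nneg_natr => [*|]; [exact: outer_measure_ge0|rewrite -addnn leq_addr].
  rewrite big_mkord.
  have -> : \sum_(j < n.*2) H (Y j) = \sum_(j < n) H (Y (false + j.*2)%N) + \sum_(j < n) H (Y (true + j.*2)%N).
    elim: {+}n => [|m IH]; first by rewrite !big_ord0 adde0.
    by rewrite doubleS !big_ord_recr/= IH -!addeA; congr (_ + _); rewrite addeCA addeA.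
  apply: leeD; apply: (le_trans (oddsum _ _)); apply: le_outer_measure => x [j _ []//].
have tail : \sum_(n <= j <oo) H (Y j) @[n --> \oo] --> 0.
  by apply: nneseries_tail_cvg => // j _; exact: outer_measure_ge0.
have AnX n : H (X `&` D) + H (A n) <= H X.
  apply: (@le_trans _ _ (H ((X `&` D) `|` A n))); last first.
    by apply: le_outer_measure => x [[]|[]].
  apply: (@hausdorff_outer_sep _ _ (e n)) => // x y [_ xD] [_ ny].
  apply: (le_trans (ltW ny)); apply: le_trans (dlip x y).
  by rewrite /dist xD subrr normr0 sub0r normrN normr_id.
have XDf : H (X `&` ~` D) \is a fin_num by apply: HX => x [].
have XDf' : H (X `&` D) \is a fin_num by apply: HX => x [].
have XDle n : H (X `&` ~` D) <= H (A n) + \sum_(n <= j <oo) H (Y j).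
  apply: (le_trans (le_outer_measure _ _ _ (XDn n))).
  apply: (le_trans (sigma_subU (outer_measure0 _) (@le_outer_measure _ _ _) (@outer_measure_sigma_subadditive _ _ _) _ _)).
  rewrite leeD2l//; apply: (le_trans (outer_measure_sigma_subadditive _ _)).
  rewrite -(@nneseries_addn _ (fun j => H (Y j)) n)//; last by move=> *; exact: outer_measure_ge0.
  by under eq_eseriesr do rewrite addnC.
rewrite -[leRHS]adde0.
apply: (cvge_ge _ (cvgeD _ (cvg_cst (H X)) tail)); last by rewrite fin_num_adde_defl// HX.
near=> n; apply: (le_trans (leeD2l _ (XDle n))); rewrite addeA.
by rewrite leeD2r.
Unshelve. all: by end_near. Qed.

(** [X] is first split by the sphere. On subsets of the sphere the Hausdorff measure is [sigma], and
    there splitting by [A] means splitting cones by [cone A]. *)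
Lemma cone_cara k (r : R) (A : set 'rV[R]_k.+1) : (0 < r)%R -> A `<=` sphere r ->
  mble (cone A) -> (hausdorff_outer R k.+1 k).-caratheodory A.
Proof.
move=> r0 AS mA; apply: le_caratheodory_measurable => X.
set H := hausdorff_outer R k.+1 k; change (H (X `&` A) + H (X `&` ~` A) <= H X).
have XD : H X = H (X `&` sphere r) + H (X `&` ~` sphere r) := @sphere_cara k.+1 k r X.
have XDA : H (X `&` sphere r) = H (X `&` A) + H ((X `&` sphere r) `\` A).
  have s1 : X `&` sphere r `<=` sphere r by move=> x [].
  have s2 : X `&` A `<=` sphere r by move=> x [_ /AS].
  have s3 : (X `&` sphere r) `\` A `<=` sphere r by move=> x [[]].
  rewrite /H !(hausdorff_sphere r0)// /sigma -ge0_muleDr ?outer_measure_ge0//.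
  congr (_ * _); rewrite (mble_split _ mA); congr (_ + _); congr (leb_outer R k.+1 _).
    apply/seteqP; split=> [y [/(cone_polar r0 s1)[yr [Xy Sy]] /(cone_polar r0 AS)[_ Ay]]|y].
      by apply: (polar_cone r0 yr); split.
    move=> /(cone_polar r0 s2)[yr [Xy Ay]]; split; apply: (polar_cone r0 yr) => //; split=> //; exact: AS.
  apply/seteqP; split=> [y [/(cone_polar r0 s1)[yr Xy] nA]|y /(cone_polar r0 s3)[yr [Xy nA]]].
    by apply: (polar_cone r0 yr); split=> // Ay; apply: nA; exact: (polar_cone r0 yr).
  by split; [exact: (polar_cone r0 yr)|move=> /(cone_polar r0 AS)[]].
rewrite XD XDA -addeA leeD2l//.
apply: (@le_trans _ _ (H (((X `&` sphere r) `\` A) `|` (X `&` ~` sphere r)))).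
  by apply: le_outer_measure => x [Xx nA]; have [Sx|Sx] := pselect (sphere r x); [left|right].
apply: sigma_subU; [exact: outer_measure0|exact: le_outer_measure|].
exact: outer_measure_sigma_subadditive.
Qed.

End hausdorff_measurable.

(** * Dilations of integrals, integration over the sphere *)

Section integral_transfer.
Context d1 d2 (T1 : measurableType d1) (T2 : measurableType d2) (R : realType).
Variables (m1 : {measure set T1 -> \bar R}) (m2 : {measure set T2 -> \bar R}).
Variables (D1 : set T1) (D2 : set T2) (f1 : T1 -> R) (f2 : T2 -> R) (c : R).
Hypotheses (mD1 : measurable D1) (mD2 : measurable D2).
Hypotheses (mf1 : measurable_fun D1 f1) (mf2 : measurable_fun D2 f2) (c0 : 0 <= c).
Hypothesis f12 : forall Y : set R, measurable Y ->
  m1 (D1 `&` f1 @^-1` Y) = (c%:E * m2 (D2 `&` f2 @^-1` Y))%E.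

(** The distributions of [f1] and [f2] are proportional, and both integrals are integrals of [g]
    against them. This serves for dilations as well as for the passage from the sphere to a
    shell. *)
Lemma ge0_integral_transfer (g : R -> \bar R) : measurable_fun setT g ->
  (forall t, 0 <= g t)%E -> g 0 = 0%E ->
  (\int[m1]_(x in D1) g (f1 x) = c%:E * \int[m2]_(x in D2) g (f2 x))%E.
Proof.
(* Extending [f1] and [f2] by 0 adds mass at the value 0 only; since [g 0 = 0], integrating over the
   nonzero values loses nothing. *)
move=> mg g0 g00; pose D := [set t : R | t != 0].
have mD : measurable D.
  rewrite (_ : D = ~` [set 0]); first exact: measurableC.
  by apply/seteqP; split=> t /=; [move/eqP|move/eqP].
have E d (T : measurableType d) (m : {measure set T -> \bar R}) B (f : T -> R) (mB : measurable B)
    (mf : measurable_fun B f) :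
    (\int[m]_(x in B) g (f x) = \int[pushforward m (f \_ B)]_(y in D) g y)%E.
  have mfB : measurable_fun setT (f \_ B) by apply/(measurable_restrictT f mB).
  rewrite (ge0_integral_pushforward mfB)//; last exact: measurable_funTS.
  rewrite integral_mkcond [RHS]integral_mkcond; apply: eq_integral => x _.
  rewrite /patch; case xB : (x \in B); case: ifPn => //; rewrite ?notin_setE ?inE /preimage/= /D/= xB.
  - by [].
  - by move=> /negP; rewrite negbK => /eqP ->.
  - by rewrite eqxx.
rewrite (E _ _ m1)// (E _ _ m2)//.
have -> : c%:E = ((NngNum c0)%:num)%:E by [].
have m2f2 : measurable_fun setT (f2 \_ D2) by apply/(measurable_restrictT f2 mD2).
have m1f1 : measurable_fun setT (f1 \_ D1) by apply/(measurable_restrictT f1 mD1).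
pose hf1 : {mfun T1 >-> R} := HB.pack (f1 \_ D1) (isMeasurableFun.Build _ _ _ _ _ m1f1).
pose hf2 : {mfun T2 >-> R} := HB.pack (f2 \_ D2) (isMeasurableFun.Build _ _ _ _ _ m2f2).
have -> : (f1 \_ D1) = hf1 by [].
have -> : (f2 \_ D2) = hf2 by [].
rewrite -ge0_integral_mscale//; last exact: measurable_funTS.
apply: eq_measure_integral => A mA AD.
rewrite /mscale/= /pushforward.
have pE T (B : set T) (f : T -> R) : (f \_ B) @^-1` A = B `&` f @^-1` A.
  apply/seteqP; split=> x; rewrite /preimage/= /patch; case: ifPn => xB.
  - by rewrite inE in xB; split.
  - by move=> /AD; rewrite /D/= eqxx.
  - by move=> [].
  - by move=> [Bx _]; rewrite mem_set in xB.
transitivity (c%:E * m2 ((f2 \_ D2) @^-1` A))%E; last by [].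
by rewrite !pE f12.
Qed.

Lemma integral_transfer : m2.-integrable D2 (EFin \o f2) ->
  (\int[m1]_(x in D1) (f1 x)%:E = c%:E * \int[m2]_(x in D2) (f2 x)%:E)%E.
Proof.
move=> if2.
have h (a : R) : (\int[m1]_(x in D1) (Num.max (a * f1 x) 0)%:E =
    c%:E * \int[m2]_(x in D2) (Num.max (a * f2 x) 0)%:E)%E.
  apply: (@ge0_integral_transfer (fun t => (Num.max (a * t) 0)%:E)).
  - by apply/measurable_EFinP; apply: measurable_maxr => //; exact: measurable_funM.
  - by move=> t; rewrite lee_fin le_max lexx orbT.
  - by rewrite mulr0 maxxx.
rewrite integralE [in RHS]integralE.
have pE T (f : T -> R) : (fun x => (f x)%:E)^\+%E = (fun x => (Num.max (1 * f x) 0)%:E).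
  by apply/funext => x; rewrite funeposE mul1r EFin_max.
have nE T (f : T -> R) : (fun x => (f x)%:E)^\-%E = (fun x => (Num.max (-1 * f x) 0)%:E).
  by apply/funext => x; rewrite funenegE mulN1r EFin_max.
by rewrite muleBr// ?integrable_add_def// !pE !nE !h.
Qed.

Lemma integrable_transfer : m2.-integrable D2 (EFin \o f2) -> m1.-integrable D1 (EFin \o f1).
Proof.
move=> /integrableP[_ i2]; apply/integrableP; split; first exact/measurable_EFinP.
have := @ge0_integral_transfer (fun t => `|t|%:E).
move=> /= ->//; last by rewrite normr0.
- by rewrite lte_mul_pinfty ?lee_fin.
- exact/measurable_EFinP.
Qed.

End integral_transfer.

Section leb_change.
Context {R : realType} {N : nat}.
Notation T := (caratheodory_type (leb_outer R N)).
Notation mu := (leb R N).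
Implicit Types (D : set 'rV[R]_N) (f : 'rV[R]_N -> R).

Lemma mble_affine (a : R) v D : 0 < a -> mble D -> mble ((fun x => a *: x + v) @^-1` D).
Proof.
move=> a0 mD; pose F (x : 'rV[R]_N) := a^-1 *: (x - v); apply: le_caratheodory_measurable => X.
set M := leb_outer R N.
pose P := (fun x => a *: x + v) @^-1` D.
change (M (X `&` P) + M (X `&` ~` P) <= M X)%E.
have E Y : M Y = ((a ^- N)%:E * M (F @^-1` Y))%E.
  rewrite -(leb_outer_affine v _ a0); congr (M _).
  apply/seteqP; split=> x; rewrite /preimage/F/= addrK scalerA mulVf ?gt_eqF// scale1r//.
rewrite !(E (X `&` _)) (E X).
have -> : M (F @^-1` X) = (M (F @^-1` X `&` D) + M (F @^-1` X `\` D))%E by exact: mble_split.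
rewrite -ge0_muleDr ?outer_measure_ge0//.
rewrite lee_wpmul2l ?lee_fin ?invr_ge0 ?exprn_ge0 ?(ltW a0)//.
have FK y : a *: F y + v = y by rewrite /F scalerA divff ?gt_eqF// scale1r subrK.
have PF x : P (F x) = D x by rewrite /P /preimage/= FK.
by apply: leeD; apply: le_leb => x [Fx Px]; split => //; rewrite /setC/= -PF.
Qed.

Lemma mfun_affine (a : R) v D f : 0 < a -> mble D ->
  measurable_fun (D : set (caratheodory_type mu)) (f : caratheodory_type mu -> R) ->
  measurable_fun ((fun x => a *: x + v) @^-1` D : set (caratheodory_type mu))
    ((fun x => f (a *: x + v)) : caratheodory_type mu -> R).
Proof.
move=> a0 mD mf _ Y mY.
exact: (@mble_affine a v _ a0 (mf mD Y mY)).
Qed.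

Section affine.
Variables (a : R) (v : 'rV[R]_N) (D : set 'rV[R]_N) (f : 'rV[R]_N -> R).
Hypotheses (a0 : 0 < a) (mD : mble D).
Hypothesis mf : measurable_fun (D : set (caratheodory_type mu)) (f : caratheodory_type mu -> R).
Let D' := (fun x => a *: x + v) @^-1` D.
Let an0 : 0 <= a ^- N. Proof. by rewrite invr_ge0 exprn_ge0 ?ltW. Qed.

Let f12 (Y : set R) : measurable Y ->
  mu (D' `&` (fun x => f (a *: x + v)) @^-1` Y) = ((a ^- N)%:E * mu (D `&` f @^-1` Y))%E.
Proof. by move=> _; exact: (leb_outer_affine v (D `&` f @^-1` Y) a0). Qed.

Lemma ge0_integral_affine (g : R -> \bar R) : measurable_fun setT g -> (forall t, 0 <= g t)%E ->
  g 0 = 0%E ->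
  (\int[mu]_(x in D') g (f (a *: x + v)%R) = (a ^- N)%:E * \int[mu]_(x in D) g (f x))%E.
Proof.
move=> mg g0 g00.
exact: (@ge0_integral_transfer _ _ T T R (leb R N) (leb R N) D' D (fun x : T => f (a *: x + v)) (f : T -> R) (a ^- N) (@mble_affine a v D a0 mD) mD (@mfun_affine a v D f a0 mD mf) mf an0 f12 g mg g0 g00).
Qed.

Lemma integral_affine : mu.-integrable D (EFin \o f) ->
  (\int[mu]_(x in D') (f (a *: x + v)%R)%:E = (a ^- N)%:E * \int[mu]_(x in D) (f x)%:E)%E.
Proof.
exact: (@integral_transfer _ _ T T R (leb R N) (leb R N) D' D (fun x : T => f (a *: x + v)) (f : T -> R) (a ^- N) (@mble_affine a v D a0 mD) mD (@mfun_affine a v D f a0 mD mf) mf an0 f12).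
Qed.

Lemma integrable_affine : mu.-integrable D (EFin \o f) ->
  mu.-integrable D' (EFin \o (fun x => f (a *: x + v))).
Proof.
exact: (@integrable_transfer _ _ T T R (leb R N) (leb R N) D' D (fun x : T => f (a *: x + v)) (f : T -> R) (a ^- N) (@mble_affine a v D a0 mD) mD (@mfun_affine a v D f a0 mD mf) mf an0 f12).
Qed.

End affine.
End leb_change.

Section sphere_integral.
Context {R : realType} {k : nat}.
Notation vec := 'rV[R]_k.+1.
Notation mu := (leb_outer R k.+1).
Variable r : R.
Hypothesis r0 : 0 < r.

Lemma boundary_eball : boundary (eball (0 : vec) r) = sphere r.
Proof.
have clo : closure (eball (0 : vec) r) `<=` ceball 0 r.
  rewrite [X in _ `<=` X]((closure_id (ceball 0 r)).1 (@closed_ceball _ _ _ _)).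
  by apply: closure_subset => x; rewrite /eball/ceball/= => /ltW.
rewrite /boundary ((interior_id (eball (0:vec) r)).1 (@open_eball _ _ _ _)).
apply/seteqP; split=> x.
  move=> [/clo]; rewrite /ceball/eball/sphere/= subr0 => xr /negP; rewrite -leNgt => rx.
  by apply/eqP; rewrite eq_le xr.
rewrite /sphere/= => xr; split; last by rewrite /eball/= subr0 xr ltxx.
move=> A /nbhs_ballP[e /= e0 eA].
pose t : R := Num.max (1 / 2) (1 - e / 2 / r).
have t0 : 0 < t by rewrite lt_max divr_gt0.
have t1 : t < 1.
  by rewrite gt_max ltr_pdivrMr// mul1r ltr1n/= ltrBlDr ltrDl !divr_gt0.
have te : 1 - t <= e / 2 / r.
  by rewrite lerBlDr -lerBlDl le_max lexx orbT.
exists (t *: x); split; first by rewrite /eball/= subr0 enormZ gtr0_norm// xr gtr_pMl.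
apply: eA; apply/ball_rV => // i; rewrite !mxE -normrN opprB.
have -> : x ord0 i - t * x ord0 i = (1 - t) * x ord0 i by lra.
rewrite normrM gtr0_norm ?subr_gt0//.
apply: (@le_lt_trans _ _ (e / 2 / r * r)); last by rewrite divfK ?gt_eqF// ltr_pdivrMr// ltr_pMr// ltr1n.
apply: ler_pM => //; first by rewrite subr_ge0 ltW.
by rewrite -xr ler_coord_enorm.
Qed.

(* A shell on which the dilations [e ^ m], [m] an integer, act with disjoint images. *)
Definition log_annulus : set vec := [set y | r * expR (-1) <= enorm y < r].

Definition sproj (y : vec) : vec := (r / enorm y) *: y.

Lemma mble_log_annulus : mble log_annulus.
Proof.
rewrite (_ : log_annulus = eball 0 r `\` eball 0 (r * expR (-1))).
  by apply: measurableD; exact: mble_eball.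
apply/seteqP; split=> y; rewrite /log_annulus/eball/= subr0.
  by move=> /andP[h ->]; split=> //; apply/negP; rewrite -leNgt.
by move=> [-> /negP]; rewrite -leNgt andbT.
Qed.

Lemma enorm_log_annulus y : log_annulus y -> 0 < enorm y.
Proof. by move=> /andP[h _]; rewrite (lt_le_trans _ h)// mulr_gt0// expR_gt0. Qed.

Lemma sproj_sphere y : 0 < enorm y -> sphere r (sproj y).
Proof.
move=> y0; rewrite /sphere/sproj/= enormZ gtr0_norm ?divr_gt0//.
by rewrite divfK ?gt_eqF.
Qed.

Lemma sprojZ (y : vec) (a : R) : 0 < a -> sproj (a *: y) = sproj y.
Proof.
move=> a0; rewrite /sproj enormZ gtr0_norm// scalerA invfM.
have -> : r * (a^-1 * (enorm y)^-1) * a = (a / a) * (r / enorm y) by set b := a^-1; lra.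
by rewrite divff ?mul1r// gt_eqF.
Qed.

Lemma log_annulus_reach (y : vec) : 0 < enorm y < r -> exists n : nat, log_annulus (expR n%:R *: y).
Proof.
move=> /andP[y0 yr]; pose t := ln (r / enorm y).
have l0 : 0 < r / enorm y by rewrite divr_gt0.
have t0 : 0 < t by rewrite ln_gt0// ltr_pdivlMr// mul1r.
have yE : enorm y = r * expR (- t) by rewrite expRN lnK// invf_div mulrCA divff ?mulr1// gt_eqF.
have /andP[h1 h2] := ceil_itv t.
have c1 : 1 <= Num.ceil t by rewrite -gtz0_ge1 ceil_gt0.
pose n := `|Num.ceil t - 1|%N; have nE : n%:R = (Num.ceil t)%:~R - 1 :> R.
  by rewrite /n pmulrn gez0_abs ?subr_ge0// intrB.
exists n; rewrite /log_annulus/= enormZ gtr0_norm ?expR_gt0// yE mulrCA -expRD.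
rewrite ler_pM2l// ler_expR gtr_pMr// expR_lt1 nE; move: h1 h2; rewrite intrB; lra.
Qed.

(** The part of the cone outside the shell is the cone shrunk by the factor 1/e, hence the fraction
    e^(-(k+1)) of the whole. *)
Lemma leb_cone_log_annulus (X : set vec) : X `<=` sphere r ->
  mu (cone X `&` log_annulus) = ((1 - expR (-1) ^+ k.+1)%:E * mu (cone X))%E.
Proof.
move=> XS; set q := expR (-1).
have q0 : 0 < q by exact: expR_gt0.
have q1 : q < 1 by rewrite expR_lt1 ltrN10.
have split : mu (cone X) = (mu (cone X `&` log_annulus) + mu (cone X `\` log_annulus))%E.
  exact: (mble_split _ mble_log_annulus).
have small : mu (cone X `\` log_annulus) = ((q ^+ k.+1)%:E * mu (cone X))%E.
  have q10 : 0 < q^-1 by rewrite invr_gt0.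
  rewrite -[in RHS](invrK q) exprVn -leb_outer_scale//; congr (mu _); apply/seteqP; split=> y.
    move=> [/(cone_polar r0 XS)[/andP[y0 yr] Xy] nA].
    have yq : enorm y < r * q by rewrite ltNge; apply/negP => h; apply: nA; rewrite /log_annulus/= h.
    apply: (polar_cone r0); rewrite enormZ gtr0_norm//.
      by rewrite mulr_gt0//= mulrC ltr_pdivrMr.
    by have := sprojZ y q10; rewrite /sproj enormZ (gtr0_norm q10) => ->.
  move=> /(cone_polar r0 XS); rewrite enormZ gtr0_norm// pmulr_rgt0// => -[/andP[y0 yq] Xy].
  rewrite mulrC ltr_pdivrMr// in yq.
  split; last by move=> /andP[]; rewrite leNgt yq.
  apply: (polar_cone r0); first by rewrite y0 (lt_trans yq)// gtr_pMr.
  by have := sprojZ y q10; rewrite /sproj enormZ (gtr0_norm q10) => <-.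
have fin : mu (cone X) \is a fin_num.
  rewrite ge0_fin_numE ?outer_measure_ge0//.
  apply: (@le_lt_trans _ _ (mu (eball 0 r))); last by rewrite leb_eball// ltry.
  by apply: le_leb => y /(cone_polar r0 XS)[/andP[_ yr] _]; rewrite /eball/= subr0.
rewrite small in split; rewrite EFinB muleBl ?fin_num_adde_defr// mul1e.
by rewrite {1}split addeK// fin_numM.
Qed.

(** The factor of [sigma], corrected for the fraction of a cone that lies in the shell. *)
Definition sphere_ratio : R := (k.+1%:R / r) / (1 - expR (-1) ^+ k.+1).

Let qk1 : 0 < 1 - expR (-1) ^+ k.+1 :> R.
Proof. by rewrite subr_gt0 exprn_ilt1 ?expR_ge0// expR_lt1 ltrN10. Qed.

Lemma sphere_ratio_gt0 : 0 < sphere_ratio.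
Proof.
by rewrite !divr_gt0 ?ltr0n.
Qed.

Lemma hausdorff_log_annulus (X : set vec) : X `<=` sphere r ->
  hausdorff_outer R k.+1 k X = (sphere_ratio%:E * mu (log_annulus `&` sproj @^-1` X))%E.
Proof.
move=> XS; have -> : log_annulus `&` sproj @^-1` X = cone X `&` log_annulus.
  apply/seteqP; split=> y.
    move=> [Ay Xy]; split=> //; apply: (polar_cone r0) => //.
    by rewrite (enorm_log_annulus Ay); case/andP: Ay.
  by move=> [/(cone_polar r0 XS)[_ Xy] Ay].
rewrite (hausdorff_sphere r0)// leb_cone_log_annulus// /sigma muleA -EFinM /sphere_ratio divfK//.
by rewrite gt_eqF.
Qed.

Section sphere_fun.
Variable f : vec -> R.
Hypothesis mf : measurable_fun (log_annulus : set (caratheodory_type mu)) ((fun y => f (sproj y)) : caratheodory_type mu -> R).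

(** The cone over a level set of [f] is a countable union of dilates, by powers of e, of a
    measurable subset of the shell; then [cone_cara] applies. *)
Lemma mfun_sphere : measurable_fun (sphere r : set (caratheodory_type (hausdorff_outer R k.+1 k)))
  (f : caratheodory_type (hausdorff_outer R k.+1 k) -> R).
Proof.
move=> _ Y mY; apply: (cone_cara r0); first by move=> x [].
have m1 : mble (log_annulus `&` (fun y => f (sproj y)) @^-1` Y) by exact: (mf mble_log_annulus mY).
set Z := log_annulus `&` _ in m1; set X := sphere r `&` _.
have XS : X `<=` sphere r by move=> x [].
have -> : cone X = \bigcup_n [set y | Z ((expR n%:R) *: y)].
  apply/seteqP; split=> y.
    move=> /(cone_polar r0 XS)[yr [Sy Xy]]; have [n An] := log_annulus_reach yr.
    by exists n => //; split=> //; rewrite /preimage/= sprojZ ?expR_gt0.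
  move=> [n _ [Ay Xy]]; have y0 := enorm_log_annulus Ay.
  rewrite /preimage/= sprojZ ?expR_gt0// in Xy.
  rewrite enormZ gtr0_norm ?expR_gt0// pmulr_rgt0 ?expR_gt0// in y0.
  apply: (polar_cone r0); last by split=> //; exact: sproj_sphere.
  rewrite y0; case/andP: Ay => _; rewrite enormZ gtr0_norm ?expR_gt0//; apply: le_lt_trans.
  by rewrite ler_pMl// -expR0 ler_expR.
apply: bigcup_measurable => n _.
have -> : [set y | Z (expR n%:R *: y)] = (fun y => expR n%:R *: y + 0) @^-1` Z.
  by apply/seteqP; split=> y; rewrite /preimage/= addr0.
by apply: mble_affine => //; exact: expR_gt0.
Qed.

Lemma integral_sphere (g : R -> \bar R) : measurable_fun setT g -> (forall t, 0 <= g t)%E ->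
  g 0 = 0%E ->
  (\int[hausdorff R k.+1 k]_(x in sphere r) g (f x) =
   sphere_ratio%:E * \int[leb R k.+1]_(y in log_annulus) g (f (sproj y)))%E.
Proof.
apply: (@ge0_integral_transfer _ _ (caratheodory_type (hausdorff_outer R k.+1 k))
  (caratheodory_type mu) R (hausdorff R k.+1 k) (leb R k.+1)
  (sphere r : set (caratheodory_type (hausdorff_outer R k.+1 k))) (log_annulus : set (caratheodory_type mu))
  f (fun y => f (sproj y)) sphere_ratio).
- exact: sphere_cara.
- exact: mble_log_annulus.
- exact: mfun_sphere.
- exact: mf.
- exact: ltW sphere_ratio_gt0.
- move=> Y mY; have XS : sphere r `&` f @^-1` Y `<=` sphere r by move=> x [].
  have := hausdorff_log_annulus XS; rewrite (_ : log_annulus `&` _ = log_annulus `&` (fun y => f (sproj y)) @^-1` Y)//.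
  apply/seteqP; split=> y [Ay]; first by move=> [].
  by move=> Yy; split=> //; split=> //; exact: (sproj_sphere (enorm_log_annulus Ay)).
Qed.

End sphere_fun.

End sphere_integral.

(** * Smooth functions and test fields *)

Section gradients.
Context {R : realType} {N : nat}.
Notation vec := 'rV[R]_N.
Implicit Types (f g : vec -> R) (F G : vec -> vec).

(** C^1, with the gradient as explicit data, so that a divergence is computed from the gradients of
    the coordinates of a field. *)
Definition has_grad f G : Prop :=
  (forall x : vec, is_diff x f (dotv (G x))) /\ (forall i, continuous (fun x => G x ord0 i)).

Lemma has_grad_continuous f G : has_grad f G -> continuous f.
Proof. by move=> [df _] x; apply: differentiable_continuous; have [] := df x. Qed.

Lemma eq_has_grad f g G : f =1 g -> has_grad f G -> has_grad g G.
Proof. by move=> /funext ->. Qed.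

Lemma has_grad_eq f F G : F =1 G -> has_grad f F -> has_grad f G.
Proof. by move=> /funext ->. Qed.

Lemma has_grad_cst (a : R) : has_grad (fun=> a) (fun=> 0).
Proof.
split=> [x|i]; last exact: cst_continuous.
apply: is_diff_eq; apply/funext => v /=; rewrite /dotv big1// => i _; by rewrite mxE mul0r.
Qed.

Lemma has_grad_coord (i : 'I_N) : has_grad (fun x => x ord0 i) (fun=> delta_mx ord0 i).
Proof.
split=> [x|j]; last exact: cst_continuous.
have lin : linear (fun v : vec => v ord0 i : R) by move=> a u v; rewrite !mxE.
pose l : {linear vec -> R} := HB.pack (fun v : vec => v ord0 i : R)
  (GRing.isLinear.Build _ _ _ _ _ lin).
have lc : continuous l by move=> y; exact: coord_continuous.
have -> : (fun x : vec => x ord0 i) = l by [].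
apply: DiffDef; first exact: linear_differentiable.
rewrite diff_lin//; apply/funext => v; rewrite /dotv (bigD1 i)//= mxE !eqxx mul1r big1 ?addr0//.
by move=> j ji; rewrite mxE eqxx (negbTE ji) mul0r.
Qed.

Lemma has_gradD f g F G : has_grad f F -> has_grad g G ->
  has_grad (fun x => f x + g x) (fun x => F x + G x).
Proof.
move=> [df cF] [dg cG]; split=> [x|i x].
  have h1 := df x; have h2 := dg x; apply: (is_diff_eq (is_diffD h1 h2)).
  by apply/funext => v; rewrite dotvDl.
under eq_fun do rewrite mxE.
exact: (continuousD (cF i x) (cG i x)).
Qed.

Lemma has_gradM f g F G : has_grad f F -> has_grad g G ->
  has_grad (fun x => f x * g x) (fun x => f x *: G x + g x *: F x).
Proof.
move=> hf hg; have cf := has_grad_continuous hf; have cg := has_grad_continuous hg.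
case: hf hg => df cF [dg cG]; split=> [x|i x].
  have h1 := df x; have h2 := dg x; apply: (is_diff_eq (is_diffM h1 h2)).
  by apply/funext => v; rewrite dotvDl !dotvZl.
under eq_fun do rewrite !mxE.
exact: (continuousD (continuousM (cf x) (cG i x)) (continuousM (cg x) (cF i x))).
Qed.

Lemma has_gradZ f F (a : R) : has_grad f F -> has_grad (fun x => a * f x) (fun x => a *: F x).
Proof.
move=> hf; have := has_gradM (has_grad_cst a) hf; apply: has_grad_eq => x.
by rewrite scaler0 addr0.
Qed.

Lemma has_grad_sqnorm : has_grad (fun x => enorm x ^+ 2) (fun x => 2 *: x).
Proof.
have -> : (fun x : vec => enorm x ^+ 2) = (fun x => \sum_(i < N) x ord0 i * x ord0 i).
  by apply/funext => x; rewrite sqr_enorm; apply: eq_bigr => i _; rewrite expr2.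
have -> : (fun x : vec => 2 *: x) = (fun x => \sum_(i < N) (x ord0 i *: delta_mx ord0 i + x ord0 i *: delta_mx ord0 i)).
  apply/funext => x; under [RHS]eq_bigr do rewrite -scalerDl -mulr2n -mulr_natl -scalerA.
  by rewrite -scaler_sumr -row_sum_delta.
elim: (index_enum 'I_N) => [|i s IH].
  by under eq_fun do rewrite big_nil; under [X in has_grad _ X]eq_fun do rewrite big_nil; exact: has_grad_cst.
under eq_fun do rewrite big_cons; under [X in has_grad _ X]eq_fun do rewrite big_cons.
apply: has_gradD => //; apply: has_gradM; exact: has_grad_coord.
Qed.

Lemma has_grad_comp (h h' : R -> R) f F : (forall t : R, is_derive t 1 h (h' t)) -> continuous h' ->
  has_grad f F -> has_grad (fun x => h (f x)) (fun x => h' (f x) *: F x).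
Proof.
move=> dh ch hf; have cf := has_grad_continuous hf; case: hf => df cF; split=> [x|i x].
  have h1 := df x.
  have h2 : is_diff (f x) h (fun v => v *: h' (f x)).
    have [dh1 dh2] := dh (f x); have dd : differentiable h (f x) by exact/derivable1_diffP.
    by apply: DiffDef => //; rewrite diff1E// derive1E dh2.
  apply: (is_diff_eq (is_diff_comp h1 h2)); apply/funext => v /=.
  by rewrite dotvZl mulrC.
under eq_fun do rewrite !mxE.
have c1 : {for x, continuous (fun x => h' (f x))} by exact: (continuous_comp (cf x) (ch _)).
exact: (continuousM c1 (cF i x)).
Qed.

Lemma has_grad_affine f F (a : R) (v : vec) : has_grad f F ->
  has_grad (fun x => f (a *: x + v)) (fun x => a *: F (a *: x + v)).
Proof.
move=> [df cF].
have dl (x : vec) : is_diff x (fun x : vec => a *: x + v) (fun w => a *: w).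
  apply: (is_diff_eq (is_diffD (is_diff_scaler a x) (is_diff_cst v x))).
  by apply/funext => w; rewrite /= addr0.
split=> [x|i x].
  have h1 := df (a *: x + v).
  apply: (is_diff_eq (is_diff_comp (dl x) h1)); apply/funext => w /=.
  by rewrite dotvZl dotvZr.
under eq_fun do rewrite !mxE.
have cl : {for x, continuous (fun x : vec => a *: x + v)}.
  by apply: differentiable_continuous; have [] := dl x.
have c1 : {for x, continuous (fun x : vec => F (a *: x + v) ord0 i)} := continuous_comp cl (cF i _).
have c0 : {for x, continuous (fun _ : vec => a)} by exact: cst_continuous.
exact: (continuousM c0 c1).
Qed.

Lemma has_grad_along f F (c v : vec) (t : R) : has_grad f F ->
  is_derive t 1 (fun t : R => f (c + t *: v)) (dotv (F (c + t *: v)) v).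
Proof.
move=> [df _].
have dl : is_diff t (fun t : R => c + t *: v) (fun w => w *: v).
  apply: (is_diff_eq (is_diffD (is_diff_cst c t) (is_diff_scalel t v))).
  by apply/funext => w; rewrite /= add0r.
have [d1 d2] := is_diff_comp dl (df (c + t *: v)).
have d3 : derivable (fun t : R => f (c + t *: v)) t 1 by exact/derivable1_diffP.
apply: DeriveDef => //; rewrite -derive1E.
have := diff1E d1; rewrite d2 => /(congr1 (fun h => h 1))/=.
by rewrite !scale1r => ->.
Qed.

Lemma field_of_grads (phi : vec -> vec) (G : 'I_N -> vec -> vec) :
  (forall j, has_grad (fun x => phi x ord0 j) (G j)) ->
  [/\ forall x, differentiable phi x, continuous (jacobian phi) &
      forall x, divergence phi x = \sum_j G j x ord0 j].
Proof.
move=> hphi.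
have phiE : phi = \sum_(j < N) (fun x : vec => phi x ord0 j *: delta_mx ord0 j).
  apply/funext => x; rewrite [LHS]row_sum_delta.
  by elim/big_ind2 : _ => // [a f b g -> ->].
have dphi x : differentiable phi x.
  rewrite phiE; apply: differentiable_sum => j; apply: differentiableZl.
  by have [/(_ x)[]] := hphi j.
have JE x : jacobian phi x = \matrix_(i, j) G j x ord0 i.
  apply/matrixP => i j; rewrite mxE /jacobian.
  have [lc _] := has_grad_coord j.
  have [d1 d2] := is_diff_comp (differentiableP (dphi x)) (lc (phi x)).
  have [/(_ x)[_ d3] _] := hphi j.
  have := congr1 (fun h => h (delta_mx 0 i)) d2; rewrite [in X in X -> _](_ : _ \o phi = (fun x => phi x ord0 j))// d3 /=.
  rewrite /dotv (bigD1 i)//= big1 ?addr0; last first.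
    by move=> l li; rewrite !mxE eqxx (negbTE li) mulr0.
  rewrite (bigD1 j)//= big1 ?addr0; last first.
    by move=> l lj; rewrite !mxE eqxx (negbTE lj) mul0r.
  by rewrite !mxE !eqxx mul1r mulr1 => ->.
split=> //.
  move=> x; rewrite (_ : jacobian phi = fun x => \matrix_(i, j) G j x ord0 i); last exact/funext.
  move=> A [P hP PA].
  have : nbhs x (fun y => forall i j, P i j (G j y ord0 i)).
    apply: (@filter_forall _ _ (fun i y => forall j, P i j (G j y ord0 i)) (nbhs x) (nbhs_filter x)) => i.
    apply: (@filter_forall _ _ (fun j y => P i j (G j y ord0 i)) (nbhs x) (nbhs_filter x)) => j.
    by have [_ cG] := hphi j; apply: (cG i x); have := hP i j; rewrite !mxE.
  by apply: filterS => y h; apply: PA => i j; rewrite mxE.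
move=> x; rewrite /divergence JE /mxtrace; by apply: eq_bigr => i _; rewrite mxE.
Qed.

Lemma grads_of_field (phi : vec -> vec) (j : 'I_N) : (forall x, differentiable phi x) ->
  continuous (jacobian phi) ->
  has_grad (fun x => phi x ord0 j) (fun x => (col j (jacobian phi x))^T).
Proof.
move=> dphi cJ; split=> [x|i x].
  have [lc _] := has_grad_coord j.
  apply: (is_diff_eq (is_diff_comp (differentiableP (dphi x)) (lc (phi x)))).
  apply/funext => v /=; rewrite -deriveE// deriveEjacobian// {1}/dotv (bigD1 j)//= big1 ?addr0; last first.
    by move=> l lj; rewrite !mxE eqxx (negbTE lj) mul0r.
  by rewrite !mxE !eqxx mul1r /dotv; apply: eq_bigr => l _; rewrite !mxE mulrC.
rewrite (_ : (fun x => _) = (fun A : 'M[R]_N => A i j) \o jacobian phi); last first.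
  by apply/funext => y; rewrite [LHS]mxE [LHS]mxE.
have c1 : {for jacobian phi x, continuous (fun A : 'M[R]_N => A i j)} := @coord_continuous _ _ _ i j _.
exact: (continuous_comp (cJ x) c1).
Qed.

End gradients.

Notation lebT R N := (caratheodory_type (leb_outer R N)).

Section leb_integrable.
Context {R : realType} {N : nat}.
Notation vec := 'rV[R]_N.
Notation mu := (leb R N).
Notation T := (lebT R N).

Lemma ceball_compact (c : vec) (rho : R) : compact (ceball c rho).
Proof.
apply: bounded_closed_compact; last exact: closed_ceball.
exists (rho + enorm c); split; first exact: num_real.
move=> M hM x cx /=; apply/ltW/(le_lt_trans _ hM).
rewrite /Num.norm/= mx_normrE; apply: bigmax_le => [|[i j] _ /=].
  have := le_trans (enorm_ge0 _) cx; have := enorm_ge0 c; lra.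
rewrite (ord1 i); apply: (le_trans (ler_coord_enorm _ _)).
have := ler_enormD (x - c) c; rewrite subrK => /le_trans; apply.
by rewrite lerD2r.
Qed.

Lemma continuous_bounded_ceball (f : vec -> R) (rho : R) : continuous f ->
  exists2 M, 0 <= M & forall y, enorm y <= rho -> `|f y| <= M.
Proof.
move=> cf.
have := @continuous_compact vec R f (ceball 0 rho) (continuous_subspaceT cf) (@ceball_compact 0 rho).
move=> /(@compact_bounded R R)[M [_ hM]]; exists (`|M| + 1); first by rewrite addr_ge0.
move=> y yr; apply: (hM (`|M| + 1)); last by exists y => //; rewrite /ceball/= subr0.
by rewrite (le_lt_trans (ler_norm M))// ltrDl.
Qed.

Lemma integrable_mulr_bounded (D : set vec) (u k : vec -> R) (M : R) : mble D ->
  mu.-integrable D (EFin \o u) -> measurable_fun (D : set T) (k : T -> R) ->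
  (forall y, D y -> `|k y| <= M) ->
  mu.-integrable D (EFin \o (fun y => u y * k y)).
Proof.
move=> mD iu mk kM; have [mu_ _] := integrableP _ _ _ iu.
have iMu : mu.-integrable D (EFin \o (fun y => M * u y)).
  by have := @integrableZl _ _ R mu _ mD M _ iu; apply: (eq_integrable mD) => y _ /=; rewrite EFinM.
apply: (le_integrable mD _ _ iMu).
  apply/measurable_EFinP/measurable_funM => //; exact/measurable_EFinP.
move=> y Dy /=; rewrite lee_fin !normrM mulrC ler_wpM2r//.
by apply: (le_trans (kM _ Dy)); exact: ler_norm.
Qed.

Lemma integrable_cst1 (D : set vec) : mble D -> (mu D < +oo)%E ->
  mu.-integrable D (EFin \o (fun=> 1)).
Proof.
move=> mD fD; apply/integrableP; split; first exact/measurable_EFinP/measurable_cst.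
by under eq_integral do rewrite /= normr1; rewrite integral_cst// mul1e.
Qed.

Lemma ceball_leb_fin (D : set vec) (rho : R) : D `<=` ceball 0 rho -> (mu D < +oo)%E.
Proof.
move=> Drho; apply: (@le_lt_trans _ _ (leb_outer R N (ceball 0 (`|rho| + 1)))).
  apply: le_leb => y /Drho; rewrite /ceball/= => /le_trans; apply.
  by rewrite (le_trans (ler_norm _))// lerDl.
by rewrite leb_ceball ?ltry// ltr_wpDl.
Qed.

Lemma integrable_bounded (D : set vec) (k : vec -> R) (M : R) : mble D ->
  (mu D < +oo)%E -> measurable_fun (D : set T) (k : T -> R) ->
  (forall y, D y -> `|k y| <= M) -> mu.-integrable D (EFin \o k).
Proof.
move=> mD fD mk kM; have := integrable_mulr_bounded mD (integrable_cst1 mD fD) mk kM.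
by apply: (eq_integrable mD) => y _ /=; rewrite mul1r.
Qed.

End leb_integrable.

Section dilation_derivative.
Context {R : realType} {N : nat}.
Notation vec := 'rV[R]_N.
Notation mu := (leb R N).
Notation T := (lebT R N).

Lemma continuous_dotv_scale (F : vec -> vec) (a : R) : (forall i, continuous (fun x => F x ord0 i)) ->
  continuous (fun y : vec => dotv (F (a *: y)) y).
Proof.
move=> cF.
rewrite /dotv => y; elim: (index_enum _) => [|i s IH].
  under eq_fun do rewrite big_nil; exact: cst_continuous.
under eq_fun do rewrite big_cons.
have ca : {for y, continuous (fun y : vec => a *: y)} by exact: scaler_continuous.
have c1 : {for y, continuous (fun y : vec => F (a *: y) ord0 i)} := continuous_comp ca (cF i _).
have c2 : {for y, continuous (fun y : vec => y ord0 i)} := @coord_continuous _ _ _ ord0 i _.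
exact: (continuousD (continuousM c1 c2) IH).
Qed.

(** Differentiation under the integral sign on ]0, 2 t0[. For y in [D] the point t y stays in the
    ball of radius 2 t0 [rho], where [f] and [F] are bounded, so a multiple of |u| dominates. *)
Lemma dilation_derive (D : set vec) (rho : R) (u f : vec -> R) (F : vec -> vec) (m : nat) (t0 : R) :
  mble D -> D `<=` ceball 0 rho -> mu.-integrable D (EFin \o u) -> has_grad f F -> 0 < t0 ->
  is_derive t0 1 (fun t : R => \int[mu]_(y in D) (u y * (t ^+ m * f (t *: y)))%R)%R
    (\int[mu]_(y in D) (u y * (m%:R * t0 ^+ m.-1 * f (t0 *: y) + t0 ^+ m * dotv (F (t0 *: y)) y)))%R.
Proof.
move=> mD Drho iu hf t00.
have cf := has_grad_continuous hf; have [_ cF] := hf.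
pose g (t : R) (y : T) : R := u y * (t ^+ m * f (t *: y)).
have dg (t : R) (y : vec) : is_derive t 1 (fun t => g t y)
    (u y * (m%:R * t ^+ m.-1 * f (t *: y) + t ^+ m * dotv (F (t *: y)) y)).
  have d1 := has_grad_along (0 : vec) y t hf.
  rewrite (_ : (fun t => _) = (fun t : R => f (t *: y))) ?add0r in d1; last first.
    by apply/funext => s; rewrite add0r.
  have d2 := is_deriveX m (is_derive_id t 1).
  have d3 := is_deriveZ (u y) (is_deriveM d2 d1).
  have -> : g^~ y = u y \*: (id ^+ m * (fun t : R => f (t *: y))).
    apply/funext => s; transitivity (u y * ((id ^+ m) s * f (s *: y))); last by [].
    by rewrite exprfctE.
  apply: (is_derive_eq d3); rewrite exprfctE /GRing.scale/= mulr1; lra.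
have E t y : partial1of2 g t y = u y * (m%:R * t ^+ m.-1 * f (t *: y) + t ^+ m * dotv (F (t *: y)) y).
  by rewrite partial1of2E; have [_ ->] := dg t y.
have [M1 M10 hM1] := continuous_bounded_ceball (2 * t0 * rho) cf.
pose mG (y : vec) : R := \sum_(i < N) `|F y ord0 i|.
have cmG : continuous mG.
  move=> y; rewrite /mG; elim: (index_enum _) => [|i s IH].
    by under eq_fun do rewrite big_nil; exact: cst_continuous.
  under eq_fun do rewrite big_cons.
  have c1 : {for y, continuous (fun y : vec => `|F y ord0 i|)}.
    by apply: (continuous_comp (cF i y)); exact: norm_continuous.
  exact: (continuousD c1 IH).
have [M2 M20 hM2] := continuous_bounded_ceball (2 * t0 * rho) cmG.
pose C := m%:R * (2 * t0) ^+ m.-1 * M1 + (2 * t0) ^+ m * (M2 * rho).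
have inb (t : R) y : 0 < t < 2 * t0 -> D y -> enorm (t *: y) <= 2 * t0 * rho.
  move=> /andP[t0' t2] /Drho; rewrite /ceball/= subr0 => yr.
  by rewrite enormZ gtr0_norm// ler_pM// ?enorm_ge0// ltW.
have mcont k : continuous k -> measurable_fun (D : set T) (k : T -> R).
  by move=> ck; apply: measurable_funTS; exact: continuous_mfun.
have cg (t : R) : continuous (fun y : vec => t ^+ m * f (t *: y)).
  move=> y; have ca : {for y, continuous (fun y : vec => t *: y)} by exact: scaler_continuous.
  have c1 : {for y, continuous (fun y : vec => f (t *: y))} := continuous_comp ca (cf _).
  have c0 : {for y, continuous (fun _ : vec => t ^+ m)} by exact: cst_continuous.
  exact: (continuousM c0 c1).
have I0 : `]0, 2 * t0[%classic t0 by rewrite /= in_itv/= t00/= ltr_pMl// ltr1n.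
have igt (t : R) : `]0, 2 * t0[%classic t -> mu.-integrable D (EFin \o g t).
  rewrite /= in_itv/= => tI; have /andP[t0' _] := tI.
  have h2 y : D y -> `|t ^+ m * f (t *: y)| <= t ^+ m * M1.
    by move=> Dy; rewrite normrM ger0_norm ?exprn_ge0 ?(ltW t0')// ler_wpM2l ?exprn_ge0 ?(ltW t0')// hM1// inb.
  exact: (integrable_mulr_bounded mD iu (mcont _ (cg t)) h2).
pose G y := `|u y| * `|C|.
have iG : mu.-integrable D (EFin \o G).
  have := @integrable_mulr_bounded _ _ D (fun y => `|u y|) (fun=> `|C|) `|C| mD.
  apply => //; first exact: (integrable_norm iu).
  by move=> y _; rewrite normr_id.
have G_ub t y : `]0, 2 * t0[%classic t -> D y -> `|partial1of2 g t y| <= G y.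
  rewrite /= in_itv/= => tI Dy; rewrite E normrM ler_wpM2l//.
  have yr : enorm y <= rho by have := Drho _ Dy; rewrite /ceball/= subr0.
  have ty := inb _ _ tI Dy; have /andP[t1 t2] := tI.
  apply: le_trans (ler_norm C); apply: (le_trans (ler_normD _ _)); apply: lerD.
    rewrite !normrM normr_nat (ger0_norm (exprn_ge0 _ (ltW t1))).
    apply: ler_pM => //; first by rewrite mulr_ge0 ?exprn_ge0// ltW.
      by rewrite ler_wpM2l// lerXn2r ?nnegrE ?ltW// (lt_trans t1).
    exact: hM1.
  rewrite normrM (ger0_norm (exprn_ge0 _ (ltW t1))); apply: ler_pM => //; first by rewrite exprn_ge0 ?ltW.
    by rewrite lerXn2r ?nnegrE ?ltW// (lt_trans t1).
  apply: (@le_trans _ _ (mG (t *: y) * enorm y)).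
    rewrite /dotv /mG mulr_suml; apply: (le_trans (ler_norm_sum _ _ _)); apply: ler_sum => i _.
    by rewrite normrM ler_wpM2l// ler_coord_enorm.
  apply: ler_pM; rewrite ?enorm_ge0//; first by rewrite sumr_ge0.
  by apply: (le_trans (ler_norm _)); exact: hM2.
have dd t y : `]0, 2 * t0[%classic t -> D y -> derivable (g^~ y) t 1.
  by move=> _ _; have [] := dg t y.
have G0 y : 0 <= G y by rewrite mulr_ge0.
apply: DeriveDef.
  exact: (@derivable_under_integral _ _ T mu g D mD t0 0 (2 * t0) I0 igt dd G G0 iG G_ub).
rewrite -derive1E (@differentiation_under_integral _ _ T mu g D mD t0 0 (2 * t0) I0 igt dd G G0 iG G_ub).
by apply: eq_Rintegral => y _; rewrite E.
Qed.

End dilation_derivative.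

(** * The divergence theorem for compact supports *)

Section divergence_theorem.
Context {R : realType} {N : nat}.
Notation vec := 'rV[R]_N.
Notation mu := (leb R N).
Notation T := (lebT R N).
Implicit Types (f : vec -> R) (F : vec -> vec).

Lemma has_grad_measurable f F : has_grad f F -> measurable_fun setT (f : T -> R).
Proof. by move=> /has_grad_continuous; exact: continuous_mfun. Qed.

(** The derivative of [f] at [y] in the direction [F y] is |F y|^2, and [f] is 0 near [y] on that
    line. *)
Lemma grad_locally0 f F (U : set vec) y : has_grad f F -> open U -> U y ->
  (forall z, U z -> f z = 0) -> F y = 0.
Proof.
move=> hf oU Uy f0; apply/eqP; rewrite -enorm_eq0 -sqrf_eq0 sqr_enormE; apply/eqP.
have := has_grad_along y (F y) (0 : R) hf; rewrite scale0r addr0 => -[_ <-].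
have [_ e0] : is_derive (0 : R) (1 : R) (cst (0 : R)) 0 by exact: is_derive_cst.
rewrite -[RHS]e0.
apply: near_eq_derive.
have cl : {for (0 : R), continuous (fun t : R => y + t *: F y)}.
  have c0 : {for (0 : R), continuous (fun _ : R => y)} by exact: cst_continuous.
  exact: (continuousD c0 (@scalel_continuous _ _ (F y) 0)).
have : nbhs (y + (0 : R) *: F y) U by rewrite scale0r addr0; exact: open_nbhs_nbhs.
move=> nU; have nU' := cl U nU; apply: (@filterS R (nbhs (0 : R)) _ _ _ _ nU') => t; exact: f0.
Qed.

Lemma eball_setT_int f (rho K : R) : measurable_fun setT (f : T -> R) ->
  (forall y, K < enorm y -> f y = 0) -> K < rho ->
  (\int[mu]_(y in eball 0 rho) (f y)%:E = \int[mu]_y (f y)%:E)%E.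
Proof.
move=> mf f0 Krho; rewrite integral_mkcond; apply: eq_integral => y _.
rewrite /patch; case: ifPn => // /negP; rewrite inE /eball/= subr0 => /negP; rewrite -leNgt => rhoy.
by rewrite f0// (lt_le_trans Krho).
Qed.

Lemma compact_support_integrable f (K : R) : continuous f -> (forall y, K < enorm y -> f y = 0) ->
  mu.-integrable setT (EFin \o f).
Proof.
move=> cf f0; have [M M0 hM] := continuous_bounded_ceball K cf.
pose D := eball (0 : vec) (`|K| + 1).
have mD : mble D by exact: mble_eball.
have iD : mu.-integrable D (EFin \o f).
  apply: (@integrable_bounded _ _ _ _ M) => //.
  - by rewrite [X in (X < _)%E]leb_eball ?ltry// ltr_wpDl.
  - by apply: measurable_funTS; exact: continuous_mfun.
  - move=> y _; have [yK|Ky] := leP (enorm y) K; first exact: hM.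
    by rewrite f0// normr0.
rewrite (_ : EFin \o f = (EFin \o f) \_ D); first by rewrite -integrable_mkcond.
apply/funext => y; rewrite /patch; case: ifPn => // /negP; rewrite inE /D /eball/= subr0 => /negP.
by rewrite -leNgt => h; rewrite f0// (lt_le_trans _ h)// (le_lt_trans (ler_norm K))// ltrDl.
Qed.

Lemma eball_scale (t rho : R) : 0 < t ->
  (fun y => t *: y + 0) @^-1` eball (0 : vec) (rho * t) = eball (0 : vec) rho.
Proof.
move=> t0; have e (y : vec) : (enorm (t *: y) < rho * t) = (enorm y < rho).
  by rewrite enormZ gtr0_norm// mulrC ltr_pM2r.
by apply/seteqP; split=> y; rewrite /eball/preimage/= addr0 !subr0 e.
Qed.

Section compact_support.
Variables (f : vec -> R) (F : vec -> vec) (K : R).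
Hypotheses (hf : has_grad f F) (f0 : forall y, K < enorm y -> f y = 0) (K0 : 0 < K).
Hypothesis F0 : forall y, K < enorm y -> F y = 0.

Let cf : continuous f := has_grad_continuous hf.

(** The integral of t^N f(t y) does not depend on t; its derivative at t = 1 is the integral in
    question. *)
Lemma integral_dilation_div : (\int[mu]_y (N%:R * f y + dotv (F y) y)%R = 0)%R.
Proof.
(* The radius 3K leaves room: for t > 1/2 the support of f(t y) stays inside [D]. *)
pose D := eball (0 : vec) (3 * K).
have mD : mble D by exact: mble_eball.
have DK : D `<=` ceball 0 (3 * K) by move=> y; rewrite /D/eball/ceball/= => /ltW.
have fD := ceball_leb_fin DK.
have iD := integrable_cst1 mD fD.
have := dilation_derive N mD DK iD hf (@ltr01 R).
set I := (X in is_derive _ _ X); set d := (X in is_derive _ _ _ X) => dI.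
have IE (t : R) : 1 / 2 < t -> I t = (\int[mu]_y f y)%R.
  move=> t2; have t0 : 0 < t by rewrite (lt_trans _ t2)// divr_gt0.
  have Kt : K < 3 * K * t.
    by rewrite mulrAC ltr_pMl//; lra.
  have mf : measurable_fun (eball (0 : vec) (3 * K * t) : set T) (f : T -> R).
    by apply: measurable_funTS; exact: continuous_mfun.
  have if_ : mu.-integrable (eball (0 : vec) (3 * K * t)) (EFin \o f).
    by apply: (@integrableS _ T R mu setT) => //; [exact: mble_eball|exact: compact_support_integrable f0].
  have := integral_affine 0 t0 (@mble_eball _ _ _ _) mf if_.
  rewrite eball_scale//.
  rewrite (eball_setT_int (continuous_mfun cf) f0 Kt) => E.
  rewrite /I /Rintegral -[X in _ = fine X]mul1e -[X in (X%:E * _)%E](@divff _ (t ^+ N)) ?expf_neq0 ?gt_eqF//.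
  rewrite EFinM -muleA -E -integralZl//.
  - by congr fine; apply: eq_integral => y _; rewrite /= mul1r addr0 EFinM.
  - have := integrable_affine 0 t0 (@mble_eball _ _ _ _) mf if_.
    by rewrite eball_scale.
have dE : d = 0.
  have [_ <-] := dI.
  have d0 : is_derive (1 : R) (1 : R) (cst (\int[mu]_y f y)%R) 0 by exact: is_derive_cst.
  have [_ <-] := d0; apply: near_eq_derive => //.
  near=> t; apply: IE; near: t; apply: lt_nbhsr; lra.
rewrite -dE /d /Rintegral; congr fine; rewrite [in RHS]integral_mkcond; apply: eq_integral => y _.
rewrite /patch; case: ifPn => [_|/negP].
  by rewrite !expr1n mulr1 !mul1r scale1r.
rewrite inE /D/eball/= subr0 => /negP; rewrite -leNgt => Ky.
have Ky' : K < enorm y by rewrite (lt_le_trans _ Ky)// ltr_pMl// ltr1n.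
by rewrite f0// F0// mulr0 add0r /dotv big1// => i _; rewrite mxE mul0r.
Unshelve. all: by end_near. Qed.

End compact_support.

Lemma integral_shift f (v : vec) : mu.-integrable setT (EFin \o f) ->
  (\int[mu]_y f (y + v)%R = \int[mu]_y f y)%R.
Proof.
move=> if_; have mf : measurable_fun setT (f : T -> R).
  by have [/measurable_EFinP] := integrableP _ _ _ if_.
have := integral_affine v ltr01 measurableT mf if_.
rewrite preimage_setT expr1n invr1 mul1e /Rintegral => <-; congr fine.
by apply: eq_integral => y _; rewrite scale1r.
Qed.

(** The dilation identity centred at 0 minus the one centred at [c] leaves the integral of the
    derivative in the direction [c]. This replaces integration along lines. *)
Lemma integral_grad f F (K : R) (c : vec) : has_grad f F -> 0 < K -> (forall y, K < enorm y -> f y = 0) ->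
  mu.-integrable setT (EFin \o (fun y => dotv (F y) c)) /\ (\int[mu]_y dotv (F y) c = 0)%R.
Proof.
move=> hf K0 f0; have cf := has_grad_continuous hf; have [_ cF] := hf.
have far0 (g : vec -> R) (G : vec -> vec) (K' : R) : has_grad g G -> (forall y, K' < enorm y -> g y = 0) ->
    forall y, K' < enorm y -> G y = 0.
  move=> hg g0 y yK; apply: (grad_locally0 hg (U := ~` ceball 0 K')).
  - by apply: closed_openC; exact: closed_ceball.
  - by rewrite /ceball/= subr0 => /(lt_le_trans yK); rewrite ltxx.
  - by move=> z; rewrite /ceball/= subr0 => /negP; rewrite -ltNge; exact: g0.
have F0 := far0 _ _ _ hf f0.
have cdot (w : vec -> vec) : (forall i, continuous (fun y => w y ord0 i)) ->
    continuous (fun y => dotv (F y) (w y)).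
  move=> cw y; rewrite /dotv; elim: (index_enum _) => [|i s IH].
    under eq_fun do rewrite big_nil; exact: cst_continuous.
  under eq_fun do rewrite big_cons.
  exact: (continuousD (continuousM (cF i y) (cw i y)) IH).
have idot (w : vec -> vec) : (forall i, continuous (fun y => w y ord0 i)) ->
    mu.-integrable setT (EFin \o (fun y => dotv (F y) (w y))).
  move=> cw; apply: (compact_support_integrable (K := K)); first exact: cdot.
  by move=> y yK; rewrite F0// /dotv big1// => i _; rewrite mxE mul0r.
have iNf : mu.-integrable setT (EFin \o (fun y => N%:R * f y)).
  apply: (compact_support_integrable (K := K)); last by move=> y yK; rewrite f0// mulr0.
  exact: (has_grad_continuous (has_gradZ N%:R hf)).
have ic : mu.-integrable setT (EFin \o (fun y => dotv (F y) c)).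
  by apply: idot => i; exact: cst_continuous.
have iy : mu.-integrable setT (EFin \o (fun y => dotv (F y) y)).
  by apply: (idot id) => i; exact: coord_continuous.
split=> //.
have E0 := integral_dilation_div hf f0 K0 F0.
have Ec : (\int[mu]_y (N%:R * f y + dotv (F y) (y - c))%R = 0)%R.
  have hg := has_grad_affine 1 c hf.
  have g0 y : K + enorm c < enorm y -> f (1 *: y + c) = 0.
    move=> yK; apply: f0; rewrite scale1r; have := ler_enormB y (- c).
    by rewrite enormN opprK; lra.
  have K'0 : 0 < K + enorm c by rewrite ltr_wpDr// enorm_ge0.
  have := integral_dilation_div hg g0 K'0 (far0 _ _ _ hg g0).
  rewrite -(@integral_shift (fun y => N%:R * f y + dotv (F y) (y - c)) c); last first.
    have := integrableD measurableT iNf (idot (fun y => y - c) _); apply.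
    move=> i y; under eq_fun do rewrite !mxE.
    exact: (continuousB (@coord_continuous _ _ _ ord0 i y) (@cst_continuous _ _ (c ord0 i) y)).
  move=> <-; apply: eq_Rintegral => y _; rewrite addrK !scale1r //.
have -> : (\int[mu]_y dotv (F y) c = \int[mu]_y (N%:R * f y + dotv (F y) y) -
    \int[mu]_y (N%:R * f y + dotv (F y) (y - c)))%R.
  rewrite -RintegralB//.
  - apply: eq_Rintegral => y _; rewrite dotvDr -(scaleN1r c) dotvZr; lra.
  - exact: (integrableD measurableT iNf iy).
  - have := integrableD measurableT iNf (idot (fun y => y - c) _); apply.
    move=> i y; under eq_fun do rewrite !mxE.
    exact: (continuousB (@coord_continuous _ _ _ ord0 i y) (@cst_continuous _ _ (c ord0 i) y)).
by rewrite E0 Ec subrr.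
Qed.

End divergence_theorem.

Section smooth_step.
Context {R : realType}.

Lemma is_derive_quadratic (h : R -> R) (h' t C : R) : 0 < C ->
  (forall s, `|h (t + s) - h t - s * h'| <= C * s ^+ 2) -> is_derive t (1 : R) h h'.
Proof.
move=> C0 H.
have cv : s^-1 *: (h (s *: (1 : R) + t) - h t) @[s --> (0 : R)^'] --> h'.
  apply/cvgrPdist_le => e e0; near=> s.
  have s0 : s != 0 by near: s; exact: nbhs_dnbhs_neq.
  have se : `|s| * C <= e.
    by rewrite -ler_pdivlMr//; near: s; apply: (@dnbhs0_le R R); rewrite divr_gt0.
  have -> : h' - s^-1 *: (h (s *: (1 : R) + t) - h t) = - (s^-1 * (h (t + s) - h t - s * h')).
    rewrite [s *: 1]mulr1 (addrC s) /GRing.scale/= [in RHS]mulrBr mulKf//; lra.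
  rewrite normrN normrM normfV (le_trans _ se)// ler_pdivrMl ?normr_gt0//; apply: (le_trans (H s)).
  rewrite -[s ^+ 2]real_normK ?num_real// expr2; set a := `|s|; lra.
by apply: DeriveDef; [apply/cvg_ex; exists h'|apply/cvg_lim].
Unshelve. all: by end_near. Qed.

Definition psq (t : R) : R := Num.max t 0 ^+ 2.

Lemma psq_quadratic (t s : R) : `|psq (t + s) - psq t - s * (2 * Num.max t 0)| <= 1 * s ^+ 2.
Proof.
rewrite /psq mul1r ler_norml; have [h1|h1] := leP t 0; have [h2|h2] := leP (t + s) 0;
  rewrite ?expr2; apply/andP; split; nra.
Qed.

(** A second difference of [psq] with mesh 1/2: the derivative is a tent of mass 1 on [0, 1], so the
    function is C^1 and rises from 0 to 1. *)
Definition step (t : R) : R := 2 * (psq t - 2 * psq (t - 1 / 2) + psq (t - 1)).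

Definition step' (t : R) : R := 4 * (Num.max t 0 - 2 * Num.max (t - 1 / 2) 0 + Num.max (t - 1) 0).

Lemma step_quadratic (t s : R) : `|step (t + s) - step t - s * step' t| <= 8 * s ^+ 2.
Proof.
have := psq_quadratic t s; have := psq_quadratic (t - 1 / 2) s; have := psq_quadratic (t - 1) s.
rewrite /step /step' !mul1r; set c : R := 2^-1.
have -> : t + s - c = t - c + s by rewrite addrAC.
have -> : t + s - 1 = t - 1 + s by rewrite addrAC.
move: (psq (t - 1 + s)) (psq (t - 1)) (psq (t - c + s)) (psq (t - c)) (psq (t + s)) (psq t).
move: (Num.max (t - 1) 0) (Num.max (t - c) 0) (Num.max t 0) (s ^+ 2) => m1 m2 m3 q a1 a2 a3 a4 a5 a6.
rewrite !ler_norml => /andP[h1 h2] /andP[h3 h4] /andP[h5 h6]; apply/andP; split; lra.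
Qed.

Lemma is_derive_step t : is_derive t (1 : R) step (step' t).
Proof. by apply: (@is_derive_quadratic _ _ _ 8) => // s; exact: step_quadratic. Qed.

Lemma continuous_step' : continuous step'.
Proof.
have cm (c : R) : continuous (fun t : R => Num.max (t - c) 0).
  move=> t; apply: (@continuous_max _ _ (fun t : R => t - c) (fun=> 0)).
    by apply: cvgB; [exact: cvg_id|exact: cvg_cst].
  exact: cst_continuous.
move=> t; rewrite /step'.
have c0 := cm 0 t; rewrite (_ : (fun t : R => Num.max (t - 0) 0) = (fun t => Num.max t 0)) in c0; last first.
  by apply/funext => s; rewrite subr0.
have k (a : R) : {for t, continuous (fun _ : R => a)} by exact: cst_continuous.
exact: (continuousM (k 4) (continuousD (continuousB c0 (continuousM (k 2) (cm (1 / 2) t))) (cm 1 t))).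
Qed.

Lemma step_le0 t : t <= 0 -> step t = 0.
Proof.
by move=> t0; rewrite /step /psq !max_r ?expr0n/=; lra.
Qed.

Lemma step_ge1 t : 1 <= t -> step t = 1.
Proof. by move=> t1; rewrite /step /psq !max_l ?expr2; lra. Qed.

Lemma step'_ge0 t : 0 <= step' t.
Proof. by rewrite /step' ![Num.max _ 0]maxEle; do ![case: ifP]; lra. Qed.

Lemma step'_out t : t <= 0 \/ 1 <= t -> step' t = 0.
Proof. by rewrite /step' ![Num.max _ 0]maxEle; do ![case: ifP]; lra. Qed.

Lemma step_ge0 t : 0 <= step t.
Proof.
rewrite /step /psq ![Num.max _ 0]maxEle; do ![case: ifP]; rewrite ?expr2; nra.
Qed.

Lemma step_le1 t : step t <= 1.
Proof.
rewrite /step /psq ![Num.max _ 0]maxEle; do ![case: ifP]; rewrite ?expr2; nra.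
Qed.

End smooth_step.

Section test_fields.
Context {R : realType} {N : nat}.
Notation vec := 'rV[R]_N.
Notation mu := (leb R N).
Notation T := (lebT R N).

Lemma dotv_delta (x : vec) i : dotv x (delta_mx ord0 i) = x ord0 i.
Proof.
rewrite /dotv (bigD1 i)//= big1 ?addr0; first by rewrite [X in _ * X]mxE !eqxx mulr1.
by move=> j ji; rewrite [X in _ * X]mxE eqxx (negbTE ji) mulr0.
Qed.

Lemma closed_support (phi : vec -> vec) (C : set vec) : closed C -> (forall y, ~ C y -> phi y = 0) ->
  closure [set x | phi x != 0] `<=` C.
Proof.
move=> cC h; rewrite [X in _ `<=` X]((closure_id C).1 cC); apply: closure_subset => y /=.
by move=> /eqP y0; apply: contrapT => /h.
Qed.

Lemma test_field_of_grads (Om C : set vec) (phi : vec -> vec) (G : 'I_N -> vec -> vec) (K : R) :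
  (forall j, has_grad (fun x => phi x ord0 j) (G j)) ->
  closed C -> C `<=` Om -> C `<=` ceball 0 K -> (forall y, ~ C y -> phi y = 0) ->
  (forall x, enorm (phi x) <= 1) -> test_field Om phi.
Proof.
move=> hG cC COm CK phi0 phi1; have [d c _] := field_of_grads hG.
have sC := closed_support cC phi0; split=> //; last exact: subset_trans COm.
apply: (subclosed_compact _ (@ceball_compact R N 0 K)); first exact: closed_closure.
exact: subset_trans CK.
Qed.

Lemma test_field_support (Om : set vec) (phi : vec -> vec) : test_field Om phi ->
  exists2 K, 0 < K & forall y, K < enorm y -> phi y = 0.
Proof.
move=> [_ _ /(@compact_bounded R vec)[M [_ hM]] _ _].
exists (Num.sqrt N%:R * (`|M| + 1) + 1); first by rewrite ltr_wpDl// mulr_ge0// ?sqrtr_ge0// addr_ge0.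
move=> y yK; apply/eqP; apply: contraTT yK => y0; rewrite -leNgt.
have /= h := hM (`|M| + 1) _ y (@subset_closure _ [set x | phi x != 0] y y0).
apply: (@le_trans _ _ (Num.sqrt N%:R * (`|M| + 1))); last by rewrite lerDl.
apply: ler_enorm_sup => [|i]; first by rewrite addr_ge0.
 apply: (le_trans _ (h _)); last by rewrite (le_lt_trans (ler_norm M))// ltrDl.
rewrite /Num.norm/= mx_normrE.
exact: (le_bigmax _ (fun ij : 'I_1 * 'I_N => `|y ij.1 ij.2|) (ord0, i)).
Qed.

Lemma test_field_out (Om : set vec) (phi : vec -> vec) y : test_field Om phi -> ~ Om y ->
  phi y = 0 /\ divergence phi y = 0.
Proof.
move=> [d c _ sOm _] nO.
have nc : ~ closure [set x | phi x != 0] y by move=> /sOm.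
have phi0 z : ~ closure [set x | phi x != 0] z -> phi z = 0.
  by move=> nz; apply/eqP; apply: contra_notT nz => z0; exact: subset_closure.
split; first exact: phi0.
rewrite /divergence /mxtrace big1// => i _.
have hg := grads_of_field i d c.
have := grad_locally0 (y := y) hg (closed_openC (@closed_closure _ [set x | phi x != 0])) nc _.
move=> /(_ _)/rowP; have h z : (~` closure [set x | phi x != 0]) z -> phi z ord0 i = 0.
  by move=> /phi0 ->; rewrite mxE.
by move=> /(_ h i); rewrite [in X in X -> _]mxE [in X in X -> _]mxE [RHS]mxE.
Qed.

Lemma continuous_divergence (Om : set vec) (phi : vec -> vec) : test_field Om phi ->
  continuous (divergence phi).
Proof.
move=> [d c _ _ _] y; rewrite /divergence /mxtrace.
elim: (index_enum _) => [|i s IH].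
  under eq_fun do rewrite big_nil; exact: cst_continuous.
under eq_fun do rewrite big_cons.
have [_ /(_ i y) ci] := grads_of_field i d c.
have ci' : {for y, continuous (fun x => jacobian phi x i i)}.
  rewrite (_ : (fun x => _) = (fun x => ((col i (jacobian phi x))^T : vec) ord0 i))//.
  by apply/funext => x; rewrite [RHS]mxE [RHS]mxE.
exact: (continuousD ci' IH).
Qed.

(** The sum over [i] of [integral_grad] for the products of [f] with the coordinates of [phi]. *)
Lemma integral_divergence (f : vec -> R) (F : vec -> vec) (Om : set vec) (phi : vec -> vec) :
  has_grad f F -> test_field Om phi ->
  (\int[mu]_y (f y * divergence phi y + dotv (F y) (phi y)) = 0)%R.
Proof.
move=> hf hphi; have [K K0 hK] := test_field_support hphi; case: (hphi) => d c _ _ _.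
pose G (i : 'I_N) (y : vec) : vec := (col i (jacobian phi y))^T.
have hG i := has_gradM hf (grads_of_field i d c).
have hG0 i y : K < enorm y -> f y * phi y ord0 i = 0 by move=> /hK ->; rewrite mxE mulr0.
have iG i := integral_grad (delta_mx ord0 i) (hG i) K0 (hG0 i).
transitivity (\int[mu]_y (\sum_(i < N) dotv (f y *: G i y + phi y ord0 i *: F y) (delta_mx ord0 i)))%R.
  apply: eq_Rintegral => y _.
  rewrite /divergence /mxtrace mulr_sumr {1}/dotv -big_split/=; apply: eq_bigr => i _.
  rewrite dotv_delta [RHS]mxE [X in _ = X + _]mxE [X in _ = _ + X]mxE.
  by rewrite /G [X in _ = _ * X + _]mxE [X in _ = _ * X + _]mxE [F y ord0 i * _]mulrC.
rewrite /Rintegral; under eq_integral do rewrite -sumEFin.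
rewrite integral_sum//; last by move=> i; exact: (iG i).1.
rewrite big1// => i _; apply/eqP; rewrite -[X in X == _]fineK ?(integrable_fin_num _ (iG i).1)//.
by rewrite eqe; apply/eqP; exact: (iG i).2.
Qed.

Lemma test_field0 (Om : set vec) : test_field Om (fun=> 0).
Proof.
apply: (@test_field_of_grads _ set0 _ (fun _ _ => 0) 1) => //.
- by move=> j; apply: (eq_has_grad _ (has_grad_cst 0)) => y; rewrite mxE.
- exact: closed0.
- by move=> x; rewrite enorm0.
Qed.

Lemma variation_ge0 (Om : set vec) u : (0 <= variation Om u)%E.
Proof.
apply: ereal_sup_ubound; exists (fun=> 0); first exact: test_field0.
rewrite integral0_eq// => y _; rewrite (_ : divergence _ y = 0) ?mulr0//.
have [|_ _ ->] := @field_of_grads R N (fun=> 0) (fun _ _ => 0).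
  by move=> j; apply: (eq_has_grad _ (has_grad_cst 0)) => z; rewrite mxE.
by rewrite big1// => j _; rewrite mxE.
Qed.

Lemma integral_div_setT (Om : set vec) (phi : vec -> vec) (v : vec -> R) : test_field Om phi ->
  (\int[mu]_(y in Om) (v y * divergence phi y)%:E = \int[mu]_y (v y * divergence phi y)%:E)%E.
Proof.
move=> hphi; rewrite integral_mkcond; apply: eq_integral => y _; rewrite /patch; case: ifPn => //.
by rewrite notin_setE => nO; rewrite (test_field_out hphi nO).2 mulr0.
Qed.

Lemma test_field_div_integrable (Om : set vec) (phi : vec -> vec) : test_field Om phi ->
  mu.-integrable setT (EFin \o divergence phi).
Proof.
move=> hphi; have [K K0 hK] := test_field_support hphi.
apply: (compact_support_integrable (K := K)); first exact: continuous_divergence hphi.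
have sub : test_field (ceball 0 K : set vec) phi.
  case: hphi => d c cs _ p1; split=> //; apply: closed_support; first exact: closed_ceball.
  by move=> y; rewrite /ceball/= subr0 => /negP; rewrite -ltNge; exact: hK.
move=> y Ky; apply: (test_field_out sub _).2.
by rewrite /ceball/= subr0 => /(lt_le_trans Ky); rewrite ltxx.
Qed.

Lemma variation_cst (Om : set vec) (a : R) : variation Om (fun=> a) = 0%E.
Proof.
apply/eqP; rewrite eq_le variation_ge0 andbT; apply: ge_ereal_sup => _ [phi hphi <-].
rewrite integral_div_setT//.
have i1 := test_field_div_integrable hphi.
have h : (\int[mu]_y (a * divergence phi y)%R = 0)%R.
  rewrite -[RHS](integral_divergence (has_grad_cst a) hphi); apply: eq_Rintegral => y _.
  by rewrite /dotv big1 ?addr0// => i _; rewrite mxE mul0r.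
have ia : mu.-integrable setT (fun y => (a * divergence phi y)%:E).
  have := @integrableZl _ _ R mu _ measurableT a _ i1; exact: eq_integrable.
by rewrite -[leLHS]fineK ?(integrable_fin_num _ ia)//; move: h; rewrite /Rintegral => ->.
Qed.

End test_fields.

(** * The Cheeger constant of the ball *)

Section radial_fields.
Context {R : realType} {N : nat}.
Notation vec := 'rV[R]_N.
Notation mu := (leb R N).
Notation T := (lebT R N).

Lemma has_grad_congr (f g : vec -> R) (F G : vec -> vec) : f =1 g -> F =1 G ->
  has_grad f F -> has_grad g G.
Proof. by move=> /funext -> /funext ->. Qed.

Lemma continuous_addf (f g : vec -> R) : continuous f -> continuous g -> continuous (fun y => f y + g y).
Proof. by move=> cf cg y; exact: (continuousD (cf y) (cg y)). Qed.

Lemma continuous_mulf (f g : vec -> R) : continuous f -> continuous g -> continuous (fun y => f y * g y).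
Proof. by move=> cf cg y; exact: (continuousM (cf y) (cg y)). Qed.

Lemma continuous_dotv (F W : vec -> vec) : (forall i, continuous (fun y => F y ord0 i)) ->
  (forall i, continuous (fun y => W y ord0 i)) -> continuous (fun y => dotv (F y) (W y)).
Proof.
move=> cF cW y; rewrite /dotv; elim: (index_enum _) => [|i s IH].
  under eq_fun do rewrite big_nil; exact: cst_continuous.
under eq_fun do rewrite big_cons.
exact: (continuousD (continuousM (cF i y) (cW i y)) IH).
Qed.

Lemma has_grad_radial (h : vec -> R) (H : vec -> vec) j : has_grad h H ->
  has_grad (fun y => (h y *: y) ord0 j) (fun y => h y *: delta_mx ord0 j + y ord0 j *: H y).
Proof.
move=> hh; apply: (eq_has_grad _ (has_gradM hh (has_grad_coord j))) => y.
by rewrite mxE.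
Qed.

Lemma divergence_radial (h : vec -> R) (H : vec -> vec) y : has_grad h H ->
  divergence (fun y => h y *: y) y = N%:R * h y + dotv (H y) y.
Proof.
move=> hh; have [_ _ ->] := field_of_grads (fun j => has_grad_radial j hh).
rewrite (eq_bigr (fun j => h y + H y ord0 j * y ord0 j)); last first.
  by move=> j _; rewrite [LHS]mxE [X in X + _]mxE [X in _ + X]mxE mxE !eqxx mulr1 [in X in _ + X]mulrC.
by rewrite big_split/= sumr_const card_ord mulr_natl.
Qed.

(** A function of |y|^2 rather than of |y|, so that it is C^1 at the origin as well. *)
Definition cutoff (r1 r2 : R) (y : vec) : R := step ((r2 ^+ 2 - enorm y ^+ 2) / (r2 ^+ 2 - r1 ^+ 2)).

Definition cutoff_slope (r1 r2 : R) (y : vec) : R :=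
  2 / (r2 ^+ 2 - r1 ^+ 2) * step' ((r2 ^+ 2 - enorm y ^+ 2) / (r2 ^+ 2 - r1 ^+ 2)).

Lemma has_grad_cutoff (r1 r2 : R) :
  has_grad (cutoff r1 r2) (fun y => - cutoff_slope r1 r2 y *: y).
Proof.
pose b : R := (r2 ^+ 2 - r1 ^+ 2)^-1.
have hs : has_grad (fun y : vec => (r2 ^+ 2 - enorm y ^+ 2) / (r2 ^+ 2 - r1 ^+ 2)) (fun y => - (2 * b) *: y).
  have := has_gradD (@has_grad_cst R N (r2 ^+ 2 * b)) (has_gradZ (- b) (@has_grad_sqnorm R N)).
  apply: has_grad_congr => y.
    by rewrite -/b mulrBl mulNr [b * _]mulrC.
  by rewrite add0r scalerA mulNr mulrC.
have := has_grad_comp (@is_derive_step R) (@continuous_step' R) hs.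
apply: has_grad_eq => y; rewrite scalerA /cutoff_slope -/b; congr (_ *: _); lra.
Qed.

Section cutoff_radii.
Variables (r1 r2 : R).
Hypotheses (r10 : 0 < r1) (r12 : r1 < r2).

Let d0 : 0 < r2 ^+ 2 - r1 ^+ 2.
Proof. by rewrite subr_gt0 ltrXn2r ?nnegrE ?ltW// (lt_trans r10). Qed.

Lemma cutoff_in y : enorm y <= r1 -> cutoff r1 r2 y = 1 /\ cutoff_slope r1 r2 y = 0.
Proof.
move=> yr; have s1 : 1 <= (r2 ^+ 2 - enorm y ^+ 2) / (r2 ^+ 2 - r1 ^+ 2).
  by rewrite ler_pdivlMr// mul1r lerD2l lerN2 lerXn2r ?nnegrE ?enorm_ge0// ltW.
by rewrite /cutoff /cutoff_slope step_ge1// step'_out ?mulr0//; right.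
Qed.

Lemma cutoff_out y : r2 <= enorm y -> cutoff r1 r2 y = 0 /\ cutoff_slope r1 r2 y = 0.
Proof.
move=> yr; have s1 : (r2 ^+ 2 - enorm y ^+ 2) / (r2 ^+ 2 - r1 ^+ 2) <= 0.
  rewrite ler_pdivrMr// mul0r subr_le0 lerXn2r ?nnegrE ?enorm_ge0// ltW//.
  exact: lt_trans r12.
by rewrite /cutoff /cutoff_slope step_le0// step'_out ?mulr0//; left.
Qed.

Lemma cutoff_slope_ge0 y : 0 <= cutoff_slope r1 r2 y.
Proof. by rewrite mulr_ge0 ?step'_ge0// divr_ge0// ltW. Qed.

End cutoff_radii.

Lemma cutoff_ge0 r1 r2 y : 0 <= cutoff r1 r2 y. Proof. exact: step_ge0. Qed.

Lemma cutoff_le1 r1 r2 y : cutoff r1 r2 y <= 1. Proof. exact: step_le1. Qed.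

End radial_fields.

Section ball_perimeter.
Context {R : realType} {N : nat}.
Notation vec := 'rV[R]_N.
Notation mu := (leb R N).
Notation T := (lebT R N).
Variable r : R.
Hypothesis r0 : 0 < r.
Notation B := (eball (0 : vec) r).

Lemma integrable_addr (D : set vec) (f g : vec -> R) : mble D -> mu.-integrable D (EFin \o f) ->
  mu.-integrable D (EFin \o g) -> mu.-integrable D (EFin \o (fun y => f y + g y)).
Proof. by move=> mD hf hg; exact: (integrableD mD hf hg). Qed.

Lemma integrable_scale (D : set vec) (a : R) (f : vec -> R) : mble D -> mu.-integrable D (EFin \o f) ->
  mu.-integrable D (EFin \o (fun y => a * f y)).
Proof. by move=> mD hf; exact: (integrableZl mD a hf). Qed.

Lemma integrable_subr (D : set vec) (f g : vec -> R) : mble D -> mu.-integrable D (EFin \o f) ->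
  mu.-integrable D (EFin \o g) -> mu.-integrable D (EFin \o (fun y => f y - g y)).
Proof. by move=> mD hf hg; exact: (integrableB mD hf hg). Qed.

Lemma Rintegral_indic (D : set vec) (m : R) : mble D -> leb_outer R N D = m%:E ->
  mu.-integrable setT (EFin \o (\1_D : T -> R)) /\ (\int[mu]_y \1_D y = m)%R.
Proof.
move=> mD Dm; split; last by rewrite /Rintegral integral_indic//= setIT [X in fine X]Dm.
apply/integrableP; split; first exact/measurable_EFinP/measurable_indic.
under eq_integral do rewrite /= ger0_norm//.
by rewrite integral_indic//= setIT [X in (X < _)%E]Dm ltry.
Qed.

Lemma integrable_indic_div (phi : vec -> vec) : test_field setT phi ->
  mu.-integrable setT (EFin \o (fun y => \1_B y * divergence phi y)).
Proof.
move=> hphi.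
have m1 : measurable_fun setT (\1_B : T -> R) by apply: measurable_indic; exact: mble_eball.
have := @integrable_mulr_bounded R N setT (divergence phi) \1_B 1 measurableT (test_field_div_integrable hphi) m1.
rewrite (_ : (fun y => divergence phi y * \1_B y) = (fun y => \1_B y * divergence phi y)); last first.
  by apply/funext => y; rewrite mulrC.
by apply=> y _; rewrite indicE; case: (_ \in _); rewrite ?normr1 ?normr0.
Qed.

(** Let [eta] be the cutoff, with gradient -m y. The integral of eta div phi is that of m y.phi,
    which is at most 1/rho times that of m |y|^2, and this is N times that of eta by the dilation
    identity. The term with [M] is the error on the shell between [rho] and [r]. *)
Lemma indic_div_ball_le (phi : vec -> vec) (M rho : R) : test_field setT phi -> 0 < rho < r ->
  (forall y, enorm y <= r -> `|divergence phi y| <= M) ->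
  (\int[mu]_y (\1_B y * divergence phi y)%R)%R <=
  N%:R / rho * (r ^+ N * ballvol R N) + M * ((r ^+ N - rho ^+ N) * ballvol R N).
Proof.
move=> hphi /andP[rho0 rhor] hM.
pose eta := @cutoff R N rho r; pose m := @cutoff_slope R N rho r.
have heta := @has_grad_cutoff R N rho r; rewrite -/eta -/m in heta.
have ceta := has_grad_continuous heta.
have eta0 y : r < enorm y -> eta y = 0 by move=> /ltW/(cutoff_out rho0 rhor)[].
have F0 y : r < enorm y -> - m y *: y = 0.
  by move=> /ltW/(cutoff_out rho0 rhor)[_]; rewrite /m => ->; rewrite oppr0 scale0r.
have E1 := integral_divergence heta hphi.
have E2 := integral_dilation_div heta eta0 r0 F0.
have [iB EB] := Rintegral_indic (@mble_eball _ _ _ _) (@leb_eball R N 0 r r0).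
have [irho Erho] := Rintegral_indic (@mble_eball _ _ _ _) (@leb_eball R N 0 rho rho0).
pose h1 (y : vec) := eta y * divergence phi y + dotv (- m y *: y) (phi y).
pose h2 (y : vec) := N%:R * eta y + dotv (- m y *: y) y.
have [_ cF] := heta.
have cphi i : continuous (fun y => phi y ord0 i).
  by case: hphi => d c _ _ _; exact: (has_grad_continuous (grads_of_field i d c)).
have dot0 (y w : vec) : r < enorm y -> dotv (- m y *: y) w = 0.
  by move=> ry; rewrite F0// /dotv big1// => i _; rewrite mxE mul0r.
have i1 : mu.-integrable setT (EFin \o h1).
  apply: (compact_support_integrable (K := r)); last first.
    by move=> y ry; rewrite /h1 eta0// dot0// mul0r addr0.
  exact: (continuous_addf (continuous_mulf ceta (continuous_divergence hphi)) (continuous_dotv cF cphi)).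
have i2 : mu.-integrable setT (EFin \o h2).
  apply: (compact_support_integrable (K := r)); last first.
    by move=> y ry; rewrite /h2 eta0// dot0// mulr0 addr0.
  have cid i : continuous (fun y : vec => y ord0 i) by exact: coord_continuous.
  exact: (continuous_addf (has_grad_continuous (has_gradZ N%:R heta)) (continuous_dotv cF cid)).
(* The last bracket has integral 0, by [E1] and [E2]. *)
have le y : \1_B y * divergence phi y <=
   N%:R / rho * \1_B y + M * (\1_B y - \1_(eball 0 rho) y) + (h1 y - rho^-1 * h2 y).
  have [By|By] := boolP (y \in B); last first.
    have yr : r <= enorm y by move: By; rewrite notin_setE /eball/= subr0 => /negP; rewrite -leNgt.
    have nrho : y \notin eball 0 rho.
      by rewrite notin_setE /eball/= subr0 => /(le_lt_trans yr)/(lt_trans rhor); rewrite ltxx.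
    have [e0 m0] := cutoff_out rho0 rhor yr.
    have d0 w : dotv (- m y *: y) w = 0 by rewrite /m m0 oppr0 scale0r /dotv big1// => i _; rewrite mxE mul0r.
    by rewrite /h1 /h2 !d0 /eta e0 !indicE (negbTE By) (negbTE nrho)/=; lra.
  have yr : enorm y < r by move: By; rewrite inE /eball/= subr0.
  have := hM y (ltW yr); rewrite ler_norml => /andP[dM1 dM2].
  have e0 : 0 <= eta y by exact: cutoff_ge0.
  have e1 : eta y <= 1 by exact: cutoff_le1.
  rewrite indicE By/=; have [yrho|yrho] := ltP (enorm y) rho.
    have [ee m0] := cutoff_in rho0 rhor (ltW yrho).
    have d0 w : dotv (- m y *: y) w = 0 by rewrite /m m0 oppr0 scale0r /dotv big1// => i _; rewrite mxE mul0r.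
    rewrite /h1 /h2 !d0 /eta ee indicE mem_set/=; last by rewrite /eball/= subr0.
    by lra.
  rewrite indicE memNset/=; last by rewrite /eball/= subr0; apply/negP; rewrite -leNgt.
  rewrite /h1 /h2 !dotvZl -sqr_enormE.
  have m0 : 0 <= m y by exact: cutoff_slope_ge0.
  have phi1 : enorm (phi y) <= 1 by case: hphi.
  have : `|dotv y (phi y)| <= enorm y by apply: (le_trans (dotv_le _ _)); rewrite ler_piMr ?enorm_ge0.
  rewrite ler_norml => /andP[_ dle].
  have k1 : m y * dotv y (phi y) <= rho^-1 * (m y * enorm y ^+ 2).
    rewrite mulrCA ler_wpM2l//; apply: (le_trans dle).
    by rewrite ler_pdivlMl// expr2 ler_wpM2r ?enorm_ge0.
  have k2 : (1 - eta y) * divergence phi y <= (1 - eta y) * M by rewrite ler_wpM2l// subr_ge0.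
  have k3 : eta y * M >= 0 \/ True by right.
  have M0 : 0 <= M by apply: le_trans (hM y (ltW yr)).
  have k4 : 0 <= eta y * M by rewrite mulr_ge0.
  have k5 : 0 <= N%:R / rho * (1 - eta y) by rewrite mulr_ge0 ?subr_ge0// divr_ge0// ltW.
  set a := rho^-1 in k1 k5 *; lra.
have idiv := integrable_indic_div hphi.
have j1 := integrable_scale (N%:R / rho) measurableT iB.
have j2 := integrable_scale M measurableT (integrable_subr measurableT iB irho).
have j3 := integrable_scale rho^-1 measurableT i2.
have j4 := integrable_subr measurableT i1 j3.
have j12 := integrable_addr measurableT j1 j2.
apply: (le_trans (le_Rintegral measurableT idiv (integrable_addr measurableT j12 j4) (fun y _ => le y))).
rewrite (RintegralD measurableT j12 j4) (RintegralD measurableT j1 j2) (RintegralB measurableT i1 j3).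
rewrite (RintegralZl _ measurableT iB) (RintegralZl _ measurableT (integrable_subr measurableT iB irho)).
rewrite (RintegralZl _ measurableT i2) (RintegralB measurableT iB irho) EB Erho E1 E2.
by rewrite mulr0 subr0 addr0 -mulrBl.
Qed.

Lemma perimeter_ball_le : (perimeter B <= (N%:R / r * (r ^+ N * ballvol R N))%:E)%E.
Proof.
apply: ge_ereal_sup => _ [phi hphi <-].
have [M M0 hM] := continuous_bounded_ceball r (continuous_divergence hphi).
set I := (X in (X <= _)%E).
have If : I \is a fin_num.
  exact: (integrable_fin_num measurableT (integrable_indic_div hphi)).
rewrite -(fineK If) lee_fin.
pose V := r ^+ N * ballvol R N.
(* Taking rho = (1 - e) r and multiplying by 1 - e turns both sides into polynomials in e. *)
pose p : {poly R} := fine I *: (1%:P - 'X).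
pose q : {poly R} := (N%:R / r * V)%:P + (M * V) *: ((1%:P - 'X) * (1%:P - (1%:P - 'X) ^+ N)).
have qE x : q.[x] = N%:R / r * V + (M * V) * ((1 - x) * (1 - (1 - x) ^+ N)).
  by rewrite /q hornerD hornerC hornerZ hornerM !(hornerD, hornerN) !hornerC horner_exp hornerD hornerN hornerC hornerX.
have -> : fine I = p.[0] by rewrite !hornerE subr0 mulr1.
have -> : N%:R / r * (r ^+ N * ballvol R N) = q.[0].
  by rewrite qE subr0 expr1n subrr !mulr0 addr0.
apply: (@poly_lim_le _ _ _ 1%N) => n n1; set e : R := _^-1.
have e0 : 0 < e by rewrite invr_gt0.
have e1 : e < 1 by rewrite invf_lt1// ltr1n.
have e1' : 0 < 1 - e by rewrite subr_gt0.
have rr : 0 < (1 - e) * r < r by rewrite mulr_gt0//= gtr_pMl// ltrBlDr ltrDl.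
have := indic_div_ball_le hphi rr hM.
rewrite -[X in X <= _]/(fine I) => h.
rewrite qE !hornerE mulrC.
apply: (le_trans (ler_wpM2l (ltW e1') h)); rewrite exprMn -/V.
set x := (1 - e) ^+ N; set v := ballvol R N; rewrite /V.
rewrite le_eqVlt; apply/orP; left; apply/eqP.
have -> : N%:R / ((1 - e) * r) = (1 - e)^-1 * (N%:R / r) by rewrite invfM; set a := (1 - e)^-1; set b := r^-1; lra.
have dd : (1 - e) * (1 - e)^-1 = 1 by rewrite divff ?gt_eqF.
have H (P d A W w X Z : R) : P * d = 1 ->
    P * (d * A * (W * w) + Z * ((W - X * W) * w)) = A * W * w + Z * W * w * P * (1 - X).
  move=> Pd; transitivity ((P * d) * (A * (W * w)) + P * (Z * ((W - X * W) * w))); first by lra.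
  rewrite Pd; lra.
exact: H.
Qed.

(** The room between [r] and [rho] lets the field y/rho be cut off outside the ball while its norm
    stays at most 1. *)
Lemma cheeger_field_le (E : set vec) (rho : R) : mble E -> E `<=` B -> r < rho ->
  ((N%:R / rho)%:E * mu E <= perimeter E)%E.
Proof.
move=> mE EB rrho; have rho0 : 0 < rho by exact: lt_trans rrho.
pose h (y : vec) := rho^-1 * @cutoff R N r rho y.
have hh := has_gradZ rho^-1 (@has_grad_cutoff R N r rho).
pose phi (y : vec) := h y *: y.
have hphi : test_field setT phi.
  apply: (@test_field_of_grads _ _ _ (ceball 0 rho) _ _ rho (fun j => has_grad_radial j hh)) => //.
  - exact: closed_ceball.
  - move=> y; rewrite /ceball/= subr0 => /negP; rewrite -ltNge => /ltW/(cutoff_out r0 rrho)[c0 _].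
    by rewrite c0 mulr0 scale0r.
  - move=> y; rewrite enormZ; have [yrho|yrho] := leP (enorm y) rho; last first.
      by rewrite (cutoff_out r0 rrho (ltW yrho)).1 mulr0 normr0 mul0r.
    have ri0 : 0 <= rho^-1 by rewrite invr_ge0 ltW.
    rewrite ger0_norm; last exact: mulr_ge0 ri0 (cutoff_ge0 _ _ _).
    rewrite -mulrA ler_pdivrMl// mulr1; apply: le_trans yrho.
    by rewrite ler_piMl ?enorm_ge0// cutoff_le1.
have : (\int[mu]_(y in setT) (\1_E y * divergence phi y)%:E <= perimeter E)%E.
  by apply: ereal_sup_ubound; exists phi.
apply: le_trans; rewrite (eq_integral (fun y : T => (N%:R / rho)%:E * (\1_(E : set T) y)%:E)%E).
  have mEE : measurable_fun (setT : set T) (fun y : T => (\1_(E : set T) y : R)%:E).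
    by apply/measurable_EFinP/measurable_indic.
  have i0 (y : T) : [set: T] y -> (0 <= (\1_(E : set T) y : R)%:E)%E by rewrite lee_fin.
  have k0 : (0 <= (N%:R / rho)%:E)%E by rewrite lee_fin divr_ge0// ltW.
  rewrite (@ge0_integralZl _ T R mu setT measurableT _ mEE _ i0 k0).
  by rewrite integral_indic//= setIT.
move=> y _; rewrite -EFinM; congr EFin; rewrite mulrC; case: (boolP (y \in E)) => yE; last first.
  by rewrite indicE (negbTE yE)/= !mulr0.
have yr : enorm y <= r by have := EB y; rewrite /eball/= subr0 => /(_ _)/ltW; apply; rewrite inE in yE.
rewrite /phi (divergence_radial y hh) /h; have [-> ->] := cutoff_in r0 rrho yr.
rewrite oppr0 scale0r scaler0 /dotv big1 ?addr0 ?mulr1//.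
by move=> i _; rewrite mxE mul0r.
Qed.

Lemma cheeger_ball : cheeger B = (N%:R / r)%:E.
Proof.
have V0 : 0 < r ^+ N * ballvol R N by rewrite mulr_gt0 ?exprn_gt0// ballvol_gt0.
have muB : mu B = (r ^+ N * ballvol R N)%:E by exact: leb_eball.
apply/eqP; rewrite eq_le; apply/andP; split.
  apply: (@le_trans _ _ (perimeter B / mu B)%E).
    apply: ereal_inf_lbound; exists B => //; split=> //.
    - exact: mble_eball.
    - by rewrite muB lte_fin.
    - by apply: (le_lt_trans perimeter_ball_le); rewrite ltry.
  rewrite muB inver gt_eqF// lee_pdivrMr//.
  by apply: (le_trans perimeter_ball_le).
apply: le_ereal_inf_tmp => _ [E [mE EB E0 PE] <-].
have Ef : mu E \is a fin_num.
  rewrite ge0_fin_numE; last exact: ltW.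
  by apply: (@le_lt_trans _ _ (mu B)); [exact: le_leb|rewrite muB ltry].
have Pf : perimeter E \is a fin_num by rewrite ge0_fin_numE// variation_ge0.
have key := fun rho => @cheeger_field_le E rho mE EB.
rewrite -(fineK Ef) -(fineK Pf) in key E0 *; set m := fine (mu E) in key E0 *.
set P := fine (perimeter E) in key *; rewrite lte_fin in E0.
rewrite inver gt_eqF// -EFinM lee_fin ler_pdivlMr//.
pose p : {poly R} := (N%:R / r * m) *: (1%:P - 'X).
have -> : N%:R / r * m = p.[0] by rewrite !hornerE subr0 mulr1.
have -> : P = (P%:P).[0] by rewrite hornerC.
apply: (@poly_lim_le _ _ _ 1%N) => n n1; set e : R := _^-1.
have e0 : 0 < e by rewrite invr_gt0.
have e1 : e < 1 by rewrite invf_lt1// ltr1n.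
have e1' : 0 < 1 - e by rewrite subr_gt0.
have := key (r / (1 - e)) _; rewrite -EFinM lee_fin !hornerE => /(_ _).
have -> : N%:R / (r / (1 - e)) * m = N%:R / r * m * (1 - e).
  by rewrite invf_div; set b := r^-1; lra.
by apply; rewrite ltr_pdivlMr// gtr_pMr// ltrBlDr ltrDl.
Qed.

End ball_perimeter.

(** * Density of smooth functions *)

Section leb_integral_real.
Context {R : realType} {N : nat}.
Notation vec := 'rV[R]_N.
Notation mu := (leb R N).
Notation T := (lebT R N).
Implicit Types (D : set vec) (f g : vec -> R).

(** Fixes the Caratheodory sigma-algebra on the source once and for all. *)
Definition lmeas D f : Prop := measurable_fun (D : set T) (f : T -> R).

Lemma mbleT : mble (setT : set vec). Proof. exact: measurableT. Qed.

Lemma lmeasD D f g : lmeas D f -> lmeas D g -> lmeas D (fun y => f y + g y).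
Proof. exact: measurable_funD. Qed.

Lemma lmeasB D f g : lmeas D f -> lmeas D g -> lmeas D (fun y => f y - g y).
Proof. exact: measurable_funB. Qed.

Lemma lmeasM D f g : lmeas D f -> lmeas D g -> lmeas D (fun y => f y * g y).
Proof. exact: measurable_funM. Qed.

Lemma lmeas_cst D (a : R) : lmeas D (fun=> a).
Proof. exact: measurable_cst. Qed.

Lemma lmeasZ D f (a : R) : lmeas D f -> lmeas D (fun y => a * f y).
Proof. by move=> mf; apply: lmeasM => //; exact: lmeas_cst. Qed.

Lemma lmeas_norm D f : lmeas D f -> lmeas D (fun y => `|f y|).
Proof. by move=> mf; rewrite /lmeas; apply: measurableT_comp. Qed.

Lemma lmeasS D D' f : mble D -> D' `<=` D -> lmeas D f -> lmeas D' f.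
Proof. by move=> mD DD' mf; exact: (measurable_funS mD DD' mf). Qed.

Lemma lmeas_continuous D f : continuous f -> lmeas D f.
Proof. by move=> cf; apply: measurable_funTS; exact: continuous_mfun. Qed.

Lemma lmeas_integrable D f : mu.-integrable D (EFin \o f) -> lmeas D f.
Proof. by move=> /integrableP[/measurable_EFinP]. Qed.

Lemma lmeas_indic D E : mble E -> lmeas D (\1_E : vec -> R).
Proof. exact: measurable_indic. Qed.

Lemma le_leb_integral D f g : mble D -> lmeas D f -> lmeas D g -> (forall y, D y -> 0 <= f y) ->
  (forall y, D y -> f y <= g y) ->
  (\int[mu]_(y in D) (f y)%:E <= \int[mu]_(y in D) (g y)%:E)%E.
Proof.
move=> mD mf mg f0 fg.
apply: (@ge0_le_integral _ T R mu D mD (fun y => (f y)%:E) (fun y => (g y)%:E)).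
- by move=> y Dy; rewrite lee_fin f0.
- exact/measurable_EFinP.
- exact/measurable_EFinP.
- by move=> y Dy; rewrite lee_fin fg.
Qed.

Lemma leb_integralD D f g : mble D -> lmeas D f -> lmeas D g -> (forall y, D y -> 0 <= f y) ->
  (forall y, D y -> 0 <= g y) ->
  (\int[mu]_(y in D) (f y + g y)%:E = \int[mu]_(y in D) (f y)%:E + \int[mu]_(y in D) (g y)%:E)%E.
Proof.
move=> mD mf mg f0 g0.
apply: (@ge0_integralD _ T R mu D mD (fun y => (f y)%:E) (fun y => (g y)%:E)).
- by move=> y Dy; rewrite lee_fin f0.
- exact/measurable_EFinP.
- by move=> y Dy; rewrite lee_fin g0.
- exact/measurable_EFinP.
Qed.

Lemma leb_integralZ D f (a : R) : mble D -> lmeas D f -> (forall y, D y -> 0 <= f y) -> 0 <= a ->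
  (\int[mu]_(y in D) (a * f y)%:E = a%:E * \int[mu]_(y in D) (f y)%:E)%E.
Proof.
move=> mD mf f0 a0.
have mEf : measurable_fun (D : set T) (fun y : T => (f y)%:E) by exact/measurable_EFinP.
have f0' (y : T) : D y -> (0 <= (f y)%:E)%E by move=> /f0; rewrite lee_fin.
have a0' : (0 <= a%:E)%E by rewrite lee_fin.
exact: (@ge0_integralZl _ T R mu D mD _ mEf a%:E f0' a0').
Qed.

Lemma leb_integral_ge0 D f : (forall y, D y -> 0 <= f y) -> (0 <= \int[mu]_(y in D) (f y)%:E)%E.
Proof. by move=> f0; apply: integral_ge0 => y Dy; rewrite lee_fin f0. Qed.

Lemma leb_integral_indic D E : mble D -> mble E ->
  (\int[mu]_(y in D) (\1_E y)%:E = leb_outer R N (D `&` E))%E.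
Proof. by move=> mD mE; rewrite (@integral_indic _ T R mu D mD E mE) setIC. Qed.

Lemma leb_integral_le_subset D D' f : mble D -> mble D' -> D `<=` D' -> lmeas D' f ->
  (forall y, D' y -> 0 <= f y) -> (\int[mu]_(y in D) (f y)%:E <= \int[mu]_(y in D') (f y)%:E)%E.
Proof.
move=> mD mD' DD' mf f0.
have mEf : measurable_fun (D' : set T) (fun y : T => (f y)%:E) by exact/measurable_EFinP.
have f0' (y : T) : D' y -> (0 <= (f y)%:E)%E by move=> /f0; rewrite lee_fin.
exact: (@ge0_subset_integral _ T R mu D D' mD mD' _ mEf f0' DD').
Qed.

End leb_integral_real.

Section smooth_density.
Context {R : realType} {N : nat}.
Notation vec := 'rV[R]_N.
Notation mu := (leb R N).
Notation T := (lebT R N).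
Implicit Types (f g w : vec -> R).

Definition L1dist f g : \bar R := (\int[mu]_y `|f y - g y|%:E)%E.

Lemma L1dist_triangle f g w : lmeas setT f -> lmeas setT g ->
  lmeas setT w -> (L1dist f w <= L1dist f g + L1dist g w)%E.
Proof.
move=> mf mg mw.
have mfg := lmeas_norm (lmeasB mf mg); have mgw := lmeas_norm (lmeasB mg mw).
rewrite /L1dist -(leb_integralD mbleT)//; apply: (le_leb_integral mbleT) => //.
- exact: lmeas_norm (lmeasB mf mw).
- exact: lmeasD.
- by move=> y _; apply: le_trans (ler_normD _ _); rewrite addrA subrK.
Qed.

(** Membership in the L^1-closure of the C^1 functions with compact support. *)
Definition smoothable w : Prop := lmeas setT w /\
  forall e, 0 < e -> exists g G K, [/\ has_grad g G, 0 < K, forall y, K < enorm y -> g y = 0 &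
    (L1dist w g <= e%:E)%E].

Lemma smoothable_lim w : lmeas setT w ->
  (forall e, 0 < e -> exists2 w', smoothable w' & (L1dist w w' <= e%:E)%E) -> smoothable w.
Proof.
move=> mw H; split=> // e e0; have e20 : 0 < e / 2 by rewrite divr_gt0.
have [w' [mw' /(_ _ e20)[g [G [K [hg K0 g0 gw]]]]] ww'] := H _ e20.
exists g, G, K; split=> //.
apply: (le_trans (L1dist_triangle mw mw' (has_grad_measurable hg))).
by apply: (le_trans (leeD ww' gw)); rewrite -EFinD -splitr.
Qed.

Lemma smoothableD w1 w2 : smoothable w1 -> smoothable w2 -> smoothable (fun y => w1 y + w2 y).
Proof.
move=> [m1 H1] [m2 H2]; split=> [|e e0]; first exact: lmeasD.
have e20 : 0 < e / 2 by rewrite divr_gt0.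
have [g1 [G1 [K1 [hg1 K10 g10 d1]]]] := H1 _ e20; have [g2 [G2 [K2 [hg2 K20 g20 d2]]]] := H2 _ e20.
exists (fun y => g1 y + g2 y), (fun y => G1 y + G2 y), (K1 + K2); split=> //.
- exact: has_gradD.
- by rewrite addr_gt0.
- move=> y Ky; rewrite g10 ?g20 ?addr0//; apply: lt_trans Ky; rewrite ?ltrDl ?ltrDr//.
have mg1 := has_grad_measurable hg1; have mg2 := has_grad_measurable hg2.
apply: (@le_trans _ _ (L1dist w1 g1 + L1dist w2 g2)%E); last first.
  by apply: (le_trans (leeD d1 d2)); rewrite -EFinD -splitr.
have k1 := lmeas_norm (lmeasB m1 mg1); have k2 := lmeas_norm (lmeasB m2 mg2).
rewrite /L1dist -(leb_integralD mbleT)//; apply: (le_leb_integral mbleT) => //.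
- exact: lmeas_norm (lmeasB (lmeasD m1 m2) (lmeasD mg1 mg2)).
- exact: lmeasD.
- by move=> y _; rewrite opprD addrACA ler_normD.
Qed.

Lemma smoothableZ (a : R) w : smoothable w -> smoothable (fun y => a * w y).
Proof.
move=> [m1 H1]; split=> [|e e0]; first exact: lmeasZ.
have e20 : 0 < e / (`|a| + 1) by rewrite divr_gt0// ltr_wpDl.
have [g1 [G1 [K1 [hg1 K10 g10 d1]]]] := H1 _ e20.
exists (fun y => a * g1 y), (fun y => a *: G1 y), K1; split=> //; first exact: has_gradZ.
  by move=> y /g10 ->; rewrite mulr0.
have mg1 := has_grad_measurable hg1.
rewrite /L1dist (_ : (fun y => _) = (fun y => (`|a| * `|w y - g1 y|)%:E)); last first.
  by apply/funext => y; rewrite -mulrBr normrM.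
rewrite (leb_integralZ mbleT)//; last exact: lmeas_norm (lmeasB m1 mg1).
apply: (@le_trans _ _ (`|a|%:E * (e / (`|a| + 1))%:E)%E); first by rewrite lee_wpmul2l ?lee_fin.
rewrite -EFinM lee_fin mulrCA ler_piMr ?(ltW e0)// ler_pdivrMr ?mul1r ?lerDl//.
Qed.

Lemma smoothable_cst0 : smoothable (fun=> 0).
Proof.
split=> [|e e0]; first exact: lmeas_cst.
exists (fun=> 0), (fun=> 0), 1; split=> //; first exact: has_grad_cst.
rewrite /L1dist integral0_eq; first by rewrite lee_fin ltW.
by move=> y _; rewrite subrr normr0.
Qed.

Lemma smoothable_sum (I : Type) (s : seq I) (w : I -> vec -> R) :
  (forall i, smoothable (w i)) -> smoothable (fun y => \sum_(i <- s) w i y).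
Proof.
move=> H; elim: s => [|i s IH].
  by under eq_fun do rewrite big_nil; exact: smoothable_cst0.
by under eq_fun do rewrite big_cons; exact: smoothableD.
Qed.

Definition box_bump (ab : vec * vec) (d : R) (y : vec) : R :=
  \prod_(i < N) (step ((y ord0 i - ab.1 ord0 i + d) / d) * step ((ab.2 ord0 i - y ord0 i + d) / d)).

Lemma has_grad_box_bump ab (d : R) : exists G, has_grad (box_bump ab d) G.
Proof.
rewrite /box_bump; elim: (index_enum _) => [|i s [G IH]].
  by exists (fun=> 0); under eq_fun do rewrite big_nil; exact: has_grad_cst.
suff: exists G, has_grad (fun y : vec => step ((y ord0 i - ab.1 ord0 i + d) / d) * step ((ab.2 ord0 i - y ord0 i + d) / d)) G.
  by move=> [F hF]; eexists; under eq_fun do rewrite big_cons; exact: (has_gradM hF IH).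
have hc (a b : R) : exists F, has_grad (fun y : vec => step ((a * y ord0 i + b) / d)) F.
  have h1 := has_gradZ d^-1 (has_gradD (has_gradZ a (has_grad_coord i)) (has_grad_cst b)).
  have := has_grad_comp (@is_derive_step R) (@continuous_step' R) h1.
  rewrite (_ : (fun x => step (d^-1 * _)) = (fun y : vec => step ((a * y ord0 i + b) / d))); last first.
    by apply/funext => y; rewrite mulrC.
  by move=> h; eexists; exact: h.
have [F1 h1] := hc 1 (d - ab.1 ord0 i); have [F2 h2] := hc (-1) (d + ab.2 ord0 i).
eexists; apply: has_gradM.
  by apply: (eq_has_grad _ h1) => y; congr (step (_ / _)); lra.
by apply: (eq_has_grad _ h2) => y; congr (step (_ / _)); lra.
Qed.

Definition wide_box (ab : vec * vec) (d : R) : vec * vec := (ab.1 - const_mx d, ab.2 + const_mx d).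

Lemma box_bump_bound ab (d : R) y : 0 < d -> \1_(box ab) y <= box_bump ab d y <= \1_(box (wide_box ab d)) y.
Proof.
move=> d0; rewrite !indicE; have s0 (i : 'I_N) : 0 <= step ((y ord0 i - ab.1 ord0 i + d) / d) * step ((ab.2 ord0 i - y ord0 i + d) / d).
  by rewrite mulr_ge0// step_ge0.
apply/andP; split.
  have [yb|_] := boolP (y \in _); last by rewrite /box_bump prodr_ge0.
  rewrite inE in yb; rewrite /box_bump big1// => i _; have /andP[h1 h2] := yb i.
  rewrite !step_ge1 ?mulr1// ler_pdivlMr// mul1r; lra.
have [yb|] := boolP (y \in box (wide_box _ _)).
  rewrite /box_bump; apply: prodr_ile1 => i _; rewrite s0/=.
  by rewrite mulr_ile1 ?step_ge0 ?step_le1.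
rewrite notin_setE => /existsNP[i /negP]; rewrite !mxE negb_and -!ltNge => H.
rewrite /box_bump (bigD1 i)//=.
case/orP: H => H; first by rewrite step_le0 ?mul0r// ler_pdivrMr// mul0r; lra.
by rewrite [X in _ * X * _]step_le0 ?mulr0 ?mul0r// ler_pdivrMr// mul0r; lra.
Qed.

Lemma mble_box ab : mble (box ab : set vec).
Proof.
apply: closed_mble; rewrite (_ : box ab = \bigcap_(i in [set: 'I_N])
    (((fun y : vec => y ord0 i) @^-1` [set z | ab.1 ord0 i <= z]) `&`
     ((fun y : vec => y ord0 i) @^-1` [set z | z <= ab.2 ord0 i]))).
  apply: closed_bigI => i _; apply: closedI.
    by move/continuous_closedP: (@coord_continuous R 1 N ord0 i); apply; exact: closed_ge.
  by move/continuous_closedP: (@coord_continuous R 1 N ord0 i); apply; exact: closed_le.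
apply/seteqP; split=> y h; first by move=> i _; have /andP[] := h i.
by move=> i; have [/= -> ->] := h i I.
Qed.

Lemma wide_box_vol_cvg ab (e : R) : 0 < e -> exists2 d, 0 < d & box_vol (wide_box ab d) <= box_vol ab + e.
Proof.
move=> e0; pose v (d : R) := box_vol (wide_box ab d).
have cv : continuous v.
  rewrite /v /box_vol /=; move=> d; elim: (index_enum _) => [|i s IH].
    under eq_fun do rewrite big_nil; exact: cst_continuous.
  under eq_fun do rewrite big_cons.
  have c1 : {for d, continuous (fun d : R => Num.max 0 ((ab.2 + const_mx d) ord0 i - (ab.1 - const_mx d) ord0 i))}.
    apply: (@continuous_max _ _ (fun=> 0)); first exact: cst_continuous.
    rewrite (_ : (fun d : R => _) = (fun d : R => (ab.2 ord0 i - ab.1 ord0 i) + 2 * d)); last first.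
      by apply/funext => x; rewrite !mxE; lra.
    have k (a : R) : {for d, continuous (fun _ : R => a)} by exact: cst_continuous.
    have id_ : {for d, continuous (fun x : R => x)} by exact: cvg_id.
    exact: (continuousD (k _) (continuousM (k 2) id_)).
  exact: (continuousM c1 IH).
have v0 : v 0 = box_vol ab by rewrite /v /wide_box (_ : const_mx 0 = 0) ?subr0 ?addr0 -?surjective_pairing.
have /cvgrPdist_le/(_ e e0) := cv 0; rewrite v0 => H.
have [d0 /= d00 hd] := (nbhs_ballP _ _).1 H.
have d20 : 0 < d0 / 2 by rewrite divr_gt0.
exists (d0 / 2) => //.
have : `|box_vol ab - v (d0 / 2)| <= e.
  by apply: hd; rewrite /ball/= sub0r normrN gtr0_norm// ltr_pdivrMr// ltr_pMr// ltr1n.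
by rewrite ler_distlC => /andP[_]; rewrite addrC.
Qed.

(** The bump lies between the indicators of the box and of the widened box, so the error is at most
    the difference of the two volumes. *)
Lemma smoothable_box ab : smoothable \1_(box ab).
Proof.
split=> [|e e0]; first exact: lmeas_indic (mble_box _).
have [d d0 hd] := wide_box_vol_cvg ab e0.
have [G hG] := has_grad_box_bump ab d.
have bnd y := box_bump_bound ab y d0.
pose K := \sum_(i < N) (`|(ab.1 - const_mx d) ord0 i| + `|(ab.2 + const_mx d) ord0 i|).
exists (box_bump ab d), G, (Num.sqrt N%:R * K + 1).
have K0 : 0 <= K by rewrite sumr_ge0// => i _; rewrite addr_ge0.
split=> //.
- by rewrite ltr_wpDl// mulr_ge0// sqrtr_ge0.
- move=> y Ky; have /andP[h1 h2] := bnd y; apply/eqP; rewrite eq_le.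
  rewrite (le_trans _ h1) ?indicE ?ler0n// andbT (le_trans h2)// indicE.
  case: (boolP (y \in _)) => // /set_mem yb; exfalso; move: Ky; apply/negP; rewrite -leNgt.
  apply: (@le_trans _ _ (Num.sqrt N%:R * K)); last by rewrite lerDl.
  apply: ler_enorm_sup => // i; rewrite /K (bigD1 i)//=; have /andP[h3 h4] := yb i.
  apply: (@le_trans _ _ (`|(ab.1 - const_mx d) ord0 i| + `|(ab.2 + const_mx d) ord0 i|)).
    rewrite ler_norml; have := ler_norm (- (ab.1 - const_mx d) ord0 i); rewrite normrN.
    have := ler_norm ((ab.2 + const_mx d) ord0 i).
    have := normr_ge0 ((ab.1 - const_mx d) ord0 i); have := normr_ge0 ((ab.2 + const_mx d) ord0 i).
    by move: h3 h4; rewrite /wide_box/=; lra.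
  by rewrite lerDl sumr_ge0// => j _; rewrite addr_ge0.
have mb := @lmeas_continuous R N setT _ (has_grad_continuous hG).
have ma : lmeas setT \1_(box ab) by exact: lmeas_indic (mble_box _).
have mw : lmeas setT \1_(box (wide_box ab d)) by exact: lmeas_indic (mble_box _).
have iE ab' : (\int[mu]_y (\1_(box ab') y)%:E = (box_vol ab')%:E)%E.
  by rewrite (leb_integral_indic mbleT (mble_box _)) setTI leb_outer_box.
rewrite -(@leeD2lE _ (box_vol ab)%:E)// -{1}iE /L1dist.
rewrite -(leb_integralD mbleT)//; last exact: lmeas_norm (lmeasB ma mb).
rewrite -EFinD; apply: (@le_trans _ _ (box_vol (wide_box ab d))%:E); last by rewrite lee_fin.
rewrite -iE; apply: (le_leb_integral mbleT) => //.
- exact: lmeasD ma (lmeas_norm (lmeasB ma mb)).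
- move=> y _; have /andP[h1 h2] := bnd y.
  rewrite ler0_norm ?subr_le0//; lra.
Qed.

(** Take a cover of [E] by boxes of total volume less than |E| + e/2 and keep the first n of them,
    the others having total volume below e/4. The sum [s] of the indicators of the boxes kept is the
    approximation. *)
Lemma smoothable_indic (E : set vec) : mble E -> (leb_outer R N E < +oo)%E -> smoothable \1_E.
Proof.
move=> mE fE; have mE1 := @lmeas_indic R N setT E mE.
apply: smoothable_lim => // e e0; have e20 : 0 < e / 2 by rewrite divr_gt0.
have Ef : leb_outer R N E \is a fin_num by rewrite ge0_fin_numE ?outer_measure_ge0.
have [_ [F [_ EF] <-] hF] := lb_ereal_inf_adherent e20 Ef.
rewrite -[ereal_inf _]/(leb_outer R N E) in hF.
pose c (o : option (vec * vec)) : R := oapp (@box_vol R N) 0 o.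
pose b o : vec -> R := \1_(oapp (@box R N) set0 o).
have mb o : mble (oapp (@box R N) set0 o) by case: o => [ab|]; [exact: mble_box|exact: measurable0].
have cE o : oapp (fun ab => (box_vol ab)%:E) 0%E o = (c o)%:E by case: o.
have ib o : (\int[mu]_y (b o y)%:E = (c o)%:E)%E.
  by rewrite (leb_integral_indic mbleT (mb _)) setTI; case: o => [ab|] /=; [exact: leb_outer_box|exact: outer_measure0].
have c0 o : 0 <= c o by case: o => //= ab; exact: box_vol_ge0.
rewrite (eq_eseriesr (fun k _ => cE (F k))) in hF.
have sb o : smoothable (b o).
  case: o => [ab|]; first exact: smoothable_box.
  by rewrite /b /= indic0; exact: smoothable_cst0.
have e40 : 0 < e / 4 by rewrite divr_gt0.
have sfin : (\sum_(k <oo) (c (F k))%:E < +oo)%E.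
  by apply: (lt_trans hF); rewrite lte_add_pinfty// ltry.
have t0 : nbhs (0 : \bar R) [set x | x < (e / 4)%:E]%E.
  by apply: open_nbhs_nbhs; split; [exact: open_ereal_lt_ereal|rewrite /= lte_fin].
have [n _ hn] := nneseries_tail_cvg sfin (fun k _ => c0 (F k)) t0.
have {}hn : (\sum_(n <= k <oo) (c (F k))%:E < (e / 4)%:E)%E := hn n (leqnn n).
pose U := \bigcup_(k in [set k | (k < n)%N]) oapp (@box R N) set0 (F k).
have mU : mble U by apply: bigcup_measurable => k _; exact: mb.
have mEU : mble (E `\` U) by exact: measurableD.
have tail : (leb_outer R N (E `\` U) <= (e / 4)%:E)%E.
  apply: (@le_trans _ _ (leb_outer R N (\bigcup_k oapp (@box R N) set0 (F (k + n)%N)))).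
    apply: le_leb => y [/EF[k _ Fky] nU]; have [kn|nk] := ltnP k n; first by case: nU; exists k.
    by exists (k - n)%N => //; rewrite subnK.
  apply: (le_trans (outer_measure_sigma_subadditive _ _)); apply: le_trans (ltW hn).
  rewrite -(@nneseries_addn _ (fun k => (c (F k))%:E) n); last by move=> k; rewrite lee_fin.
  apply: lee_nneseries => k _; first by move=> *; exact: outer_measure_ge0.
  case: (F (k + n)%N) => [ab|] /=; last by rewrite (outer_measure0 (leb_outer R N)).
  by have := leb_outer_box ab => ->.
pose s y := \sum_(k <- iota 0 n) b (F k) y.
exists s; first exact: smoothable_sum.
have b0 o y : 0 <= b o y by rewrite /b indicE.
have ms m : lmeas setT (fun y => \sum_(k <- iota 0 m) b (F k) y).
  by have [] := @smoothable_sum _ (iota 0 m) (fun k => b (F k)) (fun k => sb (F k)).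
have intS (l : seq nat) : (\int[mu]_y (\sum_(k <- l) b (F k) y)%:E = (\sum_(k <- l) c (F k))%:E)%E.
  elim: l => [|k l IH].
    by rewrite big_nil integral0_eq// => y _; rewrite big_nil.
  rewrite (_ : (fun y => _) = (fun y => (b (F k) y + \sum_(k <- l) b (F k) y)%:E)); last first.
    by apply/funext => y; rewrite big_cons.
  rewrite (leb_integralD mbleT)//.
  - by rewrite ib IH big_cons EFinD.
  - by have [] := sb (F k).
  - by have [] := @smoothable_sum _ l (fun k => b (F k)) (fun k => sb (F k)).
  - by move=> y _; rewrite sumr_ge0.
have s0 y : 0 <= s y by rewrite sumr_ge0.
have mEU1 := @lmeas_indic R N setT _ mEU.
(* Pointwise |1_E - s| + 1_E is at most s plus twice the indicator of [E] minus [U]: on the part of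
   [E] inside [U], s is at least 1. *)
have ls : (L1dist \1_E s + leb_outer R N E <= (\sum_(k <- iota 0 n) c (F k))%:E + 2%:E * leb_outer R N (E `\` U))%E.
  have IE : (\int[mu]_y (\1_E y)%:E = leb_outer R N E)%E.
    by rewrite (leb_integral_indic mbleT mE) setTI.
  have IEU : (\int[mu]_y (\1_(E `\` U) y)%:E = leb_outer R N (E `\` U))%E.
    by rewrite (leb_integral_indic mbleT mEU) setTI.
  rewrite -IE -IEU -intS -(leb_integralZ mbleT)// /L1dist -!(leb_integralD mbleT)//; last first.
  - exact: lmeas_norm (lmeasB mE1 (ms n)).
  - by move=> y _; exact: s0.
  - exact: lmeasZ.
  apply: (le_leb_integral mbleT).
  - exact: lmeasD (lmeas_norm (lmeasB mE1 (ms n))) mE1.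
  - exact: lmeasD (ms n) (lmeasZ _ mEU1).
  - by move=> y _; rewrite addr_ge0// indicE.
  move=> y _; rewrite -/(s y) !indicE; have sy := s0 y.
  have [yE|yE] := boolP (y \in E); last first.
    rewrite memNset/=; last by move=> [/mem_set]; rewrite (negbTE yE).
    by rewrite sub0r normrN ger0_norm//; lra.
  have [yU|yU] := boolP (y \in U).
    have s1 : 1 <= s y.
      move: yU => /set_mem[k /= kn Fky]; rewrite /s (big_rem k) ?mem_iota//= /b indicE mem_set//.
      by rewrite lerDl sumr_ge0.
    rewrite memNset/=; last by move=> [_]; apply; exact: set_mem.
    rewrite ler0_norm; lra.
  rewrite mem_set/=; last by split; [exact: set_mem|move/mem_set; rewrite (negbTE yU)].
  have := ler_normB (1 : R) (s y); rewrite normr1 (ger0_norm sy); lra.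
rewrite -(@leeD2rE _ (leb_outer R N E))//; apply: (le_trans ls).
have h1 : ((\sum_(k <- iota 0 n) c (F k))%:E <= leb_outer R N E + (e / 2)%:E)%E.
  apply: le_trans (ltW hF); rewrite -sumEFin.
  have := @nneseries_lim_ge R (fun k => (c (F k))%:E) xpredT 0 n (fun k _ _ => c0 (F k)).
  by rewrite /index_iota subn0.
apply: (le_trans (leeD h1 (lee_wpmul2l _ tail))); first by rewrite lee_fin.
rewrite -addeA addeC leeD2r// -EFinM -EFinD lee_fin; lra.
Qed.

End smooth_density.

Section smooth_density_integrable.
Context {R : realType} {N : nat}.
Notation vec := 'rV[R]_N.
Notation mu := (leb R N).
Notation T := (lebT R N).
Implicit Types (D : set vec) (f g w : vec -> R).
Import HBSimple.

Lemma lmeas_patch D w : mble D -> lmeas D w -> lmeas setT (w \_ D).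
Proof. by move=> mD; apply: (measurable_restrictT (w : T -> R) mD).1. Qed.

Lemma leb_integral_patch D w (h : R -> \bar R) : h 0 = 0%E ->
  (\int[mu]_(y in D) h (w y) = \int[mu]_y h ((w \_ D) y))%E.
Proof.
move=> h0; rewrite integral_mkcond; apply: eq_integral => y _.
by rewrite /patch; case: ifPn => // _; rewrite h0.
Qed.

Lemma smoothable_integrable D w : mble D -> (leb_outer R N D < +oo)%E ->
  mu.-integrable D (EFin \o w) -> smoothable (w \_ D).
Proof.
move=> mD fD iw; have mw := lmeas_integrable iw.
apply: smoothable_lim => [|e e0]; first exact: lmeas_patch.
have [g [ig _ gw]] := @approximation_sfun_integrable _ T R mu D mD _ iw.
have t0 : nbhs (0 : \bar R) [set x | x < e%:E]%E.
  by apply: open_nbhs_nbhs; split; [exact: open_ereal_lt_ereal|rewrite /= lte_fin].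
have [n _ hn] := gw _ t0.
have {}hn : (\int[mu]_(y in D) `|(w y)%:E - (g n y)%:E| < e%:E)%E := hn n (leqnn n).
pose h (y : vec) : R := g n y.
have hE : (h \_ D) = (fun y => \sum_(c <- finmap.enum_fset (fset_set (range (g n)))) c * \1_(D `&` g n @^-1` [set c]) y).
  apply/funext => y; rewrite /patch; case: ifPn => yD; last first.
    rewrite big1// => c _; rewrite indicE memNset ?mulr0//.
    by move=> [/mem_set]; rewrite (negbTE yD).
  rewrite /h fimfunE fsbig_finite//=; apply: eq_bigr => c _; congr (_ * _).
  rewrite !indicE; congr (_%:R); apply: congr1; apply/idP/idP => /set_mem h1; apply/mem_set; last by case: h1.
  by split=> //; exact: set_mem.
exists (h \_ D).
  rewrite hE; apply: smoothable_sum => c; apply: smoothableZ; apply: smoothable_indic.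
    by apply: (@measurableI _ T) => //; exact: measurable_sfunP.
  by apply: (le_lt_trans _ fD); apply: le_leb => y [].
apply: le_trans (ltW hn); rewrite /L1dist [in leRHS]integral_mkcond.
rewrite le_eqVlt; apply/orP; left; apply/eqP; apply: eq_integral => y _.
by rewrite /patch; case: ifPn => // _; rewrite subrr normr0.
Qed.

End smooth_density_integrable.

Section dual_norm.
Context {R : realType} {N : nat}.
Notation vec := 'rV[R]_N.
Notation mu := (leb R N).
Notation T := (lebT R N).

Definition annulus (a b : R) : set vec := [set y | a < enorm y < b].

Lemma annulusE (a b : R) : annulus a b = eball 0 b `\` ceball 0 a.
Proof.
apply/seteqP; split=> y; rewrite /annulus/eball/ceball/= subr0.
  by move=> /andP[h ->]; split=> //; apply/negP; rewrite -ltNge.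
by move=> [-> /negP]; rewrite -ltNge => ->.
Qed.

Lemma open_annulus (a b : R) : open (annulus a b).
Proof.
rewrite annulusE; apply: openI; first exact: open_eball.
exact/closed_openC/closed_ceball.
Qed.

Lemma mble_annulus (a b : R) : mble (annulus a b).
Proof. by apply: open_mble; exact: open_annulus. Qed.

Lemma leb_annulus_fin (a b : R) : (leb_outer R N (annulus a b) < +oo)%E.
Proof.
have := @ceball_leb_fin R N (annulus a b) b; apply=> y /andP[_ /ltW].
by rewrite /ceball/= subr0.
Qed.

(** The radii [a'] and [b'] keep the support at a positive distance from both boundary spheres. *)
Definition annulus_test (a b : R) (g : vec -> R) : Prop :=
  exists G a' b', [/\ has_grad g G, a < a', b' < b,
    (forall y, g y != 0 -> a' <= enorm y <= b') & forall y, `|g y| <= 1].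

(** The test function is a smoothed sign of a C^1 approximation [g] of [w], cut off near the
    boundary by [chi d]; then d tends to 0 by dominated convergence. *)
Lemma dual_norm_le (a b : R) (w : vec -> R) (C : R) : 0 <= a < b ->
  mu.-integrable (annulus a b) (EFin \o w) ->
  (forall g, annulus_test a b g -> (\int[mu]_(y in annulus a b) (w y * g y))%R <= C) ->
  (\int[mu]_(y in annulus a b) `|w y|%:E <= C%:E)%E.
Proof.
move=> /andP[a0 ab] iw H; set D := annulus a b in iw H *.
have mD : mble D by exact: mble_annulus.
have fD : (leb_outer R N D < +oo)%E by exact: leb_annulus_fin.
have mw := lmeas_integrable iw; have iaw := integrable_norm iw.
pose chi (d : R) (y : vec) : R := (1 - cutoff (a + d) (a + 2 * d) y) * cutoff (b - 2 * d) (b - d) y.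
have chi01 d y : 0 <= chi d y <= 1.
  have := @cutoff_ge0 R N (a + d) (a + 2 * d) y; have := @cutoff_le1 R N (a + d) (a + 2 * d) y.
  have := @cutoff_ge0 R N (b - 2 * d) (b - d) y; have := @cutoff_le1 R N (b - 2 * d) (b - d) y.
  move=> h1 h2 h3 h4; rewrite /chi mulr_ge0 ?subr_ge0//= mulr_ile1 ?subr_ge0//; lra.
have cchi d : exists G, has_grad (chi d) G.
  eexists; apply: has_gradM; last exact: has_grad_cutoff.
  apply: (eq_has_grad _ (has_gradD (has_grad_cst 1) (has_gradZ (-1) (@has_grad_cutoff R N (a + d) (a + 2 * d))))) => y.
  by rewrite mulN1r.
have key (d : R) : 0 < d < (b - a) / 4 -> (\int[mu]_(y in D) (`|w y| * chi d y)%:E <= C%:E)%E.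
  move=> /andP[d0 d4].
  have ad0 : 0 < a + d by rewrite ltr_wpDl.
  have ad2 : a + d < a + 2 * d by lra.
  have bd0 : 0 < b - 2 * d by lra.
  have bd2 : b - 2 * d < b - d by lra.
  have [Gchi hchi] := cchi d.
  have mchi := @lmeas_continuous R N D _ (has_grad_continuous hchi).
  pose m := fine (leb_outer R N D).
  have mE : leb_outer R N D = m%:E by rewrite fineK// ge0_fin_numE ?outer_measure_ge0.
  have m0 : 0 <= m by rewrite -lee_fin -mE outer_measure_ge0.
  (* Chosen so that the total error 2 h + 2 h m equals [e], with [m] the measure of the annulus. *)
  apply/lee_addgt0Pr => e e0; pose h := e / (2 + 2 * m).
  have h0 : 0 < h by rewrite divr_gt0//; lra.
  have [_ /(_ h h0)[g [G [K [hg K0 g0 gw]]]]] := smoothable_integrable mD fD iw.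
  have cg := has_grad_continuous hg.
  (* A C^1 sign function: -1 below -h, 1 above h, and t sgn(t) >= |t| - 2 h everywhere. *)
  pose sgn (t : R) : R := 2 * step (t / (2 * h) + 1 / 2) - 1.
  have sgn1 t : `|sgn t| <= 1.
    by rewrite /sgn ler_norml; have := @step_ge0 R (t / (2 * h) + 1 / 2); have := @step_le1 R (t / (2 * h) + 1 / 2); lra.
  have sgnt t : `|t| - 2 * h <= t * sgn t.
    have h20 : 0 < 2 * h by rewrite mulr_gt0.
    rewrite /sgn; have [t1|t1] := leP h t.
      rewrite step_ge1 ?ger0_norm; try lra.
      by rewrite -lerBlDr ler_pdivlMr//; lra.
    have [t2|t2] := leP t (- h).
      rewrite step_le0 ?ler0_norm; try lra.
      by rewrite -lerBrDr sub0r ler_pdivrMr//; lra.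
    have := sgn1 t; rewrite /sgn; set s := 2 * _ - 1 => s1.
    have th : `|t| <= h by rewrite ler_norml; lra.
    have : `|t * s| <= h * 1 by rewrite normrM ler_pM.
    rewrite ler_norml mulr1; have := normr_ge0 t; lra.
  have hs : exists S, has_grad (fun y => sgn (g y)) S.
    have h1 := has_gradD (has_gradZ (2 * h)^-1 hg) (has_grad_cst (1 / 2)).
    have h2 := has_grad_comp (@is_derive_step R) (@continuous_step' R) h1.
    have h3 := has_gradD (has_gradZ 2 h2) (has_grad_cst (-1)).
    eexists; apply: (eq_has_grad _ h3) => y; by rewrite /sgn [g y / _]mulrC.
  have [S hS] := hs.
  pose phi y := sgn (g y) * chi d y.
  have tphi : annulus_test a b phi.
    exists (fun y => sgn (g y) *: Gchi y + chi d y *: S y), (a + d), (b - d); split.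
    - exact: has_gradM hS hchi.
    - by rewrite ltrDl.
    - by rewrite ltrBlDr ltrDl.
    - move=> y; apply: contraR; rewrite negb_and -!ltNge /phi /chi => /orP[/ltW ya|/ltW yb].
        by rewrite (cutoff_in ad0 ad2 ya).1 subrr mul0r mulr0.
      by rewrite (cutoff_out bd0 bd2 yb).1 !mulr0.
    - move=> y; have /andP[c0 c1] := chi01 d y.
      by rewrite /phi normrM (ger0_norm c0) mulr_ile1.
  have sphi y : `|phi y| <= 1 by case: tphi => ? [? [? []]].
  have mphi : lmeas D phi.
    by apply: lmeas_continuous; case: tphi => G' [? [? [hG' _ _ _ _]]]; exact: (has_grad_continuous hG').
  have iwphi := integrable_mulr_bounded mD iw mphi (fun y _ => sphi y).
  have [M M0 hM] := continuous_bounded_ceball b cg.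
  have ig : mu.-integrable D (EFin \o g).
    apply: (integrable_bounded mD fD (lmeas_continuous cg)) => y /andP[_ /ltW]; exact: hM.
  have iwg := integrable_norm (integrable_subr mD iw ig).
  have i1 : mu.-integrable D (EFin \o (fun=> 1)) by exact: integrable_cst1.
  have iwc : mu.-integrable D (EFin \o (fun y => `|w y| * chi d y)).
    apply: (integrable_mulr_bounded (M := 1) mD iaw mchi) => y _.
    by have /andP[c0 c1] := chi01 d y; rewrite ger0_norm.
  have iB := integrable_addr mD (integrable_addr mD iwphi (integrable_scale 2 mD iwg)) (integrable_scale (2 * h) mD i1).
  have ptw y : D y -> `|w y| * chi d y <= w y * phi y + 2 * `|w y - g y| + 2 * h * 1.
    move=> _; have /andP[c0 c1] := chi01 d y; rewrite /phi mulr1.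
    have t1 : `|w y| * chi d y <= `|g y| * chi d y + `|w y - g y|.
      have : `|w y| <= `|g y| + `|w y - g y| by rewrite addrC; have := ler_normD (w y - g y) (g y); rewrite subrK.
      move=> /(ler_wpM2r c0) => t; apply: (le_trans t); rewrite mulrDl lerD2l.
      by rewrite ler_piMr.
    have t2 : `|g y| * chi d y - 2 * h <= g y * sgn (g y) * chi d y.
      apply: le_trans (ler_wpM2r c0 (sgnt (g y))); rewrite mulrBl lerD2l lerN2.
      by rewrite ler_piMr// mulr_ge0// ltW.
    have t3 : `|(g y - w y) * (sgn (g y) * chi d y)| <= `|w y - g y|.
      by rewrite normrM (distrC (g y)) ler_piMr// -/(phi y).
    move: t3; rewrite ler_norml => /andP[_ t3]; lra.
  have Rle := le_Rintegral mD iwc iB ptw.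
  rewrite -[X in (X <= _)%E]fineK; last exact: (integrable_fin_num mD iwc).
  rewrite -EFinD lee_fin; apply: (le_trans Rle).
  rewrite (RintegralD mD) //; last 2 first.
  - exact: (integrable_addr mD iwphi (integrable_scale 2 mD iwg)).
  - exact: (integrable_scale (2 * h) mD i1).
  rewrite (RintegralD mD iwphi (integrable_scale 2 mD iwg)) (RintegralZl _ mD iwg) (RintegralZl _ mD i1).
  have e1 : (\int[mu]_(y in D) 1 = m)%R by rewrite Rintegral_cst//= mul1r /m.
  have e2 : (\int[mu]_(y in D) `|w y - g y| <= h)%R.
    rewrite -lee_fin /Rintegral fineK; last exact: (integrable_fin_num mD iwg).
    apply: le_trans gw; rewrite /L1dist.
    have mp := lmeas_norm (lmeasB (lmeas_patch mD mw) (@lmeas_continuous R N setT _ cg)).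
    apply: le_trans (leb_integral_le_subset mD mbleT (@subsetT _ D) mp (fun y _ => normr_ge0 _)).
    rewrite le_eqVlt; apply/orP; left; apply/eqP; apply: eq_integral => y yD.
    by rewrite /patch yD.
  have := H _ tphi; rewrite e1 -addrA => Hp; apply: lerD => //.
  have -> : e = 2 * h + 2 * h * m.
    have : h * (2 + 2 * m) = e by rewrite divfK// gt_eqF//; lra.
    by lra.
  by rewrite lerD2r ler_pM2l.
pose d (n : nat) : R := (b - a) / 5 * n.+1%:R^-1.
have d5 n : 0 < d n <= (b - a) / 5.
  have ba0 : 0 < (b - a) / 5 by rewrite divr_gt0// subr_gt0.
  by rewrite mulr_gt0//= ler_piMr ?(ltW ba0)// invf_le1// ler1n.
have cv : (\int[mu]_(y in D) (`|w y| * chi (d n) y)%:E)%E @[n --> \oo] --> (\int[mu]_(y in D) `|w y|%:E)%E.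
  apply: (@dominated_cvg _ T R mu D mD (fun n y => (`|w y| * chi (d n) y)%:E) (fun y => `|w y|%:E) (fun y => `|w y|%:E)).
  - move=> n; apply/measurable_EFinP; apply: lmeasM (lmeas_norm mw) _; apply: lmeas_continuous.
    by have [G hG] := cchi (d n); exact: (has_grad_continuous hG).
  - move=> y /andP[ay yb]; apply: cvg_near_cst.
    pose s := Num.min (enorm y - a) (b - enorm y) / ((b - a) * 2).
    have m0 : 0 < Num.min (enorm y - a) (b - enorm y) by rewrite lt_min !subr_gt0 ay.
    have ba0 : 0 < b - a by rewrite subr_gt0.
    have s0 : 0 < s by rewrite divr_gt0// mulr_gt0.
    near=> n; have ns : n.+1%:R^-1 < s by near: n; exact: (near_infty_natSinv_lt (PosNum s0)).
    have dn : 2 * d n <= Num.min (enorm y - a) (b - enorm y).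
      move: (ltW ns); rewrite ler_pdivlMr ?mulr_gt0// => h1; apply: le_trans h1; rewrite /d.
      set q := n.+1%:R^-1; have q0 : 0 <= q by rewrite invr_ge0.
      have : 0 <= q * (b - a) by rewrite mulr_ge0// ltW.
      lra.
    have [dn1 dn2] : 2 * d n <= enorm y - a /\ 2 * d n <= b - enorm y.
      by move: dn; rewrite le_min => /andP.
    have /andP[dn0 dn5] := d5 n.
    have i1 : 0 < a + d n by lra.
    have i2 : a + d n < a + 2 * d n by lra.
    have i3 : 0 < b - 2 * d n by lra.
    have i4 : b - 2 * d n < b - d n by lra.
    have i5 : a + 2 * d n <= enorm y by lra.
    have i6 : enorm y <= b - 2 * d n by lra.
    by rewrite /chi (cutoff_out i1 i2 i5).1 (cutoff_in i3 i4 i6).1 subr0 !mulr1.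
  - by [].
  - exact: iaw.
  - move=> n y _; rewrite lee_fin normrM normr_id; have /andP[c0 c1] := chi01 (d n) y.
    by rewrite ger0_norm// ler_piMr.
apply: (cvge_le _ cv); apply: nearW => n; apply: key.
have /andP[-> h] := d5 n; apply: (le_lt_trans h); lra.
Unshelve. all: by end_near. Qed.

End dual_norm.

(** * Variation and dilations *)

Section dilation_variation.
Context {R : realType} {N : nat}.
Notation vec := 'rV[R]_N.
Notation mu := (leb R N).
Notation T := (lebT R N).
Variables (r : R) (u : vec -> R).
Hypotheses (N0 : (0 < N)%N) (r0 : 0 < r).
Notation B := (eball (0 : vec) r).
Hypothesis iu : mu.-integrable B (EFin \o u).

Let mB : mble B := @mble_eball R N 0 r.

Let Br : B `<=` ceball 0 r. Proof. by move=> y; rewrite /eball/ceball/= => /ltW. Qed.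

Let annulus_sub (a b : R) : b <= r -> annulus a b `<=` B.
Proof. by move=> br y /andP[_ yb]; rewrite /eball/= subr0 (lt_le_trans yb). Qed.

Lemma integrable_dilate (l a b : R) : 0 < l <= 1 -> b <= r ->
  mu.-integrable (annulus a b) (EFin \o (fun y => u (l *: y))).
Proof.
move=> /andP[l0 l1] br; have := integrable_affine 0 l0 mB (lmeas_integrable iu) iu.
rewrite (_ : (fun x : vec => u (l *: x + 0)) = (fun x => u (l *: x))); last first.
  by apply/funext => x; rewrite addr0.
move=> h; apply: (@integrableS _ T R mu _ (annulus a b)) h => //.
- by apply: mble_affine.
- exact: mble_annulus.
move=> y /andP[_ yb]; rewrite /preimage/eball/= addr0 subr0 enormZ gtr0_norm//.
by apply: le_lt_trans (lt_le_trans yb br); rewrite ler_piMl ?enorm_ge0.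
Qed.

(* The left-hand side is minus the derivative at [c] of
   [t |-> int u(y) t^N g(t y) dy]; the integrand is a multiple of [u] times the
   divergence of the radial field [g(c y) y]. *)
Lemma dilation_test_le (l a b c : R) (g : vec -> R) (G : vec -> vec) (a' b' : R) :
  0 < l < 1 -> 0 <= a -> b <= r -> 1 <= c < l^-1 ->
  has_grad g G -> a < a' -> b' < b -> (forall y, g y != 0 -> a' <= enorm y <= b') -> (forall y, `|g y| <= 1) ->
  ((- \int[mu]_(y in B) (u y * (N%:R * c ^+ N.-1 * g (c *: y) + c ^+ N * dotv (G (c *: y)) y)))%R%:E <=
   (r * l ^- N)%:E * variation (annulus (l * a) b) u)%E.
Proof.
move=> /andP[l0 l1] a0 br /andP[c1 cl] hg aa' b'b gs g1.
have c0 : 0 < c by exact: lt_le_trans c1.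
pose k : R := r * l ^- N.
have k0 : 0 < k by rewrite mulr_gt0// invr_gt0 exprn_gt0.
(* The factor 1/k gives [psi] norm at most 1, since c^(N-1) |y| <= r l^(-N) on its support; the
   power of c produces those in the integrand. *)
pose al : R := - k^-1 * c ^+ N.-1.
have hh := has_gradZ al (has_grad_affine c 0 hg).
pose h (y : vec) : R := al * g (c *: y + 0).
pose psi (y : vec) : vec := h y *: y.
have hpsi : test_field (annulus (l * a) b) psi.
  (* Since 1 <= c < 1/l, dividing the radii [a'] and [b'] by c keeps them between l a and b. *)
  pose C : set vec := [set y | a' / c <= enorm y <= b' / c].
  apply: (@test_field_of_grads _ _ _ C _ _ r (fun j => has_grad_radial j hh)).
  - rewrite (_ : C = ceball 0 (b' / c) `\` eball 0 (a' / c)); last first.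
      apply/seteqP; split=> y; rewrite /C/eball/ceball/= subr0.
        by move=> /andP[h1 ->]; split=> //; apply/negP; rewrite -leNgt.
      by move=> [-> /negP]; rewrite -leNgt andbT.
    by apply: closedI; [exact: closed_ceball|apply: open_closedC; exact: open_eball].
  - move=> y /andP[h1 h2]; apply/andP; split.
      apply: lt_le_trans h1; rewrite ltr_pdivlMr//; apply: le_lt_trans aa'.
      rewrite mulrAC -mulrA; have : l * c <= 1.
        by rewrite -(mulfV (x := l)) ?gt_eqF// ler_pM2l// ltW.
      by move=> lc; rewrite mulrA ler_piMl.
    apply: (le_lt_trans h2); rewrite ltr_pdivrMr//; apply: (lt_le_trans b'b).
    have [bn|bn] := leP 0 b; first by rewrite ler_peMr.
    have := le_trans (enorm_ge0 y) h2; rewrite pmulr_lge0 ?invr_gt0// => /(le_lt_trans)/(_ b'b).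
    by rewrite ltNge (ltW bn).
  - move=> y /andP[_ h2]; rewrite /ceball/= subr0; apply: (le_trans h2).
    have b'0 : 0 <= b' by have := le_trans (enorm_ge0 y) h2; rewrite pmulr_lge0 ?invr_gt0.
    rewrite ler_pdivrMr//; apply: (@le_trans _ _ r); first exact: ltW (lt_le_trans b'b br).
    by rewrite ler_peMr// ltW.
  - move=> y nC; rewrite /psi /h; have [->|gy] := eqVneq (g (c *: y + 0)) 0; first by rewrite mulr0 scale0r.
    exfalso; apply: nC; have := gs _ gy; rewrite addr0 enormZ gtr0_norm// => /andP[h1 h2].
    by rewrite /C/= ler_pdivrMr// ler_pdivlMr// ![enorm y * c]mulrC h1.
  - move=> y; rewrite /psi /h enormZ addr0; have [->|gy] := eqVneq (g (c *: y)) 0.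
      by rewrite mulr0 normr0 mul0r.
    have := gs _ gy; rewrite enormZ gtr0_norm// => /andP[_ h2].
    have yr : enorm y <= r.
      apply: (@le_trans _ _ (c * enorm y)); first by rewrite ler_peMl ?enorm_ge0.
      by apply: (le_trans h2); exact: ltW (lt_le_trans b'b br).
    have -> : `|al * g (c *: y)| = k^-1 * c ^+ N.-1 * `|g (c *: y)|.
      by rewrite normrM /al normrM normrN [`|k^-1|]gtr0_norm ?invr_gt0// [`|c ^+ _|]ger0_norm ?exprn_ge0 ?(ltW c0).
    rewrite -!mulrA ler_pdivrMl// mulr1.
    apply: (@le_trans _ _ (c ^+ N.-1 * (1 * r))).
      by rewrite ler_wpM2l ?exprn_ge0 ?(ltW c0)// ler_pM ?enorm_ge0.
    rewrite mul1r /k mulrC ler_pM2l// -exprVn.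
    apply: (@le_trans _ _ (l^-1 ^+ N.-1)); first by rewrite lerXn2r ?nnegrE ?invr_ge0 ?(ltW l0)// ?(ltW c0)// ltW.
    by apply: ler_weXn2l; [rewrite invf_ge1// ltW|exact: leq_pred].
have : ((\int[mu]_(y in annulus (l * a) b) (u y * divergence psi y)%:E) <= variation (annulus (l * a) b) u)%E.
  by apply: ereal_sup_ubound; exists psi.
have -> : (\int[mu]_(y in annulus (l * a) b) (u y * divergence psi y)%:E =
           \int[mu]_(y in B) (u y * divergence psi y)%:E)%E.
  rewrite [LHS]integral_mkcond [RHS]integral_mkcond; apply: eq_integral => y _.
  rewrite /patch; case: ifPn => yA.
    by rewrite (mem_set (annulus_sub br (set_mem yA))).
  case: ifPn => // _; rewrite (test_field_out hpsi _).2 ?mulr0//.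
  by move=> /mem_set; rewrite (negbTE yA).
pose J (y : vec) : R := u y * (N%:R * c ^+ N.-1 * g (c *: y) + c ^+ N * dotv (G (c *: y)) y).
have divE y : u y * divergence psi y = - k^-1 * J y.
  rewrite /psi (divergence_radial y hh) /h /J addr0 !dotvZl /al.
  have -> : c ^+ N = c * c ^+ N.-1 by rewrite -exprS (prednK N0).
  set w := dotv _ _; set q := c ^+ _; set d := k^-1; lra.
have iJ : mu.-integrable B (EFin \o J).
  have cJ : continuous (fun y : vec => N%:R * c ^+ N.-1 * g (c *: y) + c ^+ N * dotv (G (c *: y)) y).
    have [_ cG] := hg; apply: continuous_addf.
      have := has_grad_continuous (has_gradZ (N%:R * c ^+ N.-1) (has_grad_affine c 0 hg)).
      rewrite (_ : (fun y : vec => _ * g (c *: y + 0)) = (fun y => N%:R * c ^+ N.-1 * g (c *: y)))//.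
      by apply/funext => y; rewrite addr0.
    apply: continuous_mulf; first exact: cst_continuous.
    exact: continuous_dotv_scale.
  have [M M0 hM] := continuous_bounded_ceball r cJ.
  apply: (integrable_mulr_bounded mB iu (lmeas_continuous cJ)) => y yB; apply: hM.
  by have := Br yB; rewrite /ceball/= subr0.
rewrite (eq_integral (fun y : T => (- k^-1 * J y)%:E)); last by move=> y _; rewrite divE.
have -> : (\int[mu]_(y in B) (- k^-1 * J y)%:E = (- k^-1 * \int[mu]_(y in B) J y)%R%:E)%E.
  rewrite -(RintegralZl _ mB iJ) /Rintegral fineK//.
  exact: (integrable_fin_num mB (integrable_scale (- k^-1) mB iJ)).
rewrite -/k -/J -(lee_pdivrMl _ _ k0) -EFinM.
by apply: le_trans; rewrite lee_fin mulrN mulNr.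
Qed.

(** Paired with g, the difference u - u(l y) gives F(1) - F(1/l), where F(t) is the integral of u(y)
    t^N g(t y). The mean value theorem and [dilation_test_le] bound it, and [dual_norm_le]
    concludes. *)
Lemma dilation_variation (l a b : R) : 0 < l < 1 -> 0 <= a < b -> b <= r ->
  (\int[mu]_(y in annulus a b) `|u y - u (l *: y)|%:E <=
   ((l^-1 - 1) * (r * l ^- N))%:E * variation (annulus (l * a) b) u)%E.
Proof.
move=> l01 /andP[a0 ab] br; have /andP[l0 l1] := l01.
set V := variation _ _; have V0 : (0 <= V)%E by exact: variation_ge0.
have l11 : 0 < l^-1 - 1 by rewrite subr_gt0 invf_gt1.
have k0 : 0 < r * l ^- N by rewrite mulr_gt0// invr_gt0 exprn_gt0.
have K0 : 0 < (l^-1 - 1) * (r * l ^- N) by rewrite mulr_gt0.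
have [VE|VE] := eqVneq V +oo%E; first by rewrite VE gt0_muley ?lte_fin// leey.
have Vf : V \is a fin_num by rewrite ge0_fin_numE// ltey.
rewrite -(fineK Vf) -EFinM; set v := fine V.
have mA := @mble_annulus R N a b.
have iuA : mu.-integrable (annulus a b) (EFin \o u).
  exact: (@integrableS _ T R mu B _ _ mB mA (annulus_sub br) iu).
have ilA : mu.-integrable (annulus a b) (EFin \o (fun y => u (l *: y))).
  by apply: integrable_dilate; rewrite ?l0 ?(ltW l1).
apply: dual_norm_le; [by rewrite a0|exact: (integrable_subr mA iuA ilA)|].
move=> g [G [a' [b' [hg aa' b'b gs g1]]]].
have cg := has_grad_continuous hg.
have gout y : ~ annulus a b y -> g y = 0.
  move=> ny; apply/eqP; apply: contra_notT ny => /gs/andP[h1 h2].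
  by rewrite /annulus/= (lt_le_trans aa')//= (le_lt_trans h2).
pose F (t : R) := (\int[mu]_(y in B) (u y * (t ^+ N * g (t *: y))))%R.
pose F' (t : R) := (\int[mu]_(y in B) (u y * (N%:R * t ^+ N.-1 * g (t *: y) + t ^+ N * dotv (G (t *: y)) y)))%R.
have dF (t : R) : 0 < t -> is_derive t (1 : R) F (F' t) by move=> t0; exact: dilation_derive mB Br iu hg t0.
have iug (w : vec -> R) : mu.-integrable (annulus a b) (EFin \o w) ->
    mu.-integrable (annulus a b) (EFin \o (fun y => w y * g y)).
  by move=> iw; apply: (integrable_mulr_bounded mA iw (lmeas_continuous cg)) => y _; exact: g1.
have E1 : (\int[mu]_(y in annulus a b) (u y * g y) = F 1)%R.
  rewrite /F /Rintegral; congr fine; rewrite [LHS]integral_mkcond [RHS]integral_mkcond.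
  apply: eq_integral => y _; rewrite /patch; case: ifPn => yA.
    by rewrite (mem_set (annulus_sub br (set_mem yA))) expr1n mul1r scale1r.
  case: ifPn => // _; rewrite expr1n mul1r scale1r gout ?mulr0//.
  by move=> /mem_set; rewrite (negbTE yA).
have E2 : (\int[mu]_(y in annulus a b) (u (l *: y) * g y) = F l^-1)%R.
  pose f (z : vec) : R := u z * g (l^-1 *: z).
  have cgl : continuous (fun z : vec => g (l^-1 *: z)).
    have := has_grad_continuous (has_grad_affine l^-1 0 hg).
    rewrite (_ : (fun y : vec => g (l^-1 *: y + 0)) = (fun y => g (l^-1 *: y)))//.
    by apply/funext => y; rewrite addr0.
  have if_ : mu.-integrable B (EFin \o f).
    by apply: (integrable_mulr_bounded mB iu (lmeas_continuous cgl)) => y _; exact: g1.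
  have := integral_affine 0 l0 mB (lmeas_integrable if_) if_.
  have -> : (\int[mu]_(y in (fun x => l *: x + 0)%R @^-1` B) (f (l *: y + 0)%R)%:E =
             \int[mu]_(y in annulus a b) (u (l *: y) * g y)%:E)%E.
    rewrite [LHS]integral_mkcond [RHS]integral_mkcond; apply: eq_integral => y _.
    rewrite /patch /f addr0 scalerA mulVf ?gt_eqF// scale1r; case: ifPn => yB; case: ifPn => yA //.
      by rewrite gout ?mulr0// => /mem_set; rewrite (negbTE yA).
    exfalso; move: yB => /negP; apply; apply/mem_set; have /andP[_ yb] := set_mem yA.
    rewrite /preimage/eball/= addr0 subr0 enormZ gtr0_norm//.
    by apply: le_lt_trans (lt_le_trans yb br); rewrite ler_piMl ?enorm_ge0// ltW.
  rewrite /F /Rintegral => ->.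
  have i2 : mu.-integrable B (EFin \o f) by [].
  have -> : (fun y : T => (u y * (l^-1 ^+ N * g (l^-1 *: y)))%:E) = (fun y => ((l ^- N) * f y)%:E).
    by apply/funext => y; rewrite /f exprVn mulrCA.
  have := integrableZl mB (l ^- N) i2; rewrite -integralZl//.
have iw1 := iug _ iuA; have iw2 := iug _ ilA.
have -> : (\int[mu]_(y in annulus a b) ((u y - u (l *: y)) * g y) = F 1 - F l^-1)%R.
  rewrite -E1 -E2 -(RintegralB mA iw1 iw2); apply: eq_Rintegral => y _; by rewrite mulrBl.
have l11' : 1 < l^-1 by rewrite invf_gt1.
have dF1 (t : R) : t \in `]1, l^-1[%R -> is_derive t (1 : R) F (F' t).
  by rewrite in_itv/= => /andP[t1 _]; apply: dF; exact: lt_trans t1.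
have cF : {within `[1, l^-1], continuous F}.
  apply: derivable_within_continuous => t; rewrite in_itv/= => /andP[t1 _].
  by have [] := dF t (lt_le_trans ltr01 t1).
have [c cI FE] := MVT l11' dF1 cF.
move: cI; rewrite in_itv/= => /andP[c1 cl].
have c1l : 1 <= c < l^-1 by rewrite ltW.
have := dilation_test_le l01 a0 br c1l hg aa' b'b gs g1.
rewrite -/V -(fineK Vf) -EFinM lee_fin -/v -/(F' c) => H.
have -> : F 1 - F l^-1 = (l^-1 - 1) * (- F' c) by rewrite mulrN mulrC -FE opprB.
by rewrite -mulrA ler_pM2l.
Qed.

End dilation_variation.

Section variation_additivity.
Context {R : realType} {N : nat}.
Notation vec := 'rV[R]_N.
Notation mu := (leb R N).
Notation T := (lebT R N).
Implicit Types (Om A B : set vec) (u : vec -> R) (phi psi : vec -> vec).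

Lemma test_field_sub A Om phi : A `<=` Om -> test_field A phi -> test_field Om phi.
Proof. by move=> AO [d c k s p1]; split=> //; exact: subset_trans AO. Qed.

Lemma variation_le_sub A Om u : A `<=` Om -> (variation A u <= variation Om u)%E.
Proof.
move=> AO; apply: ge_ereal_sup => _ [phi hphi <-].
rewrite (integral_div_setT u hphi) -(integral_div_setT u (test_field_sub AO hphi)).
by apply: ereal_sup_ubound; exists phi => //; exact: test_field_sub hphi.
Qed.

(** The two fields live in disjoint sets, so their sum is still bounded by 1. *)
Lemma test_field_add A B Om phi psi : A `<=` Om -> B `<=` Om -> A `&` B = set0 ->
  test_field A phi -> test_field B psi -> test_field Om (fun x => phi x + psi x) /\
  (forall x, divergence (fun x => phi x + psi x) x = divergence phi x + divergence psi x).
Proof.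
move=> AO BO AB hphi hpsi; case: (hphi) => d1 c1 k1 s1 p1; case: (hpsi) => d2 c2 k2 s2 p2.
pose G (j : 'I_N) (x : vec) : vec := (col j (jacobian phi x))^T + (col j (jacobian psi x))^T.
have hG j : has_grad (fun x => (phi x + psi x) ord0 j) (G j).
  apply: (eq_has_grad _ (has_gradD (grads_of_field j d1 c1) (grads_of_field j d2 c2))) => x.
  by rewrite mxE.
have [d c e] := field_of_grads hG; split; last first.
  move=> x; rewrite e /divergence /mxtrace -big_split; apply: eq_bigr => j _.
  by rewrite /G [LHS]mxE [X in X + _]mxE [X in X + _]mxE [X in _ + X]mxE [X in _ + X]mxE.
have sub : closure [set x | phi x + psi x != 0] `<=`
    closure [set x | phi x != 0] `|` closure [set x | psi x != 0].
  rewrite -closureU; apply: closure_subset => x /=.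
  by have [->|] := eqVneq (phi x) 0; [rewrite add0r; right|left].
split=> //.
- apply: (subclosed_compact _ (compactU k1 k2) sub); exact: closed_closure.
- by apply: (subset_trans sub) => x [/s1/AO|/s2/BO].
- move=> x; have [Ax|nAx] := pselect (A x); last by rewrite (test_field_out hphi nAx).1 add0r.
  have nBx : ~ B x by move=> Bx; have : (A `&` B) x by []; rewrite AB.
  by rewrite (test_field_out hpsi nBx).1 addr0.
Qed.

Lemma variation_superadditive A B Om u : mble Om -> mu.-integrable Om (EFin \o u) ->
  A `<=` Om -> B `<=` Om -> A `&` B = set0 -> (variation A u + variation B u <= variation Om u)%E.
Proof.
move=> mO iu AO BO AB.
have i1 phi : test_field Om phi -> mu.-integrable Om (EFin \o (fun y => u y * divergence phi y)).
  move=> hphi; have [K K0 hK] := test_field_support hphi.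
  have cd := continuous_divergence hphi; have [M M0 hM] := continuous_bounded_ceball K cd.
  apply: (@integrable_mulr_bounded _ _ _ _ _ M mO iu (lmeas_continuous cd)) => y _.
  have [/hM//|Ky] := leP (enorm y) K.
  have sub : test_field (ceball 0 K : set vec) phi.
    case: hphi => d c cs _ p1; split=> //; apply: closed_support; first exact: closed_ceball.
    by move=> z; rewrite /ceball/= subr0 => /negP; rewrite -ltNge; exact: hK.
  have -> := (test_field_out (y := y) sub _).2; first by rewrite normr0.
  by rewrite /ceball/= subr0 => /(lt_le_trans Ky); rewrite ltxx.
have [VE|VE] := eqVneq (variation Om u) +oo%E; first by rewrite VE leey.
have Vf : variation Om u \is a fin_num by rewrite ge0_fin_numE ?variation_ge0// ltey.
have fin X : X `<=` Om -> variation X u \is a fin_num.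
  move=> XO; rewrite ge0_fin_numE ?variation_ge0//; apply: (le_lt_trans (variation_le_sub u XO)).
  by rewrite ltey.
rewrite -leeBrDr ?fin//; apply: ge_ereal_sup => _ [phi hphi <-].
rewrite leeBrDr ?fin// addeC -leeBrDr; last first.
  rewrite (integral_div_setT u hphi) -(integral_div_setT u (test_field_sub AO hphi)).
  exact: integrable_fin_num (i1 _ (test_field_sub AO hphi)).
apply: ge_ereal_sup => _ [psi hpsi <-].
rewrite leeBrDr; last first.
  rewrite (integral_div_setT u hphi) -(integral_div_setT u (test_field_sub AO hphi)).
  exact: integrable_fin_num (i1 _ (test_field_sub AO hphi)).
have [h1 h2] := test_field_add AO BO AB hphi hpsi.
rewrite (integral_div_setT u hphi) -(integral_div_setT u (test_field_sub AO hphi)).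
rewrite (integral_div_setT u hpsi) -(integral_div_setT u (test_field_sub BO hpsi)).
rewrite -integralD//; [|exact: i1 (test_field_sub BO hpsi)|exact: i1 (test_field_sub AO hphi)].
apply: ereal_sup_ubound; exists (fun x => phi x + psi x) => //.
have E y : u y * divergence (fun x => phi x + psi x) y = u y * divergence psi y + u y * divergence phi y.
  by rewrite (h2 y) mulrDr [LHS]addrC.
apply: (@eq_integral _ T R mu Om) => y _; rewrite -EFinD; exact: (congr1 EFin (E y)).
Qed.

End variation_additivity.

(** * Limits along dyadic dilations *)

Section dyadic_dilations.
Context {R : realType} {k : nat}.
Notation N := k.+1.
Notation vec := 'rV[R]_N.
Notation mu := (leb R N).
Notation T := (lebT R N).
Implicit Types (D : set vec) (f : vec -> R).

Lemma leb_integral_scale (a : R) D f : 0 < a -> mble D -> lmeas D f -> (forall y, 0 <= f y) ->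
  (\int[mu]_(y in [set y : vec | D (a *: y)]) (f (a *: y))%:E = (a ^- N)%:E * \int[mu]_(y in D) (f y)%:E)%E.
Proof.
move=> a0 mD mf f0.
have h (t : R) : (0 <= `|t|%:E)%E by rewrite lee_fin.
have mg : measurable_fun setT (fun t : R => `|t|%:E) by apply/measurable_EFinP; exact: (@measurableT_comp _ _ _ _ _ _ (fun t : R => `|t|)).
have := ge0_integral_affine 0 a0 mD mf mg h (congr1 EFin (normr0 R)).
have -> : (fun x : vec => a *: x + 0) @^-1` D = [set y : vec | D (a *: y)].
  by apply/seteqP; split=> y; rewrite /preimage/= addr0.
rewrite (eq_integral (fun y : T => (f (a *: y))%:E)); last by move=> y _; rewrite addr0 ger0_norm.
by rewrite [in X in _ = X -> _](eq_integral (fun y : T => (f y)%:E))// => y _; rewrite ger0_norm.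
Qed.

Variable r : R.
Hypothesis r0 : 0 < r.
Notation A := (log_annulus r : set vec).

Definition dya (j : nat) : R := 2 ^- j.

Lemma dya_gt0 j : 0 < dya j. Proof. by rewrite invr_gt0 exprn_gt0. Qed.

Lemma dyaS j : dya j = 2 * dya j.+1.
Proof. by rewrite /dya exprS invfM mulrA divff ?mul1r. Qed.

(** Dilation by [dyq j] raises [height] by [dya j]; squaring passes from index j + 1 to index j. *)
Definition dyq (j : nat) : R := expR (- dya j).

Lemma dyqS j : dyq j = dyq j.+1 ^+ 2.
Proof. by rewrite /dyq -expRM_natl dyaS mulrN. Qed.

Lemma dyq01 j : 0 < dyq j < 1.
Proof. by rewrite expR_gt0 expR_lt1 oppr_lt0 dya_gt0. Qed.

(** Logarithmic distance to the sphere, 0 on it; dilations act on it as translations. *)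
Definition height (y : vec) : R := - ln (enorm y / r).

Lemma enorm_height (y : vec) : 0 < enorm y -> enorm y = r * expR (- height y).
Proof. by move=> y0; rewrite opprK lnK ?posrE ?divr_gt0// mulrC divfK ?gt_eqF. Qed.

Lemma heightZ (y : vec) (c : R) : 0 < enorm y -> height (expR c *: y) = height y - c.
Proof.
move=> y0; rewrite /height enormZ gtr0_norm ?expR_gt0// -mulrA lnM ?posrE ?divr_gt0 ?expR_gt0//.
by rewrite expRK opprD addrC.
Qed.

Lemma enormZ_expR_gt0 (y : vec) (c : R) : 0 < enorm y -> 0 < enorm (expR c *: y).
Proof. by move=> y0; rewrite enormZ gtr0_norm ?mulr_gt0 ?expR_gt0. Qed.

(** In terms of [height], the interval ]dya j, 2 dya j]: a fundamental domain for the dilation by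
    [dyq j], and for varying j a partition of the heights in ]0, 2]. *)
Definition dyshell (j : nat) : set vec := [set y | r * dyq j ^+ 2 <= enorm y < r * dyq j].

Lemma dyshellE j (y : vec) : 0 < enorm y -> dyshell j y <-> dya j < height y <= 2 * dya j.
Proof.
move=> y0; rewrite /dyshell/= {1 2}(enorm_height y0) !ler_pM2l// !ltr_pM2l// /dyq -expRM_natl.
by rewrite ler_expR ltr_expR mulrN lerN2 ltrN2 andbC.
Qed.

Lemma log_annulusE (y : vec) : 0 < enorm y -> A y <-> 0 < height y <= 1.
Proof.
move=> y0; rewrite /log_annulus/= {1 2}(enorm_height y0) ler_pM2l// gtr_pMr//.
by rewrite ler_expR expR_lt1 lerN2 oppr_lt0 andbC.
Qed.

Lemma mble_dyshell j : mble (dyshell j).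
Proof.
rewrite (_ : dyshell j = eball 0 (r * dyq j) `\` eball 0 (r * dyq j ^+ 2)).
  by apply: measurableD; exact: mble_eball.
apply/seteqP; split=> y; rewrite /dyshell/eball/= subr0.
  by move=> /andP[h ->]; split=> //; apply/negP; rewrite -leNgt.
by move=> [-> /negP]; rewrite -leNgt andbT.
Qed.

Lemma dyshell_enorm j y : dyshell j y -> 0 < enorm y.
Proof.
move=> /andP[h _]; apply: lt_le_trans h; have /andP[q0 _] := dyq01 j.
by rewrite mulr_gt0 ?exprn_gt0.
Qed.

(* The point of the shell of index [j] in the orbit of [y] under the dilations
   [expR (i * dya j)], [i] an integer. *)
Definition dykap (j : nat) (y : vec) : vec :=
  expR (((Num.ceil (height y / dya j))%:~R - 2) * dya j) *: y.

Lemma dykap_id j y : dyshell j y -> dykap j y = y.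
Proof.
move=> ys; have y0 := dyshell_enorm ys; have d0 := dya_gt0 j.
have /andP[h1 h2] := (dyshellE j y0).1 ys.
rewrite /dykap (_ : Num.ceil _ = 2) ?subrr ?mul0r ?expR0 ?scale1r//.
apply/eqP; rewrite ceil_eq ltr_pdivlMr// ler_pdivrMr//.
by apply/andP; split; lra.
Qed.

(** The dilation by exp([dya n]) is a power of the one by exp([dya j]), so the two points have the
    same orbit of index j. *)
Lemma dykap_inv n j (i : int) y : (n <= j)%N -> 0 < enorm y ->
  dykap j (expR (i%:~R * dya n) *: y) = dykap j y.
Proof.
move=> nj y0; rewrite /dykap heightZ// scalerA -expRD; congr (expR _ *: _).
have d0 := dya_gt0 j.
have dE : dya n = (2 ^ (j - n))%N%:R * dya j.
  by rewrite /dya -{2}(subnKC nj) exprD invfM natrX mulrCA mulfV ?mulr1// expf_neq0.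
have -> : (height y - i%:~R * dya n) / dya j = height y / dya j + (- (i * (2 ^ (j - n))%N%:Z))%:~R.
  by rewrite mulrBl dE mulrA mulfK ?gt_eqF// intrN intrM.
by rewrite ceilDrz ?intr_int// intrD intrKceil intrN intrM dE -pmulrn; set c := _%:~R; set a := _%:R; lra.
Qed.

(** With t = height / dya j, the ceiling of 2 t is either 2 ceil(t) or 2 ceil(t) - 1; hence the two
    cases. *)
Lemma dykap_step j y : 0 < enorm y ->
  dykap j y = dyq j.+1 *: dykap j.+1 y \/ dykap j y = dyq j.+1 *: (dyq j.+1 *: dykap j.+1 y).
Proof.
move=> y0; have d0 := dya_gt0 j.+1; rewrite /dykap !scalerA -!expRD.
set t := height y / dya j.
have -> : height y / dya j.+1 = 2 * t.
  by rewrite /t (dyaS j) invfM mulrCA [2 * _]mulrA divff ?mul1r.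
have : Num.ceil (2 * t) = 2 * Num.ceil t \/ Num.ceil (2 * t) = 2 * Num.ceil t - 1.
  have /andP[] := ceil_itv t; rewrite intrB => h1 h2.
  have [h3|h3] := leP (2 * t) ((2 * Num.ceil t - 1)%:~R); [right|left]; apply/eqP; rewrite ceil_eq.
    by rewrite h3 andbT; move: h3; rewrite !intrB intrM; lra.
  by rewrite h3/= intrM; lra.
by rewrite (dyaS j) => -[->|->]; [right|left]; congr (expR _ *: _); rewrite ?intrB intrM; lra.
Qed.

(** Heights on the annulus lie in ]0, 1], and exactly one of the 2^j dilations takes the point into
    the shell. Written as a finite sum, the composition with [dykap j] can be measured and
    integrated. *)
Lemma dykap_sum j f y : A y ->
  f (dykap j y) = \sum_(i < 2 ^ j) (f \_ (dyshell j)) (expR ((i%:R - 1) * dya j) *: y).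
Proof.
move=> Ay; have y0 := enorm_log_annulus r0 Ay; have /andP[t0 t1] := (log_annulusE y0).1 Ay.
have d0 := dya_gt0 j; set t := height y / dya j.
have t0' : 0 < t by rewrite divr_gt0.
have c1 : 1 <= Num.ceil t by rewrite -gtz0_ge1 ceil_gt0.
pose m := `|Num.ceil t - 1|%N; have mE : m%:R = (Num.ceil t)%:~R - 1 :> R.
  by rewrite /m pmulrn gez0_abs ?subr_ge0// intrB.
have mlt : (m < 2 ^ j)%N.
  rewrite -(ltr_nat R) mE natrX ltrBlDr; apply: (@lt_le_trans _ _ (t + 1)).
    by have := ceilB1_lt t; rewrite intrB; lra.
  by rewrite lerD2r /t /dya invrK ler_piMl// exprn_ge0.
have sh (i : nat) : dyshell j (expR ((i%:R - 1) * dya j) *: y) <-> i = m.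
  rewrite (dyshellE j (enormZ_expR_gt0 _ y0)) heightZ//.
  have -> : height y = t * dya j by rewrite /t divfK ?gt_eqF.
  have -> : dya j < t * dya j - (i%:R - 1) * dya j <= 2 * dya j = (i%:R < t <= i%:R + 1).
    rewrite -mulrBl ler_pM2r// -[X in X < _]mul1r ltr_pM2r//.
    by apply/andP/andP => -[]; split; lra.
  split=> [/andP[h1 h2]|->].
    have e : Num.ceil t = (i.+1%:Z).
      by apply/eqP; rewrite ceil_eq intrB -pmulrn -natr1 addrK h1.
    by apply/eqP; rewrite -(eqr_nat R) mE e -pmulrn -natr1 addrK.
  by rewrite mE; have /andP[] := ceil_itv t; rewrite intrB => h1 h2; apply/andP; split; lra.
rewrite (bigD1 (Ordinal mlt))//= big1 ?addr0; last first.
  move=> i im; rewrite /patch; case: ifPn => //; rewrite inE => /sh e.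
  by case/eqP: im; exact: val_inj.
rewrite /patch mem_set; last exact/sh.
have -> : m%:R - 1 = (Num.ceil t)%:~R - 2 :> R by rewrite mE; set c := _%:~R; lra.
by [].
Qed.

Lemma lmeas_dykap j f : lmeas (dyshell j) f -> lmeas A (f \o dykap j).
Proof.
move=> mf; have mS := mble_dyshell j.
have mp := lmeas_patch mS mf.
apply: (eq_measurable_fun (fun y : T => \sum_(i < 2 ^ j) (f \_ (dyshell j)) (expR ((i%:R - 1) * dya j) *: y))).
  by move=> y /set_mem Ay; rewrite -dykap_sum.
apply: (@measurable_sum _ T R A _ (index_enum _) (fun (i : 'I_(2 ^ j)) (y : vec) => (f \_ (dyshell j)) (expR ((i%:R - 1) * dya j) *: y))) => i.
apply: measurable_funTS.
have := @mfun_affine R N (expR ((i%:R - 1) * dya j)) 0 setT (f \_ (dyshell j)) (expR_gt0 _) mbleT mp.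
rewrite preimage_setT; apply: eq_measurable_fun => y _.
by rewrite addr0.
Qed.

(** Each of the 2^j dilations costs a Jacobian of at most e^N, its exponent being at least -[dya j],
    hence at least -1. *)
Lemma dykap_integral_le j f : lmeas (dyshell j) f -> (forall y, 0 <= f y) ->
  (\int[mu]_(y in A) (f (dykap j y))%:E <= (2 ^+ j * expR N%:R)%:E * \int[mu]_(y in dyshell j) (f y)%:E)%E.
Proof.
move=> mf f0; have mS := mble_dyshell j.
have mp := lmeas_patch mS mf; pose F := f \_ (dyshell j).
have F0 y : 0 <= F y by rewrite /F /patch; case: ifP.
have mFi (i : nat) : lmeas setT (fun y : vec => F (expR ((i%:R - 1) * dya j) *: y)).
  have := @mfun_affine R N (expR ((i%:R - 1) * dya j)) 0 setT F (expR_gt0 _) mbleT mp.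
  by rewrite preimage_setT; apply: eq_measurable_fun => y _; rewrite addr0.
rewrite (eq_integral (fun y : T => \sum_(i < 2 ^ j) (F (expR ((i%:R - 1) * dya j) *: y))%:E)%E); last first.
  by move=> y /set_mem Ay; rewrite dykap_sum// -sumEFin.
rewrite (@ge0_integral_sum _ T R mu A (@mble_log_annulus R k r) _ (fun (i : 'I_(2 ^ j)) (y : vec) => (F (expR ((i%:R - 1) * dya j) *: y))%:E)); first last.
- by move=> i y _; rewrite lee_fin.
- by move=> i; apply/measurable_EFinP; apply: measurable_funTS; exact: mFi.
have IS : (\int[mu]_(y in dyshell j) (f y)%:E = \int[mu]_y (F y)%:E)%E.
  by rewrite /F -(@leb_integral_patch _ _ _ f EFin).
apply: (@le_trans _ _ (\sum_(i < 2 ^ j) (expR N%:R)%:E * \int[mu]_(y in dyshell j) (f y)%:E)%E).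
  apply: lee_sum => i _; set c : R := (i%:R - 1) * dya j.
  apply: (@le_trans _ _ (\int[mu]_y (F (expR c *: y))%:E)%E).
    by apply: leb_integral_le_subset => //; [exact: mble_log_annulus|exact: mbleT|exact: mFi].
  rewrite (leb_integral_scale (expR_gt0 c) mbleT mp F0) -IS.
  apply: lee_wpmul2r; first exact: leb_integral_ge0.
  rewrite lee_fin -expRM_natl -expRN ler_expR -mulrN -[leRHS]mulr1 ler_wpM2l//.
  have d0 := dya_gt0 j; have d1 : dya j <= 1 by rewrite invf_le1 ?exprn_gt0// exprn_ege1// ler1n.
  rewrite /c -mulNr; apply: (@le_trans _ _ (1 * dya j)); last by rewrite mul1r.
  by rewrite ler_pM2r// opprB gerBl.
set x := (_%:E * _)%E.
have x0 : (0 <= x)%E by rewrite mule_ge0 ?leb_integral_ge0// lee_fin expR_ge0.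
have H n : (\sum_(i < n) x = (n%:R)%:E * x)%E.
  elim: n => [|n IH]; first by rewrite big_ord0 mul0e.
  by rewrite big_ord_recr/= IH -natr1 EFinD ge0_muleDl ?mul1e// lee_fin.
by rewrite H /x muleA -EFinM natrX.
Qed.

End dyadic_dilations.

Section dyadic_increments.
Context {R : realType} {k : nat}.
Notation N := k.+1.
Notation vec := 'rV[R]_N.
Notation mu := (leb R N).
Notation T := (lebT R N).
Variables (r : R) (u : vec -> R).
Hypothesis r0 : 0 < r.
Notation B := (eball (0 : vec) r).
Hypotheses (iu : mu.-integrable B (EFin \o u)) (mu_ : lmeas setT u).
Notation A := (log_annulus r : set vec).

Lemma lmeas_scale (a : R) (f : vec -> R) : 0 < a -> lmeas setT f -> lmeas setT (fun y => f (a *: y)).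
Proof.
move=> a0 mf; have := @mfun_affine R N a 0 setT f a0 mbleT mf.
by rewrite preimage_setT; apply: eq_measurable_fun => y _; rewrite addr0.
Qed.

(** The shift of the index leaves two spare dyadic levels: [dyinc j] is invariant under the
    dilations of index up to j + 2, which [half_ball_integral_le] exploits. *)
Definition dyinc (j : nat) (y : vec) : R := `|u (dykap r j.+3 y) - u (dykap r j.+2 y)|.

Lemma dyinc_ge0 j y : 0 <= dyinc j y. Proof. exact: normr_ge0. Qed.

Lemma lmeas_dyinc j : lmeas A (dyinc j).
Proof.
by apply/lmeas_norm/lmeasB; apply: lmeas_dykap => //; apply: (lmeasS mbleT _ mu_).
Qed.

Lemma dyq_invX_le n m : (dyq n : R)^-1 ^+ m <= expR m%:R.
Proof.
rewrite /dyq -expRN opprK -expRM_natl ler_expR -[leRHS]mulr1 ler_wpM2l//.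
by rewrite invf_le1 ?exprn_gt0// exprn_ege1// ler1n.
Qed.

(** By [dykap_step] the increment is made of at most two differences u(z) - u(q z), with q =
    [dyq j.+3]. Transport to the shell costs 2^(j+3), while the factor q^-1 - 1 of
    [dilation_variation] is of order 2^-(j+3); so the constant does not depend on j. *)
Lemma dyinc_integral_le j :
  (\int[mu]_(y in A) (dyinc j y)%:E <=
   (expR N%:R * (1 + expR N%:R) * (expR 1 * (r * expR N%:R)))%:E *
     variation (annulus (r * dyq j) (r * dyq j.+4)) u)%E.
Proof.
set J := j.+3; set q := @dyq R J; have /andP[q0 q1] := @dyq01 R J; rewrite -/q in q0 q1.
(* The annulus between these radii contains the shell of index [J] and its image under q; after one
   more dilation it still lies within the radii of the statement, because [dyq j] is q^8. *)
set b := r * dyq j.+4; set a := r * q ^+ 4.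
pose H (z : vec) : R := `|u z - u (q *: z)|.
have mH : lmeas setT H by apply/lmeas_norm/lmeasB => //; exact: lmeas_scale.
have H0 z : 0 <= H z by exact: normr_ge0.
have mHq := lmeas_scale q0 mH.
have le1 y : 0 < enorm y -> dyinc j y <= H (dykap r J y) + H (q *: dykap r J y).
  move=> y0; rewrite /dyinc; have [->|->] := dykap_step r j.+2 y0; first by rewrite lerDl.
  rewrite (le_trans _ (ler_normD _ _))//.
  by rewrite addrA subrK.
have S1 : (\int[mu]_(y in A) (dyinc j y)%:E <=
    \int[mu]_(y in A) (H (dykap r J y) + H (q *: dykap r J y))%:E)%E.
  apply: le_leb_integral; first exact: mble_log_annulus.
  - exact: lmeas_dyinc.
  - by apply: lmeasD; [apply: (lmeas_dykap r0 (f := H))|apply: (lmeas_dykap r0 (f := fun z => H (q *: z)))];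
      apply: (lmeasS mbleT) => //.
  - by move=> y _; exact: dyinc_ge0.
  - by move=> y Ay; apply: le1; exact: enorm_log_annulus Ay.
apply: (le_trans S1).
pose D : set vec := annulus a b.
have mD : mble D by exact: mble_annulus.
have qS : @dyq R j.+4 ^+ 2 = q by rewrite -dyqS.
have bq : r * q <= b.
  rewrite ler_pM2l// -qS expr2 ler_piMl//; have /andP[/ltW ? /ltW ?] := @dyq01 R j.+4 => //.
have bq' : r * q < b.
  rewrite ltr_pM2l// -qS expr2 gtr_pMl//; have /andP[? ?] := @dyq01 R j.+4 => //.
have br : b <= r by rewrite /b ger_pMr//; have /andP[_ /ltW] := @dyq01 R j.+4.
have SD y : dyshell r J y -> D y.
  move=> /andP[h1 h2]; apply/andP; split; last exact: lt_le_trans bq.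
  apply: lt_le_trans h1; rewrite ltr_pM2l// -/q.
  by rewrite (exprD q 2 2) gtr_pMl ?exprn_gt0// exprn_ilt1// ?ltW.
have SqD y : dyshell r J y -> D (q *: y).
  move=> /andP[h1 h2]; rewrite /D /annulus/= enormZ gtr0_norm//; apply/andP; split.
    apply: (@lt_le_trans _ _ (q * (r * q ^+ 2))); last by rewrite ler_pM2l.
    rewrite mulrCA -exprS ltr_pM2l// (exprSr q 3) gtr_pMr ?exprn_gt0//.
  by apply: lt_trans (lt_le_trans h2 bq); rewrite gtr_pMl// (dyshell_enorm r0 (j := J))//; apply/andP; split.
have aD : 0 <= a by rewrite mulr_ge0 ?exprn_ge0 ?ltW.
have qN0 : 0 < q ^- N by rewrite invr_gt0 exprn_gt0.
have ID0 : (0 <= \int[mu]_(y in D) (H y)%:E)%E by exact: leb_integral_ge0.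
have S2 : (\int[mu]_(y in A) (H (dykap r J y) + H (q *: dykap r J y))%:E <=
    (2 ^+ J * expR N%:R)%:E * ((1 + q ^- N)%:E * \int[mu]_(y in D) (H y)%:E))%E.
  have mS : mble (dyshell r J : set vec) by exact: mble_dyshell.
  apply: (le_trans (dykap_integral_le r0 (j := J) (f := fun z => H z + H (q *: z)) _ _)).
  - by apply: lmeasD; apply: (lmeasS mbleT) => //.
  - by move=> y; rewrite addr_ge0.
  apply: lee_wpmul2l; first by rewrite lee_fin mulr_ge0 ?exprn_ge0// expR_ge0.
  rewrite leb_integralD//; try by [apply: (lmeasS mbleT) mH|apply: (lmeasS mbleT) mHq].
  rewrite EFinD ge0_muleDl ?lee_fin// ?(ltW qN0)// mul1e; apply: leeD.
    by apply: leb_integral_le_subset => //; apply: (lmeasS mbleT) mH.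
  have mDH : lmeas D H by apply: (lmeasS mbleT) mH.
  rewrite -(leb_integral_scale q0 mD mDH H0).
  have mD' : mble [set y : vec | D (q *: y)].
    have := mble_affine 0 q0 mD; rewrite (_ : _ @^-1` D = [set y : vec | D (q *: y)])//.
    by apply/seteqP; split=> y; rewrite /preimage/= addr0.
  have mDHq : lmeas [set y : vec | D (q *: y)] (fun z => H (q *: z)) by apply: (lmeasS mbleT) mHq.
  exact: (leb_integral_le_subset mS mD' SqD mDHq (fun y _ => H0 (q *: y))).
apply: (le_trans S2).
have ab : 0 <= a < b.
  rewrite aD/=; apply: le_lt_trans bq'; rewrite ler_pM2l// exprS ger_pMr//.
  by rewrite exprn_ile1// ltW.
have S3 := @dilation_variation R N r u (ltn0Sn k) r0 iu q a b (introT andP (conj q0 q1)) ab br.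
set v := variation (annulus (r * dyq j) b) u.
have S4 : (variation (annulus (q * a) b) u <= v)%E.
  apply: variation_le_sub => y /andP[h1 h2]; apply/andP; split => //.
  apply: lt_trans h1; rewrite mulrCA -exprS ltr_pM2l//.
  have -> : @dyq R j = q ^+ 8 by rewrite (@dyqS R j) (@dyqS R j.+1) (@dyqS R j.+2) -!exprM.
  by rewrite (exprD q 5 3) gtr_pMr ?exprn_gt0// exprn_ilt1// ltW.
have v0 : (0 <= v)%E by exact: variation_ge0.
apply: (@le_trans _ _ ((2 ^+ J * expR N%:R)%:E * ((1 + q ^- N)%:E * (((q^-1 - 1) * (r * q ^- N))%:E * v)))%E).
  apply: lee_wpmul2l; first by rewrite lee_fin mulr_ge0 ?exprn_ge0// expR_ge0.
  apply: lee_wpmul2l; first by rewrite lee_fin addr_ge0// ltW.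
  apply: (le_trans S3); apply: lee_wpmul2l => //.
  by rewrite lee_fin !mulr_ge0 ?(ltW r0) ?(ltW qN0)// subr_ge0 invf_ge1// ltW.
rewrite !muleA -!EFinM; apply: lee_wpmul2r => //; rewrite lee_fin.
have qE : q ^- N <= expR N%:R by rewrite -exprVn; exact: dyq_invX_le.
have dE : 2 ^+ J * (q^-1 - 1) <= expR 1.
  have q'E : q^-1 = expR (@dya R J) by rewrite /q /dyq -expRN opprK.
  have d0 := @dya_gt0 R J; have d1 : @dya R J <= 1 by rewrite invf_le1 ?exprn_gt0// exprn_ege1// ler1n.
  have h : 1 - q <= @dya R J by have := expR_ge1Dx (- @dya R J); rewrite -/(dyq J) -/q; lra.
  have -> : 2 ^+ J * (q^-1 - 1) = ((@dya R J)^-1 * (1 - q)) * q^-1.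
    by rewrite -mulrA mulrBl mul1r mulfV ?gt_eqF// /dya invrK.
  apply: (@le_trans _ _ (1 * q^-1)); last by rewrite mul1r q'E ler_expR.
  by rewrite ler_pM2r ?invr_gt0// mulrC ler_pdivrMr// mul1r.
have -> : 2 ^+ J * expR N%:R * (1 + q ^- N) * ((q^-1 - 1) * (r * q ^- N)) =
  expR N%:R * (1 + q ^- N) * (2 ^+ J * (q^-1 - 1) * (r * q ^- N)).
  move: (2 ^+ J) (expR N%:R) (q ^- N) (q^-1 - 1) => x1 x2 x3 x4; lra.
have e0 : 0 < expR N%:R :> R by exact: expR_gt0.
apply: ler_pM.
- by rewrite mulr_ge0 ?(ltW e0)// addr_ge0// ltW.
- have p0 : 0 <= q^-1 - 1 by rewrite subr_ge0 invf_ge1// ltW.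
  by apply: mulr_ge0; apply: mulr_ge0 => //; exact: ltW.
- by rewrite ler_pM2l// lerD2l.
- apply: ler_pM => //.
  + by rewrite mulr_ge0 ?exprn_ge0// subr_ge0 invf_ge1// ltW.
  + by rewrite mulr_ge0 ?(ltW r0) ?(ltW qN0).
  + by rewrite ler_pM2l.
Qed.

(* With [m j] the variation on the punctured ball of radius [r * dyq j], the
   variation on the [j]-th annulus is at most [m (j + 4) - m j]. *)
Lemma annuli_variation_sum_le n :
  (\sum_(j < n) variation (annulus (r * dyq j) (r * dyq j.+4)) u <= 4%:E * variation B u)%E.
Proof.
pose m j := variation (annulus 0 (r * dyq j) : set vec) u.
have subB j : annulus 0 (r * dyq j) `<=` B.
  move=> y /andP[_ h]; rewrite /eball/= subr0; apply: (lt_trans h).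
  by rewrite gtr_pMr//; have /andP[] := @dyq01 R j.
have mono (i j : nat) : (i <= j)%N -> @dyq R i <= @dyq R j.
  move=> /subnK <-; elim: (j - i)%N => [|d IH]; first by rewrite add0n.
  apply: (le_trans IH); rewrite addSn dyqS expr2; have /andP[h1 h2] := @dyq01 R (d + i).+1.
  by rewrite ger_pMr// ltW.
have step j : (variation (annulus (r * dyq j) (r * dyq j.+4)) u + m j <= m j.+4)%E.
  have jj : @dyq R j <= @dyq R j.+4 by apply: mono; lia.
  have q0 : 0 < @dyq R j by have /andP[] := @dyq01 R j.
  apply: variation_superadditive.
  - exact: mble_annulus.
  - exact: (@integrableS _ T R mu B _ _ (@mble_eball R N 0 r) (@mble_annulus R N _ _) (subB _) iu).
  - by move=> y /andP[h1 h2]; apply/andP; split => //; apply: lt_trans h1; rewrite mulr_gt0.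
  - by move=> y /andP[h1 h2]; apply/andP; split => //; apply: (lt_le_trans h2); rewrite ler_pM2l.
  - by rewrite -subset0 => y [/andP[h1 _] /andP[_ h2]]; have := lt_trans h1 h2; rewrite ltxx.
have main : (\sum_(j < n) variation (annulus (r * dyq j) (r * dyq j.+4)) u <=
    m n + (m n.+1 + (m n.+2 + m n.+3)))%E.
  elim: n => [|n IH].
    by rewrite big_ord0 !adde_ge0// variation_ge0.
  rewrite big_ord_recr/=; apply: (le_trans (leeD2r _ IH)).
  have AC (a b c d v : \bar R) : (a + (b + (c + d)) + v = b + (c + (d + (v + a))))%E.
    by rewrite -!addeA [LHS]addeC -!addeA.
  by rewrite AC; do 3![apply: leeD2l]; exact: step.
apply: (le_trans main).
have mB j : (m j <= variation B u)%E by exact: variation_le_sub.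
have -> : (4%:E * variation B u = variation B u + (variation B u + (variation B u + variation B u)))%E.
  have v0 : (0 <= variation B u)%E by exact: variation_ge0.
  have -> : 4 = 1 + (1 + (1 + 1)) :> R by lra.
  by rewrite !EFinD !ge0_muleDl ?mul1e ?adde_ge0 ?lee_fin.
by do 3![apply: leeD => //].
Qed.

End dyadic_increments.

Section telescoping_limit.
Context {R : realType}.

Lemma telescoping_limit (a : R^nat) (m : nat) (v : R) :
  (forall M : nat, \sum_(m <= j < M) `|a j.+1 - a j| <= v) ->
  cvgn a /\ `|a m - limn a| <= v.
Proof.
move=> h; pose b (i : nat) : R := a (i + m)%N.
have bs M : \sum_(0 <= j < M) `|b j.+1 - b j| <= v.
  by have := h (M + m)%N; rewrite -{1}[m]add0n big_addn addnK.
have ns : cvgn [normed series (telescope b)].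
  apply: nondecreasing_is_cvgn.
    by apply: nondecreasing_series => i _ _; exact: normr_ge0.
  by exists v => _ [M _ <-]; exact: bs.
have cb : cvgn b.
  have := normed_cvg ns; rewrite telescopeK => cs.
  have -> : b = (fun i => (b i - b 0%N) + b 0%N) by apply/funext => i; rewrite subrK.
  by apply: is_cvgD => //; exact: is_cvg_cst.
have ca : cvgn a by apply/cvg_ex; exists (limn b); rewrite -(cvg_shiftn m); exact: cb.
split=> //.
have c1 : (fun i => `|a m - a i|) @ \oo --> `|a m - limn a|.
  by apply: cvg_norm; apply: cvgB => //; exact: cvg_cst.
have <- := cvg_lim (@Rhausdorff R) c1.
apply: limr_le; first by apply/cvg_ex; exists `|a m - limn a|.
near=> M; have mM : (m <= M)%N by near: M; exact: nbhs_infty_ge.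
apply: (le_trans _ (h M)); rewrite distrC -telescope_sumr//.
exact: ler_norm_sum.
Unshelve. all: by end_near. Qed.

End telescoping_limit.

Section dyadic_limit.
Context {R : realType} {k : nat}.
Notation N := k.+1.
Notation vec := 'rV[R]_N.
Notation mu := (leb R N).
Notation T := (lebT R N).
Variables (r : R) (u : vec -> R).
Hypothesis r0 : 0 < r.
Notation B := (eball (0 : vec) r).
Hypotheses (iu : mu.-integrable B (EFin \o u)) (mu_ : lmeas setT u).
Notation A := (log_annulus r : set vec).

Definition dytail (n : nat) (y : vec) : \bar R := (\sum_(j <oo) (dyinc r u (j + n) y)%:E)%E.

(* A junk value where the sequence diverges. *)
Definition dylim (y : vec) : R := limn (fun j => u (dykap r j y)).

Lemma dytail_ge0 n y : (0 <= dytail n y)%E.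
Proof. by apply: nneseries_ge0 => j _ _; rewrite lee_fin dyinc_ge0. Qed.

Lemma dyinc_inv n j (i : int) y : (n <= j.+2)%N -> 0 < enorm y ->
  dyinc r u j (expR (i%:~R * dya n) *: y) = dyinc r u j y.
Proof. by move=> nj y0; rewrite /dyinc !(dykap_inv r0 (n := n))// (leq_trans nj). Qed.

Lemma dytail_inv n m (i : int) y : (n <= m.+2)%N -> 0 < enorm y ->
  dytail m (expR (i%:~R * dya n) *: y) = dytail m y.
Proof.
move=> nm y0; apply: eq_eseriesr => j _; rewrite (dyinc_inv (n := n))//.
by rewrite (leq_trans nm)// !ltnS leq_addl.
Qed.

(** From index n on the two sequences coincide, so they have the same limit, junk value included. *)
Lemma dylim_inv n (i : int) y : 0 < enorm y -> dylim (expR (i%:~R * dya n) *: y) = dylim y.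
Proof.
move=> y0; rewrite /dylim; congr (lim _); apply/funext => X; apply/propext.
have E : \forall j \near \oo, u (dykap r j (expR (i%:~R * dya n) *: y)) = u (dykap r j y).
  by exists n => // j /= nj; rewrite (dykap_inv r0).
split; apply: near_eq_cvg; apply: filterS E => j /= -> //.
Qed.

Lemma dytailE n y : dytail n y = (\sum_(n <= j <oo) (dyinc r u j y)%:E)%E.
Proof. by apply: (@nneseries_addn R (fun j => (dyinc r u j y)%:E)) => j; rewrite lee_fin dyinc_ge0. Qed.

Lemma dytail_le m n y : (m <= n)%N -> (dytail n y <= dytail m y)%E.
Proof.
move=> mn; rewrite !dytailE (@nneseries_split _ _ m (n - m))//; last by move=> j _; rewrite lee_fin dyinc_ge0.
by rewrite subnKC// leeDr// sume_ge0// => j _; rewrite lee_fin dyinc_ge0.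
Qed.

Lemma dylim_shell n m y : (n <= m)%N -> (dytail n y < +oo)%E -> 0 < enorm y ->
  cvgn (fun j => u (dykap r j y)) /\ (`|u (dykap r m.+2 y) - dylim y|%:E <= dytail n y)%E.
Proof.
move=> nm Vf y0; have Vfin : dytail n y \is a fin_num by rewrite ge0_fin_numE ?dytail_ge0.
pose a j := u (dykap r j.+2 y).
have [|ca la] := @telescoping_limit R a m (fine (dytail n y)).
  move=> M; rewrite -lee_fin fineK// -sumEFin; apply: (le_trans _ (dytail_le y nm)).
  rewrite dytailE; apply: (nneseries_lim_ge (u_ := fun j => (dyinc r u j y)%:E)) => j _ _.
  by rewrite lee_fin dyinc_ge0.
have E : a = (fun j => u (dykap r (j + 2) y)) by apply/funext => j; rewrite addn2.
have cb : cvgn (fun j => u (dykap r j y)).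
  by apply/cvg_ex; exists (limn a); rewrite -(cvg_shiftn 2) -E; exact: ca.
split=> //; rewrite -(fineK Vfin) lee_fin (_ : dylim y = limn a)//.
apply/esym/cvg_lim; first exact: Rhausdorff.
by rewrite E (cvg_shiftn 2 (fun j => u (dykap r j y))); exact: cb.
Qed.

Lemma dyshell_exists n (y : vec) : 0 < enorm y -> 0 < height r y <= dya n ->
  exists2 m, (n < m)%N & (dyshell r m : set vec) y.
Proof.
move=> y0 /andP[t0 tn].
have ex : exists m, dya m < height r y.
  have [m _ hm] := near_infty_natSinv_lt (PosNum t0); exists m.
  apply: le_lt_trans (hm m (leqnn m)); rewrite /dya lef_pV2 ?posrE ?exprn_gt0// ?ltr0n// -natrX ler_nat; exact: ltn_expl.
case: (ex_minnP ex) => m hm mmin.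
have nm : (n < m)%N.
  rewrite ltnNge; apply/negP => mn; have := lt_le_trans hm tn; apply/negP; rewrite -leNgt.
  by rewrite lef_pV2 ?posrE ?exprn_gt0// ler_weXn2l// ler1n.
exists m => //; apply/(dyshellE r0 m y0); rewrite hm/=.
case: m hm mmin nm => // m hm mmin nm; rewrite -dyaS leNgt; apply/negP => /mmin.
by rewrite ltnn.
Qed.

(** The value u(y) is itself a term of the sequence: y lies in a shell of some index m > n + 1,
    where [dykap m] fixes it. *)
Lemma dylim_bound n y : 0 < enorm y -> 0 < height r y <= dya n.+1 ->
  (`|u y - dylim y|%:E <= dytail n y)%E.
Proof.
move=> y0 hy; have [VE|VE] := eqVneq (dytail n y) +oo%E; first by rewrite VE leey.
have Vf : (dytail n y < +oo)%E by rewrite ltey.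
have [m nm ms] := dyshell_exists y0 hy; case: m nm ms => // -[//|m] nm ms.
by have [|_] := @dylim_shell n m y _ Vf y0; rewrite ?(dykap_id r0 ms).
Qed.

Lemma dytail_measurable n : measurable_fun (A : set T) (dytail n : T -> \bar R).
Proof.
have := @ge0_emeasurable_sum _ T R A (fun j (y : vec) => (dyinc r u (j + n) y)%:E) xpredT.
by apply=> [j y _ _|j _]; [rewrite lee_fin dyinc_ge0|apply/measurable_EFinP; exact: lmeas_dyinc].
Qed.

(** The integrals of the increments are summable: each is at most a fixed constant times the
    variation on an annulus, and [annuli_variation_sum_le] bounds the sum of these. *)
Lemma dytail_integral_cvg : (variation B u < +oo)%E ->
  (\int[mu]_(y in A) dytail n y)%E @[n --> \oo] --> 0%E.
Proof.
move=> vf; pose a j := (\int[mu]_(y in A) (dyinc r u j y)%:E)%E.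
have a0 j : (0 <= a j)%E by apply: leb_integral_ge0 => y _; exact: dyinc_ge0.
have aE n : (\int[mu]_(y in A) dytail n y = \sum_(n <= j <oo) a j)%E.
  rewrite -(nneseries_addn n a0).
  apply: (@integral_nneseries _ T R mu A (@mble_log_annulus R k r) (fun j (y : vec) => (dyinc r u (j + n) y)%:E)).
  - by move=> j; apply/measurable_EFinP; exact: lmeas_dyinc.
  - by move=> j y _; rewrite lee_fin dyinc_ge0.
rewrite (eq_cvg _ _ aE); apply: nneseries_tail_cvg; last by move=> j _; exact: a0.
set C := expR N%:R * (1 + expR N%:R) * (expR 1 * (r * expR N%:R)).
have C0 : 0 <= C by rewrite !mulr_ge0 ?addr_ge0 ?expR_ge0// ltW.
apply: (@le_lt_trans _ _ (C%:E * (4%:E * variation B u))%E).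
  apply: lime_le; first by apply: is_cvg_nneseries => j _ _; exact: a0.
  near=> n; rewrite big_mkord; apply: (@le_trans _ _ (\sum_(j < n) C%:E *
      variation (annulus (r * dyq j) (r * dyq j.+4)) u)%E).
    by apply: lee_sum => j _; exact: dyinc_integral_le.
  rewrite -ge0_sume_distrr; last by move=> j _; exact: variation_ge0.
  by apply: lee_wpmul2l; rewrite ?lee_fin//; exact: annuli_variation_sum_le.
have vfin : variation B u \is a fin_num by rewrite ge0_fin_numE// variation_ge0.
by rewrite -(fineK vfin) -!EFinM ltry.
Unshelve. all: by end_near. Qed.

Lemma dylim_measurable : (variation B u < +oo)%E -> lmeas A dylim.
Proof.
move=> vf; have mA := @mble_log_annulus R k r : mble A.
have iV : exists n, (\int[mu]_(y in A) dytail n y < +oo)%E.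
  have := dytail_integral_cvg vf; move=> /(_ [set x | (x < +oo)%E]) [|n _ h].
    by apply: open_nbhs_nbhs; split; [exact: open_ereal_lt_ereal|rewrite /= ltey].
  by exists n; apply: h => /=.
case: iV => n hn.
have iVn : mu.-integrable A (dytail n).
  apply/integrableP; split; first exact: dytail_measurable.
  by rewrite (eq_integral (fun y : T => dytail n y))// => y _; rewrite gee0_abs// dytail_ge0.
(* The sequence converges where this tail is finite, hence almost everywhere on the annulus;
   completeness of the measure settles the rest. *)
pose D : set vec := A `&` [set y | (dytail n y < +oo)%E].
have mD : mble D.
  have := @dytail_measurable n mA [set x | (x < +oo)%E].
  by apply; have := emeasurable_itv (Interval -oo%O (BLeft (+oo%E : \bar R))); rewrite set_itvE.
have mlim : lmeas D dylim.
  apply: (@measurable_fun_cvg _ T R D (fun j y => u (dykap r j y))).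
    move=> j; apply: (lmeasS mA); first by move=> y [].
    by apply: (lmeas_dykap r0 (f := u)); apply: (lmeasS mbleT).
  move=> y [Ay Vy]; have y0 := enorm_log_annulus r0 Ay.
  by have [] := @dylim_shell n n y (leqnn n) Vy y0.
apply/measurable_EFinP.
apply: (@ae_measurable_fun _ T R mu (@measure_is_complete_caratheodory R _ (leb_outer R N)) A (EFin \o (dylim \_ D))).
  have [] := integrable_ae mA iVn => X [mX X0 hX]; exists X; split=> // y /= hy.
  apply: hX => /= hA; apply: hy => Ay; rewrite /patch mem_set//; split=> //=.
  by have := hA Ay; rewrite ge0_fin_numE ?dytail_ge0.
by apply/measurable_EFinP; apply: (lmeasS mbleT) => //; exact: lmeas_patch.
Qed.

Lemma dylim_integrable : (variation B u < +oo)%E -> mu.-integrable A (EFin \o dylim).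
Proof.
move=> vf; have mA := @mble_log_annulus R k r : mble A.
have [n hn] : exists n, (\int[mu]_(y in A) dytail n y < +oo)%E.
  have := dytail_integral_cvg vf; move=> /(_ [set x | (x < +oo)%E]) [|n _ h].
    by apply: open_nbhs_nbhs; split; [exact: open_ereal_lt_ereal|rewrite /= ltey].
  by exists n; apply: h => /=.
have mS : mble (dyshell r n.+2 : set vec) by exact: mble_dyshell.
have mn : lmeas setT (fun y => `|u y|) by exact: lmeas_norm.
have mk : lmeas A (fun y => `|u (dykap r n.+2 y)|).
  by apply: (lmeas_dykap r0 (f := fun y => `|u y|)); apply: (lmeasS mbleT).
apply/integrableP; split; first by apply/measurable_EFinP; exact: dylim_measurable.
apply: (@le_lt_trans _ _ (\int[mu]_(y in A) (`|u (dykap r n.+2 y)|%:E + dytail n y))%E).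
  apply: (@ge0_le_integral _ T R mu A mA).
  - by move=> y _; exact: abse_ge0.
  - by apply/measurableT_comp => //; apply/measurable_EFinP; exact: dylim_measurable.
  - by apply: emeasurable_funD; [apply/measurable_EFinP|exact: dytail_measurable].
  - move=> y Ay; have y0 := enorm_log_annulus r0 Ay.
    have [VE|VE] := eqVneq (dytail n y) +oo%E; first by rewrite VE addey ?leey.
    have [|_ h] := @dylim_shell n n y (leqnn n) _ y0; first by rewrite ltey.
    apply: (le_trans _ (leeD2l _ h)); rewrite -EFinD lee_fin.
    rewrite -{1}[dylim y](subKr (u (dykap r n.+2 y))); exact: ler_normB.
rewrite (@ge0_integralD _ T R mu A mA (fun y => `|u (dykap r n.+2 y)|%:E) (dytail n)); first last.
- exact: dytail_measurable.
- by move=> y _; exact: dytail_ge0.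
- exact/measurable_EFinP.
- by [].
rewrite lte_add_pinfty//.
apply: (le_lt_trans (dykap_integral_le r0 (j := n.+2) (f := fun y => `|u y|) _ _)) => //.
  by apply: (lmeasS mbleT).
have SB : dyshell r n.+2 `<=` B.
  move=> y /andP[_ h]; rewrite /eball/= subr0; apply: (lt_trans h).
  by rewrite gtr_pMr//; have /andP[] := @dyq01 R n.+2.
have := @integrableS _ T R mu B _ _ (@mble_eball R N 0 r) mS SB iu.
move=> /integrableP[_ /= hf].
have hfin : (\int[mu]_(y in dyshell r n.+2) `|u y|%:E)%E \is a fin_num.
  by rewrite ge0_fin_numE// integral_ge0.
by rewrite -(fineK hfin) -EFinM ltry.
Qed.

End dyadic_limit.

(** * Maximal inequality and Lebesgue points *)

Section maximal_inequality.
Context {R : realType} {k : nat}.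
Notation N := k.+1.
Notation vec := 'rV[R]_N.
Notation mu := (leb R N).
Notation T := (lebT R N).
Implicit Types (s d : seq (vec * R)) (b c : vec * R).

Let sball b : set vec := eball b.1 b.2.
Let tball b : set vec := eball b.1 (3 * b.2).
Let union (F : vec * R -> set vec) s : set vec := [set y | exists2 b, b \in s & F b y].
Let sep b c : bool := `[< sball b `&` sball c = set0 >].

Lemma union_cons (F : vec * R -> set vec) b s : union F (b :: s) = F b `|` union F s.
Proof.
apply/seteqP; split=> y.
  by move=> [c]; rewrite inE => /orP[/eqP -> h|cs h]; [left|right; exists c].
by move=> [h|[c cs h]]; [exists b; rewrite ?mem_head|exists c; rewrite // inE cs orbT].
Qed.

Lemma union_nil (F : vec * R -> set vec) : union F [::] = set0.
Proof. by apply/seteqP; split=> y // -[]. Qed.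

(** Greedy choice: a ball of largest radius, whose triple contains every ball that meets it; then
    recursion on the balls disjoint from it. *)
Lemma finite_vitali s : exists d, [/\ {subset d <= s}, pairwise sep d &
  union sball s `<=` union tball d].
Proof.
elim: {s}(size s) {-2}s (leqnn (size s)) => [|n IH] s.
  by rewrite leqn0 size_eq0 => /eqP ->; exists [::]; split=> //; rewrite !union_nil; exact: subset_refl.
case: s => [|b0 s0]; first by move=> _; exists [::]; split=> //; rewrite union_nil.
set s := b0 :: s0 => sn.
have [b bs bmax] : exists2 b, b \in s & forall c, c \in s -> c.2 <= b.2.
  have : forall l : seq (vec * R), l != [::] -> exists2 b, b \in l & forall c, c \in l -> c.2 <= b.2.
    elim=> // a l IHl _; have [->|l0] := eqVneq l [::].
      by exists a; [rewrite mem_head|move=> c; rewrite inE => /eqP ->].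
    have [b bl hb] := IHl l0; have [ab|ba] := leP a.2 b.2.
      by exists b; [rewrite inE bl orbT|move=> c; rewrite inE => /orP[/eqP ->//|/hb]].
    exists a; first by rewrite mem_head.
    by move=> c; rewrite inE => /orP[/eqP ->//|/hb/le_trans]; apply; exact: ltW.
  by apply.
pose s1 := [seq c <- s | (c != b) && sep b c].
have s1n : (size s1 <= n)%N.
  rewrite -ltnS (leq_trans _ sn)// size_filter -(count_predC (fun c => (c != b) && sep b c) s).
  by rewrite -addn1 leq_add2l -has_count; apply/hasP; exists b => //=; rewrite eqxx.
have [d [ds dp dc]] := IH s1 s1n; exists (b :: d); split.
- move=> c; rewrite inE => /orP[/eqP ->//|/ds]; by rewrite mem_filter => /andP[].
- rewrite pairwise_cons dp andbT; apply/allP => c /ds; rewrite mem_filter => /andP[/andP[_ ->]].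
  by [].
- move=> y [c cs cy]; rewrite union_cons.
  have [cb|cb] := eqVneq c b.
    left; move: cy; rewrite cb /sball /tball /eball/= => h; apply: (lt_le_trans h).
    by have := le_trans (enorm_ge0 _) (ltW h); lra.
  have [bc|/negP bc] := boolP (sep b c).
    by right; apply: dc; exists c => //; rewrite mem_filter cb bc.
  left; have [z [bz cz]] : exists z, sball b z /\ sball c z.
    apply: contrapT => nz; apply: bc; apply/asboolP; rewrite -subset0 => z [h1 h2].
    by apply: nz; exists z.
  have cb2 := bmax c cs; move: cy bz cz; rewrite /sball /tball /eball/= => h1 h2 h3.
  have -> : y - b.1 = (y - c.1) + ((c.1 - z) + (z - b.1)) by rewrite !addrA !subrK.
  apply: (le_lt_trans (ler_enormD _ _)); have := ler_enormD (c.1 - z) (z - b.1).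
  by rewrite enormB in h3; lra.
Qed.

Variable h : vec -> \bar R.
Hypotheses (mh : measurable_fun (setT : set T) (h : T -> \bar R)) (h0 : forall y, (0 <= h y)%E).

Let mball b : mble (sball b). Proof. exact: mble_eball. Qed.

Let munion (s : seq (vec * R)) : mble (union sball s).
Proof.
elim: s => [|b s IH]; first by rewrite union_nil; exact: measurable0.
by rewrite union_cons; exact: (measurableU _ _ (mball b) IH).
Qed.

Lemma disjoint_balls_integral_le (d : seq (vec * R)) : pairwise sep d ->
  (\sum_(b <- d) \int[mu]_(y in sball b) h y <= \int[mu]_y h y)%E.
Proof.
move=> pd; apply: (@le_trans _ _ (\int[mu]_(y in union sball d) h y)%E); last first.
  by apply: (@ge0_subset_integral _ T R mu _ _ (munion d) mbleT) => //.
elim: d pd => [|b d IH]; first by rewrite big_nil union_nil integral_set0.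
rewrite pairwise_cons big_cons union_cons => /andP[/allP bd /IH{}IH].
rewrite ge0_integral_setU//; first exact: leeD2l.
- exact: mball.
- exact: munion.
- exact: measurable_funTS.
apply/disj_set2P; rewrite -subset0 => y [by_ [c cd cy]].
by have /asboolP := bd c cd; rewrite -subset0; apply; split; [exact: by_|exact: cy].
Qed.

(** The constant 12 is 3 times 4: the radii are tripled, and the integral over each ball is bounded
    below in terms of a quarter of its radius. *)
Lemma tball_leb_le (d : seq (vec * R)) (e : R) : 0 < e -> pairwise sep d ->
  (forall b, b \in d -> 0 < b.2 /\ ((e * (b.2 / 4) ^+ N)%:E <= \int[mu]_(y in sball b) h y)%E) ->
  (leb_outer R N (union tball d) <= (12 ^+ N * ballvol R N / e)%:E * \int[mu]_y h y)%E.
Proof.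
move=> e0 pd hd; have w0 : 0 <= ballvol R N by exact: ltW ballvol_gt0.
apply: (@le_trans _ _ (\sum_(b <- d) (12 ^+ N * ballvol R N / e)%:E * \int[mu]_(y in sball b) h y)%E); last first.
  rewrite -ge0_sume_distrr; last by move=> b _; exact: integral_ge0.
  apply: lee_wpmul2l; last exact: disjoint_balls_integral_le.
  by rewrite lee_fin divr_ge0 ?(ltW e0)// mulr_ge0// exprn_ge0.
elim: d hd {pd} => [|b d IH] hd; first by rewrite big_nil union_nil outer_measure0.
rewrite union_cons big_cons; apply: (le_trans (outer_measureU2 _ _ _)); apply: leeD; last first.
  by apply: IH => c cd; apply: hd; rewrite inE cd orbT.
have [b0 hb] := hd b (mem_head _ _); 
change (leb_outer R N (eball b.1 (3 * b.2)) <=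
  (12 ^+ N * ballvol R N / e)%:E * \int[mu]_(y in sball b) h y)%E.
rewrite leb_eball ?mulr_gt0//.
apply: (@le_trans _ _ ((12 ^+ N * ballvol R N / e)%:E * (e * (b.2 / 4) ^+ N)%:E)%E); last first.
  by apply: lee_wpmul2l => //; rewrite lee_fin divr_ge0 ?(ltW e0)// mulr_ge0// exprn_ge0.
rewrite -EFinM lee_fin mulrA divfK ?gt_eqF// mulrAC -exprMn.
by rewrite (_ : 12 * (b.2 / 4) = 3 * b.2)//; lra.
Qed.

(** Vitali covering. The balls of the statement are replaced by those of a countable family, so that
    the set is exhausted by increasing finite unions. *)
Lemma maximal_weak_type (e : R) : 0 < e ->
  (leb_outer R N [set y : vec | exists2 t : R, (0 < t < 1)%R & (e * t ^+ N)%:E < \int[mu]_(z in eball y t) h z] <=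
   (12 ^+ N * ballvol R N / e)%:E * \int[mu]_y h y)%E.
Proof.
move=> e0; set M := [set y | _].
have /choice[c hc] (m : nat) : exists c : nat -> vec, forall x : vec, exists n, enorm (x - c n) < m.+1%:R^-1.
  by have [//|c hc] := @ceball_dense R k m.+1%:R^-1; exists c.
(* Balls of radius 2/(m+1) around points that are 1/(m+1)-dense. For 1/(m+2) < t <= 1/(m+1) one of
   them contains the ball of radius [t], and a quarter of its radius is at most [t]. *)
pose ball_ (i : nat) : vec * R := if (unpickle i : option (nat * nat)) is Some (m, n)
  then (c m n, 2 / m.+1%:R) else (0, 1).
pose good i := `[< ((e * ((ball_ i).2 / 4) ^+ N)%:E <= \int[mu]_(y in sball (ball_ i)) h y)%E >].
have ball0 i : 0 < (ball_ i).2 by rewrite /ball_; case: unpickle => [[m n]|]//=.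
pose s n := [seq ball_ i | i <- iota 0 n & good i].
pose U n := union sball (s n).
have mU n : mble (U n) by exact: munion.
have Ule n : (leb_outer R N (U n) <= (12 ^+ N * ballvol R N / e)%:E * \int[mu]_y h y)%E.
  have [d [ds pd dc]] := finite_vitali (s n).
  apply: (le_trans (le_leb dc)); apply: tball_leb_le => // b /ds /mapP[i].
  by rewrite mem_filter => /andP[/asboolP gi _] ->; split.
have Und : {homo U : n m / (n <= m)%N >-> (n <= m)%O}.
  move=> n m nm; apply/subsetPset => y [b /mapP[i]]; rewrite mem_filter mem_iota add0n => /andP[gi /andP[_ im]] -> h1.
  exists (ball_ i) => //; apply/mapP; exists i => //; rewrite mem_filter gi mem_iota add0n.
  exact: leq_trans im nm.
have MU : M `<=` \bigcup_n U n.
  move=> y [t /andP[t0 t1] ht].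
  have ex : exists m : nat, m.+1%:R^-1 < t.
    by have [m _ hm] := near_infty_natSinv_lt (PosNum t0); exists m; apply: hm => /=.
  case: (ex_minnP ex) => -[|m] hm mmin; first by move: hm; rewrite invr1 => /(lt_trans t1); rewrite ltxx.
  have tm : t <= m.+1%:R^-1 by rewrite leNgt; apply/negP => /mmin; rewrite ltnn.
  have [n hn] := hc m y; pose i := pickle (m, n).
  have bE : ball_ i = (c m n, 2 / m.+1%:R) by rewrite /ball_ /i pickleK.
  have yb : eball y t `<=` sball (ball_ i).
    move=> z; rewrite bE /sball /eball/= => hz; have -> : z - c m n = (z - y) + (y - c m n) by rewrite addrA subrK.
    rewrite mulr_natl mulr2n; apply: (le_lt_trans (ler_enormD _ _)).
    by apply: ltrD => //; exact: lt_le_trans tm.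
  exists i.+1 => //; exists (ball_ i).
    apply/mapP; exists i => //; rewrite mem_filter mem_iota leq0n add0n ltnSn !andbT.
    apply/asboolP; apply: (@le_trans _ _ (\int[mu]_(z in eball y t) h z)%E); last first.
      apply: (@ge0_subset_integral _ T R mu _ _ (@mble_eball R N y t) (mball _)) => //.
      exact: measurable_funTS.
    apply: le_trans (ltW ht); rewrite lee_fin ler_pM2l// lerXn2r ?nnegrE ?(ltW t0)//.
      by rewrite divr_ge0// ltW.
    rewrite bE/=; apply: le_trans (ltW hm).
    rewrite -[leRHS]div1r ler_pdivlMr ?ltr0n// -[m.+2%:R]natr1.
    have := mulVf (lt0r_neq0 (ltr0Sn R m)); have : (m.+1%:R)^-1 <= 1 :> R by rewrite invf_le1 ?ler1n.
    by move: (m.+1%:R : R) (m.+1%:R^-1 : R) => a q; lra.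
  by apply: yb; rewrite /eball/= subrr enorm0.
apply: (le_trans (le_leb MU)).
have mUU : mble (\bigcup_n U n) by apply: bigcup_measurable => n _; exact: mU.
have cU := @nondecreasing_cvg_mu _ T R mu U mU mUU Und.
rewrite -[X in (X <= _)%E](cvg_lim (@ereal_hausdorff R) cU).
apply: lime_le; first by apply/cvg_ex; eexists; exact: cU.
by near=> n; exact: Ule.
Unshelve. all: by end_near. Qed.

End maximal_inequality.

Section lebesgue_points.
Context {R : realType} {k : nat}.
Notation N := k.+1.
Notation vec := 'rV[R]_N.
Notation mu := (leb R N).
Notation T := (lebT R N).
Implicit Types (f g : vec -> R).

Definition leb_point f (y : vec) : Prop := forall e : R, 0 < e -> exists2 d : R, 0 < d &
  forall t : R, 0 < t < d -> (\int[mu]_(z in eball y t) `|f z - f y|%:E <= (e * t ^+ N)%:E)%E.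

Let bad f (e : R) : set vec := [set y | forall d : R, 0 < d -> exists2 t : R, 0 < t < d &
  ((e * t ^+ N)%:E < \int[mu]_(z in eball y t) `|f z - f y|%:E)%E].

Let w0 : 0 < ballvol R N := ballvol_gt0.

(** At a bad point of [f], either the maximal function of |f - g| or |f - g| itself is large.
    Otherwise |f - f(y)| <= |f - g| + 2 c on small balls, and 2 c times the volume of a ball is two
    thirds of e t^N. *)
Lemma bad_approx f g (e : R) : 0 < e -> lmeas setT f -> continuous g ->
  bad f e `<=` [set y : vec | exists2 t : R, (0 < t < 1)%R &
       ((e / 3 * t ^+ N)%:E < \int[mu]_(z in eball y t) `|f z - g z|%:E)%E] `|`
    (setT `&` [set y : vec | ((e / (3 * ballvol R N))%:E <= `| `|f y - g y|%:E |)%E]).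
Proof.
move=> e0 mf cg y yb; set c := e / (3 * ballvol R N); have c0 : 0 < c by rewrite divr_gt0 ?mulr_gt0.
have [cy|cy] := leP c `|f y - g y|; first by right; split=> //=; rewrite normr_id lee_fin.
left; have [d d0 hd] : exists2 d, 0 < d & forall z : vec, enorm (z - y) < d -> `|g z - g y| <= c.
  have /nbhs_ballP[d /= d0 hd] : nbhs y [set z | `|g y - g z| < c].
    by have /cvgrPdist_lt := cg y; apply.
  exists d => // z zy; rewrite distrC; apply/ltW/hd.
  by apply/ball_rV => // i; have := ler_coord_enorm (z - y) i; rewrite !mxE => /le_lt_trans; apply.
have d10 : 0 < Num.min d 1 by rewrite lt_min d0 ltr01.
have [t /andP[t0]] := yb _ d10; rewrite lt_min => /andP[td t1] ht; exists t; rewrite ?t0//.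
rewrite ltNge; apply: contraTN ht => le; rewrite -leNgt.
have mg : lmeas setT g by exact: lmeas_continuous.
have mE := @mble_eball R N y t.
have mfg : lmeas (eball y t) (fun z => `|f z - g z|).
  by apply: (lmeasS mbleT) => //; exact: lmeas_norm (lmeasB mf mg).
apply: (@le_trans _ _ (\int[mu]_(z in eball y t) (`|f z - g z| + (c + c))%:E)%E).
  apply: le_leb_integral => //.
  - apply: (lmeas_norm (f := fun z => f z - f y)); apply: lmeasB; last exact: lmeas_cst.
    exact: (lmeasS mbleT).
  - by apply: lmeasD => //; exact: lmeas_cst.
  - move=> z zy; have -> : f z - f y = (f z - g z) + ((g z - g y) + (g y - f y)).
      by rewrite !addrA !subrK.
    apply: (le_trans (ler_normD _ _)); rewrite lerD2l; apply: (le_trans (ler_normD _ _)).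
    by apply: lerD; [exact: hd (lt_trans zy td)|rewrite distrC ltW].
rewrite leb_integralD//; [|exact: lmeas_cst|by move=> z _; rewrite addr_ge0 ?(ltW c0)].
have -> : (\int[mu]_(_ in eball y t) (c + c)%:E = (c + c)%:E * (t ^+ N * ballvol R N)%:E)%E.
  by rewrite -(leb_eball y t0); exact: (@integral_cst _ T R mu _ mE (c + c)%:E).
apply: (le_trans (leeD2r _ le)); rewrite -EFinM -EFinD lee_fin.
have -> : (c + c) * (t ^+ N * ballvol R N) = (e / 3 + e / 3) * t ^+ N.
  rewrite /c invfM; have := mulfV (lt0r_neq0 w0).
  move: (ballvol R N) (ballvol R N)^-1 (t ^+ N) => w w' p h.
  have -> : e * (3^-1 * w') + e * (3^-1 * w') = (e / 3 + e / 3) * w' by lra.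
  set q := e / 3 + e / 3; have -> : q * w' * (p * w) = q * p * (w * w') by lra.
  by rewrite h mulr1.
by move: (t ^+ N) => p; lra.
Qed.

(** For [g] close to [f] in L^1, the two sets of [bad_approx] are small by the weak-type inequality
    and by Chebyshev's inequality. *)
Lemma lebesgue_point_ae f : smoothable f -> leb_outer R N [set y | ~ leb_point f y] = 0%E.
Proof.
move=> [mf hf].
have bad0 (e : R) : 0 < e -> leb_outer R N (bad f e) = 0%E.
  move=> e0; apply/eqP; rewrite eq_le outer_measure_ge0 andbT.
  set C1 := 12 ^+ N * ballvol R N / (e / 3); set C2 := (e / (3 * ballvol R N))^-1.
  have C10 : 0 < C1 by rewrite !(divr_gt0, mulr_gt0, exprn_gt0).
  have C20 : 0 < C2 by rewrite invr_gt0 !(divr_gt0, mulr_gt0).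
  apply/lee_addgt0Pr => eta eta0; rewrite add0e.
  have ee : 0 < eta / (C1 + C2) by rewrite divr_gt0// addr_gt0.
  have [g [G [K [hg K0 gK fg]]]] := hf _ ee.
  have cg := has_grad_continuous hg; have mg : lmeas setT g by exact: lmeas_continuous.
  have mfg := lmeas_norm (lmeasB mf mg).
  have mEfg : measurable_fun (setT : set T) (fun y : T => `|f y - g y|%:E) by exact/measurable_EFinP.
  apply: (le_trans (le_leb (bad_approx e0 mf cg))).
  apply: (le_trans (outer_measureU2 _ _ _)).
  have h1 := maximal_weak_type mEfg (fun y => ltac:(by rewrite lee_fin)) (divr_gt0 e0 (ltr0Sn R 2)).
  have h2 := @le_integral_abse _ T R mu setT mbleT (fun y : T => `|f y - g y|%:E) (e / (3 * ballvol R N)) mEfg (divr_gt0 e0 (mulr_gt0 (ltr0Sn R 2) w0)).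
  have I0 : (\int[mu]_y `|f y - g y|%:E <= (eta / (C1 + C2))%:E)%E by exact: fg.
  have -> : eta = C1 * (eta / (C1 + C2)) + C2 * (eta / (C1 + C2)).
    by rewrite -mulrDl mulrC divfK// gt_eqF// addr_gt0.
  rewrite EFinD; apply: leeD.
    apply: (le_trans h1); rewrite [leRHS]EFinM; apply: lee_wpmul2l => //.
    by rewrite lee_fin; exact: ltW.
  rewrite [leRHS]EFinM; apply: (@le_trans _ _ (C2%:E * \int[mu]_y `|f y - g y|%:E)%E); last first.
    by apply: lee_wpmul2l => //; rewrite lee_fin; exact: ltW.
  rewrite /C2 lee_pdivlMl ?divr_gt0 ?mulr_gt0//.
  apply: (le_trans h2); rewrite le_eqVlt; apply/orP; left; apply/eqP.
  by apply: eq_integral => y _; rewrite gee0_abs// lee_fin.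
have sub : [set y | ~ leb_point f y] `<=` \bigcup_n bad f n.+1%:R^-1.
  move=> y; apply: contra_notP => nb e e0.
  have [n _ hn] := near_infty_natSinv_lt (PosNum e0).
  have := hn n (leqnn n) => /= ne.
  apply: contrapT => nd; apply: nb; exists n => // d d0; apply: contrapT => nt.
  apply: nd; exists d => // t td; rewrite leNgt; apply/negP => ht; apply: nt; exists t => //.
  apply: le_lt_trans ht; rewrite lee_fin ler_wpM2r ?exprn_ge0//; last exact: ltW.
  by have /andP[/ltW] := td.
apply/eqP; rewrite eq_le outer_measure_ge0 andbT; apply: (le_trans (le_leb sub)).
apply: (le_trans (outer_measure_sigma_subadditive _ _)).
by rewrite eseries0// => n _ _; exact: bad0.
Qed.

End lebesgue_points.

(** * The trace on the sphere *)

Section ereal_squeeze.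
Context {R : realType}.

Lemma cvg_to0 {I : Type} (F : set_system I) {FF : Filter F} (f : I -> \bar R) :
  (forall e : R, 0 < e -> \forall t \near F, (0 <= f t <= e%:E)%E) -> f @ F --> 0%E.
Proof.
move=> h X /= [e /= e0 he]; have e20 : 0 < e / 2 by rewrite divr_gt0.
apply: filterS (h _ e20) => t /andP[f0 ht]; rewrite /=.
have ft : f t \is a fin_num by rewrite ge0_fin_numE// (le_lt_trans ht)// ltry.
rewrite -(fineK ft); apply: he => /=; rewrite sub0r normrN ger0_norm ?fine_ge0//.
by apply: le_lt_trans (_ : fine (f t) <= e / 2) _; [rewrite -lee_fin fineK|rewrite ltr_pdivrMr//; lra].
Qed.

End ereal_squeeze.

Section trace_of_limit.
Context {R : realType} {k : nat}.
Notation N := k.+1.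
Notation vec := 'rV[R]_N.
Notation mu := (leb R N).
Notation T := (lebT R N).
Variables (r : R) (u : vec -> R).
Hypothesis r0 : 0 < r.
Notation B := (eball (0 : vec) r).
Hypotheses (iu : mu.-integrable B (EFin \o u)) (mu_ : lmeas setT u).
Notation A := (log_annulus r : set vec).

Let mA : mble A := @mble_log_annulus R k r.
Let mB : mble B := @mble_eball R N 0 r.

Lemma lmeas_scale_on (a : R) (D : set vec) (f : vec -> R) : 0 < a -> mble D -> lmeas D f ->
  lmeas [set z : vec | D (a *: z)] (fun z => f (a *: z)).
Proof.
move=> a0 mD mf; have := @mfun_affine R N a 0 D f a0 mD mf.
rewrite (_ : _ @^-1` D = [set z : vec | D (a *: z)]); last first.
  by apply/seteqP; split=> z; rewrite /preimage/= addr0.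
by apply: eq_measurable_fun => z _; rewrite addr0.
Qed.

Lemma mble_scale (a : R) (D : set vec) : 0 < a -> mble D -> mble [set z : vec | D (a *: z)].
Proof.
move=> a0 mD; have := mble_affine 0 a0 mD; rewrite (_ : _ @^-1` D = [set z : vec | D (a *: z)])//.
by apply/seteqP; split=> z; rewrite /preimage/= addr0.
Qed.

Lemma dytail_scale (a : R) (D : set vec) m : 0 < a -> mble D -> D `<=` A ->
  measurable_fun ([set z : vec | D (a *: z)] : set T) (fun z : T => dytail r u m (a *: z)) /\
  (\int[mu]_(z in [set z : vec | D (a *: z)]) dytail r u m (a *: z) =
   (a ^- N)%:E * \int[mu]_(z in D) dytail r u m z)%E.
Proof.
move=> a0 mD DA; have mD' := mble_scale a0 mD.
have mi j : lmeas D (dyinc r u j) by exact: (lmeasS mA DA (lmeas_dyinc r0 mu_ j)).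
have mj j := lmeas_scale_on a0 mD (mi j).
split.
  have := @ge0_emeasurable_sum _ T R [set z : vec | D (a *: z)] (fun j (z : vec) => (dyinc r u (j + m) (a *: z))%:E) xpredT.
  by apply=> [j z _ _|j _]; [rewrite lee_fin dyinc_ge0|apply/measurable_EFinP; exact: mj].
rewrite (@integral_nneseries _ T R mu _ mD' (fun j (z : vec) => (dyinc r u (j + m) (a *: z))%:E)); first last.
- by move=> j z _; rewrite lee_fin dyinc_ge0.
- by move=> j; apply/measurable_EFinP; exact: mj.
rewrite (@integral_nneseries _ T R mu _ mD (fun j (z : vec) => (dyinc r u (j + m) z)%:E)); first last.
- by move=> j z _; rewrite lee_fin dyinc_ge0.
- by move=> j; apply/measurable_EFinP; exact: mi.
rewrite -nneseriesZl; last by move=> j _; apply: leb_integral_ge0 => z _; exact: dyinc_ge0.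
apply: eq_eseriesr => j _.
by rewrite (leb_integral_scale a0 mD)// => z; exact: dyinc_ge0.
Qed.

(** From -ln q <= 1/q - 1 with q = |z|/r, which exceeds 1 - s/r >= 1/2. *)
Lemma boundary_height_le (x z : vec) (s : R) : enorm x = r -> 0 < s <= r / 2 -> B z -> eball x s z ->
  [/\ 0 < enorm z, 0 < height r z & height r z <= 2 * s / r].
Proof.
move=> xr /andP[s0 sr]; rewrite /eball/= subr0 => zr zx.
have zs : r - s < enorm z.
  have := ler_enormB x z; rewrite xr enormB; lra.
have z0 : 0 < enorm z by apply: le_lt_trans zs; lra.
have q0 : 0 < enorm z / r by rewrite divr_gt0.
split=> //; first by rewrite /height oppr_gt0 ln_lt0// q0 ltr_pdivrMr// mul1r.
rewrite /height -lnV ?posrE//.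
have q1 : 1 + ((enorm z / r)^-1 - 1) = (enorm z / r)^-1 by rewrite addrC subrK.
apply: (@le_trans _ _ ((enorm z / r)^-1 - 1)).
  by rewrite -{1}q1; apply: le_ln1Dx; rewrite ltrBrDl subrr invr_gt0.
rewrite invf_div lerBlDr ler_pdivrMr//.
have h : 2 * s / r * r = 2 * s by rewrite divfK// gt_eqF.
have h2 : s / r <= 1 / 2 by rewrite ler_pdivrMr//; lra.
have h3 : (2 * s / r + 1) * (r - s) <= (2 * s / r + 1) * enorm z.
  by rewrite ler_wpM2l ?(ltW zs)// addr_ge0// !mulr_ge0 ?invr_ge0 ?ltW.
apply: le_trans h3; rewrite mulrDl mul1r mulrBr h -mulrA -mulrA.
have -> : s / r * s = (s / r) * s by [].
have : s / r * s <= 1 / 2 * s by rewrite ler_wpM2r// ltW.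
by set q := s / r; lra.
Qed.

Lemma dyadic_scale (s : R) (m : nat) : 0 < s -> s <= dya m.+1 ->
  exists2 n : nat, (m <= n)%N & dya n.+2 < s <= dya n.+1.
Proof.
move=> s0 sm; have ex : exists p, dya p < s.
  have [p _ hp] := near_infty_natSinv_lt (PosNum s0); exists p.
  apply: le_lt_trans (hp p (leqnn p)); rewrite /dya lef_pV2 ?posrE ?exprn_gt0// ?ltr0n// -natrX ler_nat.
  exact: ltn_expl.
case: (ex_minnP ex) => p hp pmin.
have mp : (m.+1 < p)%N.
  rewrite ltnNge; apply/negP => pm; have := lt_le_trans hp sm; apply/negP; rewrite -leNgt.
  by rewrite lef_pV2 ?posrE ?exprn_gt0// ler_weXn2l// ler1n.
case: p hp pmin mp => // -[//|n] hp pmin mn; exists n => //; rewrite hp/= leNgt.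
by apply/negP => /pmin; rewrite ltnn.
Qed.

Lemma dyadic_dilation_approx (l : R) (n : nat) : expR (-1) < l < 1 ->
  exists i : int, [/\ l <= expR (i%:~R * (dya n : R)), expR (i%:~R * (dya n : R)) <= 1 &
                      expR (i%:~R * (dya n : R)) - l <= dya n].
Proof.
move=> /andP[el l1]; have l0 : 0 < l by apply: lt_trans el; exact: expR_gt0.
have d0 : 0 < (dya n : R) by exact: dya_gt0.
pose i := Num.ceil (ln l / dya n); exists i.
have /andP[] := ceil_itv (ln l / dya n); rewrite intrB ltr_pdivlMr// ler_pdivrMr// -/i.
set c : R := i%:~R => h1 h2.
have c0 : c * dya n <= 0.
  rewrite pmulr_lle0// /c -[0]/(0%:~R) ler_int /i ceil_le0 pmulr_lle0 ?invr_gt0// ltW//.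
  by rewrite ln_lt0// l0.
have lE : l = expR (ln l) by rewrite lnK.
split; [by rewrite lE ler_expR|by rewrite expR_le1|].
have -> : expR (c * dya n) - l = expR (c * dya n) * (1 - expR (ln l - c * dya n)).
  have e1 : c * dya n + (ln l - c * dya n) = ln l by rewrite addrC subrK.
  by rewrite mulrBr mulr1 -expRD e1 -lE.
apply: (@le_trans _ _ (1 * (1 - expR (ln l - c * dya n)))).
  by rewrite ler_wpM2r ?expR_le1// subr_ge0 expR_le1 subr_le0.
by have := expR_ge1Dx (ln l - c * dya n); rewrite mul1r; lra.
Qed.

End trace_of_limit.

Section trace_exists.
Context {R : realType} {k : nat}.
Notation N := k.+1.
Notation vec := 'rV[R]_N.
Notation mu := (leb R N).
Notation T := (lebT R N).
Variables (r : R) (u : vec -> R).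
Hypothesis r0 : 0 < r.
Notation B := (eball (0 : vec) r).
Hypotheses (iu : mu.-integrable B (EFin \o u)) (mu_ : lmeas setT u).
Notation A := (log_annulus r : set vec).

Let mA : mble A := @mble_log_annulus R k r.
Let mB : mble B := @mble_eball R N 0 r.

(* A dyadic dilation of ratio close to [l] carries the half ball at [x] into a
   ball around [l *: x], and leaves [dylim] and the relevant tail unchanged. *)
Lemma half_ball_integral_le (x : vec) (l s : R) (m : nat) (a e : R) : lmeas A (dylim r u) -> 0 <= e ->
  enorm x = r -> expR (-1) < l < 1 -> 0 < s -> s <= r / 2 -> 2 * s / r <= dya m.+1 ->
  eball (l *: x) (3 * s) `<=` A ->
  (\int[mu]_(z in eball (l *: x) (3 * s)) dytail r u m z <= (e * (3 * s) ^+ N)%:E)%E ->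
  (\int[mu]_(z in eball (l *: x) (3 * s)) `|dylim r u z - a|%:E <= (e * (3 * s) ^+ N)%:E)%E ->
  (\int[mu]_(z in B `&` eball x s) `|u z - a|%:E <= (expR N%:R * (2 * e) * (3 * s) ^+ N)%:E)%E.
Proof.
move=> mlim e0 xr /andP[el l1] s0 sr2 sm DA h1 h2; set y := l *: x in DA h1 h2 *.
have l0 : 0 < l by apply: lt_trans el; exact: expR_gt0.
have q0 : 0 < 2 * s / r by rewrite divr_gt0// mulr_gt0.
(* The level n matches the scale s: heights on the half ball are at most 2 s/r <= [dya n.+1], as
   [dylim_bound] asks, and the dilations of index n + 2, which preserve the tail of index n,
   approximate [l] within 2 s/r. A point thus moves from [l *: x] by less than s + 2 s, whence the
   radius 3 s. *)
have [n mn /andP[n1 n2]] := dyadic_scale q0 sm.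
have [i] := dyadic_dilation_approx n.+2 (introT andP (conj el l1)).
set lam := expR _ => -[h3 h4 h5].
have lam0 : 0 < lam by exact: expR_gt0.
set t := 3 * s in DA h1 h2 *; have t0 : 0 < t by rewrite mulr_gt0.
set D := eball y t in DA h1 h2; have mD : mble D by exact: mble_eball.
pose D' : set vec := [set z | D (lam *: z)]; have mD' : mble D' := mble_scale lam0 mD.
set D0 := B `&` eball x s; have mD0 : mble D0 by apply: measurableI; [exact: mB|exact: mble_eball].
have nr : dya n.+2 * r <= 2 * s by have := ltW n1; rewrite ler_pdivlMr.
have D0D' : D0 `<=` D'.
  move=> z [zB zx]; rewrite /D' /D /eball/= /y.
  have -> : lam *: z - l *: x = lam *: (z - x) + (lam - l) *: x.
    by rewrite scalerBr scalerBl addrA subrK.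
  apply: (le_lt_trans (ler_enormD _ _)); rewrite !enormZ gtr0_norm// ger0_norm ?subr_ge0// xr.
  have a1 : lam * enorm (z - x) <= enorm (z - x) by rewrite ler_piMl ?enorm_ge0.
  have a2 : (lam - l) * r <= dya n.+2 * r by rewrite ler_pM2r.
  by move: zx; rewrite /eball/= /t => zx; lra.
have [mV IV] := dytail_scale r0 mu_ m lam0 mD DA.
have mTa : lmeas D (fun z => `|dylim r u z - a|).
  by apply: (lmeas_norm (f := fun z => dylim r u z - a)); apply: lmeasB; [exact: (lmeasS mA DA)|exact: lmeas_cst].
have mT' := lmeas_scale_on lam0 mD mTa.
have S1 : (\int[mu]_(z in D0) `|u z - a|%:E <=
  \int[mu]_(z in D0) (dytail r u m (lam *: z) + `|dylim r u (lam *: z) - a|%:E))%E.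
  apply: (@ge0_le_integral _ T R mu D0 mD0).
  - by move=> z _; rewrite lee_fin.
  - apply/measurable_EFinP; apply: (lmeas_norm (f := fun z => u z - a)).
    by apply: lmeasB; [exact: (lmeasS mbleT)|exact: lmeas_cst].
  - apply: emeasurable_funD; first exact: (measurable_funS mD' D0D').
    by apply/measurable_EFinP; exact: (lmeasS mD' D0D').
  - move=> z [zB zx]; have [|z0 z1 z2] := boundary_height_le r0 xr _ zB zx; first by rewrite s0.
    rewrite dylim_inv//.
    apply: (@le_trans _ _ (`|u z - dylim r u z|%:E + `|dylim r u z - a|%:E)%E).
      by rewrite -EFinD lee_fin; apply: le_trans (ler_normD _ _); rewrite addrA subrK.
    apply: leeD2r; apply: (@le_trans _ _ (dytail r u n z)).
      apply: dylim_bound => //.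
      by rewrite z1 (le_trans z2).
    have inv := @dytail_inv R k r u r0 n.+2 n i z (leqnn _) z0; rewrite -/lam in inv.
    by rewrite -inv; exact: (dytail_le r u (lam *: z) mn).
apply: (le_trans S1).
apply: (@le_trans _ _ (\int[mu]_(z in D') (dytail r u m (lam *: z) + `|dylim r u (lam *: z) - a|%:E))%E).
  have mf : measurable_fun (D' : set T) (fun z : T => dytail r u m (lam *: z) + `|dylim r u (lam *: z) - a|%:E)%E.
    by apply: emeasurable_funD; [exact: mV|apply/measurable_EFinP; exact: mT'].
  have f0 (z : T) : D' z -> (0 <= dytail r u m (lam *: z) + `|dylim r u (lam *: z) - a|%:E)%E.
    by move=> _; apply: adde_ge0; [exact: dytail_ge0|rewrite lee_fin].
  exact: (@ge0_subset_integral _ T R mu _ _ mD0 mD' _ mf f0 D0D').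
rewrite (@ge0_integralD _ T R mu D' mD' (fun z => dytail r u m (lam *: z)) (fun z => `|dylim r u (lam *: z) - a|%:E)); first last.
- exact/measurable_EFinP.
- by [].
- exact: mV.
- by move=> z _; exact: dytail_ge0.
rewrite IV (leb_integral_scale lam0 mD mTa) => //.
rewrite -ge0_muleDr ?integral_ge0//; last by move=> z _; exact: dytail_ge0.
have lN : lam ^- N <= expR N%:R.
  rewrite -expRM_natl -expRN ler_expR -mulrN -[leRHS]mulr1 ler_wpM2l//.
  by have := lt_le_trans el h3; rewrite ltr_expR; set c := _ * _; lra.
apply: (@le_trans _ _ ((expR N%:R)%:E * ((e * t ^+ N)%:E + (e * t ^+ N)%:E))%E).
  apply: lee_pmul => //.
  - by rewrite lee_fin invr_ge0 exprn_ge0// ltW.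
  - by rewrite adde_ge0 ?integral_ge0// => z _; exact: dytail_ge0.
  - exact: leeD.
by rewrite -EFinD -EFinM lee_fin; set p := t ^+ N; set E := expR _; rewrite -mulrA mulrDr; lra.
Qed.

End trace_exists.

Section trace_points.
Context {R : realType} {k : nat}.
Notation N := k.+1.
Notation vec := 'rV[R]_N.
Notation mu := (leb R N).
Notation T := (lebT R N).
Variables (r : R) (u : vec -> R).
Hypothesis r0 : 0 < r.
Notation B := (eball (0 : vec) r).
Hypotheses (iu : mu.-integrable B (EFin \o u)) (mu_ : lmeas setT u).
Hypothesis vf : (variation B u < +oo)%E.
Notation A := (log_annulus r : set vec).

Let mA : mble A := @mble_log_annulus R k r.
Let mB : mble B := @mble_eball R N 0 r.

Let large (m : nat) (e : R) : set vec := [set y : vec | exists2 t : R, (0 < t < 1)%R &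
  ((e * t ^+ N)%:E < \int[mu]_(z in eball y t) ((dytail r u m \_ A) z))%E].

(** The exceptional set is a Lebesgue null set inside the annulus; [boundary_integral] carries its
    complement to the sphere through [sproj]. Its second part collects the points where, for some
    level, the maximal functions of all the tails are large. *)
Definition trace_bad : set vec := [set y | ~ leb_point (dylim r u \_ A) y] `|`
  \bigcup_n \bigcap_m large m n.+1%:R^-1.

(** Lebesgue differentiation handles the first part. For the second, the integrals of the tails tend
    to 0, so the weak-type inequality makes the sets [large m e] arbitrarily small. *)
Lemma trace_bad_null : leb_outer R N trace_bad = 0%E.
Proof.
have lA : (leb_outer R N A < +oo)%E.
  apply: (ceball_leb_fin (rho := r)) => y /andP[_ h]; rewrite /ceball/= subr0; exact: ltW.
have G1 := lebesgue_point_ae (smoothable_integrable mA lA (dylim_integrable r0 iu mu_ vf)).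
have G2 n : leb_outer R N (\bigcap_m large m n.+1%:R^-1) = 0%E.
  set e : R := n.+1%:R^-1; have e0 : 0 < e by rewrite invr_gt0.
  set C := 12 ^+ N * ballvol R N / e.
  have C0 : 0 < C by rewrite divr_gt0// mulr_gt0 ?exprn_gt0// ballvol_gt0.
  apply/eqP; rewrite eq_le outer_measure_ge0 andbT.
  apply/lee_addgt0Pr => eta eta0; rewrite add0e.
  have [m hm] : exists m, (\int[mu]_(y in A) dytail r u m y < (eta / C)%:E)%E.
    have := dytail_integral_cvg r0 iu mu_ vf; move=> /(_ [set x | (x < (eta / C)%:E)%E]) [|m _ h].
      by apply: open_nbhs_nbhs; split; [exact: open_ereal_lt_ereal|rewrite /= lte_fin divr_gt0].
    by exists m; apply: h => /=.
  have mh : measurable_fun (setT : set T) (dytail r u m \_ A : T -> \bar R).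
    by apply/(measurable_restrictT _ mA); exact: dytail_measurable.
  have h0 y : (0 <= (dytail r u m \_ A) y)%E.
    by rewrite /patch; case: ifP => // _; exact: dytail_ge0.
  apply: (@le_trans _ _ (leb_outer R N (large m e))); first by apply: le_leb => y; apply.
  apply: (le_trans (maximal_weak_type mh h0 e0)); rewrite -/C -integral_mkcond.
  have -> : eta = C * (eta / C) by rewrite mulrC divfK// gt_eqF.
  by rewrite [leRHS]EFinM; apply: lee_wpmul2l; [rewrite lee_fin ltW|exact: ltW].
apply/eqP; rewrite eq_le outer_measure_ge0 andbT /trace_bad.
apply: (le_trans (outer_measureU2 _ _ _)).
change (leb_outer R N [set y | ~ leb_point (dylim r u \_ A) y] +
  leb_outer R N (\bigcup_n \bigcap_m large m n.+1%:R^-1) <= 0)%E.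
rewrite G1 add0e; apply: (le_trans (outer_measure_sigma_subadditive _ _)).
by rewrite eseries0// => n _ _; exact: G2.
Qed.

(** Outside [trace_bad] both integral hypotheses of [half_ball_integral_le] hold on small balls: one
    because y is a Lebesgue point of the limit, the other because the maximal function of some tail
    is small at y. *)
Lemma trace_at (y : vec) : r * expR (-1) < enorm y < r -> ~ trace_bad y ->
  is_bv_trace B u (sproj r y) (dylim r u y).
Proof.
move=> /andP[yl yr] ny.
have y0 : 0 < enorm y by apply: lt_trans yl; rewrite mulr_gt0// expR_gt0.
set x := sproj r y; have xr : enorm x = r by exact: sproj_sphere.
set l := enorm y / r; have yE : y = l *: x.
  by rewrite /x /sproj scalerA /l mulrA divfK ?gt_eqF// mulfV ?gt_eqF// scale1r.
have l1 : expR (-1) < l < 1 by rewrite /l ltr_pdivlMr// mulrC yl ltr_pdivrMr// mul1r.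
have Ay : A y by rewrite /log_annulus/= (ltW yl).
have lp : leb_point (dylim r u \_ A) y by apply: contrapT => h; apply: ny; left.
rewrite /is_bv_trace; apply: cvg_to0 => e e0.
set K : R := expR N%:R * 2 * 3 ^+ N.
have K0 : 0 < K by rewrite !mulr_gt0 ?exprn_gt0// expR_gt0.
have e'0 : 0 < e / K by rewrite divr_gt0.
have [n _ hn] := near_infty_natSinv_lt (PosNum e'0); have {}hn := ltW (hn n (leqnn n)).
have [m hm] : exists m, ~ large m n.+1%:R^-1 y.
  apply: contrapT => h; apply: ny; right; exists n => // m _; apply: contrapT => h'.
  by apply: h; exists m.
have [d d0 hd] := lp _ e'0.
(* Small enough for the ball of radius 3 s around y to stay in the annulus and within the radii
   allowed by [large] and [hd], and for 2 s/r to be at most [dya m.+1]. *)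
pose del := Num.min (Num.min (r / 2) (dya m.+1 * r / 2))
  (Num.min (Num.min (1 / 3) (d / 3)) (Num.min ((r - enorm y) / 3) ((enorm y - r * expR (-1)) / 3))).
have del0 : 0 < del.
  by rewrite !lt_min !divr_gt0 ?mulr_gt0 ?dya_gt0 ?subr_gt0.
near=> s.
have s0 : 0 < s by near: s; exact: nbhs_right_gt.
have : s < del by near: s; exact: nbhs_right_lt.
rewrite /del !lt_min => /andP[/andP[s1 s2] /andP[/andP[s3 s4] /andP[s5 s6]]].
have t0 : 0 < 3 * s by rewrite mulr_gt0.
have DA : eball y (3 * s) `<=` A.
  move=> z; rewrite /eball/= => h; have := le_lt_trans (ler_dist_enorm z y) h.
  rewrite ltr_norml => /andP[h1 h2]; apply/andP; split; lra.
have half := @half_ball_integral_le R k r u r0 mu_ x l s m (dylim r u y) (e / K).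
rewrite -yE in half.
have {}half : (\int[mu]_(z in B `&` eball x s) `|u z - dylim r u y|%:E <=
    (expR N%:R * (2 * (e / K)) * (3 * s) ^+ N)%:E)%E.
  apply: half => //.
  - exact: dylim_measurable.
  - exact: ltW.
  - exact: ltW.
  - by rewrite ler_pdivrMr//; lra.
  - rewrite leNgt; apply/negP => h; apply: hm; exists (3 * s); first by rewrite t0/=; lra.
    rewrite (eq_integral (fun z : T => dytail r u m z)); last first.
      by move=> z /set_mem zD; rewrite /patch mem_set//; exact: DA.
    by apply: le_lt_trans h; rewrite lee_fin ler_wpM2r// exprn_ge0// ltW.
  - have {}hd := hd (3 * s); rewrite (eq_integral (fun z : T => `|(dylim r u \_ A) z - (dylim r u \_ A) y|%:E)).
      by apply: hd; rewrite t0/=; lra.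
    move=> z /set_mem zD; rewrite /patch mem_set; last exact: DA.
    by rewrite mem_set.
have sN : 0 < s ^- N by rewrite invr_gt0 exprn_gt0.
apply/andP; split; first by rewrite mule_ge0 ?integral_ge0// lee_fin ltW.
have le2 : ((s ^- N)%:E * (\int[mu]_(z in B `&` eball x s) `|u z - dylim r u y|%:E) <=
    (s ^- N)%:E * (expR N%:R * (2 * (e / K)) * (3 * s) ^+ N)%:E)%E.
  by apply: lee_wpmul2l => //; rewrite lee_fin ltW.
apply: (le_trans le2); rewrite -EFinM lee_fin exprMn.
have -> : s ^- N * (expR N%:R * (2 * (e / K)) * (3 ^+ N * s ^+ N)) =
    (e / K) * (expR N%:R * 2 * 3 ^+ N) * (s ^- N * s ^+ N).
  by move: (s ^- N) (s ^+ N) (expR N%:R) (3 ^+ N) (e / K) => a b c f g; lra.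
by rewrite mulVf ?expf_neq0 ?gt_eqF// mulr1 -/K divfK// gt_eqF.
Unshelve. all: by end_near. Qed.

End trace_points.

Section bv_trace_unique.
Context {R : realType} {k : nat}.
Notation N := k.+1.
Notation vec := 'rV[R]_N.
Notation mu := (leb R N).
Notation T := (lebT R N).

Lemma mble_null (X : set vec) : leb_outer R N X = 0%E -> mble X.
Proof.
move=> X0; apply: le_caratheodory_measurable => Y.
have h : leb_outer R N (Y `&` X) = 0%E.
  apply/eqP; rewrite eq_le outer_measure_ge0 andbT -X0.
  by apply: le_leb; exact: subIsetr.
change (leb_outer R N (Y `&` X) + leb_outer R N (Y `&` ~` X) <= leb_outer R N Y)%E.
by rewrite h add0e; apply: le_leb; exact: subIsetl.
Qed.

Lemma lmeas_ae (D X : set vec) (f g : vec -> R) : leb_outer R N X = 0%E ->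
  (forall y, D y -> ~ X y -> f y = g y) -> lmeas D f ->
  lmeas D g /\ ae_eq mu (D : set T) (EFin \o f) (EFin \o g).
Proof.
move=> X0 fg mf.
have ae : ae_eq mu (D : set T) (EFin \o f) (EFin \o g).
  exists X; split=> //; first exact: mble_null.
  move=> y /= hy; apply: contrapT => nX; apply: hy => Dy; congr (_%:E); exact: fg.
split=> //; apply/measurable_EFinP.
apply: (@ae_measurable_fun _ T R mu (@measure_is_complete_caratheodory R _ (leb_outer R N)) D (EFin \o f)) => //.
exact/measurable_EFinP.
Qed.

Lemma leb_sphere_null (c : R) : 0 < c -> leb_outer R N (sphere c : set vec) = 0%E.
Proof.
move=> c0; apply/eqP; rewrite eq_le outer_measure_ge0 andbT.
have h : leb_outer R N (ceball 0 c) =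
    (leb_outer R N (ceball 0 c `&` eball 0 c) + leb_outer R N (ceball 0 c `\` eball 0 c))%E.
  by apply: mble_split; exact: mble_eball.
rewrite leb_ceball// in h.
have E : ceball 0 c `&` eball 0 c = eball (0 : vec) c.
  by apply: setIidr => y; rewrite /ceball/eball/= => /ltW.
rewrite E leb_eball// in h.
have : ((c ^+ N * ballvol R N)%:E + leb_outer R N (ceball 0 c `\` eball 0 c) <=
  (c ^+ N * ballvol R N)%:E + 0)%E by rewrite -h adde0.
rewrite leeD2lE//; apply: le_trans; apply: le_leb => y; rewrite /sphere/ceball/eball/= subr0 => ->.
by split=> //; rewrite ltxx.
Qed.

Variables (r : R) (u : vec -> R).
Hypothesis r0 : 0 < r.
Notation B := (eball (0 : vec) r).
Hypotheses (iu : mu.-integrable B (EFin \o u)) (mu_ : lmeas setT u).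
Notation A := (log_annulus r : set vec).

Let mB : mble B := @mble_eball R N 0 r.

(** The intersection contains the ball of radius s/2 whose centre is [x] moved towards 0 by s/2. *)
Lemma half_ball_leb_ge (x : vec) (s : R) : enorm x = r -> 0 < s < 2 * r ->
  (((s / 2) ^+ N * ballvol R N)%:E <= leb_outer R N (B `&` eball x s))%E.
Proof.
move=> xr /andP[s0 sr]; have s20 : 0 < s / 2 by rewrite divr_gt0.
rewrite -(leb_eball ((1 - s / (2 * r)) *: x) s20); apply: le_leb => z; rewrite /eball/= => hz.
have q0 : 0 < s / (2 * r) by rewrite divr_gt0// mulr_gt0.
have q1 : s / (2 * r) < 1 by rewrite ltr_pdivrMr ?mulr_gt0// mul1r.
have qr : s / (2 * r) * r = s / 2 by rewrite invfM mulrA -mulrA mulVf ?mulr1// gt_eqF.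
split; rewrite /eball/= ?subr0.
  have -> : z = (z - (1 - s / (2 * r)) *: x) + (1 - s / (2 * r)) *: x by rewrite subrK.
  apply: (le_lt_trans (ler_enormD _ _)); rewrite [X in _ + X]enormZ xr gtr0_norm ?subr_gt0//.
  by rewrite mulrBl qr mul1r; lra.
have -> : z - x = (z - (1 - s / (2 * r)) *: x) + (- (s / (2 * r))) *: x.
  by rewrite scalerBl scale1r scaleNr opprB addrA addrAC addrK addrC.
apply: (le_lt_trans (ler_enormD _ _)); rewrite [X in _ + X]enormZ xr normrN gtr0_norm// qr; lra.
Qed.

(** Both averages being small, |a - b| is small in the mean over a set whose measure is at least a
    fixed multiple of s^N. *)
Lemma is_bv_trace_unique (x : vec) (a b : R) : enorm x = r ->
  is_bv_trace B u x a -> is_bv_trace B u x b -> a = b.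
Proof.
move=> xr ha hb; apply/eqP; rewrite -subr_eq0 -normr_eq0; apply/eqP/le_anti; rewrite normr_ge0 andbT.
apply/ler_addgt0Pr => e e0; rewrite add0r.
set c := ballvol R N / 2 ^+ N; have c0 : 0 < c by rewrite divr_gt0 ?exprn_gt0// ballvol_gt0.
have e'0 : 0 < e * c / 2 by apply: divr_gt0 => //; exact: mulr_gt0.
have near_small t : is_bv_trace B u x t -> \forall s \near 0^'+,
    ((s ^- N)%:E * \int[mu]_(y in B `&` eball x s) `|u y - t|%:E < (e * c / 2)%:E)%E.
  move=> /(_ [set z | (z < (e * c / 2)%:E)%E]); apply.
  by apply: open_nbhs_nbhs; split; [exact: open_ereal_lt_ereal|rewrite /= lte_fin].
have : \forall s \near 0^'+, [/\ 0 < s :> R, s < 2 * r,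
    ((s ^- N)%:E * \int[mu]_(y in B `&` eball x s) `|u y - a|%:E < (e * c / 2)%:E)%E &
    ((s ^- N)%:E * \int[mu]_(y in B `&` eball x s) `|u y - b|%:E < (e * c / 2)%:E)%E].
  near=> s; split.
  - by near: s; exact: nbhs_right_gt.
  - by near: s; apply: nbhs_right_lt; rewrite mulr_gt0.
  - by near: s; exact: near_small.
  - by near: s; exact: near_small.
move=> hn; have [s [s0 sr h1 h2]] := @filter_ex _ _ (at_right_proper_filter (0 : R)) _ hn.
set D := B `&` eball x s in h1 h2 *.
have mD : mble D by apply: measurableI; [exact: mB|exact: mble_eball].
have mt t : lmeas D (fun y => `|u y - t|).
  apply: (lmeas_norm (f := fun z => u z - t)); apply: lmeasB; [exact: (lmeasS mbleT)|exact: lmeas_cst].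
have S1 : ((`|a - b|%:E * leb_outer R N D) <=
   \int[mu]_(y in D) `|u y - a|%:E + \int[mu]_(y in D) `|u y - b|%:E)%E.
  have <- : (\int[mu]_(y in D) `|a - b|%:E = `|a - b|%:E * leb_outer R N D)%E.
    exact: (@integral_cst _ T R mu _ mD `|a - b|%:E).
  rewrite -leb_integralD//; apply: le_leb_integral => //.
  - exact: lmeas_cst.
  - exact: lmeasD.
  - move=> y _; rewrite [X in _ <= X + _]distrC; apply: le_trans (ler_normD _ _).
    by rewrite addrA subrK.
have sN : 0 < s ^- N by rewrite invr_gt0 exprn_gt0.
have S2 : ((s ^- N)%:E * (`|a - b|%:E * leb_outer R N D) <= (e * c)%:E)%E.
  apply: (@le_trans _ _ ((s ^- N)%:E * (\int[mu]_(y in D) `|u y - a|%:E + \int[mu]_(y in D) `|u y - b|%:E))%E).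
    by apply: lee_wpmul2l => //; rewrite lee_fin ltW.
  rewrite ge0_muleDr ?integral_ge0//.
  have -> : e * c = e * c / 2 + e * c / 2 by lra.
  by rewrite [leRHS]EFinD; apply: leeD; exact: ltW.
have S3 : ((s ^- N)%:E * (`|a - b|%:E * ((s / 2) ^+ N * ballvol R N)%:E) <= (e * c)%:E)%E.
  apply: (le_trans _ S2); apply: lee_wpmul2l; first by rewrite lee_fin ltW.
  by apply: lee_wpmul2l => //; apply: half_ball_leb_ge; rewrite ?s0.
move: S3; rewrite -!EFinM lee_fin.
have -> : s ^- N * (`|a - b| * ((s / 2) ^+ N * ballvol R N)) = `|a - b| * c * (s ^- N * s ^+ N).
  rewrite expr_div_n /c; move: (s ^- N) (s ^+ N) (2 ^- N) (ballvol R N) `|a - b| => *; lra.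
by rewrite mulVf ?mulr1 ?expf_neq0 ?gt_eqF// ler_pM2r.
Unshelve. all: by end_near. Qed.

Lemma bv_traceE (x : vec) (a : R) : enorm x = r -> is_bv_trace B u x a -> bv_trace B u x = a.
Proof.
move=> xr ha; rewrite /bv_trace; apply: xget_subset1 => // b c hb hc.
exact: is_bv_trace_unique xr hb hc.
Qed.

Hypothesis vf : (variation B u < +oo)%E.

(** Almost everywhere on the annulus, [dylim] is the trace at the projected point; [integral_sphere]
    then turns the integral over the sphere into one over the annulus. *)
Lemma boundary_integral : (\int[hausdorff R N k]_(x in boundary B) `|bv_trace B u x|%:E =
  (@sphere_ratio R k r)%:E * \int[mu]_(y in A) `|dylim r u y|%:E)%E.
Proof.
rewrite boundary_eball//.
set X := trace_bad r u `|` sphere (r * expR (-1)).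
have X0 : leb_outer R N X = 0%E.
  apply/eqP; rewrite eq_le outer_measure_ge0 andbT; apply: (le_trans (outer_measureU2 _ _ _)).
  change (leb_outer R N (trace_bad r u) + leb_outer R N (sphere (r * expR (-1)) : set vec) <= 0)%E.
  rewrite (trace_bad_null r0 iu mu_ vf) leb_sphere_null ?adde0//.
  by rewrite mulr_gt0 ?expR_gt0.
have eqT y : A y -> ~ X y -> dylim r u y = bv_trace B u (sproj r y).
  move=> Ay nX; have y0 := enorm_log_annulus r0 Ay.
  apply/esym/bv_traceE; first exact: sproj_sphere.
  apply: trace_at => //; last by move=> h; apply: nX; left.
  move: Ay => /andP[]; rewrite le_eqVlt => /orP[/eqP h|-> ->//] _.
  by exfalso; apply: nX; right.
have mA := @mble_log_annulus R k r : mble A.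
have [mT ae] := lmeas_ae X0 eqT (dylim_measurable r0 iu mu_ vf).
have mg : measurable_fun setT (fun t : R => `|t|%:E) by apply/measurable_EFinP; exact: (@measurableT_comp _ _ _ _ _ _ (fun t : R => `|t|)).
have m1 : measurable_fun (A : set T) (fun y : T => `|bv_trace B u (sproj r y)|%:E).
  by apply/measurable_EFinP; exact: lmeas_norm mT.
have m2 : measurable_fun (A : set T) (fun y : T => `|dylim r u y|%:E).
  by apply/measurable_EFinP; exact: lmeas_norm (dylim_measurable r0 iu mu_ vf).
have p1 (y : T) : A y -> (0 <= `|bv_trace B u (sproj r y)|%:E)%E by move=> _; rewrite lee_fin.
have p2 (y : T) : A y -> (0 <= `|dylim r u y|%:E)%E by move=> _; rewrite lee_fin.
have <- : (\int[mu]_(y in A) `|bv_trace B u (sproj r y)|%:E = \int[mu]_(y in A) `|dylim r u y|%:E)%E; last first.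
  exact: (integral_sphere r0 mT mg (fun t => ltac:(by rewrite lee_fin)) (congr1 EFin (normr0 R))).
apply: (@ge0_ae_eq_integral _ T R mu A _ _ mA m1 m2 p1 p2).
move: ae => [Y [mY Y0 hY]]; exists Y; split=> // y /= hy; apply: hY => /= h; apply: hy => Ay.
by have [->] := h Ay.
Qed.

End bv_trace_unique.

(** * The trace inequality *)

Section invariant_integrals.
Context {R : realType} {k : nat}.
Notation N := k.+1.
Notation vec := 'rV[R]_N.
Notation mu := (leb R N).
Notation T := (lebT R N).
Variables (r : R) (u : vec -> R).
Hypothesis r0 : 0 < r.
Notation B := (eball (0 : vec) r).
Hypotheses (iu : mu.-integrable B (EFin \o u)) (mu_ : lmeas setT u).
Notation A := (log_annulus r : set vec).

Let mA : mble A := @mble_log_annulus R k r.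
Let mB : mble B := @mble_eball R N 0 r.

Definition collar (n : nat) : set vec := [set y | r * dyq n <= enorm y < r].

Lemma mble_collar n : mble (collar n).
Proof.
rewrite (_ : collar n = eball 0 r `\` eball 0 (r * dyq n)).
  by apply: measurableD; exact: mble_eball.
apply/seteqP; split=> y; rewrite /collar/eball/= subr0.
  by move=> /andP[h ->]; split=> //; apply/negP; rewrite -leNgt.
by move=> [-> /negP]; rewrite -leNgt andbT.
Qed.

Lemma collar_sub n : collar n `<=` A.
Proof.
move=> y /andP[h1 h2]; apply/andP; split=> //; apply: le_trans h1; rewrite ler_pM2l// ler_expR lerN2.
by rewrite invf_le1 ?exprn_gt0// exprn_ege1// ler1n.
Qed.

Lemma collar_height n y : collar n y -> 0 < enorm y /\ 0 < height r y <= dya n.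
Proof.
move=> /[dup] yc /collar_sub Ay; have y0 := enorm_log_annulus r0 Ay; split=> //.
have /andP[-> _] := (log_annulusE r0 y0).1 Ay.
move: yc => /andP[]; rewrite {1}(enorm_height r0 y0) ler_pM2l// /dyq ler_expR lerN2 => -> _.
by [].
Qed.

(** The ratio of the measure of the annulus to that of the collar of index n. *)
Definition shell_ratio (n : nat) : R := (1 - expR (-1) ^+ N) / (1 - dyq n ^+ N).

Lemma dyqX_lt1 n : (dyq n : R) ^+ N < 1.
Proof. by have /andP[h1 h2] := @dyq01 R n; rewrite exprn_ilt1 ?ltW. Qed.

Lemma shell_ratio_gt0 n : 0 < shell_ratio n.
Proof.
rewrite divr_gt0// subr_gt0; last exact: dyqX_lt1.
by rewrite exprn_ilt1 ?expR_ge0// expR_lt1 ltrN10.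
Qed.

(** An invariant function is determined by its values on one shell. The 2^m dilates of the shell
    that make up the annulus give a geometric series, summed with q^(2^m) = 1/e; the collar is the
    shell dilated by 1/q. *)
Lemma invariant_integral n (f : vec -> R) :
  (forall (i : int) y, 0 < enorm y -> f (expR (i%:~R * dya n.+1) *: y) = f y) ->
  lmeas A f -> (forall y, 0 <= f y) ->
  (\int[mu]_(y in A) (f y)%:E = (shell_ratio n.+1)%:E * \int[mu]_(y in collar n.+1) (f y)%:E)%E.
Proof.
move=> inv mf f0; set m := n.+1 in inv *; set S := dyshell r m : set vec.
have d0 : 0 < (dya m : R) by exact: dya_gt0.
have d2 : 2 * dya m <= 1 :> R.
  by rewrite -dyaS invf_le1 ?exprn_gt0// exprn_ege1// ler1n.
have mS : mble S by exact: mble_dyshell.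
have SA : S `<=` A.
  move=> y Sy; have y0 := dyshell_enorm r0 Sy; apply/(log_annulusE r0 y0).
  have /andP[h1 h2] := (dyshellE r0 m y0).1 Sy; apply/andP; split; [exact: lt_trans h1|exact: le_trans h2 d2].
have mfS : lmeas S f by exact: (lmeasS mA SA mf).
have mp := lmeas_patch mS mfS; pose F := f \_ S.
have F0 y : 0 <= F y by rewrite /F /patch; case: ifP.
pose a (i : nat) : R := expR ((i%:R - 1) * dya m).
have mFi (i : nat) : lmeas setT (fun y : vec => F (a i *: y)).
  exact: (lmeas_scale (expR_gt0 _) mp).
have fE y : A y -> f y = \sum_(i < 2 ^ m) F (a i *: y).
  move=> Ay; rewrite -(dykap_sum r0 m f Ay) /dykap -[2]/(2%:~R) -intrB inv//.
  exact: (enorm_log_annulus r0 Ay).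
rewrite (eq_integral (fun y : T => \sum_(i < 2 ^ m) (F (a i *: y))%:E)%E); last first.
  by move=> y /set_mem Ay; rewrite (fE y Ay) -sumEFin.
rewrite (@ge0_integral_sum _ T R mu A mA _ (fun (i : 'I_(2 ^ m)) (y : vec) => (F (a i *: y))%:E)); first last.
- by move=> i y _; rewrite lee_fin.
- by move=> i; apply/measurable_EFinP; apply: measurable_funTS; exact: mFi.
have IS : (\int[mu]_(y in S) (f y)%:E = \int[mu]_y (F y)%:E)%E.
  by rewrite /F -(@leb_integral_patch _ _ _ f EFin).
set q : R := dyq m; have /andP[q0 q1] := @dyq01 R m; rewrite -/q in q0 q1.
have terms (i : 'I_(2 ^ m)) : (\int[mu]_(y in A) (F (a i *: y))%:E =
    ((q ^+ N) ^+ i * q ^- N)%:E * \int[mu]_(y in S) (f y)%:E)%E.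
  have -> : (\int[mu]_(y in A) (F (a i *: y))%:E = \int[mu]_y (F (a i *: y))%:E)%E.
    rewrite integral_mkcond; apply: eq_integral => y _; rewrite /patch; case: ifPn => // yA.
    rewrite /F /patch; case: ifPn => // /set_mem Sy; exfalso; move/negP: yA; apply; apply/mem_set.
    have ay0 := dyshell_enorm r0 Sy.
    have y0 : 0 < enorm y by move: ay0; rewrite enormZ gtr0_norm ?expR_gt0// pmulr_rgt0// expR_gt0.
    apply/(log_annulusE r0 y0); have := (dyshellE r0 m ay0).1 Sy; rewrite heightZ// => /andP[h1 h2].
    have i0 : 0 <= i%:R :> R by [].
    have i1 : (i%:R + 1) * dya m <= 1 :> R.
      rewrite /dya ler_pdivrMr ?exprn_gt0// mul1r -natrX natr1 ler_nat; exact: ltn_ord.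
    have i2 : 0 <= i%:R * dya m :> R by rewrite mulr_ge0// ltW.
    by apply/andP; split; lra.
  rewrite (leb_integral_scale (expR_gt0 _) mbleT mp F0) -IS; congr (_%:E * _)%E.
  rewrite /a /q /dyq -!expRM_natl -!expRN -expRD; congr expR; lra.
rewrite (eq_bigr _ (fun i _ => terms i)).
have Sc : (\int[mu]_(y in S) (f y)%:E = (q ^+ N)%:E * \int[mu]_(y in collar m) (f y)%:E)%E.
  have h := leb_integral_scale q0 mS mfS f0.
  have E1 : [set y : vec | S (q *: y)] = collar m.
    apply/seteqP; split=> y; rewrite /S /dyshell /collar/= enormZ gtr0_norm// -/q expr2.
      by rewrite mulrCA [X in q * _ < X]mulrC ler_pM2l// ltr_pM2l.
    by rewrite mulrCA [X in q * _ < X]mulrC ler_pM2l// ltr_pM2l.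
  rewrite E1 in h.
  have E2 : (\int[mu]_(y in collar m) (f (q *: y))%:E = \int[mu]_(y in collar m) (f y)%:E)%E.
    apply: eq_integral => y /set_mem yc; have [y0 _] := collar_height yc.
    by have := inv (-1) y y0; rewrite mulN1r => ->.
  rewrite -E2 h muleA -EFinM mulfV ?mul1e// gt_eqF// exprn_gt0//.
rewrite Sc -ge0_sume_distrl; last first.
  by move=> i _; rewrite lee_fin mulr_ge0 ?exprn_ge0 ?invr_ge0 ?exprn_ge0// ltW.
rewrite sumEFin muleA -EFinM; congr (_%:E * _)%E.
rewrite -mulr_suml -mulrA mulVf ?mulr1; last by rewrite gt_eqF// exprn_gt0.
rewrite /shell_ratio -/q; have p0 : 1 - q ^+ N != 0 by rewrite gt_eqF// subr_gt0; exact: dyqX_lt1.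
apply: (mulIf p0); rewrite divfK// mulrC -[RHS]opprB -[in LHS](opprB (q ^+ N)) mulNr -subrX1.
congr (- (_ - _)); rewrite -exprM mulnC exprM; congr (_ ^+ _).
rewrite /q /dyq -expRM_natl; congr expR; rewrite natrX mulrN mulfV// expf_neq0//.
Qed.

Lemma dytail_collar_integral n : (\int[mu]_(y in A) dytail r u n y =
  (shell_ratio n.+1)%:E * \int[mu]_(y in collar n.+1) dytail r u n y)%E.
Proof.
have mi j : lmeas A (dyinc r u j) by exact: lmeas_dyinc.
have mc := mble_collar n.+1.
rewrite (@integral_nneseries _ T R mu _ mA (fun j (y : vec) => (dyinc r u (j + n) y)%:E)); first last.
- by move=> j y _; rewrite lee_fin dyinc_ge0.
- by move=> j; apply/measurable_EFinP; exact: mi.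
rewrite (@integral_nneseries _ T R mu _ mc (fun j (y : vec) => (dyinc r u (j + n) y)%:E)); first last.
- by move=> j y _; rewrite lee_fin dyinc_ge0.
- by move=> j; apply/measurable_EFinP; exact: (lmeasS mA (collar_sub (n := n.+1)) (mi _)).
rewrite -nneseriesZl; last by move=> j _; apply: leb_integral_ge0 => y _; exact: dyinc_ge0.
apply: eq_eseriesr => j _; apply: invariant_integral => //; last by move=> y; exact: dyinc_ge0.
by move=> i y y0; apply: dyinc_inv => //; lia.
Qed.

End invariant_integrals.

Section trace_estimate.
Context {R : realType} {k : nat}.
Notation N := k.+1.
Notation vec := 'rV[R]_N.
Notation mu := (leb R N).
Notation T := (lebT R N).
Variables (r : R) (u : vec -> R).
Hypothesis r0 : 0 < r.
Notation B := (eball (0 : vec) r).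
Hypotheses (iu : mu.-integrable B (EFin \o u)) (mu_ : lmeas setT u).
Hypothesis vf : (variation B u < +oo)%E.
Notation A := (log_annulus r : set vec).

Let mA : mble A := @mble_log_annulus R k r.
Let mB : mble B := @mble_eball R N 0 r.
Let mn : lmeas setT (fun y => `|u y|) := lmeas_norm mu_.
Let I := (\int[mu]_(y in B) `|u y|%:E)%E.

Lemma leb_set0_null : leb_outer R N [set (0 : vec)] = 0%E.
Proof.
apply/eqP; rewrite eq_le outer_measure_ge0 andbT; apply/lee_addgt0Pr => e e0; rewrite add0e.
have w0 : 0 < ballvol R N by exact: ballvol_gt0.
set c := Num.min 1 (e / ballvol R N); have c0 : 0 < c by rewrite lt_min ltr01 divr_gt0.
apply: (@le_trans _ _ (leb_outer R N (ceball 0 c))).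
  by apply: le_leb => y ->; rewrite /ceball/= subrr enorm0 ltW.
rewrite leb_ceball// lee_fin -ler_pdivlMr//; apply: (@le_trans _ _ c).
  by rewrite exprS ler_piMr ?(ltW c0)// exprn_ile1 ?(ltW c0)// ge_min lexx.
by rewrite ge_min lexx orbT.
Qed.

(** [dilation_variation] concerns annuli; the centre of the ball is a null set. *)
Lemma integral_ball_annulus : I = (\int[mu]_(y in annulus 0 r) `|u y|%:E)%E.
Proof.
have BE : B = annulus 0 r `|` [set (0 : vec)].
  apply/seteqP; split=> y; rewrite /eball/annulus/= subr0.
    move=> yr; have [->|y0] := eqVneq y 0; [by right|left].
    by rewrite yr andbT enorm_gt0.
  by move=> [/andP[]//|->]; rewrite enorm0.
have m0 : mble [set (0 : vec)] by apply: mble_null; exact: leb_set0_null.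
have z0 : (\int[mu]_(y in [set (0%R : vec)]) `|u y|%:E = 0)%E.
  have mEu : measurable_fun ([set (0%R : vec)] : set T) (fun y : T => `|u y|%:E).
    by apply/measurable_EFinP; exact: (lmeasS mbleT).
  exact: (@null_set_integral _ T R mu _ _ m0 mEu leb_set0_null).
rewrite /I {1}BE (@ge0_integral_setU _ T R mu _ _ (mble_annulus 0 r) m0 (fun y => `|u y|%:E)).
- by rewrite z0 adde0.
- by apply/measurable_EFinP; exact: (lmeasS mbleT).
- by move=> y _; rewrite lee_fin.
- apply/disj_set2P; rewrite -subset0 => y [/andP[h _] /= yE].
  by move: h; rewrite yE enorm0 ltxx.
Qed.

Lemma I_fin : I \is a fin_num.
Proof. by have /integrableP[_ /= h] := iu; rewrite ge0_fin_numE// integral_ge0. Qed.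

Let V := fine (variation B u).

(** With Z the integral of |u| over the ball of radius q r, the integral of |u(q y)| is q^(-N) Z,
    while that of |u| is Z + J. They differ by at most the bound of [dilation_variation];
    multiplying by q^N gives the estimate. *)
Lemma collar_estimate n (q := dyq n : R) : exists J : R,
  (\int[mu]_(y in collar r n) `|u y|%:E)%E = J%:E /\
  `|J - (1 - q ^+ N) * fine I| <= (q^-1 - 1) * r * V.
Proof.
have /andP[q0 q1] : 0 < q < 1 := @dyq01 R n.
have vE : variation B u = V%:E by rewrite fineK// ge0_fin_numE// variation_ge0.
have sub (b : R) : b <= r -> annulus 0 b `<=` B.
  by move=> br y /andP[_ yb]; rewrite /eball/= subr0 (lt_le_trans yb).
set D : set vec := annulus 0 r; have mD : mble D by exact: mble_annulus.
set Z := (\int[mu]_(y in annulus 0 (q * r)) `|u y|%:E)%E.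
set J := (\int[mu]_(y in collar r n) `|u y|%:E)%E.
have mZ : mble (annulus 0 (q * r) : set vec) by exact: mble_annulus.
have mJ : mble (collar r n : set vec) by exact: mble_collar.
have qr : q * r < r by rewrite gtr_pMl.
have IE : I = (Z + J)%E.
  rewrite integral_ball_annulus -(@ge0_integral_setU _ T R mu _ _ mZ mJ (fun y => `|u y|%:E)).
  - congr (integral _ _ _); apply/seteqP; split=> y.
      move=> /andP[h1 h2]; have [h|h] := ltP (enorm y) (q * r); [left|right]; apply/andP; split => //.
      by rewrite mulrC.
    move=> [/andP[h1 h2]|/andP[h1 h2]]; apply/andP; split => //; first exact: lt_trans h2 qr.
    by apply: lt_le_trans h1; rewrite mulr_gt0.
  - by apply/measurable_EFinP; exact: (lmeasS mbleT).
  - by move=> y _; rewrite lee_fin.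
  - apply/disj_set2P; rewrite -subset0 => y [/andP[_ h1] /andP[h2 _]].
    by have := le_lt_trans h2 h1; rewrite mulrC ltxx.
have Z0 : (0 <= Z)%E by exact: integral_ge0.
have J0 : (0 <= J)%E by exact: integral_ge0.
have If := I_fin; rewrite IE in If.
have Jf : J \is a fin_num.
  by rewrite ge0_fin_numE//; apply: le_lt_trans (leeDr J Z0) _; rewrite -ge0_fin_numE// adde_ge0.
have Zf : Z \is a fin_num.
  by rewrite ge0_fin_numE//; apply: le_lt_trans (leeDl Z J0) _; rewrite -ge0_fin_numE// adde_ge0.
exists (fine J); split; first by rewrite fineK.
have mDu : lmeas D (fun y => `|u y|) by exact: (lmeasS mbleT).
have mq : lmeas setT (fun y => u (q *: y)) := lmeas_scale q0 mu_.
have mDq : lmeas D (fun y => `|u (q *: y)|) by apply: (lmeasS mbleT) => //; exact: lmeas_norm mq.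
have mDd : lmeas D (fun y => `|u y - u (q *: y)|).
  by apply: (lmeasS mbleT) => //; exact: lmeas_norm (lmeasB mu_ mq).
have YE : (\int[mu]_(y in D) `|u (q *: y)|%:E = (q ^- N)%:E * Z)%E.
  rewrite -(leb_integral_scale q0 mZ) => //; last exact: (lmeasS mbleT).
  congr (integral _ _ _); apply/seteqP; split=> y; rewrite /D/annulus/= enormZ gtr0_norm// pmulr_rgt0// ltr_pM2l//.
set K := (q^-1 - 1) * (r * q ^- N).
have dil : (\int[mu]_(y in D) `|u y - u (q *: y)|%:E <= (K * V)%:E)%E.
  have S3 := @dilation_variation R N r u (ltn0Sn k) r0 iu q 0 r (introT andP (conj q0 q1)).
  rewrite lexx r0 lexx in S3.
  apply: (le_trans (S3 isT isT)); rewrite [leRHS]EFinM -vE; apply: lee_wpmul2l.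
    rewrite lee_fin; apply: mulr_ge0; first by rewrite subr_ge0 invf_ge1// ltW.
    by rewrite mulr_ge0 ?(ltW r0)// invr_ge0 exprn_ge0// ltW.
  by apply: variation_le_sub; rewrite mulr0; exact: sub.
have h1 : (Z + J <= (q ^- N)%:E * Z + (K * V)%:E)%E.
  rewrite -IE integral_ball_annulus -YE.
  apply: (@le_trans _ _ (\int[mu]_(y in D) (`|u (q *: y)| + `|u y - u (q *: y)|)%:E)%E).
    apply: le_leb_integral => //; first exact: lmeasD.
    by move=> y _; rewrite addrC; apply: le_trans (ler_normD _ _); rewrite subrK.
  by rewrite leb_integralD//; exact: leeD.
have h2 : ((q ^- N)%:E * Z <= Z + J + (K * V)%:E)%E.
  rewrite -IE integral_ball_annulus -YE.
  apply: (@le_trans _ _ (\int[mu]_(y in D) (`|u y| + `|u y - u (q *: y)|)%:E)%E).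
    apply: le_leb_integral => //; first exact: lmeasD.
    by move=> y _; rewrite addrC distrC; apply: le_trans (ler_normD _ _); rewrite subrK.
  by rewrite leb_integralD//; exact: leeD.
have fI : fine I = fine Z + fine J by rewrite IE fineD.
move: h1 h2; rewrite -(fineK Zf) -(fineK Jf) -!EFinM -!EFinD !lee_fin fI.
move: (fine Z) (fine J) => z j h1 h2.
have qN : 0 < q ^+ N by rewrite exprn_gt0.
have e1 : q ^+ N * q ^- N = 1 by rewrite mulfV// gt_eqF.
have e2 : q ^+ N * (K * V) = (q^-1 - 1) * r * V.
  rewrite /K; have -> : q ^+ N * ((q^-1 - 1) * (r * q ^- N) * V) = (q^-1 - 1) * r * V * (q ^+ N * q ^- N).
    by move: (q ^+ N) (q ^- N) (q^-1 - 1) V => *; lra.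
  by rewrite e1 mulr1.
have g1 : q ^+ N * (z + j) <= z + (q^-1 - 1) * r * V.
  by rewrite -e2 -{2}[z]mul1r -e1 -mulrA -mulrDr ler_pM2l.
have g2 : z <= q ^+ N * (z + j) + (q^-1 - 1) * r * V.
  by rewrite -e2 -[X in X <= _]mul1r -e1 -mulrA -mulrDr ler_pM2l.
move: g1 g2; set C := (q^-1 - 1) * r * V; set Q := q ^+ N => g1 g2.
by rewrite /= ler_norml; apply/andP; split; lra.
Qed.

(** 1 - q^N is 1 - q times a sum of N powers of q, each at least q^(N-1). *)
Lemma one_sub_expr_ge (q : R) : 0 < q < 1 -> (q^-1 - 1) <= q ^- N / N%:R * (1 - q ^+ N).
Proof.
move=> /andP[q0 q1]; have qN : 0 < q ^+ N by rewrite exprn_gt0.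
have : N%:R * q ^+ k * (1 - q) <= 1 - q ^+ N.
  rewrite -[leRHS]opprB subrX1 -mulNr opprB mulrC ler_pM2l ?subr_gt0//.
  rewrite -[N in N%:R]card_ord -sum1_card natr_sum mulr_suml; apply: ler_sum => i _.
  by rewrite mul1r ler_wiXn2l ?(ltW q0) ?(ltW q1)// -ltnS.
move=> h; rewrite -mulrA ler_pdivlMl// ler_pdivlMl ?ltr0n//.
apply: le_trans h; rewrite mulrBr mulr1 exprSr.
have -> : q ^+ k * q * q^-1 = q ^+ k by rewrite mulfK// gt_eqF.
by rewrite [leRHS]mulrBr mulr1 mulrBr mulrA.
Qed.

Let K := fine (\int[mu]_(y in A) `|dylim r u y|%:E)%E.
Let kappa : R := 1 - expR (-1) ^+ N.

Lemma dylim_norm_fin : (\int[mu]_(y in A) `|dylim r u y|%:E)%E = K%:E.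
Proof.
by have /integrableP[_ /= h] := dylim_integrable r0 iu mu_ vf; rewrite fineK// ge0_fin_numE// integral_ge0.
Qed.

(** On the collar, |u| and |dylim| differ by at most the tail. The limit and the tail are invariant,
    so their integrals over the collar are exact multiples of those over the annulus. Dividing by 1
    - q^N, the order of thickness of the collar, therefore leaves the tail term at w / kappa. *)
Lemma trace_estimate_approx n (w : R) : (\int[mu]_(y in A) dytail r u n y <= w%:E)%E ->
  `|K / kappa - fine I| <= w / kappa + r / N%:R * V * dyq n.+1 ^- N.
Proof.
move=> hw; set q : R := dyq n.+1; have /andP[q0 q1] : 0 < q < 1 := @dyq01 R n.+1.
have [J [JE hJ]] := collar_estimate n.+1; rewrite -/q in hJ.
have p0 : 0 < 1 - q ^+ N by rewrite subr_gt0; exact: dyqX_lt1.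
have ka0 : 0 < kappa by rewrite subr_gt0 exprn_ilt1 ?expR_ge0// expR_lt1 ltrN10.
set C := collar r n.+1 : set vec; have mC : mble C by exact: mble_collar.
have CA : C `<=` A by exact: collar_sub.
set c : R := shell_ratio (k := k) n.+1; have c0 : 0 < c by exact: shell_ratio_gt0.
have mT := dylim_measurable r0 iu mu_ vf.
have mTn : lmeas A (fun y => `|dylim r u y|) := lmeas_norm mT.
have KE := invariant_integral r0 (n := n) (f := fun y => `|dylim r u y|) _ mTn (fun y => normr_ge0 _).
rewrite dylim_norm_fin -/C -/c in KE.
have {}KE : K%:E = (c%:E * \int[mu]_(y in C) `|dylim r u y|%:E)%E.
  by apply: KE => i y y0; rewrite dylim_inv.
have WE := dytail_collar_integral r0 iu mu_ n; rewrite -/C -/c in WE.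
set L := (\int[mu]_(y in C) `|dylim r u y|%:E)%E in KE.
set W := (\int[mu]_(y in C) dytail r u n y)%E in WE.
have LE : L = (K / c)%:E by rewrite mulrC EFinM KE muleA -EFinM mulVf ?mul1e// gt_eqF.
have W0 : (0 <= W)%E by apply: integral_ge0 => y _; exact: dytail_ge0.
have Wle : (W <= (w / c)%:E)%E.
  rewrite mulrC EFinM -(mul1e W) -(mulVf (lt0r_neq0 c0)) EFinM -muleA; apply: lee_wpmul2l.
    by rewrite lee_fin invr_ge0 ltW.
  by rewrite -WE.
have pt y : C y -> (`|u y - dylim r u y|%:E <= dytail r u n y)%E.
  by move=> /(collar_height r0)[y0 hy]; exact: dylim_bound.
have mCu : lmeas C (fun y => `|u y|) by exact: (lmeasS mbleT).
have mCT : lmeas C (fun y => `|dylim r u y|) by exact: (lmeasS mA CA).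
have mCV : measurable_fun (C : set T) (dytail r u n : T -> \bar R).
  exact: (measurable_funS mA CA (dytail_measurable r0 mu_ n)).
have cmp (f g : vec -> R) : lmeas C f -> lmeas C g -> (forall y, 0 <= f y) -> (forall y, 0 <= g y) ->
    (forall y, C y -> ((f y)%:E <= (g y)%:E + dytail r u n y)%E) ->
    (\int[mu]_(y in C) (f y)%:E <= \int[mu]_(y in C) (g y)%:E + W)%E.
  move=> mf mg f0 g0 fg.
  rewrite -(@ge0_integralD _ T R mu C mC (fun y => (g y)%:E) (dytail r u n)); first last.
  - exact: mCV.
  - by move=> y _; exact: dytail_ge0.
  - exact/measurable_EFinP.
  - by move=> y _; rewrite lee_fin.
  apply: (@ge0_le_integral _ T R mu C mC).
  - by move=> y _; rewrite lee_fin.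
  - exact/measurable_EFinP.
  - by apply: emeasurable_funD; [exact/measurable_EFinP|exact: mCV].
  - exact: fg.
have h1 : (J%:E <= L + W)%E.
  rewrite -JE; apply: cmp => // y Cy; apply: le_trans (leeD2l _ (pt y Cy)).
  by rewrite -EFinD lee_fin addrC; apply: le_trans (ler_normD _ _); rewrite subrK.
have h2 : (L <= J%:E + W)%E.
  rewrite -JE; apply: cmp => // y Cy; apply: le_trans (leeD2l _ (pt y Cy)).
  by rewrite -EFinD lee_fin addrC distrC; apply: le_trans (ler_normD _ _); rewrite subrK.
have {}h1 : J <= K / c + w / c.
  by rewrite -lee_fin EFinD -LE; apply: (le_trans h1); exact: leeD.
have {}h2 : K / c <= J + w / c.
  by rewrite -lee_fin EFinD -LE; apply: (le_trans h2); exact: leeD.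
have cE : c^-1 = (1 - q ^+ N) / kappa by rewrite /c /shell_ratio -/q invf_div.
have V0 : 0 <= V by rewrite fine_ge0// variation_ge0.
have qq := one_sub_expr_ge (introT andP (conj q0 q1)).
have h3 : (q^-1 - 1) * r * V <= r / N%:R * V * q ^- N * (1 - q ^+ N).
  have -> : r / N%:R * V * q ^- N * (1 - q ^+ N) = q ^- N / N%:R * (1 - q ^+ N) * (r * V).
    by move: (q ^- N) (N%:R^-1 : R) (q ^+ N) V => *; lra.
  by rewrite -[leLHS]mulrA ler_wpM2r// mulr_ge0// ltW.
rewrite -(ler_pM2r p0) -[X in _ * X <= _](ger0_norm (ltW p0)) -normrM.
have e1 : (K / kappa - fine I) * (1 - q ^+ N) = K / c - (1 - q ^+ N) * fine I.
  by rewrite cE mulrBl; move: (kappa^-1) (q ^+ N) (fine I) K => *; lra.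
have e2 : w / kappa * (1 - q ^+ N) = w / c by rewrite cE; move: (kappa^-1) (q ^+ N) => *; lra.
rewrite e1 [leRHS]mulrDl e2.
move: hJ h1 h2 h3; rewrite !ler_norml.
move: (r / N%:R * V * q ^- N * (1 - q ^+ N)) ((q^-1 - 1) * r * V) ((1 - q ^+ N) * fine I) (K / c) (w / c).
by move=> a b d e f /andP[g1 g2] g3 g4 g5; apply/andP; split; lra.
Qed.

(** As n tends to infinity, the integral [w] of the tail tends to 0 and q^(-N) to 1. *)
Lemma trace_estimate : `|K / kappa - fine I| <= r / N%:R * V.
Proof.
have ka0 : 0 < kappa by rewrite subr_gt0 exprn_ilt1 ?expR_ge0// expR_lt1 ltrN10.
have V0 : 0 <= V by rewrite fine_ge0// variation_ge0.
set v := r / N%:R * V; have v0 : 0 <= v by rewrite mulr_ge0// divr_ge0// ltW.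
apply/ler_addgt0Pl => e e0.
have w0 : 0 < e / 2 * kappa by rewrite mulr_gt0// divr_gt0.
(* [v + 1] in place of [v], which may be 0. *)
have d0 : 0 < e / (2 * (v + 1)) by rewrite divr_gt0// mulr_gt0// ltr_wpDl.
have hn1 : \forall n \near \oo, (\int[mu]_(y in A) dytail r u n y < (e / 2 * kappa)%:E)%E.
  have := dytail_integral_cvg r0 iu mu_ vf; move=> /(_ [set x | (x < (e / 2 * kappa)%:E)%E])[|m mm h]; last by exists m.
  by apply: open_nbhs_nbhs; split; [exact: open_ereal_lt_ereal|rewrite /= lte_fin].
have hn2 : \forall n \near \oo, (dyq n.+1 : R) ^- N <= 1 + e / (2 * (v + 1)).
  move: (e / (2 * (v + 1))) d0 => d d0; have d1 : 0 < 1 + d by rewrite addr_gt0.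
  have y0 : 0 < d / (1 + d) / N%:R by rewrite !divr_gt0.
  apply: filterS (near_infty_natSinv_lt (PosNum y0)) => n /= hn.
  have dn : N%:R * dya n.+1 <= d / (1 + d).
    rewrite mulrC -ler_pdivlMr ?ltr0n//; apply: le_trans (ltW hn).
    rewrite /dya lef_pV2 ?posrE ?exprn_gt0// ?ltr0n// -natrX ler_nat ltnW//.
    exact: ltn_expl.
  have qE : dyq n.+1 ^+ N = expR (- (N%:R * dya n.+1)) :> R by rewrite /dyq -expRM_natl mulrN.
  have q1 : 1 / (1 + d) <= dyq n.+1 ^+ N.
    rewrite qE; apply: le_trans (expR_ge1Dx _).
    have -> : 1 / (1 + d) = 1 - d / (1 + d).
      have h : (1 + d) / (1 + d) = 1 by rewrite mulfV// gt_eqF.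
      by apply/eqP; rewrite eq_sym subr_eq -mulrDl h.
    by rewrite lerD2l lerN2.
  rewrite -[leRHS]invrK lef_pV2 ?posrE ?invr_gt0// ?exprn_gt0//; first by rewrite -div1r.
  by rewrite expR_gt0.
have [n [h1 h2]] := @filter_ex _ _ eventually_filter _ (filterI hn1 hn2).
have := trace_estimate_approx (ltW h1); rewrite mulfK ?gt_eqF//.
move=> /le_trans; apply; rewrite -/v.
apply: (@le_trans _ _ (e / 2 + v * (1 + e / (2 * (v + 1))))).
  by rewrite lerD2l ler_wpM2l.
have : v * (e / (2 * (v + 1))) <= e / 2.
  rewrite invfM mulrCA mulrA mulrAC -mulrA.
  have : v / (v + 1) <= 1 by rewrite ler_pdivrMr ?ltr_wpDl// mul1r lerDl.
  have e20 : 0 <= e / 2 by rewrite ltW// divr_gt0.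
  move=> h; have := ler_wpM2l e20 h; rewrite mulr1; apply: le_trans.
  by move: (v / (v + 1)) ((v + 1)^-1) => *; lra.
by rewrite mulrDr mulr1; lra.
Qed.

End trace_estimate.

Section trace_inequality.
Context {R : realType} {k : nat}.
Notation N := k.+1.
Notation vec := 'rV[R]_N.
Notation mu := (leb R N).
Notation T := (lebT R N).
Variables (r : R).
Hypothesis r0 : 0 < r.
Notation B := (eball (0 : vec) r).

Let mB : mble B := @mble_eball R N 0 r.

(** [u] is replaced by its extension by 0, which is measurable everywhere; variation, integral and
    trace depend on [u] inside the ball only. [S] is r/N times the boundary integral, the quantity
    comparable with the integral over the ball. *)
Lemma boundary_trace_integral (u : vec -> R) : BV B u ->
  exists V I S : R, [/\ variation B u = V%:E, (\int[mu]_(y in B) `|u y|%:E)%E = I%:E,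
    (\int[hausdorff R N k]_(x in boundary B) `|bv_trace B u x|%:E)%E = (N%:R / r * S)%:E,
    0 <= V & `|S - I| <= r / N%:R * V].
Proof.
move=> [iu vf]; pose w := u \_ B.
have wu y : B y -> w y = u y by move=> By; rewrite /w /patch mem_set.
have mw : lmeas setT w by exact: lmeas_patch (lmeas_integrable iu).
have iw : mu.-integrable B (EFin \o w).
  by apply: (@eq_integrable _ T R mu B mB (EFin \o u)) iu => y /set_mem By /=; rewrite wu.
have vE : variation B w = variation B u.
  congr (ereal_sup _); apply/seteqP; split=> _ [phi hphi <-]; exists phi => //;
    by apply: eq_integral => y /set_mem By; rewrite wu.
have IE : (\int[mu]_(y in B) `|w y|%:E = \int[mu]_(y in B) `|u y|%:E)%E.
  by apply: eq_integral => y /set_mem By; rewrite wu.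
have tE x : bv_trace B w x = bv_trace B u x.
  rewrite /bv_trace; congr (xget _ _); apply/funext => t; rewrite /= /is_bv_trace.
  have h s : (\int[mu]_(y in B `&` eball x s) `|w y - t|%:E = \int[mu]_(y in B `&` eball x s) `|u y - t|%:E)%E.
    by apply: eq_integral => y /set_mem[By _]; rewrite wu.
  by under eq_fun do rewrite h.
rewrite -vE in vf *; have est := trace_estimate r0 iw mw vf.
have bE := boundary_integral r0 iw mw vf.
rewrite (dylim_norm_fin r0 iw mw vf) -EFinM in bE.
set V := fine (variation B w) in est; set K := fine _ in est bE.
exists V, (fine (\int[mu]_(y in B) `|w y|%:E)%E), (K / (1 - expR (-1) ^+ N)); split.
- by rewrite fineK// ge0_fin_numE// variation_ge0.
- by rewrite -IE fineK//; exact: I_fin iw.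
- under eq_integral do rewrite -tE.
  by rewrite bE /sphere_ratio mulrAC mulrA.
- by rewrite fine_ge0// variation_ge0.
- exact: est.
Qed.

Lemma BV_cst1 : BV B (fun=> 1).
Proof.
split; last by rewrite variation_cst.
by apply: integrable_cst1 => //; apply: (ceball_leb_fin (rho := r)) => y; rewrite /eball/ceball/= => /ltW.
Qed.

Lemma Lambda_ball (beta : R) : -1 < beta ->
  Lambda B beta = (Num.min beta 1 * (N%:R / r))%:E.
Proof.
move=> beta1; set b := Num.min beta 1.
have b1 : b <= 1 by rewrite /b ge_min lexx orbT.
have b2 : -1 < b by rewrite /b lt_min beta1 (lt_trans (ltrN10 R))//.
have q0 : 0 < N%:R / r by rewrite divr_gt0.
apply/eqP; rewrite eq_le; apply/andP; split.
  apply: ereal_inf_lbound; exists (fun=> 1).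
    split; first exact: BV_cst1.
    move=> [Y [mY Y0 hY]].
    have : (leb_outer R N B <= 0)%E.
      by rewrite -Y0; apply: le_leb => y By; apply: hY => /= h; have /eqP := h By; rewrite oner_eq0.
    by rewrite leb_eball// lee_fin leNgt mulr_gt0 ?exprn_gt0 ?ballvol_gt0.
  (* A constant has variation 0, and the estimate then forces S = I. *)
  have [V [I [S [VE IE SE V0 SI]]]] := boundary_trace_integral BV_cst1.
  rewrite variation_cst in VE; have V00 : V = 0 by case: VE.
  have I0 : 0 < I.
    rewrite -lte_fin -IE; under eq_integral do rewrite normr1.
    rewrite (@integral_cst _ T R mu _ mB 1%E) mul1e.
    change (0 < leb_outer R N B)%E.
    by rewrite leb_eball// lte_fin mulr_gt0 ?exprn_gt0 ?ballvol_gt0.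
  have {}SI : S = I.
    by move: SI; rewrite V00 mulr0 normr_le0 subr_eq0 => /eqP.
  by rewrite variation_cst add0e IE SE inver gt_eqF// -!EFinM SI mulrA mulfK// gt_eqF.
apply: le_ereal_inf_tmp => _ [u [bu nz] <-].
have [V [I [S [VE IE SE V0 SI]]]] := boundary_trace_integral bu.
have I0 : 0 < I.
  rewrite -lte_fin -IE lt0e integral_ge0 ?andbT//; apply/eqP => h0; apply: nz.
  have [iu _] := bu; have mu_ : measurable_fun (B : set T) (EFin \o u) by case/integrableP: iu.
  have := (@ae_eq_integral_abs _ T R mu B mB (EFin \o u) mu_).1.
  by move=> /(_ h0)[Y [mY Y0 hY]]; exists Y; split=> // y /= ny; apply: hY => /= h; apply: ny => By; case: (h By).
rewrite VE IE SE.
have -> : ((V%:E + b%:E * (N%:R / r * S)%:E) / I%:E = ((V + b * (N%:R / r * S)) / I)%:E)%E.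
  by rewrite inver gt_eqF.
rewrite lee_fin ler_pdivlMr//.
have b3 : `|b| <= 1 by rewrite ler_norml b1 ltW.
have {}SI : N%:R / r * `|S - I| <= V.
  have e1 : N%:R / r * (r / N%:R * V) = V.
    by rewrite !mulrA divfK ?gt_eqF// mulfV ?mul1r// pnatr_eq0.
  by rewrite -e1 ler_pM2l.
rewrite -{1}(gtr0_norm q0) -normrM in SI.
(* Here [|b| <= 1] enters: whatever the sign of b, replacing I by S in b (N/r) I changes it by at
   most V, which the variation in the numerator compensates. *)
have h : - V <= b * (N%:R / r * (S - I)).
  rewrite lerNl; apply: (le_trans (ler_norm _)); rewrite normrN normrM.
  apply: (@le_trans _ _ (1 * V)); last by rewrite mul1r.
  exact: ler_pM.
by move: h; rewrite mulrBr mulrBr; move: (N%:R / r) => q; lra.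
Qed.

End trace_inequality.

Theorem proposition5p2 (R : realType) (N : nat) (r beta : R)
    (hN : (2 <= N)%N) (hr : 0 < r) (hbeta : -1 < beta) :
  (Lambda (eball (0 : 'rV[R]_N) r) beta =
     (Num.min beta 1)%:E * cheeger (eball (0 : 'rV[R]_N) r))%E /\
  ((Num.min beta 1)%:E * cheeger (eball (0 : 'rV[R]_N) r) =
     (Num.min beta 1 * (N%:R / r))%:E)%E.
Proof.
case: N hN => // k _; rewrite cheeger_ball// -EFinM.
by split=> //; exact: Lambda_ball.
Qed.
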